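(* Let $0<\alpha<1/2$, $c>0$, $d=c+\cot(\pi\alpha)$, and let $L$ be the isosceles trapezoidal curve with vertices $-d-i$, $-c$, $c$, $d-i$ (acute angle $\pi\alpha$). Let $\lambda\in(0,1)$ be the solution of $$\frac{B(\alpha,\frac12)}{B(1-\alpha,\frac12)}\cdot\frac{\lambda^{2\alpha-1}\,{}_2F_1(\frac12,\alpha;\alpha+\frac12;\lambda^2)}{{}_2F_1(\frac12,1-\alpha;\frac32-\alpha;\lambda^2)}=\frac dc,$$ and let $k\in(0,1)$ be the solution of $$\frac{k^{3-2\alpha}B(\frac12,2-\alpha)}{a^4B(\frac12,1+\alpha)}\cdot\frac{F_1(\frac12;-\alpha,2;\frac52-\alpha;k^2,-k^2/a^2)}{F_1(\frac12;\alpha-1,2;\frac32+\alpha;k^2,-a^2)}=\frac dc,$$ where $a=a(k)>0$ is given by $a^2=\sqrt{A^2+k^2}-A$, $A=(\frac12-\alpha)(1-k^2)$. Then $$M_L\ge\max\left[\frac{K(\lambda)K(k')}{K(\lambda')K(k)},\ \frac{K(\lambda')K(k)}{K(\lambda)K(k')}\right],\qquad \lambda'=\sqrt{1-\lambda^2},\quad k'=\sqrt{1-k^2}.$$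
   Context: $K(\cdot)$ is the complete elliptic integral of the first kind, $K(\lambda)=\int_0^1\frac{dt}{\sqrt{(1-t^2)(1-\lambda^2t^2)}}$; $B(\cdot,\cdot)$ is the Euler beta function; ${}_2F_1$ is the Gaussian hypergeometric function; $F_1$ is the Appell hypergeometric function, given (also outside the unit bidisk) by $$F_1(p;b_1,b_2;p+\mu;z,w)=\frac1{B(p,\mu)}\int_0^1t^{p-1}(1-t)^{\mu-1}(1-tz)^{-b_1}(1-tw)^{-b_2}dt,\quad p,\mu>0.$$ The equation for $k$ is equivalent to $$\frac{\int_0^1(1-s^2)^\alpha(1-k^2s^2)^{1-\alpha}(1+a^2s^2)^{-2}ds}{\int_{1/k}^\infty(s^2-1)^\alpha(k^2s^2-1)^{1-\alpha}(1+a^2s^2)^{-2}ds}=\frac cd.$$ A quadrilateral $(Q;z_1,z_2,z_3,z_4)$ is a Jordan domain $Q$ on the Riemann sphere with four boundary points labelled in the order of the positive traverse of $\partial Q$ (such quadruples are called admissible). $\mathrm{Mod}(Q;z_1,z_2,z_3,z_4)$ is the unique $h>0$ such that there is a conformal map of $Q$ onto $[0,1]\times[0,h]$ sending $z_1,z_2,z_3,z_4$ to $0,1,1+ih,ih$. For a Jordan curve $L\subset\mathbb{C}$ with interior $Q$ and exterior $Q^c$ (in the Riemann sphere), $$M_L=\sup\frac{\mathrm{Mod}(Q;z_1,z_2,z_3,z_4)}{\mathrm{Mod}(Q^c;z_4,z_3,z_2,z_1)},$$ the supremum being over all admissible quadruples on $L$. *)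

(* Defs.v *)
From mathcomp Require Import all_boot all_order all_algebra.
From mathcomp Require Import all_classical all_reals all_analysis.
From mathcomp Require Import complex.

Set Implicit Arguments.
Unset Strict Implicit.
Unset Printing Implicit Defensive.

Import Order.TTheory GRing.Theory Num.Theory.
Import numFieldNormedType.Exports.

Local Open Scope classical_set_scope.
Local Open Scope ring_scope.

(* [^o] carries the normed topology of the complex plane; derivatives of maps
   [plane R -> plane R] are complex derivatives. *)
Notation plane R := ((complex R)^o).
(* [Some z] is the finite point [z], [None] the point at infinity. *)
Notation sphere R := (one_point_compactification (plane R)).

Section special_functions.
Variable R : realType.
Implicit Types a b c p q x z w : R.
Local Notation mu := (@lebesgue_measure R).

Definition cot x := cos x / sin x.

Definition elliptic_K x : R :=
  \int[mu]_(t in `]0, 1[) (Num.sqrt ((1 - t ^+ 2) * (1 - x ^+ 2 * t ^+ 2)))^-1.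

Definition Beta p q : R :=
  \int[mu]_(t in `]0, 1[) (t `^ (p - 1) * (1 - t) `^ (q - 1)).

Definition pochhammer a (n : nat) : R := \prod_(i < n) (a + i%:R).

(* Gauss series, meant for |z| < 1 *)
Definition hyp2F1 a b c z : R :=
  limn (series (fun n => pochhammer a n * pochhammer b n / pochhammer c n
                         * z ^+ n / n`!%:R)).

(* F_1(p; b1, b2; q; z, w), meant for 0 < p < q and z, w < 1, where the
   bases of the powers below are positive *)
Definition appellF1 p b1 b2 q z w : R :=
  (Beta p (q - p))^-1 *
  \int[mu]_(t in `]0, 1[) (t `^ (p - 1) * (1 - t) `^ (q - p - 1)
      * (1 - t * z) `^ (- b1) * (1 - t * w) `^ (- b2)).

End special_functions.

Section jordan_curves.
Variable R : realType.
Implicit Types (L : set (plane R)) (g : R -> plane R).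

Definition jordan_param L g :=
  [/\ {within `[0, 1], continuous g}, g 0 = g 1,
      {in `[0, 1[ &, injective g} & g @` `[0, 1] = L].

Definition to_sphere L : set (sphere R) := [set Some z | z in L].

Definition curve_exterior L : set (sphere R) :=
  connected_component (~` to_sphere L) None.

(* by the Jordan curve theorem, the other component of the complement *)
Definition curve_interior L : set (sphere R) :=
  ~` to_sphere L `\` curve_exterior L.

(* [theta] is a continuous determination of the argument of [g - w] *)
Definition winds_once g (w : plane R) :=
  exists theta : R -> R,
    [/\ {within `[0, 1], continuous theta},
        forall t, t \in `[0, 1] ->
          g t - w = `|g t - w| * Complex (cos (theta t)) (sin (theta t))
      & theta 1 - theta 0 = 2 * pi].

Definition positive_param L g :=
  jordan_param L g /\
  forall w, curve_interior L (Some w) -> winds_once g w.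

(* four points of [L] in the order of the positive traverse, i.e. with
   [curve_interior L] on the left *)
Definition admissible L (z1 z2 z3 z4 : plane R) :=
  exists g, positive_param L g /\
  exists t1 t2 t3 t4 : R,
    [/\ 0 <= t1 < t2, t2 < t3, t3 < t4 < 1 &
        [/\ g t1 = z1, g t2 = z2, g t3 = z3 & g t4 = z4]].

End jordan_curves.

Section modulus.
Variable R : realType.
Implicit Types (Q : set (sphere R)) (f : sphere R -> plane R) (h : R).

Definition sphere_inv (w : plane R) : sphere R :=
  if w == 0 then None else Some w^-1.

(* at infinity, in the chart [w |-> 1 / w] *)
Definition holomorphic_on Q f :=
  (forall z : plane R, Q (Some z) -> derivable (f \o Some) z 1) /\
  (Q None -> derivable (f \o sphere_inv) (0 : plane R) 1).

Definition open_rect h : set (plane R) :=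
  [set z | 0 < complex.Re z < 1 /\ 0 < complex.Im z < h].

Definition closed_rect h : set (plane R) :=
  [set z | 0 <= complex.Re z <= 1 /\ 0 <= complex.Im z <= h].

(* conformal on [Q], homeomorphic up to the boundary: [closure Q] is compact,
   so the continuous bijection below is a homeomorphism *)
Definition conformal_onto_rect Q h f :=
  [/\ holomorphic_on Q f, set_bij Q (open_rect h) f,
      {within closure Q, continuous f}
    & set_bij (closure Q) (closed_rect h) f].

(* [h] is the modulus of the quadrilateral (Q; z1, z2, z3, z4); such an [h]
   is unique by conformal invariance, which is why a relation is enough *)
Definition is_modulus Q (z1 z2 z3 z4 : plane R) h :=
  0 < h /\
  exists f, conformal_onto_rect Q h f /\
    [/\ f (Some z1) = Complex 0 0, f (Some z2) = Complex 1 0,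
        f (Some z3) = Complex 1 h & f (Some z4) = Complex 0 h].

Definition modulus_ratio_sup (L : set (plane R)) : \bar R :=
  ereal_sup [set r | exists z1 z2 z3 z4 h h',
    [/\ admissible L z1 z2 z3 z4,
        is_modulus (curve_interior L) z1 z2 z3 z4 h,
        is_modulus (curve_exterior L) z4 z3 z2 z1 h'
      & r = (h / h')%:E]].

End modulus.

Section trapezoid.
Variable R : realType.

Definition segment (z w : plane R) : set (plane R) :=
  [set z + Complex t 0 * (w - z) | t in `[0, 1]%classic].

Definition polygon4 (z1 z2 z3 z4 : plane R) : set (plane R) :=
  segment z1 z2 `|` segment z2 z3 `|` segment z3 z4 `|` segment z4 z1.

Definition trapezoid (c d : R) : set (plane R) :=
  polygon4 (Complex (- d) (- 1)) (Complex (- c) 0)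
           (Complex c 0) (Complex d (- 1)).

End trapezoid.

(* Main.v *)
(** Two Schwarz-Christoffel maps of the upper half-plane are compared.  The
    interior of [L] is the image of the one with prevertices [1], [-1],
    [1 / lambda], [-1 / lambda], where the equation for [lambda] says that the
    parallel sides have ratio [d / c]; since the slope of the legs is fixed, the
    ratio determines the trapezoid up to translation once its height is 1.
    By symmetry, the exterior of [L] is treated through its right half, the
    image of the quadrant [Re s > 0], [Im s > 0].  In the variable
    [u = - 1 / (1 + a^2 s^2)] the quadrant is a half-plane and the half exterior,
    turned by a right angle, is the domain above the graph of a function: it is
    the image of a Schwarz-Christoffel map with prevertices [-1],
    [- 1 / (1 + a^2)], [- k^2 / (a^2 + k^2)], [0] that is asymptotic to the
    identity.  The choice of [a] removes the logarithmic term at the pole, and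
    the equation for [k] is again the ratio of the sides.

    The vertices of [L] thus correspond to [1], [-1] and [1 / lambda],
    [-1 / lambda] inside, to [1], [-1] and [1 / k], [-1 / k] outside.  The
    half-plane with these vertices is mapped onto a rectangle by the same map with
    right angles, so the moduli for [(c, -c, -d - i, d - i)] are
    [K(lambda') / (2 K(lambda))] and [K(k') / (2 K(k))].  This quadruple and
    [(-c, -d - i, d - i, c)] give the two quotients.

    A Schwarz-Christoffel map is defined as [F(z) = - i int_0^oo phi(z + i t) dt]:
    dominated convergence gives its continuity up to the boundary, and [F' = phi]
    inside.  Injectivity comes from a half-plane containing the values of [phi];
    surjectivity from a continuity argument along segments, the image being open
    and the boundary values being known. *)

Require Import Defs.
From mathcomp Require Import all_boot all_order all_algebra.
From mathcomp Require Import all_classical all_reals all_analysis.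
From mathcomp Require Import complex measurable_realfun.
From mathcomp Require Import ring lra.

Set Implicit Arguments.
Unset Strict Implicit.
Unset Printing Implicit Defensive.

Import Order.TTheory GRing.Theory Num.Theory.
Import numFieldNormedType.Exports.

Local Open Scope classical_set_scope.
Local Open Scope ring_scope.

(** Integrating along vertical half-lines makes path independence and boundary behaviour a matter of
    one majorant in [Im z], uniform in [Re z]: every exponent of a prevertex exceeds -1, and the
    integrand minus its limit at infinity is O(y^-2). For the exterior the latter is what the choice
    of [a] buys: with q = a^2, the coefficient of 1/u vanishes exactly when q^2 + (1 - 2 alpha)(1 -
    k^2) q = k^2. An obstacle is that the two sides of L are defined through connected components,
    and orientation through winding. The exterior map itself shows its image to be connected; the
    open trapezoid is open and closed in the complement of L, so the component of infinity misses
    it. Winding is read off an explicit argument that increases along the four sides. The half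
    exterior is doubled by reflection in the chart 1 / (z + i/2) centred inside the trapezoid, where
    infinity becomes the ordinary point 0. Since d / c and d - c are both prescribed, the two maps
    reach one and the same trapezoid. *)

Notation Re := complex.Re.
Notation Im := complex.Im.

(** * Moduli and limits of complex numbers *)

Section modulus_of_complex.
Variable R : realType.
Local Notation C := (complex R).
Implicit Types z w : C.

Definition cmod z : R := Num.sqrt (Re z ^+ 2 + Im z ^+ 2).

Lemma ReD z w : Re (z + w) = Re z + Re w. Proof. by case: z; case: w. Qed.
Lemma ImD z w : Im (z + w) = Im z + Im w. Proof. by case: z; case: w. Qed.
Lemma ReN z : Re (- z) = - Re z. Proof. by case: z. Qed.
Lemma ImN z : Im (- z) = - Im z. Proof. by case: z. Qed.
Lemma ReM z w : Re (z * w) = Re z * Re w - Im z * Im w.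
Proof. by case: z; case: w. Qed.
Lemma ImM z w : Im (z * w) = Re z * Im w + Im z * Re w.
Proof. by case: z => a b; case: w => c d /=; rewrite addrC. Qed.
Lemma Re0 : Re (0 : C) = 0. Proof. by []. Qed.
Lemma Im0 : Im (0 : C) = 0. Proof. by []. Qed.
Lemma Re1 : Re (1 : C) = 1. Proof. by []. Qed.
Lemma Im1 : Im (1 : C) = 0. Proof. by []. Qed.
Definition ReImE := (ReD, ImD, ReN, ImN, ReM, ImM, Re0, Im0, Re1, Im1).

Lemma complex_ext z w : Re z = Re w -> Im z = Im w -> z = w.
Proof. by case: z => a b; case: w => c d /= -> ->. Qed.

Lemma normc_cmod z : `|z| = Complex (cmod z) 0.
Proof. by rewrite normc_def. Qed.

Lemma cmod_ge0 z : 0 <= cmod z.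
Proof. exact: sqrtr_ge0. Qed.
Hint Resolve cmod_ge0 : core.

Lemma sqr_cmod z : cmod z ^+ 2 = Re z ^+ 2 + Im z ^+ 2.
Proof. by rewrite sqr_sqrtr// addr_ge0// sqr_ge0. Qed.

Lemma cmodM z w : cmod (z * w) = cmod z * cmod w.
Proof. by have /(congr1 (@complex.Re R)) := normrM z w; rewrite !normc_cmod/= mulr0 subr0. Qed.

Lemma cmodD z w : cmod (z + w) <= cmod z + cmod w.
Proof. by have := ler_normD z w; rewrite !normc_cmod lecE/= => /andP[]. Qed.

Lemma cmodN z : cmod (- z) = cmod z.
Proof. by have /(congr1 (@complex.Re R)) := normrN z; rewrite !normc_cmod. Qed.

Lemma cmod0 : cmod 0 = 0.
Proof. by have /(congr1 (@complex.Re R)) := normr0 C; rewrite !normc_cmod. Qed.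

Lemma cmod1 : cmod 1 = 1.
Proof. by have /(congr1 (@complex.Re R)) := normr1 C; rewrite !normc_cmod. Qed.

Lemma cmod_eq0 z : (cmod z == 0) = (z == 0).
Proof. by rewrite -[RHS]normr_eq0 normc_cmod eq_complex/= eqxx andbT. Qed.

Lemma cmod_gt0 z : (0 < cmod z) = (z != 0).
Proof. by rewrite lt_neqAle cmod_ge0 andbT eq_sym cmod_eq0. Qed.

Lemma cmodB z w : cmod (z - w) = cmod (w - z).
Proof. by rewrite -cmodN opprB. Qed.

Lemma cmodV z : cmod z^-1 = (cmod z)^-1.
Proof.
have [->|z0] := eqVneq z 0; first by rewrite invr0 cmod0 invr0.
have z0' : cmod z != 0 by rewrite cmod_eq0.
by apply: (mulfI z0'); rewrite -cmodM !mulfV// cmod1.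
Qed.

Lemma cmodX z n : cmod (z ^+ n) = cmod z ^+ n.
Proof. by elim: n => [|n ih]; rewrite ?expr0 ?cmod1// !exprS cmodM ih. Qed.

Lemma Re_le_cmod z : `|Re z| <= cmod z.
Proof.
rewrite -(@ler_pXn2r _ 2)// ?nnegrE// sqr_cmod real_normK ?num_real//.
by rewrite lerDl sqr_ge0.
Qed.

Lemma Im_le_cmod z : `|Im z| <= cmod z.
Proof.
rewrite -(@ler_pXn2r _ 2)// ?nnegrE// sqr_cmod real_normK ?num_real//.
by rewrite lerDr sqr_ge0.
Qed.

Lemma cmod_real (x : R) : cmod (Complex x 0) = `|x|.
Proof. by rewrite /cmod/= expr0n/= addr0 sqrtr_sqr. Qed.

Lemma cmod_imag (x : R) : cmod (Complex 0 x) = `|x|.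
Proof. by rewrite /cmod/= expr0n/= add0r sqrtr_sqr. Qed.

Lemma cmod_le_ReIm z : cmod z <= `|Re z| + `|Im z|.
Proof.
case: z => x y; have -> : Complex x y = Complex x 0 + Complex 0 y.
  by rewrite /GRing.add/= addr0 add0r.
by rewrite (le_trans (cmodD _ _))// cmod_real cmod_imag/= addr0 add0r.
Qed.

Lemma cmodBD z w : cmod z - cmod w <= cmod (z + w).
Proof. by rewrite lerBlDr -(cmodN w) (le_trans _ (cmodD _ _))// addrK. Qed.

Lemma ler_cmod_dist z w : `|cmod z - cmod w| <= cmod (z - w).
Proof.
rewrite ler_norml lerNl opprB; apply/andP; split.
  by rewrite cmodB lerBlDr (le_trans _ (cmodD _ _))// subrK.
by rewrite lerBlDr (le_trans _ (cmodD _ _))// subrK.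
Qed.

Lemma nbhs_planeP (z : plane R) (A : set (plane R)) :
  nbhs z A <-> exists2 e : R, 0 < e & forall w, cmod (w - z) < e -> A w.
Proof.
split.
  case/nbhs_ballP => e /= e0 zA.
  move: (e0); rewrite ltcE/= => /andP[/eqP e2 e1].
  exists (Re e) => // w zw; apply: zA.
  rewrite -ball_normE /ball_/= normc_cmod ltcE/= e2 eqxx/=.
  by rewrite (cmodB z w).
case=> e e0 zA; apply/nbhs_ballP; exists (Complex e 0).
  by rewrite /= ltcE/= eqxx.
move=> w; rewrite -ball_normE /ball_/= normc_cmod ltcE/= eqxx/= => zw.
by apply: zA; rewrite cmodB.
Qed.

Lemma near_plane (z : plane R) (e : R) : 0 < e ->
  \forall w \near nbhs z, cmod (w - z) < e.
Proof. by move=> e0; apply/nbhs_planeP; exists e. Qed.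

End modulus_of_complex.
#[global] Hint Resolve cmod_ge0 : core.

Section complex_limits.
Variable R : realType.
Local Notation C := (complex R).

(** Convergence is stated through the real function [cmod (f x - l)], so that the algebra of limits
    reduces to squeezing; [cvg_clim] is the bridge to the topology of the plane. *)
Definition clim T (F : set_system T) (f : T -> C) (l : C) :=
  (fun x => cmod (f x - l)) @ F --> (0 : R).

Variable T : Type.
Implicit Types (F : set_system T) (f g : T -> C) (l m : C).

Lemma climP F {FF : Filter F} f l :
  clim F f l <-> forall e : R, 0 < e -> \forall x \near F, cmod (f x - l) < e.
Proof.
rewrite /clim; split => [/cvgrPdist_lt fl e e0|fl].
  by apply: filterS (fl e e0) => x; rewrite sub0r normrN ger0_norm ?cmod_ge0.
apply/cvgrPdist_lt => e e0; apply: filterS (fl e e0) => x.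
by rewrite sub0r normrN ger0_norm ?cmod_ge0.
Qed.

Lemma clim_le F {FF : Filter F} f l (b : T -> R) :
  (\forall x \near F, cmod (f x - l) <= b x) -> b @ F --> (0 : R) ->
  clim F f l.
Proof.
move=> fb b0; apply: (squeeze_cvgr _ (@cvg_cst _ _ _ _ _) b0).
by apply: filterS fb => x ->; rewrite cmod_ge0.
Qed.

Lemma cvg_clim F {FF : Filter F} (f : T -> plane R) (l : plane R) :
  f @ F --> l <-> clim F f l.
Proof.
split.
  move=> fl; apply/climP => e e0.
  exact: (fl [set w | cmod (w - l) < e] (near_plane l e0)).
move=> /climP fl A /nbhs_planeP[e e0 lA].
by apply: filterS (fl e e0) => x; exact: lA.
Qed.

Lemma clim_cst F {FF : Filter F} l : clim F (fun=> l) l.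
Proof. by rewrite /clim subrr cmod0; exact: cvg_cst. Qed.

Lemma clim_near F {FF : Filter F} f g l :
  (\forall x \near F, f x = g x) -> clim F f l -> clim F g l.
Proof.
move=> fg /climP fl; apply/climP => e /fl; apply: filterS2 fg => x -> //.
Qed.

Lemma climD F {FF : Filter F} f g l m :
  clim F f l -> clim F g m -> clim F (fun x => f x + g x) (l + m).
Proof.
move=> fl gm; apply: (clim_le (b := fun x => cmod (f x - l) + cmod (g x - m))).
  apply: nearW => x; rewrite (le_trans _ (cmodD _ _))//.
  by rewrite le_eqVlt; apply/orP; left; apply/eqP; congr cmod; ring.
by rewrite -[0]addr0; exact: cvgD.
Qed.

Lemma climM F {FF : Filter F} f g l m :
  clim F f l -> clim F g m -> clim F (fun x => f x * g x) (l * m).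
Proof.
move=> fl gm; apply: (clim_le (b := fun x => cmod (f x - l) * cmod (g x - m)
    + (cmod l * cmod (g x - m) + cmod m * cmod (f x - l)))).
  apply: nearW => x; rewrite -!cmodM.
  have -> : f x * g x - l * m =
      (f x - l) * (g x - m) + (l * (g x - m) + m * (f x - l)) by ring.
  by rewrite (le_trans (cmodD _ _))// lerD2l cmodD.
have -> : (0 : R) = 0 * 0 + (cmod l * 0 + cmod m * 0) by rewrite !mulr0 !addr0.
apply: cvgD; first exact: cvgM.
by apply: cvgD; apply: cvgM => //; exact: cvg_cst.
Qed.

Lemma climN F {FF : Filter F} f l :
  clim F f l -> clim F (fun x => - f x) (- l).
Proof.
move=> fl; apply: (clim_le (b := fun x => cmod (f x - l))) => //.
by apply: nearW => x; rewrite -opprD cmodN lexx.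
Qed.

Lemma climB F {FF : Filter F} f g l m :
  clim F f l -> clim F g m -> clim F (fun x => f x - g x) (l - m).
Proof. by move=> fl gm; apply: climD => //; exact: climN. Qed.

Lemma climV F {FF : Filter F} f l : l != 0 ->
  clim F f l -> clim F (fun x => (f x)^-1) l^-1.
Proof.
move=> l0 fl; have cl0 : 0 < cmod l by rewrite cmod_gt0.
apply: (clim_le (b := fun x => cmod (f x - l) * (2 / cmod l ^+ 2))).
  move/climP/(_ (cmod l / 2)) : fl; rewrite divr_gt0// => /(_ isT).
  apply: filterS => x fx.
  have fx2 : cmod l / 2 <= cmod (f x).
    have := cmodBD l (f x - l); rewrite addrCA subrr addr0; lra.
  have fx0 : f x != 0 by rewrite -cmod_gt0 (lt_le_trans _ fx2)// divr_gt0.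
  have -> : (f x)^-1 - l^-1 = (l - f x) * ((f x)^-1 * l^-1).
    by field; rewrite l0 fx0.
  rewrite cmodM cmodB ler_wpM2l ?cmod_ge0// cmodM !cmodV expr2 invfM mulrA.
  rewrite ler_wpM2r ?invr_ge0 ?cmod_ge0// -[2 / _]invf_div lef_pV2 ?posrE//.
  by rewrite cmod_gt0.
  by rewrite divr_gt0.
by rewrite -(mul0r (2 / cmod l ^+ 2)); apply: cvgM => //; exact: cvg_cst.
Qed.

Lemma clim_Re F {FF : Filter F} f l :
  clim F f l -> (fun x => Re (f x)) @ F --> Re l.
Proof.
move=> /climP fl; apply/cvgrPdist_lt => e e0; apply: filterS (fl e e0) => x.
by apply: le_lt_trans; rewrite (le_trans _ (Re_le_cmod _))// distrC !ReImE.
Qed.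

Lemma clim_Im F {FF : Filter F} f l :
  clim F f l -> (fun x => Im (f x)) @ F --> Im l.
Proof.
move=> /climP fl; apply/cvgrPdist_lt => e e0; apply: filterS (fl e e0) => x.
by apply: le_lt_trans; rewrite (le_trans _ (Im_le_cmod _))// distrC !ReImE.
Qed.

Lemma clim_Complex F {FF : Filter F} (u v : T -> R) (a b : R) :
  u @ F --> a -> v @ F --> b -> clim F (fun x => Complex (u x) (v x)) (Complex a b).
Proof.
move=> ua vb; apply: (clim_le (b := fun x => `|u x - a| + `|v x - b|)).
  by apply: nearW => x; exact: (cmod_le_ReIm (Complex (u x - a) (v x - b))).
have -> : (0 : R) = `|a - a| + `|b - b| by rewrite !subrr normr0 addr0.
by apply: cvgD; apply: cvg_norm; apply: cvgB => //; exact: cvg_cst.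
Qed.

Lemma clim_cmod F {FF : Filter F} f l :
  clim F f l -> (fun x => cmod (f x)) @ F --> cmod l.
Proof.
move=> /climP fl; apply/cvgrPdist_lt => e e0; apply: filterS (fl e e0) => x.
by apply: le_lt_trans; rewrite distrC ler_cmod_dist.
Qed.

End complex_limits.

Lemma clim_comp (R : realType) T U (F : set_system T) (G : set_system U)
    (h : T -> U) (f : U -> complex R) l :
  h @ F --> G -> clim G f l -> clim F (f \o h) l.
Proof. by move=> hG fl; exact: (cvg_comp _ _ hG fl). Qed.

(** * Complex derivatives relative to a set *)

Section complex_derivative.
Variable R : realType.
Local Notation C := (complex R).
Implicit Types (D : set C) (f g : C -> C) (z w c : C).

(** The point [z] is not removed: when it belongs to [D], a limit along this filter must be the
    value at [z]. *)
Definition inear D z : set_system C := within D (nbhs (z : plane R)).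

Global Instance inear_filter D z : Filter (inear D z).
Proof. exact: within_filter. Qed.

Lemma inearP D z (A : set C) : inear D z A <->
  exists2 e : R, 0 < e & forall w, cmod (w - z) < e -> D w -> A w.
Proof. by rewrite /inear /within/= -nbhs_planeP. Qed.

Lemma inear_le D z (e : R) : 0 < e -> inear D z (fun w => cmod (w - z) < e).
Proof. by move=> e0; apply/inearP; exists e. Qed.

Lemma clim_id D z : clim (inear D z) id z.
Proof. by apply/climP => e; exact: inear_le. Qed.

Lemma clim_inear_sub D D' z f l : (\forall w \near inear D z, D' w) ->
  clim (inear D' z) f l -> clim (inear D z) f l.
Proof.
move=> DD' /climP fl; apply/climP => e /fl; move: DD'.
move=> /inearP[d d0 H] /inearP[d' d'0 H']; apply/inearP.
exists (Num.min d d'); first by rewrite lt_min d0.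
by move=> w; rewrite lt_min => /andP[wd wd'] Dw; apply: H' => //; exact: H.
Qed.

(* Caratheodory form of the complex derivative relative to a set *)
Definition cdiff D f z c := exists q : C -> C,
  (forall w, D w -> f w - f z = (w - z) * q w) /\ clim (inear D z) q c.

Lemma cdiffP D f z c : cdiff D f z c <-> forall e : R, 0 < e ->
  \forall w \near inear D z, cmod (f w - f z - (w - z) * c) <= e * cmod (w - z).
Proof.
split=> [[q [fq /climP qc]] e e0|fe].
  have [d d0 qd] := (inearP D z _).1 (qc e e0).
  apply/inearP; exists d => // w wd Dw.
  by rewrite fq// -mulrBr cmodM mulrC ler_wpM2r ?cmod_ge0// ltW// qd.
(* At [w = z] the quotient must take the value [c], because [z] is not removed from the filter. *)
exists (fun w => if w == z then c else (f w - f z) / (w - z)); split=> [w Dw|].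
  have [->|wz] := eqVneq w z; first by rewrite !subrr mul0r.
  by rewrite mulrC divfK// subr_eq0.
apply/climP => e e0; have e2 : 0 < e / 2 by rewrite divr_gt0.
apply: filterS (fe _ e2) => w; case: eqVneq => [_ _|wz].
  by rewrite subrr cmod0.
have wz0 : w - z != 0 by rewrite subr_eq0.
have -> : (f w - f z) / (w - z) - c = (f w - f z - (w - z) * c) / (w - z).
  by field.
rewrite cmodM cmodV => H; rewrite (@le_lt_trans _ _ (e / 2))//.
  by rewrite ler_pdivrMr// cmod_gt0.
by rewrite ltr_pdivrMr// ltr_pMr// ltrDl.
Qed.

Lemma cdiff_sub D D' f z c : (\forall w \near inear D z, D' w) ->
  cdiff D' f z c -> cdiff D f z c.
Proof.
move=> DD' /cdiffP fc; apply/cdiffP => e /fc; move: DD'.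
move=> /inearP[d d0 H] /inearP[d' d'0 H']; apply/inearP.
exists (Num.min d d'); first by rewrite lt_min d0.
by move=> w; rewrite lt_min => /andP[wd wd'] Dw; apply: H' => //; exact: H.
Qed.

Lemma cdiff_eq D f g z c : (\forall w \near inear D z, f w = g w) ->
  f z = g z -> cdiff D f z c -> cdiff D g z c.
Proof.
move=> fg fgz /cdiffP fc; apply/cdiffP => e /fc.
by apply: filterS2 fg => w ->; rewrite fgz.
Qed.

Lemma cdiff_cts D f z c : cdiff D f z c -> clim (inear D z) f (f z).
Proof.
move=> [q [fq qc]].
have H : clim (inear D z) (fun w => f z + (w - z) * q w) (f z + (z - z) * c).
  apply: climD; first exact: clim_cst.
  apply: climM => //; apply: climB; [exact: clim_id|exact: clim_cst].
rewrite subrr mul0r addr0 in H; apply: clim_near H.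
by apply/inearP; exists 1 => // w _ Dw; rewrite -fq// addrC subrK.
Qed.

Lemma cdiff_cst D z c : cdiff D (fun=> c) z 0.
Proof.
exists (fun=> 0); split=> [w _|]; first by rewrite mulr0 subrr.
exact: clim_cst.
Qed.

Lemma cdiff_id D z : cdiff D id z 1.
Proof.
exists (fun=> 1); split=> [w _|]; first by rewrite mulr1.
exact: clim_cst.
Qed.

Lemma cdiffD D f g z c d : cdiff D f z c -> cdiff D g z d ->
  cdiff D (fun w => f w + g w) z (c + d).
Proof.
move=> [p [fp pc]] [q [gq qd]]; exists (fun w => p w + q w); split=> [w Dw|].
  by rewrite mulrDr -fp// -gq//; ring.
exact: climD.
Qed.

Lemma cdiffM D f g z c d : cdiff D f z c -> cdiff D g z d ->
  cdiff D (fun w => f w * g w) z (c * g z + f z * d).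
Proof.
move=> fc gd; have gz := cdiff_cts gd.
move: fc gd => [p [fp pc]] [q [gq qd]].
exists (fun w => p w * g w + f z * q w); split=> [w Dw|].
  by rewrite mulrDr mulrA -fp// mulrCA -gq//; ring.
by apply: climD; apply: climM => //; exact: clim_cst.
Qed.

Lemma cdiffZ D f z c a : cdiff D f z c -> cdiff D (fun w => a * f w) z (a * c).
Proof.
by move=> fc; have := cdiffM (cdiff_cst D z a) fc; rewrite mul0r add0r.
Qed.

Lemma cdiffN D f z c : cdiff D f z c -> cdiff D (fun w => - f w) z (- c).
Proof.
move=> /(cdiffZ (-1)); rewrite mulN1r; apply: cdiff_eq; last by rewrite mulN1r.
by apply: nearW => w; rewrite mulN1r.
Qed.

Lemma cdiffB D f g z c d : cdiff D f z c -> cdiff D g z d ->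
  cdiff D (fun w => f w - g w) z (c - d).
Proof. by move=> fc gd; apply: cdiffD => //; exact: cdiffN. Qed.

Lemma cdiffV D f z c : f z != 0 -> cdiff D f z c ->
  cdiff D (fun w => (f w)^-1) z (- c / f z ^+ 2).
Proof.
move=> fz0 fc; have fz := cdiff_cts fc; move: fc => [q [fq qc]].
(* The factorization is required at every point of the domain, so it is proved on the smaller domain
   where [f] does not vanish, which contains all points of [D] near [z]. *)
pose D' w := f w != 0.
have DD' : \forall w \near inear D z, D' w.
  have fz0' : 0 < cmod (f z) by rewrite cmod_gt0.
  have [d d0 H] := (inearP _ _ _).1 ((climP _ _).1 fz _ fz0').
  apply/inearP; exists d => // w wd Dw; have := H w wd Dw.
  by apply: contraTneq => ->; rewrite sub0r cmodN ltxx.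
have H : cdiff (D `&` D') (fun w => (f w)^-1) z (- c / f z ^+ 2).
  exists (fun w => - q w * ((f w)^-1 * (f z)^-1)); split=> [w [Dw D'w]|].
    have -> : (f w)^-1 - (f z)^-1 = - (f w - f z) * ((f w)^-1 * (f z)^-1).
      by field; rewrite fz0.
    by rewrite fq//; ring.
  rewrite expr2 invfM; apply: (clim_inear_sub (D' := D)).
    by apply/inearP; exists 1 => // w _ [].
  apply: climM; first exact: climN.
  by apply: climM; [exact: climV|exact: clim_cst].
apply: cdiff_sub H; apply/inearP.
by have [d d0 H] := (inearP _ _ _).1 DD'; exists d => // w wd Dw; split=> //; exact: H.
Qed.

Lemma cdiff_comp D D' f g z c d : (\forall w \near inear D z, D' (f w)) ->
  cdiff D f z c -> cdiff D' g (f z) d -> cdiff D (g \o f) z (d * c).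
Proof.
move=> DD' fc [q [gq qd]]; have fz := cdiff_cts fc; move: fc => [p [fp pc]].
pose D1 := D `&` (fun w => D' (f w)).
have DD1 : \forall w \near inear D z, D1 w.
  have [e e0 H] := (inearP _ _ _).1 DD'.
  by apply/inearP; exists e => // w we Dw; split => //; exact: H.
apply: (cdiff_sub DD1); exists (fun w => q (f w) * p w); split=> [w [Dw D'w]|].
  by rewrite /= gq// fp//; ring.
have D1D : \forall w \near inear D1 z, D w by apply/inearP; exists 1 => // w _ [].
apply: climM; last exact: clim_inear_sub pc.
apply: (@clim_comp R C C (inear D1 z) (inear D' (f z)) f q); last exact: qd.
move=> A /inearP[e e0 HA].
have [e' e'0 H] := (inearP _ _ _).1 ((climP _ _).1 fz e e0).
by apply/inearP; exists e' => // w we [Dw D'w]; apply: HA => //; exact: H.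
Qed.

Lemma cdiffX D f z c n : cdiff D f z c ->
  cdiff D (fun w => f w ^+ n.+1) z (n.+1%:R * f z ^+ n * c).
Proof.
move=> fc; elim: n => [|n ih].
  by rewrite expr0 !mul1r; apply: cdiff_eq fc => //; exact: nearW.
have H := cdiffM fc ih.
have -> : n.+2%:R * f z ^+ n.+1 * c =
  c * f z ^+ n.+1 + f z * (n.+1%:R * f z ^+ n * c).
  by rewrite exprS -[n.+2%:R]natr1; ring.
by apply: (cdiff_eq _ _ H) => [|]; [apply: nearW => w|]; rewrite [RHS]exprS.
Qed.

Lemma cdiff_derivable f z c : cdiff setT f z c ->
  derivable (f : plane R -> plane R) (z : plane R) 1.
Proof.
move=> /cdiffP fc; apply/cvg_ex; exists (c : plane R).
apply/cvg_clim; apply/climP => e e0.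
have e2 : 0 < e / 2 by rewrite divr_gt0.
have [d d0 H] := (inearP _ _ _).1 (fc _ e2).
rewrite /= near_withinE; apply/nbhs_planeP; exists d => // h hd h0.
have {H} := H (h + z); rewrite addrK => /(_ _ I); rewrite -(subr0 h) => /(_ hd).
rewrite subr0 => H.
have -> : h^-1 *: (((f : plane R -> plane R) \o shift z) (h *: 1) - f z) - c
   = (f (h + z) - f z - h * c) / h.
  rewrite /= /GRing.scale/= mulr1; field; exact: h0.
rewrite cmodM cmodV; have ch0 : 0 < cmod h by rewrite cmod_gt0.
rewrite ltr_pdivrMr// (le_lt_trans H)// ltr_pM2r//.
by rewrite ltr_pdivrMr// ltr_pMr// ltrDl.
Qed.

End complex_derivative.

(** * Differentiable paths and the mean value inequality *)

Section derivative_along_lines.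
Variable R : realType.
Local Notation C := (complex R).
Implicit Types (D : set C) (f : C -> C) (p : R -> C).

Lemma is_deriveP (g : R -> R) (t c : R) :
  is_derive t 1 g c <-> forall e : R, 0 < e ->
    \forall h \near nbhs (0 : R), `|g (t + h) - g t - h * c| <= e * `|h|.
Proof.
split.
  move=> [/cvg_ex[l gl] gc] e e0.
  have lc : l = c by rewrite -gc; apply/esym/cvg_lim.
  move: gl => /cvgrPdist_le /(_ e e0); rewrite lc near_withinE => H.
  near=> h; have [->|h0] := eqVneq h 0.
    by rewrite addr0 subrr mul0r subrr normr0 mulr0.
  have : h != 0 -> `|c - h^-1 *: ((g \o shift t) (h *: 1) - g t)| <= e.
    by near: h.
  move=> /(_ h0); rewrite /= /GRing.scale/= mulr1 => He.
  rewrite -ler_pdivrMr ?normr_gt0// -normfV -normrM.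
  have -> : (g (t + h) - g t - h * c) / h = - (c - h^-1 * (g (h + t) - g t)).
    by rewrite (addrC h); field.
  by rewrite normrN.
move=> H.
have gl : h^-1 *: ((g \o shift t) (h *: 1) - g t) @[h --> 0^'] --> c.
  apply/cvgrPdist_le => e e0; rewrite near_withinE.
  apply: filterS (H e e0) => h he h0; rewrite /= /GRing.scale/= mulr1.
  have -> : c - h^-1 * (g (h + t) - g t) = - ((g (t + h) - g t - h * c) / h).
    by rewrite (addrC h); field.
  by rewrite normrN normrM normfV ler_pdivrMr// normr_gt0.
apply: DeriveDef; last exact: cvg_lim gl.
by apply/cvg_ex; exists c.
Unshelve. all: by end_near. Qed.

(** Componentwise, so that real differential calculus applies to each coordinate; [pderivP] gives
    the equivalent estimate in modulus. *)
Definition pderiv p (t : R) (v : C) :=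
  is_derive t 1 (fun x => Re (p x)) (Re v) /\
  is_derive t 1 (fun x => Im (p x)) (Im v).

Lemma pderivP p t v : pderiv p t v <-> forall e : R, 0 < e ->
  \forall h \near nbhs (0 : R),
    cmod (p (t + h) - p t - Complex h 0 * v) <= e * `|h|.
Proof.
split=> [[/is_deriveP pr /is_deriveP pi] e e0|H].
  have e2 : 0 < e / 2 by rewrite divr_gt0.
  apply: filterS2 (pr _ e2) (pi _ e2) => h hr hi.
  rewrite (le_trans (cmod_le_ReIm _))// [e]splitr mulrDl lerD//.
    by rewrite !ReImE/= mul0r subr0.
  by rewrite !ReImE/= mul0r addr0.
split; apply/is_deriveP => e /H; apply: filterS => h; apply: le_trans.
  have := Re_le_cmod (p (t + h) - p t - Complex h 0 * v).
  by rewrite !ReImE/= mul0r subr0.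
have := Im_le_cmod (p (t + h) - p t - Complex h 0 * v).
by rewrite !ReImE/= mul0r addr0.
Qed.

Lemma cdiff_pderiv D f a v (t : R) c :
  (\forall s \near t, D (a + Complex s 0 * v)) ->
  cdiff D f (a + Complex t 0 * v) c ->
  pderiv (fun s => f (a + Complex s 0 * v)) t (c * v).
Proof.
move=> nD /cdiffP fc; apply/pderivP => e e0.
pose m := cmod v + 1; have m0 : 0 < m by rewrite ltr_wpDl ?cmod_ge0.
have em : 0 < e / m by rewrite divr_gt0.
have [d d0 H] := (inearP _ _ _).1 (fc _ em).
have nD' : \forall h \near nbhs (0 : R), D (a + Complex (t + h) 0 * v).
  have /nbhs_ballP[r /= r0 hr] := nD; apply/nbhs_ballP; exists r => // h.
  rewrite -ball_normE/= sub0r normrN => hr'; apply: hr.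
  by rewrite -ball_normE/= opprD addrA subrr sub0r normrN.
have hE h : a + Complex (t + h) 0 * v - (a + Complex t 0 * v) = Complex h 0 * v.
  have -> : Complex (t + h) 0 = Complex t 0 + Complex h 0 :> C.
    by rewrite /GRing.add/= addr0.
  by ring.
near=> h; have := H (a + Complex (t + h) 0 * v).
rewrite hE cmodM cmod_real => Hh.
have : cmod (f (a + Complex (t + h) 0 * v) - f (a + Complex t 0 * v) -
     Complex h 0 * v * c) <= e / m * (`|h| * cmod v).
  apply: Hh; last by near: h.
  rewrite (@le_lt_trans _ _ (`|h| * m)) ?ler_wpM2l ?lerDl//.
  rewrite -ltr_pdivlMr//; near: h; apply/nbhs_ballP; exists (d / m).
    by rewrite /= divr_gt0.
  by move=> h; rewrite -ball_normE/= sub0r normrN.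
have -> : Complex h 0 * (c * v) = Complex h 0 * v * c by ring.
move=> /le_trans H'; apply: H'.
rewrite mulrCA mulrC; apply: ler_wpM2r => //.
by rewrite -mulrA ler_piMr ?(ltW e0)// mulrC ler_pdivrMr// mul1r lerDl.
Unshelve. all: by end_near. Qed.

Lemma cauchy_schwarz (z w : C) : Re z * Re w + Im z * Im w <= cmod z * cmod w.
Proof.
have := Re_le_cmod (z * conjc w); rewrite cmodM => /(le_trans (ler_norm _)).
have -> : cmod (conjc w) = cmod w by case: w => x y; rewrite /cmod/= sqrrN.
by case: z w => x y [u v]/=; rewrite mulrN opprK.
Qed.

Definition pcts p (a b : R) :=
  {within `[a, b], continuous (fun x => Re (p x))} /\
  {within `[a, b], continuous (fun x => Im (p x))}.

(** Projection on the direction of the total defect [D] turns the inequality between vectors into a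
    real one: [g] is the component of the defect along [D] minus [cmod D] times [B], and
    Cauchy-Schwarz makes it nonincreasing. *)
Lemma path_mvt p (p' : R -> C) (B B' : R -> R) (a b : R) (c : C) : a <= b ->
  (forall t, t \in `]a, b[ -> pderiv p t (p' t)) ->
  (forall t, t \in `]a, b[ -> is_derive t 1 B (B' t)) ->
  (forall t, t \in `]a, b[ -> cmod (p' t - c) <= B' t) ->
  pcts p a b -> {within `[a, b], continuous B} ->
  cmod (p b - p a - Complex (b - a) 0 * c) <= B b - B a.
Proof.
move=> ab pd Bd pB [cr ci] cB.
set D := _ - _ - _.
have [->|D0] := eqVneq D 0.
  rewrite cmod0 subr_ge0.
  have Bd1 t : t \in `]a, b[ -> derivable B t 1 by move=> /Bd[].
  apply: (ger0_derive1_ndecr Bd1 _ cB) => // t tab.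
  rewrite derive1E (@derive_val _ _ _ _ _ _ _ (Bd t tab)).
  exact: le_trans (cmod_ge0 _) (pB t tab).
pose g (t : R) := Re D * Re (p t) + Im D * Im (p t)
   - (Re D * Re c + Im D * Im c) * t - cmod D * B t.
have gd t : t \in `]a, b[ -> is_derive t 1 g (Re D * Re (p' t) + Im D * Im (p' t)
   - (Re D * Re c + Im D * Im c) - cmod D * B' t).
  move=> tab; have [h1 h2] := pd t tab; have h3 := Bd t tab.
  have := is_deriveB (is_deriveB (is_deriveD (is_deriveZ (Re D) h1) (is_deriveZ (Im D) h2))
     (is_deriveZ (Re D * Re c + Im D * Im c) (is_derive_id t 1))) (is_deriveZ (cmod D) h3).
  by rewrite /GRing.scale/= mulr1.
have idc : {within `[a, b], continuous (fun x : R => x)}.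
  by apply: continuous_subspaceT => x; exact: cvg_id.
have cg : {within `[a, b], continuous g}.
  move=> x; apply: cvgB; last by apply: cvgM; [exact: cvg_cst|exact: cB].
  apply: cvgB; last by apply: cvgM; [exact: cvg_cst|exact: idc].
  by apply: cvgD; apply: cvgM; [exact: cvg_cst|exact: cr|exact: cvg_cst|exact: ci].
have gd1 t : t \in `]a, b[ -> derivable g t 1 by move=> /gd[].
have : g b <= g a.
  apply: (ler0_derive1_nincr gd1 _ cg) => // t tab.
  rewrite derive1E (@derive_val _ _ _ _ _ _ _ (gd t tab)) subr_le0.
  rewrite (@le_trans _ _ (cmod D * cmod (p' t - c)))//; last first.
    by rewrite ler_wpM2l ?cmod_ge0// pB.
  rewrite (le_trans _ (cauchy_schwarz _ _))// !ReImE/=.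
  by rewrite le_eqVlt; apply/orP; left; apply/eqP; ring.
rewrite -subr_ge0 => gba.
have : cmod D * cmod D <= cmod D * (B b - B a).
  rewrite -subr_ge0 -expr2 sqr_cmod (le_trans gba)// le_eqVlt.
  apply/orP; left; apply/eqP; rewrite /g.
  have -> : Re D ^+ 2 + Im D ^+ 2 = Re D * (Re (p b) - Re (p a) - (b - a) * Re c)
    + Im D * (Im (p b) - Im (p a) - (b - a) * Im c).
    by rewrite /D !ReImE/= !mul0r subr0 addr0 !expr2.
  by ring.
by rewrite ler_pM2l// cmod_gt0.
Qed.

End derivative_along_lines.

(** * Exponential and logarithm *)

Section complex_exponential.
Variable R : realType.
Local Notation C := (complex R).
Implicit Types z w : C.

Definition cexp z : C :=
  Complex (expR (Re z) * cos (Im z)) (expR (Re z) * sin (Im z)).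

Lemma cexpD z w : cexp (z + w) = cexp z * cexp w.
Proof.
apply: complex_ext; rewrite /cexp !ReImE/= expRD ?cosD ?sinD; ring.
Qed.

Lemma cexp0 : cexp 0 = 1.
Proof. by rewrite /cexp/= expR0 cos0 sin0 mulr1 mulr0. Qed.

Lemma cmod_cexp z : cmod (cexp z) = expR (Re z).
Proof.
rewrite /cmod/= !exprMn -mulrDr cos2Dsin2 mulr1 sqrtr_sqr.
by rewrite ger0_norm// expR_ge0.
Qed.

Lemma cexp_neq0 z : cexp z != 0.
Proof. by rewrite -cmod_gt0 cmod_cexp expR_gt0. Qed.

Let cdiff_cexp0 : cdiff setT cexp 0 1.
Proof.
(* The error splits into four terms of total at most 6 (e / 8) |z|, since the real exponential is
   below 2 near 0. *)
apply/cdiffP => e e0; have e8 : 0 < e / 8 by rewrite divr_gt0.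
have /is_deriveP/(_ _ e8) hE := is_derive_expR (0 : R).
have /is_deriveP/(_ _ e8) hC := is_derive_cos (0 : R).
have /is_deriveP/(_ _ e8) hS := is_derive_sin (0 : R).
have /cvgrPdist_lt/(_ _ e8) hc := @continuous_expR R 0.
have /cvgrPdist_lt/(_ _ ltr01) hc1 := @continuous_expR R 0.
have [d d0 H] : exists2 d : R, 0 < d & forall x : R, `|x| < d ->
   [/\ `|expR x - 1 - x| <= e / 8 * `|x|, `|cos x - 1| <= e / 8 * `|x|,
       `|sin x - x| <= e / 8 * `|x|, `|expR x - 1| < e / 8 & expR x < 2].
  have : \forall x \near (0 : R), [/\ `|expR x - 1 - x| <= e / 8 * `|x|,
      `|cos x - 1| <= e / 8 * `|x|,
       `|sin x - x| <= e / 8 * `|x|, `|expR x - 1| < e / 8 & expR x < 2].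
    near=> x; split.
    - by have : `|expR (0 + x) - expR 0 - x * expR 0| <= e / 8 * `|x|;
        [near: x|rewrite add0r expR0 mulr1].
    - by have : `|cos (0 + x) - cos 0 - x * - sin 0| <= e / 8 * `|x|;
        [near: x|rewrite add0r cos0 sin0 oppr0 mulr0 subr0].
    - by have : `|sin (0 + x) - sin 0 - x * cos 0| <= e / 8 * `|x|;
        [near: x|rewrite add0r cos0 sin0 mulr1 subr0].
    - by have : `|expR 0 - expR x| < e / 8; [near: x|rewrite expR0 distrC].
    - have : `|expR 0 - expR x| < 1; first by near: x.
      by rewrite expR0 ltr_norml => /andP[]; lra.
  move=> /nbhs_ballP[d /= d0 H]; exists d => // x xd; apply: H.
  by rewrite -ball_normE/= sub0r normrN.
apply/inearP; exists d => // -[x y]; rewrite subr0 mulr1 => xyd _.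
have xd : `|x| < d by apply: le_lt_trans xyd; exact: (Re_le_cmod (Complex x y)).
have yd : `|y| < d by apply: le_lt_trans xyd; exact: (Im_le_cmod (Complex x y)).
have [h1 _ _ h4 h5] := H _ xd; have [_ h2 h3 _ _] := H _ yd.
have hx := Re_le_cmod (Complex x y); have hy := Im_le_cmod (Complex x y).
rewrite /= in hx hy.
have sy : `|expR x| <= 2 by rewrite ger0_norm ?expR_ge0// ltW.
rewrite (le_trans (cmod_le_ReIm _))// !ReImE cexp0/=.
have -> : expR x * cos y - 1 - x = (expR x - 1 - x) + expR x * (cos y - 1) by ring.
have -> : expR x * sin y - 0 - y = (expR x - 1) * y + expR x * (sin y - y) by ring.
have k1 : `|expR x * (cos y - 1)| <= 2 * (e / 8 * `|y|).
  by rewrite normrM ler_pM.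
have k2 : `|expR x * (sin y - y)| <= 2 * (e / 8 * `|y|).
  by rewrite normrM ler_pM.
have k3 : `|(expR x - 1) * y| <= e / 8 * `|y|.
  by rewrite normrM ler_wpM2r// ltW.
have k4 := ler_normD (expR x - 1 - x) (expR x * (cos y - 1)).
have k5 := ler_normD ((expR x - 1) * y) (expR x * (sin y - y)).
have k6 : e / 8 * `|x| <= e / 8 * cmod (Complex x y) by rewrite ler_pM2l.
have k7 : e / 8 * `|y| <= e / 8 * cmod (Complex x y) by rewrite ler_pM2l.
have : 0 <= e / 8 * cmod (Complex x y) by rewrite mulr_ge0 ?cmod_ge0// ltW.
have -> : e * cmod (Complex x y) = 8 * (e / 8 * cmod (Complex x y)) by field.
lra.
Unshelve. all: by end_near. Qed.

Lemma cdiff_cexp D z : cdiff D cexp z (cexp z).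
Proof.
have H : cdiff setT (fun w => cexp z * cexp (w - z)) z (cexp z).
  rewrite -[X in cdiff _ _ _ X]mulr1; apply: cdiffZ.
  rewrite -[1]mulr1; apply: (@cdiff_comp _ setT setT (fun w => w - z) cexp z 1 1).
  - exact: nearW.
  - by rewrite -[1]subr0; apply: cdiffB; [exact: cdiff_id|exact: cdiff_cst].
  - by rewrite subrr; exact: cdiff_cexp0.
apply: (@cdiff_sub _ _ setT); first exact: nearW.
apply: (cdiff_eq _ _ H).
  by apply: nearW => w; rewrite -cexpD addrC subrK.
by rewrite subrr cexp0 mulr1.
Qed.

End complex_exponential.

Section complex_logarithm.
Variable R : realType.
Local Notation C := (complex R).
Implicit Types z w : C.

(** This is the argument only where [Im z] is nonnegative, but it is continuous on the whole
    punctured plane; in particular the negative axis is no cut as seen from above. *)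
Definition carg z : R := acos (Re z / cmod z).
Definition clog z : C := Complex (ln (cmod z)) (carg z).

(* the domain of the branch of the logarithm with argument in [0, pi] *)
Definition cuhp0 : set C := [set z | 0 <= Im z /\ z != 0].

Lemma Re_div_cmod z : z != 0 -> -1 <= Re z / cmod z <= 1.
Proof.
move=> z0; have cz : 0 < cmod z by rewrite cmod_gt0.
by rewrite -ler_norml normrM normfV (ger0_norm (cmod_ge0 z)) ler_pdivrMr// mul1r Re_le_cmod.
Qed.

Lemma cos_carg z : z != 0 -> cmod z * cos (carg z) = Re z.
Proof.
move=> z0; have cz : 0 < cmod z by rewrite cmod_gt0.
rewrite /carg acosK ?in_itv/= ?Re_div_cmod//.
by rewrite mulrC divfK// gt_eqF.
Qed.

Lemma sin_carg z : z != 0 -> 0 <= Im z -> cmod z * sin (carg z) = Im z.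
Proof.
move=> z0 Iz; have cz : 0 < cmod z by rewrite cmod_gt0.
rewrite /carg sin_acos ?Re_div_cmod//.
apply/eqP; rewrite -(@eqrXn2 _ 2)// ?mulr_ge0 ?sqrtr_ge0 ?cmod_ge0//.
rewrite exprMn [X in _ * X]sqr_sqrtr; last first.
  by have := Re_div_cmod z0; nra.
have -> : cmod z ^+ 2 * (1 - (Re z / cmod z) ^+ 2) = cmod z ^+ 2 - Re z ^+ 2.
  by field; rewrite gt_eqF.
by rewrite sqr_cmod addrAC subrr add0r.
Qed.

Lemma carg_ge0 z : z != 0 -> 0 <= carg z.
Proof. by move=> z0; rewrite acos_ge0// Re_div_cmod. Qed.

Lemma carg_lepi z : z != 0 -> carg z <= pi.
Proof. by move=> z0; rewrite acos_lepi// Re_div_cmod. Qed.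

Lemma Im_gt0_neq0 z : 0 < Im z -> z != 0.
Proof. by apply: contraTneq => ->; rewrite ltxx. Qed.

Lemma carg_gt0 z : 0 < Im z -> 0 < carg z.
Proof.
move=> Iz; have z0 := Im_gt0_neq0 Iz; rewrite lt_neqAle carg_ge0// andbT.
apply/eqP => H; have := sin_carg z0 (ltW Iz).
by rewrite -H sin0 mulr0 => Iz0; rewrite -Iz0 ltxx in Iz.
Qed.

Lemma carg_ltpi z : 0 < Im z -> carg z < pi.
Proof.
move=> Iz; have z0 := Im_gt0_neq0 Iz; rewrite lt_neqAle carg_lepi// andbT.
apply/eqP => H; have := sin_carg z0 (ltW Iz).
by rewrite H sinpi mulr0 => Iz0; rewrite -Iz0 ltxx in Iz.
Qed.

Lemma carg_pos (x : R) : 0 < x -> carg (Complex x 0) = 0.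
Proof. by move=> x0; rewrite /carg cmod_real/= gtr0_norm// divff ?gt_eqF// acos1. Qed.

Lemma carg_neg (x : R) : x < 0 -> carg (Complex x 0) = pi.
Proof.
by move=> x0; rewrite /carg cmod_real/= ltr0_norm// invrN mulrN divff ?lt_eqF// acosN1.
Qed.

Lemma carg_conjN z : z != 0 -> carg (- conjc z) = pi - carg z.
Proof.
move=> z0; rewrite -acosN ?Re_div_cmod//; congr acos.
have -> : cmod (- conjc z) = cmod z by case: z {z0} => x y; rewrite /cmod/= opprK sqrrN.
by case: z {z0} => x y /=; rewrite mulNr.
Qed.

(** The sine of the difference of the arguments, times the moduli, is the cross product y (r - s) <
    0, whereas a difference lying in [0, pi] would have a nonnegative sine. *)
Lemma carg_lt (y r s : R) : 0 < y -> r < s ->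
  carg (Complex s y) < carg (Complex r y).
Proof.
move=> y0 rs; set z := Complex s y; set w := Complex r y.
have z0 : z != 0 by apply: Im_gt0_neq0.
have w0 : w != 0 by apply: Im_gt0_neq0.
have cz : 0 < cmod z by rewrite cmod_gt0.
have cw : 0 < cmod w by rewrite cmod_gt0.
rewrite ltNge; apply/negP => H.
have : 0 <= sin (carg z - carg w).
  rewrite sin_ge0_pi// subr_ge0 H/= (le_trans _ (carg_lepi z0))//.
  by rewrite gerBl carg_ge0.
rewrite sinB => /(mulr_ge0 (ltW (mulr_gt0 cz cw))).
have -> : cmod z * cmod w * (sin (carg z) * cos (carg w) - cos (carg z) * sin (carg w))
  = (cmod z * sin (carg z)) * (cmod w * cos (carg w))
    - (cmod z * cos (carg z)) * (cmod w * sin (carg w)) by ring.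
rewrite !cos_carg// !sin_carg ?(ltW y0)//= (mulrC y) -mulrBl.
by rewrite pmulr_lge0// subr_ge0 leNgt rs.
Qed.

Lemma cexp_clog z : cuhp0 z -> cexp (clog z) = z.
Proof.
move=> [Iz z0]; have cz : 0 < cmod z by rewrite cmod_gt0.
by apply: complex_ext; rewrite /= lnK ?posrE// ?cos_carg// sin_carg.
Qed.

(** The end points, where [acos] is not differentiable, are covered by the continuity of the inverse
    of the injective function [- cos] on the segment [0, pi]. *)
Lemma acos_continuous_within : {within `[-1, 1], continuous (@acos R)}.
Proof.
pose f (x : R) : R := - cos x; pose g (x : R) : R := pi - acos x.
have fg : {in `[0, pi], cancel f g}.
  move=> x; rewrite in_itv/= => x0; rewrite /f /g acosN.
    by rewrite cosK ?in_itv//= subKr.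
  by rewrite cos_geN1 cos_le1.
have cf : {within `[0, pi], continuous f}.
  by apply: continuous_subspaceT => x; apply: cvgN; exact: continuous_cos.
have := segment_can_le_continuous (pi_ge0 R) cf fg.
rewrite /f cos0 cospi opprK => cg.
have -> : (@acos R) = (fun x => pi - g x) by apply/funext => x; rewrite /g subKr.
by move=> x; apply: cvgB; [exact: cvg_cst|exact: cg].
Qed.

Lemma carg_continuous z : z != 0 -> carg w @[w --> nbhs (z : plane R)] --> carg z.
Proof.
move=> z0; have cz : cmod z != 0 by rewrite cmod_eq0.
have H : (fun w : plane R => Re w / cmod w) @ nbhs (z : plane R) --> Re z / cmod z.
  have cid : clim (nbhs (z : plane R)) id z by apply/climP => e; exact: near_plane.
  apply: cvgM; first exact: (clim_Re cid).
  by apply: cvgV => //; exact: (clim_cmod cid).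
have n0 : \forall w \near nbhs (z : plane R), w != 0.
  have cz0 : 0 < cmod z by rewrite cmod_gt0.
  apply: filterS (near_plane z cz0) => w; apply: contraTneq => ->.
  by rewrite sub0r cmodN ltxx.
have zin := Re_div_cmod z0.
have /subspace_continuousP/(_ (Re z / cmod z)) := acos_continuous_within.
rewrite /= in_itv/= zin => /(_ isT) cac.
move=> A /cac; rewrite /= => /H; apply: filterS2 n0 => w w0.
by rewrite /= in_itv/= Re_div_cmod//; apply.
Qed.

Lemma clog_clim D z : z != 0 -> clim (inear D z) clog (clog z).
Proof.
move=> z0; have cid : clim (inear D z) id z by exact: clim_id.
have cz : 0 < cmod z by rewrite cmod_gt0.
apply: clim_Complex.
  by apply: (cvg_comp _ _ (clim_cmod cid)); exact: continuous_ln.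
move=> A /(carg_continuous z0) H.
change (nbhs (z : plane R) (carg @^-1` A)) in H.
change (inear D z (carg @^-1` A)).
by apply: filterS H => w Hw _.
Qed.

(** The difference quotient of the logarithm is the reciprocal of that of the exponential, taken at
    [clog w]; besides this only the continuity of [clog] is needed. *)
Lemma cdiff_clog D z : D `<=` cuhp0 -> D z -> cdiff D clog z z^-1.
Proof.
move=> DU Dz; have [Iz z0] := DU _ Dz.
have [q [fq qc]] := cdiff_cexp setT (clog z).
exists (fun w => (q (clog w))^-1); split=> [w Dw|].
  have := fq (clog w) I; rewrite !cexp_clog//; try exact: DU.
  have [->|q0 ->] := eqVneq (q (clog w)) 0; last by rewrite mulfK.
  by rewrite mulr0 => /eqP; rewrite subr_eq0 => /eqP ->; rewrite !subrr mul0r.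
apply: (climV z0); rewrite (cexp_clog (DU _ Dz)) in qc.
apply: (@clim_comp R C C (inear D z) (inear setT (clog z)) clog q); last exact: qc.
move=> A /inearP[e e0 HA].
change (inear D z (clog @^-1` A)).
have FF := inear_filter D z.
have H := (climP (FF := FF) _ _).1 (clog_clim D z0) e e0.
by apply: (@filterS _ _ FF _ _ _ H) => w we; exact: HA.
Qed.

End complex_logarithm.

(** * Improper integrals of derivatives *)

Section improper_FTC.
Variable R : realType.
Local Notation mu := (@lebesgue_measure R).
Implicit Types (f F : R -> R).

(** For a nonnegative integrand, monotone convergence along an exhaustion by compact intervals
    yields integrability and the value of the integral together. *)
Lemma ge0_FTC_bigcup f F (a_ b_ : nat -> R) (I : set R) (l : R) :
  (forall n, a_ n < b_ n) -> {homo a_ : m n / (m <= n)%N >-> n <= m} ->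
  {homo b_ : m n / (m <= n)%N >-> m <= n} ->
  \bigcup_n `[a_ n, b_ n]%classic = I ->
  (forall x, I x -> is_derive x 1 F (f x)) ->
  (forall x, I x -> {for x, continuous f}) -> (forall x, I x -> 0 <= f x) ->
  (fun n => F (b_ n) - F (a_ n)) @ \oo --> l ->
  mu.-integrable I (EFin \o f) /\ (\int[mu]_(x in I) f x = l).
Proof.
move=> ab ha hb <- Ff cf f0 Fl.
have sub n x : `[a_ n, b_ n]%classic x -> (\bigcup_n `[a_ n, b_ n]%classic) x.
  by move=> abx; exists n.
have cfn n : {within `[a_ n, b_ n], continuous f}.
  by apply: continuous_in_subspaceT => x; rewrite inE => abx; exact/cf/sub/abx.
have mf' n : measurable_fun (`[a_ n, b_ n]%classic : set R) f.
  exact: subspace_continuous_measurable_fun.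
have mf n := (measurable_EFinP _ _).2 (mf' n).
have E n : (\int[mu]_(x in `[a_ n, b_ n]) (f x)%:E = (F (b_ n) - F (a_ n))%:E)%E.
  rewrite EFinB; apply: continuous_FTC2 => //.
    have dF x : x \in `[a_ n, b_ n] -> derivable F x 1.
      by move=> xab; have [] := Ff x (sub n x xab).
    have : {within `[a_ n, b_ n], continuous F}.
      exact: derivable_within_continuous.
    move=> /(continuous_within_itvP _ (ab n))[_ ? ?]; split => // x xab.
    by apply: dF; move: xab; exact: subset_itv_oo_cc.
  move=> x xab; rewrite derive1E.
  have H : is_derive x 1 F (f x) by apply/Ff/(sub n)/subset_itv_oo_cc.
  exact: derive_val.
have sdF : {homo (fun n => `[a_ n, b_ n]%classic) : n m / (n <= m)%N >-> (n <= m)%O}.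
  move=> n m nm; apply/subsetPset => x /=; rewrite !in_itv/= => /andP[h1 h2].
  by rewrite (le_trans (ha _ _ nm) h1) (le_trans h2 (hb _ _ nm)).
have mS n : measurable (`[a_ n, b_ n]%classic : set R) by [].
have f0n n x : `[a_ n, b_ n]%classic x -> (0 <= (EFin \o f) x)%E.
  by move=> abx; rewrite lee_fin; exact/f0/(sub n).
have cv := ge0_nondecreasing_set_cvg_integral (mu := mu) sdF mS mf f0n.
have cv2 : ((F (b_ n) - F (a_ n))%:E @[n --> \oo] --> l%:E)%E.
  by apply: cvg_EFin => //; exact: nearW.
have I1 : (\int[mu]_(x in \bigcup_n `[a_ n, b_ n]%classic) (f x)%:E = l%:E)%E.
  apply: cvg_unique cv _ => //.
  change ((fun n => \int[mu]_(x in `[a_ n, b_ n]) (f x)%:E) @ \oo --> l%:E)%E.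
  by rewrite (_ : (fun n => _) = (fun n => (F (b_ n) - F (a_ n))%:E))//; exact/funext.
have mU : measurable (\bigcup_n `[a_ n, b_ n]%classic : set R).
  exact: bigcup_measurable.
split; last by rewrite /Rintegral I1.
apply/integrableP; split.
  by apply/measurable_fun_bigcup => // n; exact: mf.
under eq_integral => x.
  rewrite inE => Ix; rewrite /= ger0_norm ?f0//; over.
by rewrite I1 ltry.
Qed.

Lemma ge0_FTC_oo f F (a b : R) : a < b ->
  {within `[a, b], continuous F} ->
  (forall x, x \in `]a, b[ -> is_derive x 1 F (f x)) ->
  (forall x, x \in `]a, b[ -> {for x, continuous f}) ->
  (forall x, x \in `]a, b[ -> 0 <= f x) ->
  mu.-integrable `]a, b[ (EFin \o f) /\ (\int[mu]_(x in `]a, b[) f x = F b - F a).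
Proof.
move=> ab cF Ff cf f0.
(* The denominator starts at 3 so that [2 * e n < b - a]: none of the inner intervals is
   degenerate. *)
pose e (n : nat) : R := (b - a) / n.+3%:R.
have ba : 0 < b - a by rewrite subr_gt0.
have e0 n : 0 < e n by rewrite divr_gt0.
have eh n m : (n <= m)%N -> e m <= e n.
  by move=> nm; rewrite ler_pM2l// lef_pV2 ?posrE// ler_nat.
have e2 n : 2 * e n < b - a.
  by rewrite /e mulrCA gtr_pMr// ltr_pdivrMr// mul1r ltr_nat.
have eoo : e @ \oo --> 0.
  rewrite -(mulr0 (b - a)); apply: cvgM; first exact: cvg_cst.
  apply/cvgrPdist_lt => d d0; have := @cvg_harmonic R.
  move=> /cvgrPdist_lt/(_ d d0)[N _ NA]; exists N => // n /= Nn.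
  exact: (NA n.+2 (leq_trans Nn (leq_addl 2 n))).
have cv : (fun n => F (b - e n) - F (a + e n)) @ \oo --> F b - F a.
  have /(continuous_within_itvP _ ab)[_ Fa Fb] := cF.
  apply: cvgB.
    apply: (cvg_at_leftP _ _ _).1 Fb _ _; split=> [n|]; first by rewrite gtrBl.
    by rewrite -[X in _ --> X]subr0; apply: cvgB => //; exact: cvg_cst.
  apply: (cvg_at_rightP _ _ _).1 Fa _ _; split=> [n|]; first by rewrite ltrDl.
  by rewrite -[X in _ --> X]addr0; apply: cvgD => //; exact: cvg_cst.
apply: (ge0_FTC_bigcup (F := F) _ _ _ _ _ _ _ cv).
- by move=> n; rewrite ltrBrDr -addrA -mulr2n -mulr_natl addrC -ltrBrDr.
- by move=> m n /eh; rewrite lerD2l.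
- by move=> m n /eh; rewrite lerD2l lerN2.
- apply/seteqP; split=> [x [n _]|x].
    rewrite /= !in_itv/= => /andP[h1 h2].
    by rewrite (lt_le_trans _ h1) ?ltrDl// (le_lt_trans h2)// gtrBl.
  rewrite /= in_itv/= => /andP[ax xb].
  have m0 : 0 < Num.min (x - a) (b - x) by rewrite lt_min !subr_gt0 ax.
  have /cvgrPdist_lt/(_ _ m0)[N _ /(_ N (leqnn N))] := eoo.
  rewrite /= sub0r normrN gtr0_norm// lt_min => /andP[h1 h2].
  by exists N => //=; rewrite in_itv/=; apply/andP; split; lra.
- by move=> x /=; exact: cf.
- by move=> x /=; exact: f0.
Qed.

Lemma ge0_FTC_oy f F (l : R) :
  (forall x : R, 0 < x -> is_derive x 1 F (f x)) ->
  (forall x : R, 0 < x -> {for x, continuous f}) ->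
  (forall x : R, 0 < x -> 0 <= f x) ->
  F x @[x --> 0^'+] --> F 0 -> F x @[x --> +oo] --> l ->
  mu.-integrable `]0, +oo[ (EFin \o f) /\ (\int[mu]_(x in `]0, +oo[) f x = l - F 0).
Proof.
move=> Ff cf f0 F0 Fl.
have hoo := @cvg_harmonic R.
have cv : (fun n => F n.+2%:R - F (n.+1%:R^-1)) @ \oo --> l - F 0.
  apply: cvgB.
    apply: (cvg_pinftyP _ _).1 Fl _ _; apply/cvgryPge => A.
    have [N AN] : exists N : nat, A <= N%:R.
      by exists (Num.truncn `|A|).+1; rewrite (le_trans (ler_norm _))// ltW// truncnS_gt.
    exists N => // n /= Nn; rewrite (le_trans AN)// ler_nat (leq_trans Nn)//.
    by rewrite -addn2 leq_addr.
  apply: (cvg_at_rightP _ _ _).1 F0 _ _; split=> [n|]; first by rewrite invr_gt0.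
  exact: hoo.
apply: (ge0_FTC_bigcup (F := F) (a_ := fun n => n.+1%:R^-1) (b_ := fun n => n.+2%:R)
   _ _ _ _ _ _ _ cv).
- by move=> n; rewrite (@le_lt_trans _ _ 1) ?invf_le1 ?ler1n ?ltr1n.
- by move=> m n mn; rewrite lef_pV2 ?posrE// ler_nat.
- by move=> m n mn; rewrite ler_nat !ltnS.
- apply/seteqP; split=> [x [n _]|x].
    rewrite /= !in_itv/= => /andP[h1 h2].
    by rewrite (lt_le_trans _ h1).
  rewrite /= in_itv/= andbT => x0.
  have m0 : 0 < Num.min x x^-1 by rewrite lt_min invr_gt0 x0.
  have /cvgrPdist_lt/(_ _ m0)[N _ /(_ N (leqnn N))] := hoo.
  rewrite /= sub0r normrN gtr0_norm// lt_min => /andP[h1 h2].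
  exists N => //=; rewrite in_itv/= (ltW h1)/=.
  move: h2; rewrite ltf_pV2 ?posrE// => /ltW h2.
  by rewrite (le_trans h2)// ler_nat.
- by move=> x /=; rewrite in_itv/= andbT; exact: Ff.
- by move=> x /=; rewrite in_itv/= andbT; exact: cf.
- by move=> x /=; rewrite in_itv/= andbT; exact: f0.
Qed.

End improper_FTC.

(** * Primitives along vertical half-lines *)

Section half_line_integral.
Variable R : realType.
Local Notation C := (complex R).
Local Notation mu := (@lebesgue_measure R).
Local Notation D0 := (`]0%R, +oo[%classic : set R).

Lemma Rintegral_dct (D : set R) (f_ : nat -> R -> R) (f M : R -> R) :
  measurable D ->
  (forall n, measurable_fun D (f_ n)) -> mu.-integrable D (EFin \o M) ->
  (forall t, D t -> f_ ^~ t @ \oo --> f t) ->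
  (forall n t, D t -> `|f_ n t| <= M t) ->
  mu.-integrable D (EFin \o f) /\
  (fun n => \int[mu]_(t in D) f_ n t) @ \oo --> \int[mu]_(t in D) f t.
Proof.
move=> mD mf iM ff fM.
have mf' n : measurable_fun D (EFin \o f_ n) by exact/measurable_EFinP.
have mF : measurable_fun D (EFin \o f).
  apply: (emeasurable_fun_cvg (fun n => EFin \o f_ n)) => // t Dt.
  by apply: cvg_EFin; [exact: nearW|exact: ff].
have [iF _ cF] : [/\ mu.-integrable D (EFin \o f),
    [sequence (\int[mu]_(x in D) `|(EFin \o f_ n) x - (EFin \o f) x|)%E]_n @ \oo --> 0%E
  & [sequence (\int[mu]_(x in D) (EFin \o f_ n) x)%E]_n @ \oo -->
     (\int[mu]_(x in D) (EFin \o f) x)%E].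
  apply: (@dominated_convergence _ _ _ mu D mD (fun n => EFin \o f_ n)
    (EFin \o f) (EFin \o M) mf' mF _ iM).
    by apply: aeW => t Dt; apply: cvg_EFin; [exact: nearW|exact: ff].
  by apply: aeW => t n Dt; rewrite lee_fin; exact: fM.
split => //; apply: fine_cvg; rewrite fineK; first exact: cF.
exact: integrable_fin_num.
Qed.

Definition cmeas (f : R -> C) := measurable_fun D0 (fun t => Re (f t)) /\
  measurable_fun D0 (fun t => Im (f t)).

Definition cintegrable (f : R -> C) :=
  mu.-integrable D0 (EFin \o (fun t => Re (f t))) /\
  mu.-integrable D0 (EFin \o (fun t => Im (f t))).

Definition cint (f : R -> C) : C :=
  Complex (\int[mu]_(t in D0) Re (f t)) (\int[mu]_(t in D0) Im (f t)).

Lemma cint_dct (f_ : nat -> R -> C) (f : R -> C) (M : R -> R) :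
  (forall n, cmeas (f_ n)) -> mu.-integrable D0 (EFin \o M) ->
  (forall t, 0 < t -> clim \oo (f_ ^~ t) (f t)) ->
  (forall n t, 0 < t -> cmod (f_ n t) <= M t) ->
  cintegrable f /\ clim \oo (fun n => cint (f_ n)) (cint f).
Proof.
move=> mf iM ff fM.
have D0P t : D0 t -> 0 < t by rewrite /= in_itv/= andbT.
have [i1 c1] := @Rintegral_dct D0 (fun n t => Re (f_ n t)) (fun t => Re (f t)) M
  (measurable_itv _) (fun n => (mf n).1) iM (fun t Dt => clim_Re (ff t (D0P t Dt)))
  (fun n t Dt => le_trans (Re_le_cmod _) (fM n t (D0P t Dt))).
have [i2 c2] := @Rintegral_dct D0 (fun n t => Im (f_ n t)) (fun t => Im (f t)) M
  (measurable_itv _) (fun n => (mf n).2) iM (fun t Dt => clim_Im (ff t (D0P t Dt)))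
  (fun n t Dt => le_trans (Im_le_cmod _) (fM n t (D0P t Dt))).
by split => //; exact: clim_Complex.
Qed.

Lemma cintegrable_dom (f : R -> C) (M : R -> R) : cmeas f ->
  mu.-integrable D0 (EFin \o M) -> (forall t, 0 < t -> cmod (f t) <= M t) ->
  cintegrable f.
Proof.
move=> mf iM fM.
by have [] := @cint_dct (fun=> f) f M (fun=> mf) iM (fun t _ => clim_cst (f t)) (fun=> fM).
Qed.

Lemma cintB (f g : R -> C) : cintegrable f -> cintegrable g ->
  cint (fun t => f t - g t) = cint f - cint g.
Proof.
move=> [f1 f2] [g1 g2]; rewrite /cint; apply: complex_ext; rewrite !ReImE/=.
  by rewrite -RintegralB//; apply: eq_Rintegral => t _; rewrite !ReImE.
by rewrite -RintegralB//; apply: eq_Rintegral => t _; rewrite !ReImE.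
Qed.

Lemma cintZ c (f : R -> C) : cintegrable f ->
  cintegrable (fun t => c * f t) /\ cint (fun t => c * f t) = c * cint f.
Proof.
move=> [f1 f2].
have mD : measurable D0 by exact: measurable_itv.
have iZ1 (x : R) (g : R -> R) : mu.-integrable D0 (EFin \o g) ->
    mu.-integrable D0 (EFin \o (fun t => x * g t)).
  move=> ig; have -> : EFin \o (fun t => x * g t) = (fun t => x%:E * (EFin \o g) t)%E.
    by apply/funext => t; rewrite /= EFinM.
  exact: integrableZl.
have iZ (x y : R) : mu.-integrable D0 (EFin \o (fun t => x * Re (f t) + y * Im (f t))).
  have -> : EFin \o (fun t => x * Re (f t) + y * Im (f t)) =
    (EFin \o (fun t => x * Re (f t))) \+ (EFin \o (fun t => y * Im (f t)))
    by exact/funext.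
  by apply: integrableD => //; exact: iZ1.
have EZ (x y : R) : \int[mu]_(t in D0) (x * Re (f t) + y * Im (f t)) =
   x * \int[mu]_(t in D0) Re (f t) + y * \int[mu]_(t in D0) Im (f t).
  rewrite RintegralD//; [|exact: iZ1|exact: iZ1].
  by rewrite !RintegralZl.
have E1 : (fun t => Re (c * f t)) = (fun t => Re c * Re (f t) + - Im c * Im (f t)).
  by apply/funext => t; rewrite !ReImE mulNr.
have E2 : (fun t => Im (c * f t)) = (fun t => Im c * Re (f t) + Re c * Im (f t)).
  by apply/funext => t; rewrite !ReImE addrC.
split; first by rewrite /cintegrable E1 E2.
rewrite /cint E1 E2 !EZ; apply: complex_ext; rewrite !ReImE/=; ring.
Qed.

Lemma eq_cint (f g : R -> C) : (forall t, 0 < t -> f t = g t) -> cint f = cint g.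
Proof.
move=> fg; rewrite /cint; congr Complex; apply: eq_Rintegral => t;
  by rewrite inE/= in_itv/= andbT => /fg ->.
Qed.

Lemma cts_cmeas (f : R -> C) :
  (forall t : R, 0 < t -> clim (nbhs t) f (f t)) -> cmeas f.
Proof.
move=> cf; have oD : open D0 by exact: interval_open.
split; apply: open_continuous_measurable_fun => // t; rewrite inE/= in_itv/= andbT => t0.
  exact: (clim_Re (cf t t0)).
exact: (clim_Im (cf t t0)).
Qed.

(** A component h' of g' has no constant sign, but b + h' is nonnegative as soon as |h'| <= b. The
    formula for nonnegative integrands is applied to b + h' and to b, and the results are
    subtracted. *)
Lemma cint_FTC (g g' : R -> C) (b B : R -> R) (g0 g1 : C) (B1 : R) :
  (forall t : R, 0 < t -> is_derive t 1 B (b t)) ->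
  (forall t : R, 0 < t -> {for t, continuous b}) ->
  B t @[t --> 0^'+] --> B 0 -> B t @[t --> +oo] --> B1 ->
  (forall t : R, 0 < t -> pderiv g t (g' t)) ->
  (forall t : R, 0 < t -> clim (nbhs t) g' (g' t)) ->
  (forall t : R, 0 < t -> cmod (g' t) <= b t) ->
  clim (0^'+) g (g 0) -> clim (pinfty_nbhs R) g g1 ->
  cint g' = g1 - g 0.
Proof.
move=> Bb cb B_0 B_1 gg cg gb g_0 g_1.
have b0 t : 0 < t -> 0 <= b t by move=> t0; exact: le_trans (cmod_ge0 _) (gb t t0).
have [ib Eb] := ge0_FTC_oy Bb cb b0 B_0 B_1.
have H (h h' : R -> R) (l : R) : (forall t : R, 0 < t -> is_derive t 1 h (h' t)) ->
    (forall t : R, 0 < t -> {for t, continuous h'}) ->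
    (forall t : R, 0 < t -> `|h' t| <= b t) -> h t @[t --> 0^'+] --> h 0 ->
    h t @[t --> +oo] --> l -> \int[mu]_(t in D0) h' t = l - h 0.
  move=> hh ch hb h_0 h_1.
  have [i E] : mu.-integrable D0 (EFin \o (fun t => b t + h' t)) /\
    \int[mu]_(t in D0) (b t + h' t) = (B1 + l) - (B 0 + h 0).
    apply: (@ge0_FTC_oy _ (fun t => b t + h' t) (fun t => B t + h t)).
    - by move=> t t0; have h1 := Bb t t0; have h2 := hh t t0; exact: is_deriveD.
    - by move=> t t0; apply: cvgD; [exact: cb|exact: ch].
    - by move=> t t0; have := hb t t0; rewrite ler_norml => /andP[]; lra.
    - exact: cvgD.
    - exact: cvgD.
  have -> : \int[mu]_(t in D0) h' t = \int[mu]_(t in D0) ((b t + h' t) - b t).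
    by apply: eq_Rintegral => t _; rewrite addrAC subrr add0r.
  by rewrite RintegralB// E Eb; ring.
apply: complex_ext; rewrite !ReImE/=.
  apply: (H (fun t => Re (g t)) (fun t => Re (g' t))).
  - by move=> t /gg [].
  - by move=> t /cg; exact: clim_Re.
  - by move=> t /gb; apply: le_trans; exact: Re_le_cmod.
  - exact: clim_Re.
  - exact: clim_Re.
apply: (H (fun t => Im (g t)) (fun t => Im (g' t))).
- by move=> t /gg [].
- by move=> t /cg; exact: clim_Im.
- by move=> t /gb; apply: le_trans; exact: Im_le_cmod.
- exact: clim_Im.
- exact: clim_Im.
Qed.

End half_line_integral.

(** * The upper half-plane, its filters, and estimates along its segments *)

Section upper_half_plane.
Variable R : realType.
Local Notation C := (complex R).
Implicit Types (z w : C) (f : C -> C).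

Definition uhp : set C := [set z | 0 < Im z].
Definition cuhp : set C := [set z | 0 <= Im z].

(** Dominated convergence concerns sequences; when a limit along the filter fails, choice extracts a
    sequence along which it fails. *)
Lemma clim_seq (D : set C) z f l :
  (forall u : nat -> C, (forall n, D (u n)) -> clim \oo u z -> clim \oo (f \o u) l) ->
  clim (inear D z) f l.
Proof.
move=> H; apply: contrapT => nf.
have [e e0 ne] : exists2 e : R, 0 < e & forall d : R, 0 < d ->
    exists w, [/\ cmod (w - z) < d, D w & e <= cmod (f w - l)].
  apply: contrapT => ne; apply: nf; apply/climP => e e0.
  apply: contrapT => nn; apply: ne; exists e => // d d0.
  apply: contrapT => nw; apply: nn; apply/inearP; exists d => // w wd Dw.
  by rewrite ltNge; apply/negP => ew; apply: nw; exists w.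
have /choice[u uP] : forall n : nat, exists w,
    [/\ cmod (w - z) < n.+1%:R^-1, D w & e <= cmod (f w - l)].
  by move=> n; apply: ne; rewrite invr_gt0.
have uz : clim \oo u z.
  apply: (clim_le (b := fun n => n.+1%:R^-1)).
    by apply: nearW => n; have [/ltW] := uP n.
  exact: cvg_harmonic.
have := H u (fun n => let: And3 _ h _ := uP n in h) uz.
move=> /climP/(_ e e0)[N _ /(_ N (leqnn N))] /=.
by have [_ _] := uP N; rewrite leNgt => /negP.
Qed.

(** The trace on [D] of the neighbourhoods of infinity. *)
Definition cinf (D : set C) : set_system C :=
  [set A | exists N : R, forall w, D w -> N < cmod w -> A w].

Global Instance cinf_filter D : Filter (cinf D).
Proof.
split; first by exists 0.
  move=> A B [N NA] [M MB]; exists (Num.max N M) => w Dw.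
  by rewrite gt_max => /andP[h1 h2]; split; [exact: NA|exact: MB].
by move=> A B AB [N NA]; exists N => w Dw /NA H; apply: AB; exact: H.
Qed.

Lemma clim_seq_inf (D : set C) f l :
  (forall u : nat -> C, (forall n, D (u n)) -> (forall n, n%:R < cmod (u n)) ->
     clim \oo (f \o u) l) ->
  clim (cinf D) f l.
Proof.
move=> H; apply: contrapT => nf.
have [e e0 ne] : exists2 e : R, 0 < e & forall N : R,
    exists w, [/\ N < cmod w, D w & e <= cmod (f w - l)].
  apply: contrapT => ne; apply: nf; apply/climP => e e0.
  apply: contrapT => nn; apply: ne; exists e => // d.
  apply: contrapT => nw; apply: nn; exists d => // w Dw wd.
  by rewrite ltNge; apply/negP => ew; apply: nw; exists w.
have /choice[u uP] : forall n : nat, exists w,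
    [/\ n%:R < cmod w, D w & e <= cmod (f w - l)] by move=> n; exact: ne.
have := H u (fun n => let: And3 _ h _ := uP n in h) (fun n => let: And3 h _ _ := uP n in h).
move=> /climP/(_ e e0)[N _ /(_ N (leqnn N))] /=.
by have [_ _] := uP N; rewrite leNgt => /negP.
Qed.

Lemma uhp_open z : uhp z -> \forall w \near nbhs (z : plane R), uhp w.
Proof.
move=> Iz; apply/nbhs_planeP; exists (Im z) => // w wz.
have := Im_le_cmod (w - z); rewrite !ReImE => /le_lt_trans/(_ wz).
by rewrite ltr_norml /uhp/= => /andP[]; lra.
Qed.

Lemma uhp_line_near (a v : C) (t : R) : uhp (a + Complex t 0 * v) ->
  \forall s \near t, uhp (a + Complex s 0 * v).
Proof.
rewrite /uhp/= !ReImE/= => H.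
have c : (fun s : R => Im a + (s * Im v + 0 * Re v)) @ t --> Im a + (t * Im v + 0 * Re v).
  apply: cvgD; first exact: cvg_cst.
  by apply: cvgD; [apply: cvgMl; exact: cvg_id|exact: cvg_cst].
by apply: filterS (cvgr_gt _ c _ H) => s; rewrite /= !ReImE.
Qed.

Lemma uhp_convex a b (t : R) : uhp a -> uhp b -> 0 <= t <= 1 ->
  uhp (a + Complex t 0 * (b - a)).
Proof. by rewrite /uhp/= !ReImE/= => ha hb /andP[t0 t1]; nra. Qed.

Lemma uhp_mvt f (f' : C -> C) a b c (e : R) :
  (forall z, uhp z -> cdiff uhp f z (f' z)) -> uhp a -> uhp b ->
  (forall t : R, 0 <= t <= 1 -> cmod (f' (a + Complex t 0 * (b - a)) - c) <= e) ->
  cmod (f b - f a - (b - a) * c) <= e * cmod (b - a).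
Proof.
move=> fd ua ub fe.
pose p (t : R) := f (a + Complex t 0 * (b - a)).
have pd (t : R) : 0 <= t <= 1 ->
    pderiv p t (f' (a + Complex t 0 * (b - a)) * (b - a)).
  move=> t01; have u := uhp_convex ua ub t01.
  by apply: cdiff_pderiv (fd _ u); exact: uhp_line_near.
have oc t : t \in `](0:R), 1[ -> 0 <= t <= 1.
  by rewrite in_itv/= => /andP[/ltW -> /ltW ->].
have := @path_mvt R p (fun t => f' (a + Complex t 0 * (b - a)) * (b - a))
   (fun t => (e * cmod (b - a)) * t) (fun=> e * cmod (b - a)) 0 1 (c * (b - a)) ler01.
have E0 : a + Complex 0 0 * (b - a) = a by apply: complex_ext; rewrite !ReImE/=; ring.
have E1 : a + Complex 1 0 * (b - a) = b by apply: complex_ext; rewrite !ReImE/=; ring.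
have E2 : Complex (1 - 0) 0 * (c * (b - a)) = (b - a) * c.
  by apply: complex_ext; rewrite !ReImE/=; ring.
rewrite /p E0 E1 E2 mulr0 mulr1 subr0; apply.
- by move=> t /oc; exact: pd.
- move=> t _; have := is_deriveZ (e * cmod (b - a)) (is_derive_id t (1 : R)).
  by rewrite /GRing.scale/= mulr1.
- move=> t /oc/fe h; rewrite -mulrBl cmodM.
  by rewrite ler_wpM2r ?cmod_ge0.
- split; apply: derivable_within_continuous => t; rewrite in_itv/= => /pd[].
    by move=> [].
  by move=> _ [].
- by apply: continuous_subspaceT => t; apply: cvgM; [exact: cvg_cst|exact: cvg_id].
Qed.

End upper_half_plane.

Lemma clim_ReIm (R : realType) T (F : set_system T) (FF : Filter F)
    (f : T -> complex R) l :
  (fun x => Re (f x)) @ F --> Re l -> (fun x => Im (f x)) @ F --> Im l -> clim F f l.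
Proof.
case: l => a b fa fb; apply: clim_near (clim_Complex fa fb).
by apply: nearW => x; case: (f x).
Qed.

Lemma convex_gt (R : realType) (y a b s : R) :
  y < a -> y < b -> 0 <= s <= 1 -> y < a + s * (b - a).
Proof.
move=> ya yb /andP[s0 s1]; have [ab|ba] := leP a b.
  by rewrite (lt_le_trans ya)// lerDl mulr_ge0// subr_ge0.
rewrite (lt_le_trans yb)// -[leLHS](subrK a) addrC lerD2l -subr_ge0.
have -> : s * (b - a) - (b - a) = (1 - s) * (a - b) by ring.
by rewrite mulr_ge0 ?subr_ge0// ltW.
Qed.

(** * An explicit integrable majorant *)

Section power_majorant.
Variable R : realType.
Variable beta : R.
Hypothesis beta01 : 0 <= beta < 1.

(* integrable on the half-line, of order t^-beta at 0 and t^-2 at infinity *)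
Definition majo (t : R) : R := (t / (1 + t)) `^ (- beta) * (1 + t) ^- 2.
(** The derivative of t / (1 + t) is (1 + t)^-2, which is why the majorant is written with this
    ratio: its primitive is elementary and has finite limits at 0 and at infinity. *)
Definition majo_prim (t : R) : R := (1 - beta)^-1 * (t / (1 + t)) `^ (1 - beta).

Let ratio_gt0 (t : R) : 0 < t -> 0 < t / (1 + t).
Proof. by move=> t0; rewrite divr_gt0// ltr_wpDl. Qed.

Lemma is_derive_majo (t : R) : 0 < t -> is_derive t 1 majo_prim (majo t).
Proof.
move=> t0; have t1 : 1 + t != 0 by rewrite gt_eqF// ltr_wpDl.
have b1 : 1 - beta != 0 by rewrite subr_eq0 gt_eqF//; case/andP: beta01.
have d1 : is_derive t 1 (fun s : R => s / (1 + s)) ((1 + t) ^- 2).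
  have d2 : is_derive t 1 (fun s : R => 1 + s) 1.
    have := is_deriveD (is_derive_cst (1 : R) t 1) (is_derive_id t (1 : R)).
    by rewrite add0r.
  have d3 := @is_deriveV R (fun s : R => 1 + s) t 1 1 t1 d2.
  have := is_deriveM (is_derive_id t (1 : R)) d3.
  rewrite /GRing.scale/=.
  have -> : t * (- (1 + t) ^- 2 * 1) + (1 + t)^-1 * 1 = (1 + t) ^- 2.
    by field.
  by [].
have d4 := @is_derive1_comp R (fun x => x `^ (1 - beta)) (fun s => s / (1 + s)) t _ _
  (is_derive1_powR (1 - beta) (ratio_gt0 t0)) d1.
have := is_deriveZ (1 - beta)^-1 d4; rewrite /GRing.scale/=.
have -> : 1 - beta - 1 = - beta by ring.
by rewrite -mulrA mulKf.
Qed.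

Lemma continuous_majo (t : R) : 0 < t -> {for t, continuous majo}.
Proof.
move=> t0; have t1 : 1 + t != 0 by rewrite gt_eqF// ltr_wpDl.
have c1 : (fun s : R => 1 + s) @ t --> 1 + t.
  by apply: cvgD; [exact: cvg_cst|exact: cvg_id].
have c2 : (fun s : R => s / (1 + s)) @ t --> t / (1 + t).
  by apply: cvgM; [exact: cvg_id|exact: cvgV].
have c3 : (fun s : R => (s / (1 + s)) `^ (- beta)) @ t --> (t / (1 + t)) `^ (- beta).
  apply: (@cvg_comp _ _ _ (fun s : R => s / (1 + s)) (fun x => x `^ (- beta)) _ _ _ c2).
  have [+ _] := is_derive1_powR (- beta) (ratio_gt0 t0).
  by move=> /derivable1_diffP/differentiable_continuous.
have c4 : (fun s : R => (1 + s) ^- 2) @ t --> (1 + t) ^- 2.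
  apply: cvgV; first by rewrite expf_neq0.
  by rewrite expr2; apply: cvgM.
exact: (cvgM c3 c4).
Qed.

Lemma majo_prim0 : majo_prim t @[t --> 0^'+] --> majo_prim 0.
Proof.
have b1 : 0 < 1 - beta by rewrite subr_gt0; case/andP: beta01.
rewrite /majo_prim mul0r powR0 ?gt_eqF//; apply: cvgM; first exact: cvg_cst.
apply: (@squeeze_cvgr _ _ _ _ (fun=> 0) (fun t : R => t `^ (1 - beta))).
- near=> t; rewrite powR_ge0/=.
  have t0 : 0 < t by near: t; exact: nbhs_right_gt.
  rewrite ge0_ler_powR ?nnegrE ?(ltW b1)//; try exact: ltW.
    by rewrite ltW// ratio_gt0.
  by rewrite ler_pdivrMr ?ltr_wpDl// mulrDr mulr1 lerDl mulr_ge0// ltW.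
- exact: cvg_cst.
- exact: powR_cvg0.
Unshelve. all: by end_near. Qed.

Lemma majo_primy : majo_prim t @[t --> +oo] --> (1 - beta)^-1.
Proof.
rewrite -[X in _ --> X]mulr1; apply: cvgM; first exact: cvg_cst.
have p1 : 1 `^ (1 - beta) = 1 :> R by rewrite powR1.
rewrite -[X in _ --> X]p1.
have c2 : (fun s : R => s / (1 + s)) @ +oo --> (1 : R).
  apply/cvgrPdist_lt => e e0; near=> t.
  have t0 : 0 < t by near: t; exact: nbhs_pinfty_gt.
  have t1 : 0 < 1 + t by rewrite ltr_wpDl.
  have -> : 1 - t / (1 + t) = (1 + t)^-1 by field; rewrite gt_eqF.
  rewrite gtr0_norm ?invr_gt0// -[ltRHS]invrK ltf_pV2 ?posrE ?invr_gt0//.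
  by rewrite ltr_wpDl//; near: t; apply: nbhs_pinfty_gt; exact: num_real.
apply: (@cvg_comp _ _ _ (fun s : R => s / (1 + s)) (fun x => x `^ (1 - beta)) _ _ _ c2).
have [+ _] := is_derive1_powR (1 - beta) (@ltr01 R).
by move=> /derivable1_diffP/differentiable_continuous.
Unshelve. all: by end_near. Qed.

Lemma majo_ge0 (t : R) : 0 < t -> 0 <= majo t.
Proof.
by move=> t0; rewrite mulr_ge0 ?powR_ge0// invr_ge0 exprn_ge0// addr_ge0// ltW.
Qed.

Lemma majo_integrable :
  (@lebesgue_measure R).-integrable `]0, +oo[ (EFin \o majo).
Proof.
by have [] := ge0_FTC_oy is_derive_majo continuous_majo majo_ge0 majo_prim0 majo_primy.
Qed.

Lemma powRN_le (r x y : R) : 0 <= r -> 0 < x -> x <= y -> y `^ (- r) <= x `^ (- r).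
Proof.
move=> r0 x0 xy; have y0 := lt_le_trans x0 xy.
rewrite !powRN lef_pV2 ?posrE ?powR_gt0//.
by rewrite ge0_ler_powR ?nnegrE// ltW.
Qed.

(** A bound at height Im z + t is thereby a bound at height t, hence one majorant serves all points
    z of the closed half-plane. *)
Lemma majo_nincr (s t : R) : 0 < s -> s <= t -> majo t <= majo s.
Proof.
move=> s0 st; have t0 := lt_le_trans s0 st.
have s1 : 0 < 1 + s by rewrite ltr_wpDl.
have t1 : 0 < 1 + t by rewrite ltr_wpDl.
have [b0 _] := andP beta01.
apply: ler_pM; rewrite ?powR_ge0 ?invr_ge0 ?exprn_ge0 ?(ltW t1)//.
  apply: powRN_le => //; first exact: ratio_gt0.
  by rewrite ler_pdivrMr// mulrAC ler_pdivlMr//; nra.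
by rewrite lef_pV2 ?posrE ?exprn_gt0// ler_pXn2r ?nnegrE ?(ltW s1) ?(ltW t1)// lerD2l.
Qed.

(** With [majo_lb_large], this converts the natural estimates, t^-beta below height 1 and t^-2 above
    it, into multiples of the majorant: the ratio t / (1 + t) is at most t, and (1 + t)^-2 is at
    least 1/4 there. *)
Lemma majo_lb_small (t : R) : 0 < t -> t <= 1 -> t `^ (- beta) <= 4 * majo t.
Proof.
move=> t0 t1; have [b0 _] := andP beta01; have t2 : 0 < 1 + t by rewrite ltr_wpDl.
have h1 : t `^ (- beta) <= (t / (1 + t)) `^ (- beta).
  apply: powRN_le => //; first exact: ratio_gt0.
  by rewrite ler_pdivrMr// mulrDr mulr1 lerDl mulr_ge0// ltW.
have h2 : 1 <= 4 * (1 + t) ^- 2.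
  by rewrite ler_pdivlMr ?exprn_gt0// mul1r; nra.
by rewrite mulrCA -[leLHS]mulr1 ler_pM ?powR_ge0.
Qed.

Lemma majo_lb_large (t : R) : 1 <= t -> t ^- 2 <= 4 * majo t.
Proof.
move=> t1; have [b0 _] := andP beta01; have t0 : 0 < t by exact: lt_le_trans t1.
have t2 : 0 < 1 + t by rewrite ltr_wpDl.
have h1 : 1 <= (t / (1 + t)) `^ (- beta).
  have p1 : 1 `^ (- beta) = 1 :> R by rewrite powR1.
  rewrite -[leLHS]p1.
  apply: powRN_le => //; first exact: ratio_gt0.
  by rewrite ler_pdivrMr// mul1r lerDr.
have h2 : t ^- 2 <= 4 * (1 + t) ^- 2.
  by rewrite ler_pdivlMr ?exprn_gt0// mulrC ler_pdivrMr ?exprn_gt0//; nra.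
by rewrite mulrCA -[leLHS]mul1r ler_pM// invr_ge0 exprn_ge0// ltW.
Qed.

End power_majorant.

(** * The primitive of a dominated integrand, up to the boundary *)

Section vertical_primitive.
Variable R : realType.
Local Notation C := (complex R).
Local Notation I := (Complex 0 1 : C).
Variables (phi phi' : C -> C) (kap : C) (beta K : R).
Hypothesis beta01 : 0 <= beta < 1.
Hypothesis phi_diff : forall z, uhp z -> cdiff (@uhp R) phi z (phi' z).
Hypothesis phi'_cts : forall z, uhp z -> clim (inear (@uhp R) z) phi' (phi' z).
Hypothesis phi_bound : forall z : C, uhp z -> cmod (phi z - kap) <= K * majo beta (Im z).
Hypothesis phi'_bound : forall z : C, uhp z ->
  cmod (phi' z) <= K * majo beta (Im z) / Im z.
Hypothesis phi_inf : forall t : R, 0 < t ->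
  clim (cinf (@cuhp R)) (fun z => phi (z + Complex 0 t)) kap.

(** The limit [kap] of [phi] at infinity is subtracted to make the integral converge, and the linear
    term restores it. It is 0 for the trapezoids and 1 for the exterior map. *)
Definition vprim (z : C) : C :=
  kap * z - I * cint (fun t => phi (z + Complex 0 t) - kap).

Let m := majo beta.

Lemma shift_uhp (z : C) (t : R) : cuhp z -> 0 < t -> uhp (z + Complex 0 t).
Proof. by rewrite /cuhp /uhp/= ImD/= => z0 t0; rewrite ltr_wpDl. Qed.

Let K_ge0 : 0 <= K.
Proof.
have h : uhp (Complex 0 1 : C) by rewrite /uhp/=.
have m0 : 0 < majo beta (Im (Complex 0 1 : C)).
  rewrite /majo/= mulr_gt0// ?powR_gt0 ?invr_gt0 ?exprn_gt0// ?addr_gt0//.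
by have := le_trans (cmod_ge0 _) (phi_bound h); rewrite pmulr_lge0.
Qed.

Let intM (c : R) : (@lebesgue_measure R).-integrable `]0, +oo[ (EFin \o (fun t => c * m t)).
Proof.
have -> : EFin \o (fun t => c * m t) = (fun t => c%:E * (EFin \o m) t)%E.
  by apply/funext => t; rewrite /= EFinM.
by apply: integrableZl => //; exact: majo_integrable.
Qed.

Lemma clim_shift (f : C -> C) (z : C) (t : R) : cuhp z -> 0 < t ->
  clim (inear (@uhp R) (z + Complex 0 t)) f (f (z + Complex 0 t)) ->
  clim (nbhs t) (fun s => f (z + Complex 0 s)) (f (z + Complex 0 t)).
Proof.
move=> z0 t0 /climP fc; apply/climP => e /fc /inearP[d d0 H].
near=> s; apply: H; last first.
  by apply: shift_uhp => //; near: s; exact: lt_nbhsr.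
have -> : z + Complex 0 s - (z + Complex 0 t) = Complex 0 (s - t).
  by apply: complex_ext; rewrite !ReImE/=; ring.
rewrite cmod_imag distrC; near: s; by apply/nbhs_ballP; exists d.
Unshelve. all: by end_near. Qed.

Lemma psi_cmeas (z : C) : cuhp z -> cmeas (fun t => phi (z + Complex 0 t) - kap).
Proof.
move=> z0; apply: cts_cmeas => t t0; apply: climB; last exact: clim_cst.
by apply: clim_shift => //; apply: cdiff_cts; apply: phi_diff; exact: shift_uhp.
Qed.

Lemma psi_bound (z : C) (t : R) : cuhp z -> 0 < t ->
  cmod (phi (z + Complex 0 t) - kap) <= K * m t.
Proof.
move=> z0 t0; rewrite (le_trans (phi_bound (shift_uhp z0 t0)))//.
rewrite ler_wpM2l// majo_nincr// ImD/= lerDr; exact: z0.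
Qed.

Lemma psi_cintegrable (z : C) : cuhp z ->
  cintegrable (fun t => phi (z + Complex 0 t) - kap).
Proof.
by move=> z0; apply: cintegrable_dom (psi_cmeas z0) (intM K) _ => t; exact: psi_bound.
Qed.

Lemma vprim_cts (z : C) : cuhp z -> clim (inear (@cuhp R) z) vprim (vprim z).
Proof.
move=> z0; apply: climB; first by apply: climM; [exact: clim_cst|exact: clim_id].
apply: climM; first exact: clim_cst.
apply: clim_seq => u uc uz.
suff ff t : 0 < t -> clim \oo (fun n => phi (u n + Complex 0 t) - kap)
    (phi (z + Complex 0 t) - kap).
  have H n t := @psi_bound (u n) t (uc n).
  by have [] := cint_dct (fun n => psi_cmeas (uc n)) (intM K) ff H.
move=> t0; apply: climB; last exact: clim_cst.
have /climP H := cdiff_cts (phi_diff (shift_uhp z0 t0)); apply/climP => e /H /inearP[d d0 {}H].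
apply: filterS ((climP _ _).1 uz d d0) => n ud; apply: H; last exact: shift_uhp.
by rewrite opprD addrACA subrr addr0.
Qed.

Lemma vprim_inf : clim (cinf (@cuhp R)) (fun z => vprim z - kap * z) 0.
Proof.
apply: (clim_near (f := fun z => - I * cint (fun t => phi (z + Complex 0 t) - kap))).
  by apply: nearW => z; rewrite /vprim; ring.
rewrite -[X in clim _ _ X](mulr0 (- I)); apply: climM; first exact: clim_cst.
apply: clim_seq_inf => u uc un.
have c0 : cint (fun=> 0) = 0 :> C by rewrite /cint !Rintegral_cst// !mul0r.
rewrite -c0.
suff ff t : 0 < t -> clim \oo (fun n => phi (u n + Complex 0 t) - kap) 0.
  have H n t := @psi_bound (u n) t (uc n).
  by have [] := cint_dct (fun n => psi_cmeas (uc n)) (intM K) ff H.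
move=> t0; rewrite -(subrr kap); apply: climB; last exact: clim_cst.
have /climP H := phi_inf t0; apply/climP => e /H [N NH].
have [M MN] : exists M : nat, N <= M%:R.
  by exists (Num.truncn `|N|).+1; rewrite (le_trans (ler_norm _))// ltW// truncnS_gt.
exists M => // n /= Mn; apply: NH => //; rewrite (le_lt_trans _ (un n))//.
by rewrite (le_trans MN)// ler_nat.
Qed.

(** The derivative of phi (z + i t) in t is i phi' (z + i t), and phi goes from [phi z] to [kap]
    along the half-line. This is what identifies the derivative of [vprim] with [phi]. *)
Lemma phi'_int (z : C) : uhp z ->
  cint (fun t => phi' (z + Complex 0 t)) = I * (phi z - kap).
Proof.
move=> z0; have z0' : cuhp z by exact: ltW.
pose c := K / Im z.
have B t : 0 < t -> cmod (phi' (z + Complex 0 t)) <= c * m t.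
  move=> t0; rewrite (le_trans (phi'_bound (shift_uhp z0' t0)))//.
  rewrite /c mulrAC -!mulrA ler_wpM2l//; apply: ler_pM.
  - by rewrite invr_ge0; apply: ltW; exact: (shift_uhp z0' t0).
  - by rewrite majo_ge0//; exact: (shift_uhp z0' t0).
  - by rewrite lef_pV2 ?posrE//; [rewrite ImD/= lerDl ltW|exact: (shift_uhp z0' t0)].
  - by rewrite majo_nincr// ImD/= lerDr.
have pd (t : R) : 0 <= t -> pderiv (fun s => phi (z + Complex 0 s)) t (phi' (z + Complex 0 t) * I).
  move=> t0; have zt : uhp (z + Complex 0 t).
    by rewrite /uhp/= ImD/= ltr_wpDr.
  have E (s : R) : z + Complex 0 s = z + Complex s 0 * I.
    by apply: complex_ext; rewrite !ReImE/=; ring.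
  have -> : (fun s => phi (z + Complex 0 s)) = (fun s => phi (z + Complex s 0 * I)).
    by apply/funext => s; rewrite E.
  rewrite E in zt *; apply: (cdiff_pderiv _ (phi_diff zt)).
  exact: uhp_line_near.
have pc (t : R) : 0 < t -> clim (nbhs t) (fun s => phi' (z + Complex 0 s)) (phi' (z + Complex 0 t)).
  by move=> t0; apply: clim_shift => //; apply: phi'_cts; exact: shift_uhp.
have H := @cint_FTC R (fun t => phi (z + Complex 0 t)) (fun t => phi' (z + Complex 0 t) * I)
  (fun t => c * m t) (fun t => c * majo_prim beta t) (phi (z + Complex 0 0)) kap (c * (1 - beta)^-1).
have mi : cintegrable (fun t => phi' (z + Complex 0 t)).
  by apply: cintegrable_dom (cts_cmeas pc) (intM c) B.
have [_ E1] := cintZ I mi.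
have E2 : cint (fun t => phi' (z + Complex 0 t) * I) = kap - phi z.
  have {2}-> : z = z + Complex 0 0 by apply: complex_ext; rewrite !ReImE/= addr0.
  apply: H.
  - by move=> t t0; have := is_deriveZ c (is_derive_majo beta01 t0).
  - by move=> t t0; apply: cvgM; [exact: cvg_cst|exact: continuous_majo].
  - by apply: cvgM; [exact: cvg_cst|exact: majo_prim0].
  - by apply: cvgM; [exact: cvg_cst|exact: majo_primy].
  - by move=> t /ltW; exact: pd.
  - by move=> t t0; apply: climM; [exact: pc|exact: clim_cst].
  - by move=> t t0; rewrite cmodM cmod_imag normr1 mulr1; exact: B.
  - have [d1 d2] := pd 0 (lexx 0).
    have e1 : (fun s => Re (phi (z + Complex 0 s))) @ (0 : R) --> Re (phi (z + Complex 0 0)).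
      by move: d1 => [/derivable1_diffP/differentiable_continuous].
    have e2 : (fun s => Im (phi (z + Complex 0 s))) @ (0 : R) --> Im (phi (z + Complex 0 0)).
      by move: d2 => [/derivable1_diffP/differentiable_continuous].
    apply: clim_ReIm => /=.
      exact: (cvg_at_right_filter e1).
    exact: (cvg_at_right_filter e2).
  - have /climP H1 := phi_inf (@ltr01 R); apply/climP => e /H1 [N NH].
    (* The point z + i t is written as a point of the closed half-plane raised by 1, the form in
       which [phi_inf] controls it. *)
    near=> t; have := NH (z + Complex 0 (t - 1)).
    rewrite -addrA (_ : Complex 0 (t - 1) + Complex 0 1 = Complex 0 t); last first.
      by apply: complex_ext; rewrite !ReImE/=; ring.
    have t1 : 1 < t by near: t; exact: nbhs_pinfty_gt.
    apply; first by have := z0'; rewrite /cuhp/= ImD/=; lra.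
    apply: lt_le_trans (Im_le_cmod _); rewrite ImD/=.
    have tN : N + 1 < t by near: t; apply: nbhs_pinfty_gt; rewrite num_real.
    by rewrite (lt_le_trans _ (ler_norm _))//; move: z0; rewrite /uhp/=; lra.
have -> : cint (fun t => phi' (z + Complex 0 t)) =
    - I * cint (fun t => phi' (z + Complex 0 t) * I).
  have -> : cint (fun t => phi' (z + Complex 0 t) * I) = cint (fun t => I * phi' (z + Complex 0 t)).
    by apply: eq_cint => t _; rewrite mulrC.
  rewrite E1 mulrA (_ : - I * I = 1) ?mul1r//.
  by apply: complex_ext; rewrite !ReImE/=; ring.
by rewrite E2; ring.
Unshelve. all: by end_near. Qed.

(** Above the height y = Im z / 2 the derivative of [phi] is at most K / y times the majorant; by
    the mean value inequality so are the difference quotients [r w t], and dominated convergence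
    lets w tend to z under the integral. *)
Lemma vprim_diff (z : C) : uhp z -> cdiff (@uhp R) vprim z (phi z).
Proof.
move=> z0; pose y := Im z / 2; have y0 : 0 < y by rewrite divr_gt0.
pose D : set C := [set w | y < Im w].
have Dz : D z by rewrite /D/= /y ltr_pdivrMr// ltr_pMr// ltrDl.
have Du w : D w -> uhp w by move=> Dw; exact: lt_trans Dw.
apply: (@cdiff_sub _ _ D).
  have e0 : 0 < Im z - y by rewrite subr_gt0.
  apply/inearP; exists (Im z - y) => // w wz _.
  have := Im_le_cmod (w - z); rewrite !ReImE => /le_lt_trans/(_ wz).
  by rewrite ltr_norml /D/= => /andP[]; lra.
pose r w t := if w == z then phi' (z + Complex 0 t) else
  (phi (w + Complex 0 t) - phi (z + Complex 0 t)) / (w - z).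
exists (fun w => kap - I * cint (r w)).
have rE w t : phi (w + Complex 0 t) - phi (z + Complex 0 t) = (w - z) * r w t.
  rewrite /r; case: eqVneq => [->|wz]; first by rewrite !subrr mul0r.
  by rewrite mulrC divfK// subr_eq0.
pose c := K / y.
have B1 w t : D w -> 0 < t -> cmod (phi' (w + Complex 0 t)) <= c * m t.
  move=> Dw t0; have wc : cuhp w by exact/ltW/Du.
  rewrite (le_trans (phi'_bound (shift_uhp wc t0)))//.
  rewrite /c mulrAC -!mulrA ler_wpM2l//; apply: ler_pM.
  - by rewrite invr_ge0; apply: ltW; exact: (shift_uhp wc t0).
  - by rewrite majo_ge0//; exact: (shift_uhp wc t0).
  - rewrite lef_pV2 ?posrE//; last exact: (shift_uhp wc t0).
    by rewrite ImD/= (le_trans (ltW Dw))// lerDl ltW.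
  - by rewrite majo_nincr// ImD/= lerDr.
have B2 w t : D w -> 0 < t -> cmod (r w t) <= c * m t.
  move=> Dw t0; rewrite /r; case: eqVneq => [_|wz]; first exact: B1.
  rewrite cmodM cmodV ler_pdivrMr ?cmod_gt0 ?subr_eq0//.
  have zc : cuhp z by exact: ltW.
  have wc : cuhp w by exact/ltW/Du.
  have := @uhp_mvt R phi phi' (z + Complex 0 t) (w + Complex 0 t) 0 (c * m t) phi_diff
    (shift_uhp zc t0) (shift_uhp wc t0).
  rewrite mulr0 subr0 opprD addrACA subrr addr0; apply => s s01.
  rewrite subr0 (_ : _ + _ = (z + Complex s 0 * (w - z)) + Complex 0 t); last by ring.
  apply: B1 => //; rewrite /D/= !ReImE/=; move: Dz Dw s01; rewrite /D/= => h1 h2 s01.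
  by rewrite mul0r addr0 convex_gt.
have mr w : D w -> cmeas (r w).
  move=> Dw; have wc : cuhp w by exact/ltW/Du.
  have zc : cuhp z by exact: ltW.
  apply: cts_cmeas => t t0; rewrite /r; case: eqVneq => [_|wz].
    by apply: clim_shift => //; apply: phi'_cts; exact: shift_uhp.
  apply: climM; last exact: clim_cst.
  by apply: climB; apply: clim_shift => //; apply: cdiff_cts; apply: phi_diff; exact: shift_uhp.
have ir w : D w -> cintegrable (r w).
  by move=> Dw; apply: cintegrable_dom (mr w Dw) (intM c) _ => t; exact: B2.
split=> [w Dw|].
  have wc : cuhp w by exact/ltW/Du.
  have zc : cuhp z by exact: ltW.
  have E : cint (fun t => phi (w + Complex 0 t) - kap) - cint (fun t => phi (z + Complex 0 t) - kap)
     = (w - z) * cint (r w).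
    rewrite -cintB; [|exact: psi_cintegrable|exact: psi_cintegrable].
    have [_ <-] := cintZ (w - z) (ir w Dw).
    by apply: eq_cint => t _; rewrite -rE; ring.
  by rewrite /vprim mulrBr mulrCA -E; ring.
have -> : phi z = kap - I * cint (r z).
  have -> : cint (r z) = cint (fun t => phi' (z + Complex 0 t)).
    by apply: eq_cint => t _; rewrite /r eqxx.
  rewrite phi'_int// mulrA (_ : I * I = -1); first by ring.
  by apply: complex_ext; rewrite !ReImE/=; ring.
apply: climB; first exact: clim_cst.
apply: climM; first exact: clim_cst.
apply: clim_seq => u uD uz.
suff ff t : 0 < t -> clim \oo (fun n => r (u n) t) (r z t).
  have H n t := B2 (u n) t (uD n).
  by have [] := cint_dct (fun n => mr _ (uD n)) (intM c) ff H.
move=> t0; rewrite /r eqxx.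
have zc : cuhp z by exact: ltW.
have /cdiffP H := phi_diff (shift_uhp zc t0).
apply/climP => e e0; have e2 : 0 < e / 2 by rewrite divr_gt0.
have /inearP[d d0 {}H] := H _ e2.
apply: filterS ((climP _ _).1 uz d d0) => n un.
case: eqVneq => [_|uz']; first by rewrite subrr cmod0.
have uz0 : u n - z != 0 by rewrite subr_eq0.
have := H (u n + Complex 0 t); rewrite opprD addrACA subrr addr0 => /(_ un).
have uc : cuhp (u n) by exact/ltW/Du.
move=> /(_ (shift_uhp uc t0)) h.
have -> : (phi (u n + Complex 0 t) - phi (z + Complex 0 t)) / (u n - z) - phi' (z + Complex 0 t)
  = (phi (u n + Complex 0 t) - phi (z + Complex 0 t) - (u n - z) * phi' (z + Complex 0 t)) / (u n - z).
  by field.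
rewrite cmodM cmodV (@le_lt_trans _ _ (e / 2))//.
  by rewrite ler_pdivrMr// cmod_gt0.
by rewrite ltr_pdivrMr// ltr_pMr// ltrDl.
Qed.

(* Differentiability at a boundary point comes from the mean value inequality
   inside the half-plane, without any reflection. *)
Lemma vprim_diff_boundary (z : C) : cuhp z -> clim (inear (@cuhp R) z) phi (phi z) ->
  cdiff (@cuhp R) vprim z (phi z).
Proof.
move=> z0 /climP phic; apply/cdiffP => e e0.
have e2 : 0 < e / 2 by rewrite divr_gt0.
have /inearP[d d0 H] := phic _ e2.
apply/inearP; exists d => // w wz wc.
have c_eta (v : C) : cuhp v -> clim (0 : R)^'+ (fun h : R => vprim (v + Complex 0 h)) (vprim v).
  move=> vc; have /climP vP := vprim_cts vc; apply/climP => e' /vP /inearP[d' d'0 hd].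
  near=> h; have h0 : 0 < h by near: h; exact: nbhs_right_gt.
  apply: hd; last exact/ltW/shift_uhp.
  rewrite addrC addKr cmod_imag gtr0_norm//; near: h; exact: nbhs_right_lt.
have L : (fun h : R => cmod (vprim (w + Complex 0 h) - vprim (z + Complex 0 h)
    - (w - z) * phi z)) @ 0^'+ --> cmod (vprim w - vprim z - (w - z) * phi z).
  apply: clim_cmod; apply: climB; last exact: clim_cst.
  by apply: climB; exact: c_eta.
apply: le_trans (_ : _ <= e / 2 * cmod (w - z)) _; last first.
  by rewrite ler_wpM2r ?cmod_ge0//; lra.
apply: (ler_cvg_to L (cvg_cst _)).
near=> h; have h0 : 0 < h by near: h; exact: nbhs_right_gt.
have := @uhp_mvt R vprim phi (z + Complex 0 h) (w + Complex 0 h) (phi z) (e / 2) vprim_diff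
   (shift_uhp z0 h0) (shift_uhp wc h0).
rewrite opprD addrACA subrr addr0 => HH; rewrite /=; apply: HH => s s01.
apply/ltW/H; last first.
  by apply: ltW; rewrite !ReImE/=; move: z0 wc s01; rewrite /cuhp/= => h1 h2 /andP[h3 h4]; nra.
have -> : z + Complex 0 h + Complex s 0 * (w - z) - z = Complex s 0 * (w - z) + Complex 0 h by ring.
rewrite (le_lt_trans (cmodD _ _))// cmod_imag cmodM cmod_real !ger0_norm//; try exact: ltW.
  have hd : h < d - cmod (w - z) by near: h; apply: nbhs_right_lt; rewrite subr_gt0.
  move: s01 => /andP[s0 s1]; have := cmod_ge0 (w - z); nra.
by case/andP: s01.
Unshelve. all: by end_near. Qed.

End vertical_primitive.

(** * Schwarz-Christoffel integrands *)

Lemma prod_seq4 (R : pzRingType) (I : Type) (a b c d : I) (F : I -> R) :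
  \prod_(p <- [:: a; b; c; d]) F p = F a * (F b * (F c * F d)).
Proof. by rewrite !big_cons big_nil mulr1. Qed.

Section sc_integrand.
Variable R : realType.
Local Notation C := (complex R).
Implicit Types (z w : C) (s : seq (R * R)).

Lemma clim_sum (T : Type) (F : set_system T) (FF : Filter F) (I : Type) (r : seq I)
    (f : I -> T -> C) (l : I -> C) : (forall i, List.In i r -> clim F (f i) (l i)) ->
  clim F (fun x => \sum_(i <- r) f i x) (\sum_(i <- r) l i).
Proof.
elim: r => [|i r ih] H.
  rewrite big_nil; apply: clim_near (clim_cst 0).
  by apply: nearW => x; rewrite big_nil.
rewrite big_cons; apply: (@clim_near _ _ _ _ (fun x => f i x + \sum_(j <- r) f j x)).
  by apply: nearW => x; rewrite big_cons.
by apply: climD; [apply: H; left|apply: ih => j jr; apply: H; right].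
Qed.

Lemma cdiff_sum (D : set C) z (I : Type) (r : seq I)
    (f : I -> C -> C) (l : I -> C) : (forall i, List.In i r -> cdiff D (f i) z (l i)) ->
  cdiff D (fun x => \sum_(i <- r) f i x) z (\sum_(i <- r) l i).
Proof.
elim: r => [|i r ih] H.
  rewrite big_nil; apply: (cdiff_eq _ _ (cdiff_cst D z 0)); last by rewrite big_nil.
  by apply: nearW => x; rewrite big_nil.
rewrite big_cons; apply: (@cdiff_eq _ _ (fun x => f i x + \sum_(j <- r) f j x)).
- by apply: nearW => x; rewrite big_cons.
- by rewrite big_cons.
by apply: cdiffD; [apply: H; left|apply: ih => j jr; apply: H; right].
Qed.

(* the list [s] holds the prevertices with their exponents *)
Definition scphi s z : C :=
  cexp (\sum_(p <- s) Complex p.2 0 * clog (z - Complex p.1 0)).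

Definition scpre s z : C := \sum_(p <- s) Complex p.2 0 / (z - Complex p.1 0).

Definition scarg s z : R := \sum_(p <- s) p.2 * carg (z - Complex p.1 0).

Definition scfree s z := forall p, List.In p s -> z != Complex p.1 0.

Lemma scphi_neq0 s z : scphi s z != 0.
Proof. exact: cexp_neq0. Qed.

Lemma uhp_scfree s z : uhp z -> scfree s z.
Proof. by move=> z0 p _; apply: contraTneq z0 => ->; rewrite /uhp/= ltxx. Qed.

Lemma uhp_sub_real z (x : R) : uhp z -> uhp (z - Complex x 0).
Proof. by rewrite /uhp/= !ReImE/= subr0. Qed.

Lemma scphi_clim D s z : scfree s z -> clim (inear D z) (scphi s) (scphi s z).
Proof.
move=> sz; apply: (@clim_comp R C C (inear D z)
  (inear setT (\sum_(p <- s) Complex p.2 0 * clog (z - Complex p.1 0)))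
  (fun w => \sum_(p <- s) Complex p.2 0 * clog (w - Complex p.1 0)) (@cexp R)); last first.
  by apply: cdiff_cts; exact: cdiff_cexp.
have H : clim (inear D z) (fun w => \sum_(p <- s) Complex p.2 0 * clog (w - Complex p.1 0))
    (\sum_(p <- s) Complex p.2 0 * clog (z - Complex p.1 0)).
  apply: clim_sum => p ps; apply: climM; first exact: clim_cst.
  have zp : z - Complex p.1 0 != 0 by rewrite subr_eq0; exact: sz.
  apply: (@clim_comp R C C (inear D z) (inear setT (z - Complex p.1 0))
    (fun w => w - Complex p.1 0) (@clog R)); last exact: clog_clim.
  move=> A /inearP[e e0 HA]; change (inear D z [set w | A (w - Complex p.1 0)]).
  apply/inearP; exists e => // w we _; apply: HA => //.
  by rewrite opprB addrA subrK.
move=> A /inearP[e e0 HA].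
change (inear D z [set w | A (\sum_(p <- s) Complex p.2 0 * clog (w - Complex p.1 0))]).
have /climP/(_ e e0) := H; apply: filterS => w we; exact: HA.
Qed.

Lemma cdiff_scphi s z : uhp z -> cdiff (@uhp R) (scphi s) z (scphi s z * scpre s z).
Proof.
move=> z0; apply: (@cdiff_comp _ _ setT); [exact: nearW| |exact: cdiff_cexp].
apply: cdiff_sum => p _; apply: cdiffZ; rewrite -[_^-1]mulr1.
apply: (@cdiff_comp R (@uhp R) (@uhp R) (fun w => w - Complex p.1 0) (@clog R)).
- by apply/inearP; exists 1 => // w _ w0; exact: uhp_sub_real.
- by rewrite -[1]subr0; apply: cdiffB; [exact: cdiff_id|exact: cdiff_cst].
- apply: cdiff_clog; last exact: uhp_sub_real.
  by move=> w w0; split; [exact: ltW|exact: Im_gt0_neq0].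
Qed.

Lemma scpre_clim s z : uhp z -> clim (inear (@uhp R) z) (scpre s) (scpre s z).
Proof.
move=> z0; apply: clim_sum => p ps; apply: climM; first exact: clim_cst.
apply: climV; first by rewrite subr_eq0; exact: uhp_scfree ps.
by apply: climB; [exact: clim_id|exact: clim_cst].
Qed.

Lemma cmod_scphi s z : scfree s z ->
  cmod (scphi s z) = \prod_(p <- s) cmod (z - Complex p.1 0) `^ p.2.
Proof.
move=> sz; rewrite cmod_cexp; elim: s sz => [|p s ih] sz.
  by rewrite !big_nil expR0.
rewrite !big_cons ReD expRD ih; last by move=> q qs; apply: sz; right.
congr (_ * _); rewrite !ReImE/= mul0r subr0 /powR cmod_eq0 subr_eq0.
by rewrite (negbTE (sz p _))//; left.
Qed.

Lemma Im_sclog s z :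
  Im (\sum_(p <- s) Complex p.2 0 * clog (z - Complex p.1 0)) = scarg s z.
Proof.
rewrite /scarg; elim: s => [|p s ih]; first by rewrite !big_nil.
by rewrite !big_cons ImD ih !ReImE/= mul0r addr0.
Qed.

Lemma Re_scphi s z : Re (scphi s z) = cmod (scphi s z) * cos (scarg s z).
Proof. by rewrite cmod_cexp -Im_sclog. Qed.

Lemma Im_scphi s z : Im (scphi s z) = cmod (scphi s z) * sin (scarg s z).
Proof. by rewrite cmod_cexp -Im_sclog. Qed.

Lemma Im_le_dist z (x : R) : Im z <= cmod (z - Complex x 0).
Proof.
by rewrite (le_trans _ (Im_le_cmod _))// !ReImE/= subr0 ler_norm.
Qed.

Lemma cmod_scpre s z : uhp z -> cmod (scpre s z) <= (\sum_(p <- s) `|p.2|) / Im z.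
Proof.
move=> z0; rewrite /scpre; elim: s => [|p s ih].
  by rewrite !big_nil cmod0 mul0r.
rewrite !big_cons (le_trans (cmodD _ _))// mulrDl lerD//.
rewrite cmodM cmodV cmod_real ler_wpM2l// lef_pV2 ?posrE//; first exact: Im_le_dist.
by rewrite (lt_le_trans z0)// Im_le_dist.
Qed.

Lemma oner_powR (x : R) : 1 `^ x = 1 :> R.
Proof. by rewrite powR1. Qed.

(* When at most one of the points lies within [e] of [z], all the factors but
   one are controlled by [e]. *)
Lemma prod_powR_near (e t beta : R) (r : seq (R * R)) :
  0 < e <= 1 -> 0 < t <= 1 -> 0 <= beta ->
  (forall p, List.In p r -> [/\ t <= p.1, - beta <= p.2 & p.2 <= 0]) ->
  pairwise (fun p q => (e <= p.1) || (e <= q.1)) r ->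
  \prod_(p <- r) p.1 `^ p.2 <= t `^ (- beta) * \prod_(p <- r) e `^ p.2.
Proof.
move=> /andP[e0 e1] /andP[t0 t1] b0.
have tb : 1 <= t `^ (- beta).
  by rewrite -[leLHS](oner_powR (- beta)); exact: powRN_le.
have pw (x y g : R) : 0 < x -> x <= y -> g <= 0 -> y `^ g <= x `^ g.
  by move=> x0 xy g0; rewrite -(opprK g); apply: powRN_le => //; rewrite oppr_ge0.
have far (s : seq (R * R)) : (forall p, List.In p s -> [/\ t <= p.1, - beta <= p.2 & p.2 <= 0]) ->
    all (fun q => e <= q.1) s -> \prod_(p <- s) p.1 `^ p.2 <= \prod_(p <- s) e `^ p.2.
  elim: s => [|p s ih] H /=; first by rewrite !big_nil.
  move=> /andP[ep es]; rewrite !big_cons; have [_ _ p0] := H p (or_introl erefl).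
  apply: ler_pM; rewrite ?powR_ge0//; first by rewrite prodr_ge0// => *; rewrite powR_ge0.
    exact: pw.
  by apply: ih es => q qs; apply: H; right.
elim: r => [|p r ih] H /=; first by rewrite !big_nil mulr1.
move=> /andP[pr rr]; rewrite !big_cons.
have [tp bp p0] := H p (or_introl erefl).
have H' q : List.In q r -> [/\ t <= q.1, - beta <= q.2 & q.2 <= 0] by move=> qr; apply: H; right.
have e_ge1 (g : R) : g <= 0 -> 1 <= e `^ g.
  by move=> g0; rewrite -[leLHS](oner_powR g); exact: pw.
have [ep|pe] := leP e p.1.
  rewrite mulrCA; apply: ler_pM; rewrite ?powR_ge0//.
  - by rewrite prodr_ge0// => *; rewrite powR_ge0.
  - exact: pw.
  - exact: ih.
apply: ler_pM; rewrite ?powR_ge0//.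
- by rewrite prodr_ge0// => *; rewrite powR_ge0.
- apply: (@le_trans _ _ (t `^ p.2)); first exact: pw.
  rewrite /powR gt_eqF// ler_expR ler_wnM2r// ln_le0//.
- rewrite -[leLHS]mul1r; apply: ler_pM => //.
  + by rewrite prodr_ge0// => *; rewrite powR_ge0.
  + exact: e_ge1.
  + apply: far => //; apply: sub_all pr => q; by rewrite leNgt pe.
Qed.

End sc_integrand.

(** * The closed half-plane in the sphere *)

Section sphere_half_plane.
Variable R : realType.
Local Notation C := (complex R).
Implicit Types (z w : C) (f : sphere R -> C).

Lemma clim_inearP (D : set C) z (f : C -> C) l : clim (inear D z) f l <->
  forall e : R, 0 < e -> exists2 d : R, 0 < d &
    forall w, cmod (w - z) < d -> D w -> cmod (f w - l) < e.
Proof.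
split=> [/climP H e /H /inearP //|H]; apply/climP => e /H [d d0 Hd].
by apply/inearP; exists d.
Qed.

(** The closed half-plane with the point at infinity is compact, so that extremal arguments need no
    separate study of infinity. *)
Definition scuhp : set (sphere R) :=
  [set p | if p is Some z then 0 <= Im (z : C) else True].

Lemma cball_compact (a : C) (e : R) :
  compact ([set z | cmod (z - a) <= e] : set (plane R)).
Proof.
pose K : set (R * R) := `[Re a - e, Re a + e] `*` `[Im a - e, Im a + e].
have cK : compact K by apply: compact_setX; exact: segment_compact.
pose F (p : R * R) : plane R := Complex p.1 p.2.
have cF : continuous F.
  move=> p; apply/cvg_clim; apply: clim_Complex; [exact: cvg_fst|exact: cvg_snd].
have cFK : compact (F @` K).
  by apply: continuous_compact => //; exact: continuous_subspaceT.
apply: (subclosed_compact _ cFK).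
  move=> z H; apply/ler_addgt0Pr => d d0.
  have [w [/= h1 h2]] := H _ (near_plane z d0).
  have -> : z - a = (w - a) - (w - z) by ring.
  by rewrite (le_trans (cmodD _ _))// cmodN lerD// ltW.
move=> z /= za; exists (Re z, Im z); last by case: z {za}.
have h1 := le_trans (Re_le_cmod (z - a)) za.
have h2 := le_trans (Im_le_cmod (z - a)) za.
move: h1 h2; rewrite !ReImE !ler_norml => /andP[h1 h2] /andP[h3 h4].
by split; rewrite /= in_itv/=; apply/andP; split; lra.
Qed.

Lemma plane_hausdorff : hausdorff_space (plane R).
Proof. exact: norm_hausdorff. Qed.

Lemma plane_locally_compact : locally_compact [set: plane R].
Proof.
move=> z _; exists [set w : plane R | cmod (w - z) <= 1].
  by apply: filterS (near_plane z ltr01) => w /ltW wz; move=> _.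
split => //; first exact: cball_compact.
by apply: compact_closed; [exact: plane_hausdorff|exact: cball_compact].
Qed.

Lemma sphere_hausdorff : hausdorff_space (sphere R).
Proof.
exact: (one_point_compactification_hausdorff plane_locally_compact plane_hausdorff).
Qed.

Lemma scuhp_closed : closed scuhp.
Proof.
rewrite -[scuhp]setCK; apply: open_closedC.
have -> : ~` scuhp = Some @` [set z : plane R | Im z < 0].
  apply/seteqP; split=> [[z|]|].
  - by move=> /= /negP; rewrite -ltNge => z0; exists z.
  - by move=> /=.
  - by move=> _ [z /= z0 <-] /=; rewrite leNgt z0.
apply: one_point_compactification_open_some.
rewrite openE => z /= z0; apply/nbhs_planeP; exists (- Im z); first by rewrite oppr_gt0.
move=> w wz /=; have := le_lt_trans (Im_le_cmod (w - z)) wz.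
by rewrite !ReImE ltr_norml => /andP[]; lra.
Qed.

Lemma scuhp_compact : compact scuhp.
Proof.
exact: (subclosed_compact scuhp_closed one_point_compactification_compact).
Qed.

(** Continuity on the compactified closed half-plane, spelled out as one condition at finite points
    and one at infinity; [scts_within] recovers the topological form. *)
Definition scts f := (forall z, cuhp z -> clim (inear (@cuhp R) z) (fun w => f (Some w)) (f (Some z)))
  /\ clim (cinf (@cuhp R)) (fun w => f (Some w)) (f None).

Lemma scts_nbhs f (p : sphere R) (e : R) : scts f -> scuhp p -> 0 < e ->
  within scuhp (nbhs p) [set q | cmod (f q - f p) < e].
Proof.
move=> [fz fi] Xp e0; case: p Xp => [z|] Xp.
  have [d d0 H] := (clim_inearP _ _ _ _).1 (fz z Xp) e e0.
  rewrite /within/=; apply: filterS (near_plane z d0) => w wz Xw.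
  exact: H.
have /climP/(_ e e0)[N H] := fi.
exists [set w : plane R | cmod (w - 0) <= N].
  split; first exact: cball_compact.
  by apply: compact_closed; [exact: plane_hausdorff|exact: cball_compact].
move=> [w|] [|//].
  move=> [w' /= /negP]; rewrite subr0 -ltNge => h [<-] Xw; exact: H.
all: by rewrite /= ?subrr ?cmod0.
Qed.

Lemma scts_within (f : sphere R -> plane R) : scts f -> {within scuhp, continuous f}.
Proof.
move=> cf; apply/subspace_continuousP => p Xp; apply/cvg_clim.
by apply/climP => e e0; exact: scts_nbhs.
Qed.

Lemma scts_within_real f (g : C -> R) : scts f ->
  (forall z w, `|g z - g w| <= cmod (z - w)) ->
  {within scuhp, continuous (fun p => g (f p))}.
Proof.
move=> cf gl; apply/subspace_continuousP => p Xp; apply/cvgrPdist_lt => e e0.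
apply: filterS (scts_nbhs cf Xp e0) => q /=; apply: le_lt_trans.
by rewrite distrC gl.
Qed.

Lemma cdiff_decrease (D : set C) (f : C -> C) z c (w0 : C) :
  (\forall w \near nbhs (z : plane R), D w) -> cdiff D f z c -> c != 0 -> w0 != 0 ->
  forall d : R, 0 < d -> exists w, [/\ D w, cmod (w - z) < d & Re (w0 * f w) < Re (w0 * f z)].
Proof.
move=> nD /cdiffP fc c0 w00 d d0.
have wc : w0 * c != 0 by rewrite mulf_neq0.
pose k := cmod (w0 * c); have k0 : 0 < k by rewrite cmod_gt0.
have cw : 0 < cmod w0 by rewrite cmod_gt0.
(* along the direction -(w0 c)^-1 the functional decreases at unit rate *)
pose v := - (w0 * c)^-1.
have e0 : 0 < k / (2 * cmod w0) by rewrite divr_gt0// mulr_gt0.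
have /inearP[d1 d10 H] := fc _ e0.
have /nbhs_planeP[d2 d20 H2] := nD.
pose t := Num.min d (Num.min d1 d2) * k / 2.
have m0 : 0 < Num.min d (Num.min d1 d2) by rewrite !lt_min d0 d10.
have t0 : 0 < t by rewrite divr_gt0// mulr_gt0.
pose w := z + Complex t 0 * v.
have wz : cmod (w - z) = t / k.
  by rewrite /w addrC addKr cmodM cmod_real gtr0_norm// cmodN cmodV.
have wzm : cmod (w - z) < Num.min d (Num.min d1 d2).
  by rewrite wz /t mulrAC mulfK ?gt_eqF// ltr_pdivrMr// ltr_pMr// ltr1n.
move: wzm; rewrite !lt_min => /and3P[h1 h2 h3].
have Dw := H2 w h3; exists w; split=> //.
have {H} := H w h2 Dw; rewrite wz => H.
have E : w0 * f w = w0 * f z - Complex t 0 + w0 * (f w - f z - (w - z) * c).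
  have -> : w - z = - (Complex t 0 * (w0 * c)^-1) by rewrite /w addrC addKr mulrN.
  by field; rewrite w00 c0.
have := Re_le_cmod (w0 * (f w - f z - (w - z) * c)); rewrite cmodM => h4.
have h5 : cmod w0 * cmod (f w - f z - (w - z) * c) <= t / 2.
  apply: (le_trans (ler_wpM2l (ltW cw) H)); rewrite le_eqVlt; apply/orP; left; apply/eqP.
  by field; rewrite !gt_eqF.
have h6 := le_trans (ler_norm _) (le_trans h4 h5).
by rewrite E !ReD ReN/=; move: h6; set x := Re (_ * _); lra.
Qed.

(** The minimum of a real linear functional of [f] over the compact half-plane is not attained
    inside, because a nonzero derivative offers a direction of decrease. Applied to the sides of a
    convex polygon, this confines the image. *)
Lemma min_principle f (d : C -> C) (w0 : C) (m : R) : scts f ->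
  (forall z, uhp z -> cdiff (@uhp R) (fun w => f (Some w)) z (d z)) ->
  (forall z, uhp z -> d z != 0) -> w0 != 0 ->
  m <= Re (w0 * f None) -> (forall x : R, m <= Re (w0 * f (Some (Complex x 0)))) ->
  forall z, uhp z -> m < Re (w0 * f (Some z)).
Proof.
move=> cf df dn0 w00 fN fb.
have cw : 0 < cmod w0 by rewrite cmod_gt0.
pose g (z : C) := Re (w0 * z) / cmod w0.
have gl (z w : C) : `|g z - g w| <= cmod (z - w).
  rewrite /g -mulrBl -ReN -ReD -mulrBr normrM normfV (gtr0_norm cw).
  by rewrite ler_pdivrMr// (le_trans (Re_le_cmod _))// cmodM mulrC.
have Xn0 : scuhp !=set0 by exists None.
have [p] := compact_EVT_min Xn0 scuhp_compact (scts_within_real cf gl).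
rewrite inE => Xp pmin.
have pmin' q : scuhp q -> Re (w0 * f p) <= Re (w0 * f q).
  by move=> Xq; have := pmin q (mem_set Xq); rewrite /g ler_pM2r ?invr_gt0.
have nuhp z : p = Some z -> ~ uhp z.
  move=> pz uz.
  have [w [uw _]] := cdiff_decrease (uhp_open uz) (df z uz) (dn0 z uz) w00 ltr01.
  have := pmin' (Some w) (ltW uw : scuhp (Some w)); rewrite pz.
  by move=> /le_lt_trans h /h; rewrite ltxx.
have pm : m <= Re (w0 * f p).
  case: p Xp {pmin pmin'} nuhp => [z|] //= z0 /(_ z erefl) nz.
  have -> : z = Complex (Re z) 0; last exact: fb.
  apply: complex_ext => //=; apply/eqP; rewrite eq_le z0 andbT leNgt.
  by apply/negP.
move=> z uz; have h : scuhp (Some z) by exact: ltW.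
rewrite lt_neqAle (le_trans pm (pmin' _ h)) andbT; apply/eqP => mz.
have [w [uw _]] := cdiff_decrease (uhp_open uz) (df z uz) (dn0 z uz) w00 ltr01.
rewrite -mz => h2; have := le_trans pm (pmin' (Some w) (ltW uw : scuhp (Some w))).
by rewrite leNgt h2.
Qed.

(** Let p minimize the distance from f to y on a small closed disc about z. It is no boundary point
    of the disc, since f there is at distance at least 2 e from [f z]; and if f p differed from y, a
    small step along - (f p - y) / d p would reduce the distance. *)
Lemma local_open (f d : C -> C) z :
  (forall z, uhp z -> cdiff (@uhp R) f z (d z)) -> (forall z, uhp z -> d z != 0) ->
  uhp z -> exists2 e : R, 0 < e & forall y, cmod (y - f z) < e -> exists2 w, uhp w & f w = y.
Proof.
move=> df dn0 uz; have dz := df z uz.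
have cd : 0 < cmod (d z) by rewrite cmod_gt0 dn0.
have cd2 : 0 < cmod (d z) / 2 by rewrite divr_gt0.
have /inearP[d1 d10 H1] := (cdiffP _ _ _ _).1 dz _ cd2.
have /nbhs_planeP[d2 d20 H2] := uhp_open uz.
pose r := Num.min d1 d2 / 2.
have m0 : 0 < Num.min d1 d2 by rewrite lt_min d10.
have r0 : 0 < r by rewrite divr_gt0.
have rm : r < Num.min d1 d2 by rewrite /r ltr_pdivrMr// ltr_pMr// ltr1n.
have rd w : cmod (w - z) <= r -> cmod (w - z) < d1 /\ uhp w.
  move=> /le_lt_trans/(_ rm); rewrite lt_min => /andP[h1 h2]; split => //; exact: H2.
pose e := cmod (d z) / 2 * r / 2.
have e0 : 0 < e by rewrite divr_gt0// mulr_gt0.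
exists e => // y ye.
pose K : set (plane R) := [set w | cmod (w - z) <= r].
have cK : compact K by exact: cball_compact.
have Kz : K z by rewrite /K/= subrr cmod0 ltW.
have ctsK : {within K, continuous (fun w : plane R => cmod (f w - y))}.
  apply/subspace_continuousP => w Kw; have [_ uw] := rd w Kw.
  apply: clim_cmod; apply: climB; last exact: clim_cst.
  have := cdiff_cts (df w uw); apply: clim_inear_sub.
  by apply/inearP; exists 1 => // v _ /rd[].
have K0 : K !=set0 by exists z.
have [p] := compact_EVT_min K0 cK ctsK.
rewrite inE => Kp pmin; have [_ up] := rd p Kp.
have pmin' w : K w -> cmod (f p - y) <= cmod (f w - y) by move=> /mem_set; exact: pmin.
exists p => //; apply/eqP; rewrite -subr_eq0; apply: contraT => py.
have pr : cmod (p - z) < r.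
  rewrite lt_neqAle Kp andbT; apply/eqP => pr.
  have [pd1 _] := rd p Kp; have := H1 p pd1 up; rewrite pr => h1.
  have h2 := pmin' z Kz; rewrite (cmodB (f z)) in h2.
  have h3 : cmod (d z) * r - cmod (d z) / 2 * r <= cmod (f p - f z).
    have h0 := cmodBD ((p - z) * d z) (f p - f z - (p - z) * d z).
    have E0 : (p - z) * d z + (f p - f z - (p - z) * d z) = f p - f z by ring.
    by rewrite E0 cmodM pr in h0; lra.
  have h4 : cmod (f p - f z) <= cmod (f p - y) + cmod (y - f z).
    by rewrite (le_trans _ (cmodD _ _))// addrA subrK.
  rewrite /e in ye; nra.
have rp : 0 < r - cmod (p - z) by rewrite subr_gt0.
have dp := df p up.
pose v := - (f p - y) / d p.
have cv1 : 0 < cmod v + 1 by rewrite ltr_wpDl ?cmod_ge0.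
have cpy : 0 < cmod (f p - y) by rewrite cmod_gt0.
have e3 : 0 < cmod (f p - y) / (2 * (cmod v + 1)) by rewrite divr_gt0// mulr_gt0.
have /inearP[d3 d30 H3] := (cdiffP _ _ _ _).1 dp _ e3.
pose m := Num.min (Num.min d3 (r - cmod (p - z))) 1.
have mm0 : 0 < m by rewrite !lt_min d30 rp ltr01.
pose t := m / (2 * (cmod v + 1)).
have t0 : 0 < t by rewrite divr_gt0// mulr_gt0.
have t1 : t <= 1.
  rewrite ler_pdivrMr ?mulr_gt0// mul1r (@le_trans _ _ 1)//; first by rewrite ge_min lexx orbT.
  by have := cmod_ge0 v; lra.
pose w := p + Complex t 0 * v.
have wp : cmod (w - p) = t * cmod v by rewrite /w addrC addKr cmodM cmod_real gtr0_norm.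
have tvm : t * cmod v < m.
  rewrite /t mulrAC ltr_pdivrMr ?mulr_gt0// ltr_pM2l//.
  by have := cmod_ge0 v; lra.
move: (tvm); rewrite !lt_min => /andP[/andP[k1 k2] _].
have Kw : K w.
  rewrite /K/= (_ : w - z = (w - p) + (p - z)); last by ring.
  by rewrite (le_trans (cmodD _ _))// wp; lra.
have [_ uw] := rd w Kw.
have := H3 w; rewrite wp => /(_ k1 uw) h5.
have h6 := pmin' w Kw.
have E : f w - y = Complex (1 - t) 0 * (f p - y) + (f w - f p - (w - p) * d p).
  have -> : Complex (1 - t) 0 = 1 - Complex t 0 :> C.
    by apply: complex_ext; rewrite !ReImE/= ?subr0.
  have -> : w - p = Complex t 0 * v by rewrite /w addrC addKr.
  rewrite /v; field; exact: dn0.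
have h7 := cmodD (Complex (1 - t) 0 * (f p - y)) (f w - f p - (w - p) * d p).
rewrite -E cmodM cmod_real ger0_norm ?subr_ge0// in h7.
have h8 : cmod (f p - y) / (2 * (cmod v + 1)) * (t * cmod v) <= t * cmod (f p - y) / 2.
  have -> : t * cmod (f p - y) / 2 = cmod (f p - y) / (2 * (cmod v + 1)) * (t * (cmod v + 1)).
    by field; rewrite gt_eqF.
  by rewrite ler_pM2l// ler_pM2l// lerDl.
have : t * cmod (f p - y) > 0 by rewrite mulr_gt0.
have E7 : (1 - t) * cmod (f p - y) = cmod (f p - y) - t * cmod (f p - y) by ring.
rewrite E7 in h7; lra.
Qed.

(* Walking along a segment issued from a value of [f], one stays in the image
   as long as the boundary values are avoided. *)
Lemma segment_onto f (d : C -> C) z0 y : scts f ->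
  (forall z, uhp z -> cdiff (@uhp R) (fun w => f (Some w)) z (d z)) ->
  (forall z, uhp z -> d z != 0) -> uhp z0 ->
  (forall t : R, 0 <= t <= 1 ->
     f None != f (Some z0) + Complex t 0 * (y - f (Some z0)) /\
     forall x : R, f (Some (Complex x 0)) != f (Some z0) + Complex t 0 * (y - f (Some z0))) ->
  exists2 z, uhp z & f (Some z) = y.
Proof.
move=> cf df dn0 uz0 avoid.
pose seg (t : R) : C := f (Some z0) + Complex t 0 * (y - f (Some z0)).
pose A : set R := [set t | 0 <= t <= 1 /\ exists2 z, uhp z & f (Some z) = seg t].
have seg0 : seg 0 = f (Some z0) by rewrite /seg; apply: complex_ext; rewrite !ReImE/=; ring.
have seg1 : seg 1 = y by rewrite /seg; apply: complex_ext; rewrite !ReImE/=; ring.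
have segB s t : seg s - seg t = Complex (s - t) 0 * (y - f (Some z0)).
  by rewrite /seg; apply: complex_ext; rewrite !ReImE/=; ring.
have A0 : A 0 by split; [rewrite lexx ler01|exists z0].
have supA : has_sup A.
  by split; [exists 0|exists 1 => t [/andP[]]].
pose T := sup A.
have T01 : 0 <= T <= 1.
  apply/andP; split; first by apply: ub_le_sup => //; case: supA.
  by apply: ge_sup; [exists 0|move=> t [/andP[]]].
have AT : A T.
  split => //.
  have Xn0 : scuhp !=set0 by exists None.
  have gl (z w : C) : `|cmod (z - seg T) - cmod (w - seg T)| <= cmod (z - w).
    by rewrite (le_trans (ler_cmod_dist _ _))// opprB addrA subrK.
  have [p] := compact_EVT_min Xn0 scuhp_compact (scts_within_real (g := fun z => cmod (z - seg T)) cf gl).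
  rewrite inE => Xp pmin.
  have p0 : cmod (f p - seg T) <= 0.
    apply/ler_addgt0Pr => e e0; rewrite add0r.
    have n0 : 0 < cmod (y - f (Some z0)) + 1 by rewrite ltr_wpDl ?cmod_ge0.
    have e1 : 0 < e / (cmod (y - f (Some z0)) + 1) by rewrite divr_gt0.
    have [t [[t01 [z uz zt]]] Tt] := sup_adherent e1 supA.
    have tT : t <= T by apply: ub_le_sup; [case: supA|split => //; exists z].
    rewrite (le_trans (pmin (Some z) (mem_set (ltW uz : scuhp (Some z)))))//= zt segB cmodM cmod_real.
    rewrite distrC ger0_norm ?subr_ge0//.
    apply: le_trans (_ : e / (cmod (y - f (Some z0)) + 1) * cmod (y - f (Some z0)) <= _).
      by rewrite ler_wpM2r ?cmod_ge0//; rewrite -/T in Tt; lra.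
    by rewrite mulrAC ler_pdivrMr// ler_pM2l// lerDl.
  have fp : f p = seg T.
    by apply/eqP; rewrite -subr_eq0 -cmod_eq0 eq_le p0 cmod_ge0.
  have [aN ax] := avoid T T01.
  case: p Xp fp {pmin p0} => [z|] Xp fp; last by rewrite fp eqxx in aN.
  exists z => //; rewrite /uhp/= lt_neqAle Xp andbT; apply/eqP => z00.
  have zE : z = Complex (Re z) 0 by apply: complex_ext.
  by have := ax (Re z); rewrite -zE fp eqxx.
have [T1|] := ltP T 1; last first.
  move=> T1; have TE : T = 1 by apply/eqP; rewrite eq_le T1 andbT; case/andP: T01.
  by move: AT => [_ [z uz]]; rewrite TE seg1 => H; exists z.
exfalso; move: AT => [_ [z uz zT]].
have [e e0 H] := local_open df dn0 uz.
have n0 : 0 < cmod (y - f (Some z0)) + 1 by rewrite ltr_wpDl ?cmod_ge0.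
pose s := Num.min (1 - T) (e / (2 * (cmod (y - f (Some z0)) + 1))).
have s0 : 0 < s by rewrite lt_min subr_gt0 T1 divr_gt0// mulr_gt0.
have : A (T + s).
  split.
    rewrite addr_ge0 ?(ltW s0)//=; last by case/andP: T01.
    by rewrite -lerBrDl /s ge_min lexx.
  apply: H; rewrite zT segB addrC addKr cmodM cmod_real gtr0_norm//.
  apply: le_lt_trans (_ : e / (2 * (cmod (y - f (Some z0)) + 1)) * cmod (y - f (Some z0)) < _).
    by rewrite ler_wpM2r ?cmod_ge0// /s ge_min lexx orbT.
  rewrite mulrAC ltr_pdivrMr ?mulr_gt0// ltr_pM2l//.
  by have := cmod_ge0 (y - f (Some z0)); lra.
move=> /(ub_le_sup (let: conj _ h := supA in h)).
by rewrite -/T -{2}[T]addr0 lerD2l leNgt s0.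
Qed.

(** Complex values have no mean value theorem, but one real component, selected by [w0], has. That
    is enough when the values of f' lie in an open half-plane, and the end points may then be on the
    real axis. *)
Lemma cuhp_MVT (f f' : C -> C) (a b w0 : C) :
  (forall z, cuhp z -> clim (inear (@cuhp R) z) f (f z)) ->
  (forall z, uhp z -> cdiff (@uhp R) f z (f' z)) -> cuhp a -> cuhp b ->
  (forall t : R, 0 < t < 1 -> uhp (a + Complex t 0 * (b - a))) ->
  exists2 t : R, 0 < t < 1 &
    Re (w0 * (f b - f a)) = Re (w0 * (f' (a + Complex t 0 * (b - a)) * (b - a))).
Proof.
move=> fc fd ua ub us.
pose sg (t : R) : C := a + Complex t 0 * (b - a).
pose g (t : R) := Re w0 * Re (f (sg t)) - Im w0 * Im (f (sg t)).
pose g' (t : R) := Re w0 * Re (f' (sg t) * (b - a)) - Im w0 * Im (f' (sg t) * (b - a)).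
have sgc (t : R) : 0 <= t <= 1 -> cuhp (sg t).
  move: ua ub; rewrite /cuhp/sg/= !ReImE/= => ha hb /andP[t0 t1]; nra.
have gd (t : R) : t \in `](0:R), 1[ -> is_derive t 1 g (g' t).
  rewrite in_itv/= => t01.
  have [h1 h2] : pderiv (fun s => f (sg s)) t (f' (sg t) * (b - a)).
    apply: (cdiff_pderiv _ (fd _ (us t t01))); apply: uhp_line_near; exact: us.
  exact: (is_deriveB (is_deriveZ (Re w0) h1) (is_deriveZ (Im w0) h2)).
have cfs (t : R) : t \in `[(0:R), 1]%classic ->
    clim (within `[(0:R), 1]%classic (nbhs t)) (fun s => f (sg s)) (f (sg t)).
  rewrite inE/= in_itv/= => t01; apply/climP => e e0.
  have [d d0 H] := (clim_inearP _ _ _ _).1 (fc _ (sgc t t01)) e e0.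
  have n0 : 0 < cmod (b - a) + 1 by rewrite ltr_wpDl ?cmod_ge0.
  rewrite /within/=; apply/nbhs_ballP; exists (d / (cmod (b - a) + 1)); first by rewrite /= divr_gt0.
  move=> s; rewrite -ball_normE/= => ts; rewrite in_itv/= => s01; apply: H; last exact: sgc.
  have -> : sg s - sg t = Complex (s - t) 0 * (b - a).
    by rewrite /sg; apply: complex_ext; rewrite !ReImE/=; ring.
  rewrite cmodM cmod_real distrC (@le_lt_trans _ _ (`|t - s| * (cmod (b - a) + 1)))//.
    by rewrite ler_wpM2l// lerDl.
  by rewrite -ltr_pdivlMr.
have cg : {within `[0, 1], continuous g}.
  apply/subspace_continuousP => t /mem_set t01; have := cfs t t01 => h.
  apply: cvgB; apply: cvgM; [exact: cvg_cst|exact: (clim_Re h)|exact: cvg_cst|exact: (clim_Im h)].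
have [t t01 Et] := MVT ltr01 gd cg.
exists t; first by move: t01; rewrite in_itv.
move: Et; rewrite subr0 mulr1 /g /g' /sg.
have -> : a + Complex 0 0 * (b - a) = a by apply: complex_ext; rewrite !ReImE/=; ring.
have -> : a + Complex 1 0 * (b - a) = b by apply: complex_ext; rewrite !ReImE/=; ring.
have X (z : C) : Re (w0 * z) = Re w0 * Re z - Im w0 * Im z by rewrite !ReImE.
by move=> Et; rewrite !X -Et !ReImE; ring.
Qed.

End sphere_half_plane.

(** * The trapezoid map of the half-plane *)

Section boundary_traces.
Variable R : realType.
Local Notation C := (complex R).

Lemma boundary_pderiv (f : C -> C) (x : R) c : cdiff (@cuhp R) f (Complex x 0) c ->
  pderiv (fun t => f (Complex t 0)) x c.
Proof.
move=> fc.
have E (t : R) : Complex t 0 = 0 + Complex t 0 * 1 by rewrite add0r mulr1.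
have -> : (fun t => f (Complex t 0)) = (fun t => f (0 + Complex t 0 * 1)).
  by apply/funext => t; rewrite -E.
rewrite -[c]mulr1; rewrite (E x) in fc; apply: (cdiff_pderiv _ fc).
by apply/nbhs_ballP; exists 1 => //= t _; rewrite -E /cuhp/=.
Qed.

Lemma boundary_clim (f : C -> C) (x : R) :
  clim (inear (@cuhp R) (Complex x 0)) f (f (Complex x 0)) ->
  clim (nbhs x) (fun t => f (Complex t 0)) (f (Complex x 0)).
Proof.
move=> /clim_inearP H; apply/climP => e /H [d d0 Hd].
apply/nbhs_ballP; exists d => // y; rewrite -ball_normE/= => xy.
apply: Hd; last by rewrite /cuhp/=.
have -> : Complex y 0 - Complex x 0 = Complex (y - x) 0 :> C.
  by apply: complex_ext; rewrite !ReImE/= ?subr0.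
by rewrite cmod_real distrC.
Qed.

Lemma derive_pos_lt (u u' : R -> R) (x y : R) : x < y -> continuous u ->
  (forall t, x < t < y -> is_derive t 1 u (u' t)) ->
  (forall t, x < t < y -> 0 < u' t) -> u x < u y.
Proof.
move=> xy cu du u0.
have [t txy E] := @MVT R u u' x y xy (fun t => du t) (continuous_subspaceT cu).
by rewrite -subr_gt0 E mulr_gt0 ?subr_gt0// u0.
Qed.

Lemma derive_zero_eq (u u' : R -> R) (x y : R) : x <= y -> continuous u ->
  (forall t, x < t < y -> is_derive t 1 u (u' t)) ->
  (forall t, x < t < y -> u' t = 0) -> u x = u y.
Proof.
rewrite le_eqVlt => /predU1P[-> //|xy] cu du u0.
have [t txy E] := @MVT R u u' x y xy (fun t => du t) (continuous_subspaceT cu).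
by apply/eqP; rewrite eq_sym -subr_eq0 E u0// mul0r.
Qed.

Lemma carg_real_sub (x y : R) : x != y ->
  carg (Complex x 0 - Complex y 0) = if x < y then pi else 0 :> R.
Proof.
move=> xy; have -> : Complex x 0 - Complex y 0 = Complex (x - y) 0 :> C.
  by apply: complex_ext; rewrite !ReImE/= ?subr0.
have [lxy|] := ltP x y; first by rewrite carg_neg// subr_lt0.
by rewrite le_eqVlt eq_sym (negbTE xy)/= => yx; rewrite carg_pos// subr_gt0.
Qed.

(** Reflection in the imaginary axis, the symmetry shared by the trapezoid, the half-plane and the
    sets of prevertices. *)
Definition refl (z : C) : C := - conjc z.

Lemma Re_refl z : Re (refl z) = - Re z. Proof. by case: z. Qed.
Lemma Im_refl z : Im (refl z) = Im z. Proof. by case: z => x y /=; rewrite opprK. Qed.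

Lemma reflK : involutive refl.
Proof. by case=> x y; rewrite /refl/=; apply: complex_ext => /=; rewrite !opprK. Qed.

Lemma cmod_conjc (z : C) : cmod (conjc z) = cmod z.
Proof. by case: z => x y; rewrite /cmod/= sqrrN. Qed.

(** The supplement of arg (z - x) is the argument of the mirror image of z - x. This image has the
    same height as z + x and the smaller real part x - Re z, hence the larger argument. *)
Lemma carg_sum_lt (z : C) (x : R) : uhp z -> 0 < Re z -> 0 < x ->
  0 < carg (z - Complex (- x) 0) + carg (z - Complex x 0) < pi.
Proof.
move=> uz rz x0; have u1 := uhp_sub_real (- x) uz; have u2 := uhp_sub_real x uz.
rewrite addr_gt0 ?carg_gt0//= -ltrBrDr.
have -> : pi - carg (z - Complex x 0) = carg (refl (z - Complex x 0)).
  by rewrite carg_conjN// Im_gt0_neq0.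
have -> : refl (z - Complex x 0) = Complex (x - Re z) (Im z).
  by apply: complex_ext; rewrite ?Re_refl ?Im_refl !ReImE/=; ring.
have -> : z - Complex (- x) 0 = Complex (x + Re z) (Im z).
  by apply: complex_ext; rewrite !ReImE/=; ring.
by apply: carg_lt => //; lra.
Qed.

Lemma cint_conj (f : R -> C) : cintegrable f ->
  cint (fun t => conjc (f t)) = conjc (cint f).
Proof.
move=> [_ i2].
apply: complex_ext.
  rewrite (_ : Re (conjc (cint f)) = Re (cint f)); last by case: (cint f).
  by rewrite /cint/=; apply: eq_Rintegral => t _; case: (f t).
rewrite (_ : Im (conjc (cint f)) = - Im (cint f)); last by case: (cint f).
rewrite /cint/= -mulN1r -RintegralZl//; apply: eq_Rintegral => t _.
by rewrite mulN1r; case: (f t).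
Qed.

End boundary_traces.

(** * Estimates and symmetry for four symmetric prevertices *)

Section trapezoid_map.
Variable R : realType.
Local Notation C := (complex R).
Variables (b r : R).
Hypothesis b01 : 0 < b < 1.
Hypothesis r1 : 1 < r.

(** An exponent is the interior angle over pi, minus 1: the angle is pi b at the images of -r and r,
    and pi (1 - b) at those of -1 and 1. The sum is -2, so the integrand is O(z^-2) and infinity
    goes to a finite point of a side. Rectangles use b = 1/2, the interior of L uses b = 1 -
    alpha. *)
Definition tzl : seq (R * R) := [:: (- r, b - 1); (-1, - b); (1, - b); (r, b - 1)].
Definition tzphi : C -> C := scphi tzl.
Definition tzmap : C -> C := vprim tzphi 0.

Let beta : R := Num.max b (1 - b).
Let beta01 : 0 <= beta < 1.
Proof. by rewrite /beta gt_max le_max; case/andP: b01 => b0 b1; lra. Qed.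

Lemma tz_free (z : C) : (forall x, x \in [:: - r; -1; 1; r] -> z != Complex x 0) ->
  scfree tzl z.
Proof. by move=> H p /= [<-|[<-|[<-|[<-|[]]]]] /=; apply: H; rewrite !inE eqxx ?orbT. Qed.

Lemma tzphi_le (z : C) (t : R) : scfree tzl z -> 0 < t ->
  (forall p, List.In p tzl -> t <= cmod (z - Complex p.1 0)) ->
  cmod (tzphi z) <= t ^- 2.
Proof.
move=> fz t0 H; rewrite cmod_scphi//.
case/andP: b01 => b0 b1.
have pw (y g : R) : t <= y -> g <= 0 -> y `^ g <= t `^ g.
  by move=> ty g0; rewrite -(opprK g); apply: powRN_le => //; rewrite oppr_ge0.
have E : t ^- 2 = \prod_(p <- tzl) t `^ p.2.
  rewrite !big_cons big_nil/= mulr1 -!powRD; try by apply/implyP => _; rewrite gt_eqF.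
  rewrite (_ : _ + _ = - 2%:R); last by ring.
  by rewrite powRN powR_mulrn// ltW.
have g0 p : List.In p tzl -> p.2 <= 0.
  by move=> /= [<-|[<-|[<-|[<-|[]]]]] /=; lra.
rewrite E; elim: tzl H g0 => [|p s ih] H g0; first by rewrite !big_nil.
rewrite !big_cons; apply: ler_pM; rewrite ?powR_ge0//.
- by rewrite prodr_ge0// => *; rewrite powR_ge0.
- by apply: pw; [apply: H; left|apply: g0; left].
- by apply: ih => q qs; [apply: H; right|apply: g0; right].
Qed.

Lemma tzphi_bound : exists2 K : R, 0 <= K &
  forall z : C, uhp z -> cmod (tzphi z) <= K * majo beta (Im z).
Proof.
case/andP: b01 => b0 b1; case/andP: (beta01) => be0 be1.
(* Distinct prevertices are at least 2 e apart, so at most one of them is at distance less than e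
   from z. *)
pose e := Num.min 1 ((r - 1) / 2).
have e01 : 0 < e <= 1.
  by rewrite /e lt_min ge_min lexx ltr01 divr_gt0 ?subr_gt0.
have e2 : 2 * e <= 2 /\ 2 * e <= r - 1.
  have h1 : e <= 1 by rewrite ge_min lexx.
  have h2 : e <= (r - 1) / 2 by rewrite ge_min lexx orbT.
  by split; lra.
pose E := \prod_(p <- tzl) e `^ p.2.
have E0 : 0 <= E by rewrite prodr_ge0// => *; rewrite powR_ge0.
exists (4 * (E + 1)); first by rewrite mulr_ge0// addr_ge0.
move=> z uz; have z0 : 0 < Im z := uz.
have fz := @uhp_scfree R tzl z uz.
have mj := majo_ge0 beta z0.
have [z1|z1] := leP (Im z) 1; last first.
  have := @tzphi_le z (Im z) fz z0 (fun p _ => Im_le_dist z p.1).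
  move=> /le_trans; apply; apply: le_trans (majo_lb_large beta01 (ltW z1)) _.
  by rewrite ler_wpM2r// ler_peMr// lerDr.
have far (x y : R) : 2 * e <= `|x - y| ->
    (e <= cmod (z - Complex x 0)) || (e <= cmod (z - Complex y 0)).
  move=> exy; apply/orP; have [|h1] := leP e (cmod (z - Complex x 0)); first by left.
  right; rewrite leNgt; apply/negP => h2.
  have : `|x - y| <= cmod (z - Complex x 0) + cmod (z - Complex y 0).
    rewrite -cmod_real -(cmodN (z - Complex x 0)) (le_trans _ (cmodD _ _))//.
    rewrite le_eqVlt; apply/orP; left; apply/eqP; congr cmod.
    by apply: complex_ext; rewrite !ReImE/=; ring.
  by lra.
rewrite cmod_scphi//.
have := @prod_powR_near R e (Im z) beta [seq (cmod (z - Complex p.1 0), p.2) | p <- tzl].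
rewrite !big_map/= -/E => H.
apply: le_trans (H _ _ _ _ _) _ => //.
- by rewrite z0.
- have bm : b <= beta /\ 1 - b <= beta by rewrite /beta !le_max !lexx orbT.
  by move=> p /= [<-|[<-|[<-|[<-|[]]]]] /=; split; rewrite ?Im_le_dist//; lra.
- have [e2a e2b] := e2; have r1' := r1.
  clear -far e2a e2b r1'.
  by rewrite andbT !far//; rewrite ler_normr; apply/orP; clear far;
    first [right; lra|left; lra].
have := majo_lb_small beta01 z0 z1 => h.
apply: le_trans (ler_wpM2r E0 h) _.
by rewrite mulrAC ler_wpM2r//; lra.
Qed.

Let tzphi' (z : C) := tzphi z * scpre tzl z.

Let tz_hyps : exists K : R, [/\
  forall z, uhp z -> cdiff (@uhp R) tzphi z (tzphi' z),
  forall z, uhp z -> clim (inear (@uhp R) z) tzphi' (tzphi' z),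
  forall z : C, uhp z -> cmod (tzphi z - 0) <= K * majo beta (Im z),
  forall z : C, uhp z -> cmod (tzphi' z) <= K * majo beta (Im z) / Im z &
  forall t : R, 0 < t -> clim (cinf (@cuhp R)) (fun z => tzphi (z + Complex 0 t)) 0].
Proof.
case/andP: b01 => b0 b1.
(* The factor 2 is the sum of the absolute values of the exponents, which bounds the logarithmic
   derivative by 2 / Im z. *)
have [K K0 HK] := tzphi_bound; exists (2 * K); split.
- by move=> z; exact: cdiff_scphi.
- move=> z uz; apply: climM; last exact: scpre_clim.
  by apply: scphi_clim; exact: uhp_scfree.
- move=> z uz; rewrite subr0 (le_trans (HK z uz))// -mulrA ler_peMl ?ler1n//.
  by rewrite mulr_ge0// majo_ge0.
- move=> z uz; rewrite /tzphi' cmodM.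
  have h := cmod_scpre tzl uz.
  have E : \sum_(p <- tzl) `|p.2| = 2.
    rewrite !big_cons big_nil/= !normrN addr0 ler0_norm ?ger0_norm; lra.
  rewrite E in h; apply: le_trans (ler_pM _ _ (HK z uz) h) _; rewrite ?cmod_ge0//.
  by rewrite le_eqVlt; apply/orP; left; apply/eqP; ring.
- move=> t t0; apply/climP => e e0.
  exists (t + r + 1 + e^-1) => z cz zN.
  have ie : 0 < e^-1 by rewrite invr_gt0.
  have uz := shift_uhp cz t0.
  pose M := cmod z - t - r.
  have M1 : 1 + e^-1 < M by rewrite /M; lra.
  have M0 : 0 < M by lra.
  have d p : List.In p tzl -> M <= cmod (z + Complex 0 t - Complex p.1 0).
    move=> pl; have pr : `|p.1| <= r.
      by move: pl => /= [<-|[<-|[<-|[<-|[]]]]] /=; rewrite ?normrN ?normr1 ?ger0_norm; have := r1; lra.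
    have h1 := cmodBD z (Complex 0 t - Complex p.1 0).
    have h2 := cmodD (Complex 0 t) (- Complex p.1 0).
    rewrite cmodN cmod_real cmod_imag (gtr0_norm t0) in h2.
    by rewrite addrA in h1; rewrite /M; lra.
  rewrite subr0; apply: le_lt_trans (tzphi_le (uhp_scfree uz) M0 d) _.
  rewrite -[ltRHS]invrK ltf_pV2 ?posrE ?exprn_gt0//.
  by rewrite expr2; nra.
Qed.

Lemma tzmap_cts (z : C) : cuhp z -> clim (inear (@cuhp R) z) tzmap (tzmap z).
Proof. by have [K [h1 h2 h3 h4 h5]] := tz_hyps; exact: (vprim_cts beta01 h1 h3). Qed.

Lemma tzmap_inf : clim (cinf (@cuhp R)) tzmap 0.
Proof.
have [K [h1 h2 h3 h4 h5]] := tz_hyps.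
apply: clim_near (vprim_inf beta01 h1 h3 h5).
by apply: nearW => z; rewrite mul0r subr0.
Qed.

Lemma tzmap_diff (z : C) : uhp z -> cdiff (@uhp R) tzmap z (tzphi z).
Proof. by have [K [h1 h2 h3 h4 h5]] := tz_hyps; exact: (vprim_diff beta01 h1 h2 h3 h4 h5). Qed.

Lemma tzmap_bdiff (x : R) : x \notin [:: - r; -1; 1; r] ->
  pderiv (fun t => tzmap (Complex t 0)) x (tzphi (Complex x 0)).
Proof.
move=> xl; have [K [h1 h2 h3 h4 h5]] := tz_hyps.
apply: boundary_pderiv; apply: (vprim_diff_boundary beta01 h1 h2 h3 h4 h5).
  by rewrite /cuhp/=.
apply: scphi_clim; apply: tz_free => y yl; apply: contraNneq xl => /(congr1 (@complex.Re R))/= ->.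
exact: yl.
Qed.

(** Reflection replaces each argument by the supplement of the one at the opposite prevertex. As the
    exponents sum to -2, the total argument becomes its opposite, up to the period 2 pi. *)
Lemma tzphi_refl (z : C) : scfree tzl z -> tzphi (refl z) = conjc (tzphi z).
Proof.
move=> fz.
have E (x : R) : refl z - Complex x 0 = refl (z - Complex (- x) 0).
  by apply: complex_ext; rewrite !(ReImE, Re_refl, Im_refl)/=; ring.
have z0 p : List.In p tzl -> z - Complex p.1 0 != 0.
  by move=> pl; rewrite subr_eq0; exact: fz.
have zr' := z0 (- r, b - 1) (or_introl erefl).
have z1' := z0 (- 1, - b) (or_intror (or_introl erefl)).
have z1 := z0 (1, - b) (or_intror (or_intror (or_introl erefl))).
have zr := z0 (r, b - 1) (or_intror (or_intror (or_intror (or_introl erefl)))).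
rewrite /= in zr zr' z1 z1'.
have cr (w : C) : cmod (refl w) = cmod w by rewrite cmodN cmod_conjc.
have fz' : scfree tzl (refl z).
  move=> p pl; rewrite -subr_eq0 E -cmod_eq0 cr cmod_eq0.
  by move: pl => /= [<-|[<-|[<-|[<-|[]]]]] /=; rewrite ?opprK.
have M : cmod (tzphi (refl z)) = cmod (tzphi z).
  rewrite !cmod_scphi// !prod_seq4/= !E !cr !opprK.
  set A1 := _ `^ _; set A2 := _ `^ _; set A3 := _ `^ _; set A4 := _ `^ _.
  by move: A1 A2 A3 A4 => A1 A2 A3 A4; ring.
have A : scarg tzl (refl z) = - scarg tzl z - 2 * pi.
  rewrite /scarg !big_cons !big_nil/= !E !carg_conjN ?opprK//.
  set A1 := carg _; set A2 := carg _; set A3 := carg _; set A4 := carg _.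
  by move: A1 A2 A3 A4 => A1 A2 A3 A4; ring.
have c1 : cos (- scarg tzl z - 2 * pi) = cos (scarg tzl z).
  by rewrite -opprD cosN mulr_natl cosD cos2pi sin2pi mulr1 mulr0 subr0.
have s1 : sin (- scarg tzl z - 2 * pi) = - sin (scarg tzl z).
  by rewrite -opprD sinN mulr_natl sinD cos2pi sin2pi mulr1 mulr0 addr0.
apply: complex_ext.
  rewrite Re_scphi M A c1 -Re_scphi -/tzphi; by case: (tzphi z).
rewrite Im_scphi M A s1 mulrN -Im_scphi -/tzphi; by case: (tzphi z).
Qed.

Lemma tzmap_refl (z : C) : cuhp z -> tzmap (refl z) = refl (tzmap z).
Proof.
move=> cz.
have E (w : C) : tzmap w = - (Complex 0 1 * cint (fun t => tzphi (w + Complex 0 t) - 0)).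
  by rewrite /tzmap /vprim; set X := cint _; ring.
rewrite !E.
have -> : cint (fun t => tzphi (refl z + Complex 0 t) - 0) =
    conjc (cint (fun t => tzphi (z + Complex 0 t) - 0)).
  have [K [h1 h2 h3 h4 h5]] := tz_hyps.
  rewrite -cint_conj; last exact: (psi_cintegrable beta01 h1 h3).
  apply: eq_cint => t t0; rewrite !subr0.
  have -> : refl z + Complex 0 t = refl (z + Complex 0 t).
    by apply: complex_ext; rewrite !(ReImE, Re_refl, Im_refl)/=; ring.
  by rewrite tzphi_refl//; apply: uhp_scfree; exact: shift_uhp.
case: (cint _) => x y; rewrite /refl/=; apply: complex_ext; rewrite !ReImE/=; ring.
Qed.

End trapezoid_map.

Lemma lincomb_continuous (R : realType) (u v : R -> R) (p q : R) :
  continuous u -> continuous v -> continuous (fun t => p * u t - q * v t).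
Proof.
by move=> cu cv t; apply: cvgB; apply: cvgM; (try exact: cvg_cst); [exact: cu|exact: cv].
Qed.

Lemma opp_continuous_fun (R : realType) (u : R -> R) :
  continuous u -> continuous (fun t => - u t).
Proof. by move=> cu t; apply: cvgN; exact: cu. Qed.

Definition tzspeed (R : realType) (b r x : R) : R := cmod (tzphi b r (Complex x 0)).
Definition tztrace (R : realType) (b r x : R) : complex R := tzmap b r (Complex x 0).

Section trapezoid_boundary.
Variable R : realType.
Local Notation C := (complex R).
Variables (b r : R).
Hypothesis b01 : 0 < b < 1.
Hypothesis r1 : 1 < r.

Local Notation phi := (@tzphi R b r).
Local Notation S := (@tzmap R b r).
Local Notation sb := (sin (pi * b)).
Local Notation cb := (cos (pi * b)).

Lemma sb_gt0 : 0 < sin (pi * b).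
Proof.
case/andP: b01 => b0 b1; have p0 := pi_gt0 R.
by rewrite sin_gt0_pi// mulr_gt0//= -[ltRHS]mulr1 ltr_pM2l.
Qed.

Local Notation m := (tzspeed b r).

Let speed_gt0 (x : R) : 0 < m x.
Proof. by rewrite cmod_gt0 scphi_neq0. Qed.

Local Notation trace := (tztrace b r).

Let scarg_real (x : R) : x \notin [:: - r; -1; 1; r] ->
  scarg (tzl b r) (Complex x 0) =
  (b - 1) * (if x < - r then pi else 0) + (- b * (if x < -1 then pi else 0)
   + (- b * (if x < 1 then pi else 0) + (b - 1) * (if x < r then pi else 0))).
Proof.
rewrite !inE !negb_or => /and4P[h1 h2 h3 h4].
by rewrite /scarg !big_cons big_nil/= !carg_real_sub// addr0.
Qed.

Lemma tz_trace_mid (x : R) : -1 < x < 1 ->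
  pderiv trace x (Complex (- m x) 0).
Proof.
move=> /andP[x1 x2]; have r1' := r1.
have xl : x \notin [:: - r; -1; 1; r].
  by rewrite !inE !negb_or; apply/and4P; split; apply/eqP; lra.
have := tzmap_bdiff b01 r1 xl; rewrite (_ : tzphi b r _ = Complex (- m x) 0)//.
have A : scarg (tzl b r) (Complex x 0) = - pi.
  have e1 : (x < - r) = false by apply/negbTE; rewrite -leNgt; lra.
  have e2 : (x < -1) = false by apply/negbTE; rewrite -leNgt; lra.
  have e4 : x < r by lra.
  by rewrite (scarg_real xl) e1 e2 x2 e4; ring.
apply: complex_ext; rewrite ?Re_scphi ?Im_scphi A ?cosN ?sinN ?cospi ?sinpi /=.
  by rewrite mulrN1.
by rewrite oppr0 mulr0.
Qed.

Lemma tz_trace_side (x : R) : 1 < x < r ->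
  pderiv trace x (Complex (- (m x * cb)) (- (m x * sb))).
Proof.
move=> /andP[x1 x2]; have r1' := r1.
have xl : x \notin [:: - r; -1; 1; r].
  by rewrite !inE !negb_or; apply/and4P; split; apply/eqP; lra.
have := tzmap_bdiff b01 r1 xl.
rewrite (_ : tzphi b r _ = Complex (- (m x * cb)) (- (m x * sb)))//.
have A : scarg (tzl b r) (Complex x 0) = pi * b - pi.
  have e1 : (x < - r) = false by apply/negbTE; rewrite -leNgt; lra.
  have e2 : (x < -1) = false by apply/negbTE; rewrite -leNgt; lra.
  have e3 : (x < 1) = false by apply/negbTE; rewrite -leNgt; lra.
  by rewrite (scarg_real xl) e1 e2 e3 x2; ring.
apply: complex_ext; rewrite ?Re_scphi ?Im_scphi A ?cosB ?sinB ?cospi ?sinpi /=.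
  by rewrite mulrN1 mulr0 addr0 mulrN.
by rewrite mulrN1 mulr0 subr0 mulrN.
Qed.

Lemma tz_trace_out (x : R) : r < x -> pderiv trace x (Complex (m x) 0).
Proof.
move=> x2; have r1' := r1.
have xl : x \notin [:: - r; -1; 1; r].
  by rewrite !inE !negb_or; apply/and4P; split; apply/eqP; lra.
have := tzmap_bdiff b01 r1 xl; rewrite (_ : tzphi b r _ = Complex (m x) 0)//.
have A : scarg (tzl b r) (Complex x 0) = 0.
  have e1 : (x < - r) = false by apply/negbTE; rewrite -leNgt; lra.
  have e2 : (x < -1) = false by apply/negbTE; rewrite -leNgt; lra.
  have e3 : (x < 1) = false by apply/negbTE; rewrite -leNgt; lra.
  have e4 : (x < r) = false by apply/negbTE; rewrite -leNgt; lra.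
  by rewrite (scarg_real xl) e1 e2 e3 e4 !mulr0 !addr0.
by apply: complex_ext; rewrite ?Re_scphi ?Im_scphi A ?cos0 ?sin0 /= ?mulr1 ?mulr0.
Qed.

Lemma tz_trace_clim (x : R) : clim (nbhs x) trace (trace x).
Proof. by apply: boundary_clim; apply: tzmap_cts => //; rewrite /cuhp/=. Qed.

Lemma tz_trace_lim (e x : R) : 0 < e -> exists2 y : R, x < y & cmod (trace y) < e.
Proof.
move=> e0; have /climP/(_ e e0)[N H] := tzmap_inf b01 r1.
pose y := Num.max (x + 1) (Num.max (N + 1) 0).
have h : [/\ x + 1 <= y, N + 1 <= y & 0 <= y] by rewrite /y !le_max !lexx !orbT.
case: h => h1 h2 h3.
exists y; first by lra.
have := H (Complex y 0); rewrite subr0; apply; first by rewrite /cuhp/=.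
by rewrite cmod_real ger0_norm//; lra.
Qed.

Lemma tz_trace_opp (x : R) : trace (- x) = refl (trace x).
Proof.
have cx : cuhp (Complex x 0) by rewrite /cuhp/=.
rewrite /tztrace -(tzmap_refl b01 r1 cx).
by congr tzmap; apply: complex_ext; rewrite ?Re_refl ?Im_refl/=.
Qed.

End trapezoid_boundary.

(* the side slopes of the trapezoid enter only through the direction [(cb, sb)] *)
Record trapezoid_trace (R : realType) (r sb cb : R) (m : R -> R) (T : R -> complex R) : Prop :=
  TrapezoidTrace {
    tt_r : 1 < r;
    tt_sb : 0 < sb;
    tt_speed : forall x, 0 < m x;
    tt_clim : forall x : R, clim (nbhs x) T (T x);
    tt_lim : forall e x : R, 0 < e -> exists2 y : R, x < y & cmod (T y) < e;
    tt_opp : forall x, T (- x) = refl (T x);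
    tt_mid : forall x, -1 < x < 1 -> pderiv T x (Complex (- m x) 0);
    tt_side : forall x, 1 < x < r -> pderiv T x (Complex (- (m x * cb)) (- (m x * sb)));
    tt_out : forall x, r < x -> pderiv T x (Complex (m x) 0) }.

(** * Geometry of the boundary trace of a trapezoid *)

Section trapezoid_trace_theory.
Variable R : realType.
Local Notation C := (complex R).
Variables (r sb cb : R) (m : R -> R) (trace : R -> C).
Hypothesis tt : trapezoid_trace r sb cb m trace.

Let r1 := tt_r tt.
Let sb_gt0 := tt_sb tt.
Let tz_speed_gt0 := tt_speed tt.
Let lim0 := tt_lim tt.
Let tz_trace_opp := tt_opp tt.
Let tz_trace_mid := tt_mid tt.
Let tz_trace_side := tt_side tt.
Let tz_trace_out := tt_out tt.

Let cRe : continuous (fun x => Re (trace x)).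
Proof. by move=> x; exact: (clim_Re (tt_clim tt x)). Qed.
Let cIm : continuous (fun x => Im (trace x)).
Proof. by move=> x; exact: (clim_Im (tt_clim tt x)). Qed.

Lemma tt_out_Re_lt (x y : R) : r <= x -> x < y -> Re (trace x) < Re (trace y).
Proof.
move=> rx xy; apply: (derive_pos_lt (u := fun t => Re (trace t)) (u' := m) xy cRe) => t /andP[xt _].
  by have [] := tz_trace_out (le_lt_trans rx xt).
exact: tz_speed_gt0.
Qed.

(** The real part increases beyond r while the trace comes arbitrarily close to 0 far out, so it
    cannot have reached 0. *)
Lemma tt_out_Re_lt0 (x : R) : r <= x -> Re (trace x) < 0.
Proof.
move=> rx; have h1 : Re (trace x) < Re (trace (x + 1)) by apply: tt_out_Re_lt => //; rewrite ltrDl.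
rewrite ltNge; apply/negP => h0.
have e0 : 0 < Re (trace (x + 1)) by exact: le_lt_trans h1.
have [y xy ye] := lim0 (x + 1) e0.
have h2 : Re (trace (x + 1)) < Re (trace y).
  by apply: tt_out_Re_lt => //; rewrite (le_trans rx)// lerDl.
have := le_lt_trans (le_trans (ler_norm _) (Re_le_cmod _)) ye.
by rewrite ltNge ltW.
Qed.

Lemma tt_out_Im (x : R) : r <= x -> Im (trace x) = 0.
Proof.
move=> rx; apply/eqP; rewrite -normr_eq0 eq_le normr_ge0 andbT.
apply/ler_addgt0Pr => e e0; rewrite add0r.
have [y xy ye] := lim0 x e0.
have -> : Im (trace x) = Im (trace y).
  apply: (derive_zero_eq (u := fun t => Im (trace t)) (u' := fun=> 0) (ltW xy) cIm) => [t /andP[xt _]|t _]; last by [].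
  by have [] := tz_trace_out (le_lt_trans rx xt).
by rewrite (le_trans (Im_le_cmod _))// ltW.
Qed.

(** Half-lengths of the parallel sides and the height: the side through the image of infinity lies
    on the real axis and has half-length [ttC], the image of [-1, 1] lies at height [tth] and has
    half-length [ttD]. *)
Definition ttC : R := - Re (trace r).
Definition ttD : R := - Re (trace 1).
Definition tth : R := Im (trace 1).

Lemma tt_side_line (x : R) : 1 <= x <= r ->
  sb * Re (trace x) - cb * Im (trace x) = - (sb * ttC).
Proof.
move=> /andP[x1 xr]; pose u (x : R) := sb * Re (trace x) - cb * Im (trace x).
have -> : - (sb * ttC) = u r by rewrite /u tt_out_Im// mulr0 subr0 /ttC mulrN opprK.
have cu : continuous u.
  exact: lincomb_continuous.
apply: (derive_zero_eq (u := u) (u' := fun t => sb * - (m t * cb) - cb * - (m t * sb)) xr cu).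
  move=> t /andP[xt tr]; have t1 : 1 < t < r by rewrite (le_lt_trans x1).
    have [h1 h2] := tz_trace_side t1.
    exact: (is_deriveB (is_deriveZ sb h1) (is_deriveZ cb h2)).
by move=> t _; ring.
Qed.

Lemma tt_side_Im_lt (x y : R) : 1 <= x -> x < y -> y <= r -> Im (trace y) < Im (trace x).
Proof.
move=> x1 xy yr; rewrite -ltrN2.
have cNIm : continuous (fun t => - Im (trace t)) := opp_continuous_fun cIm.
apply: (derive_pos_lt (u := fun t => - Im (trace t)) (u' := fun t => - - (m t * sb)) xy cNIm).
  move=> t /andP[xt ty]; have t1 : 1 < t < r by rewrite (le_lt_trans x1 xt) (lt_le_trans ty yr).
  by have [_ h2] := tz_trace_side t1; exact: is_deriveN h2.
by move=> t _; rewrite opprK mulr_gt0 ?tz_speed_gt0// sb_gt0.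
Qed.

Lemma tth_gt0 : 0 < tth.
Proof. by rewrite -(tt_out_Im (lexx r)); exact: tt_side_Im_lt. Qed.

Lemma ttC_gt0 : 0 < ttC.
Proof. by rewrite oppr_gt0 tt_out_Re_lt0. Qed.

Lemma tt_mid_Im (x : R) : -1 <= x <= 1 -> Im (trace x) = tth.
Proof.
move=> /andP[x1 x2].
apply: (derive_zero_eq (u := fun t => Im (trace t)) (u' := fun=> 0) x2 cIm) => [t /andP[xt tx]|t _]; last by [].
have t1 : -1 < t < 1 by rewrite (le_lt_trans x1).
by have [] := tz_trace_mid t1.
Qed.

Lemma tt_mid_Re_lt (x y : R) : -1 <= x -> x < y -> y <= 1 -> Re (trace y) < Re (trace x).
Proof.
move=> x1 xy yr; rewrite -ltrN2.
have cN : continuous (fun t => - Re (trace t)) := opp_continuous_fun cRe.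
apply: (derive_pos_lt (u := fun t => - Re (trace t)) (u' := fun t => - - m t) xy cN).
  move=> t /andP[xt ty]; have t1 : -1 < t < 1 by rewrite (le_lt_trans x1 xt) (lt_le_trans ty yr).
  by have [h1 _] := tz_trace_mid t1; exact: is_deriveN h1.
by move=> t _; rewrite opprK tz_speed_gt0.
Qed.

Lemma tt_Re0 : Re (trace 0) = 0.
Proof.
have := congr1 (@complex.Re R) (tz_trace_opp 0); rewrite oppr0 Re_refl; lra.
Qed.

Lemma ttD_gt0 : 0 < ttD.
Proof. by rewrite oppr_gt0 -tt_Re0; apply: tt_mid_Re_lt => //; lra. Qed.

Lemma tt_slope : sb * (ttD - ttC) = - (cb * tth).
Proof.
have h : (1 : R) <= 1 <= r by rewrite lexx (ltW r1).
by have := tt_side_line h; rewrite -/tth /ttD; lra.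
Qed.

Lemma tt_trace_Re_lt0 (x : R) : 0 < x -> Re (trace x) < 0.
Proof.
move=> x0; have [x1|x1] := leP x 1.
  by rewrite -tt_Re0; apply: tt_mid_Re_lt => //; lra.
have [rx|xr] := leP r x; first exact: tt_out_Re_lt0.
have h : 1 <= x <= r by rewrite !ltW.
have E := tt_side_line h; have E2 := tt_slope.
have i1 : Im (trace x) < tth by apply: tt_side_Im_lt => //; exact: ltW.
have i2 : 0 < Im (trace x) by rewrite -(tt_out_Im (lexx r)); apply: tt_side_Im_lt => //; exact: ltW.
have h0 := tth_gt0; have C0 := ttC_gt0; have D0 := ttD_gt0; have s0 := sb_gt0.
(* On the leg, minus the real part interpolates linearly between [ttC] and [ttD], which are both
   positive. *)
have k1 : tth * (sb * Re (trace x)) =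
    - (sb * (Im (trace x) * ttD + (tth - Im (trace x)) * ttC)).
  have -> : sb * Re (trace x) = cb * Im (trace x) - sb * ttC by lra.
  have -> : tth * (cb * Im (trace x) - sb * ttC) = (cb * tth) * Im (trace x) - tth * sb * ttC by ring.
  have -> : cb * tth = - (sb * (ttD - ttC)) by lra.
  by ring.
have k2 : 0 < sb * (Im (trace x) * ttD + (tth - Im (trace x)) * ttC).
  by rewrite mulr_gt0// addr_gt0// mulr_gt0// subr_gt0.
have k3 : tth * (sb * Re (trace x)) < 0 by rewrite k1 oppr_lt0.
by move: k3; rewrite pmulr_rlt0// pmulr_rlt0.
Qed.

(* the open trapezoid, with its short side [-ttC, ttC] at the bottom when b > 1/2 *)
Definition tt_dom : set C := [set w | [/\ 0 < Im w, Im w < tth,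
  0 < sb * Re w - cb * Im w + sb * ttC & 0 < - (sb * Re w) - cb * Im w + sb * ttC]].

Lemma tt_boundary_ge0 (x : R) : [/\ 0 <= Im (trace x), Im (trace x) <= tth,
  0 <= sb * Re (trace x) - cb * Im (trace x) + sb * ttC &
  0 <= - (sb * Re (trace x)) - cb * Im (trace x) + sb * ttC].
Proof.
have h0 := tth_gt0; have C0 := ttC_gt0; have D0 := ttD_gt0; have s0 := sb_gt0.
have pos (y : R) : 0 <= y -> [/\ 0 <= Im (trace y), Im (trace y) <= tth,
  0 <= sb * Re (trace y) - cb * Im (trace y) + sb * ttC & Re (trace y) <= 0].
  move=> y0; have Ry : Re (trace y) <= 0.
    have := y0; rewrite le_eqVlt => /predU1P[<-|/tt_trace_Re_lt0/ltW//].
    by rewrite tt_Re0.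
  have [y1|y1] := leP y 1.
    have I1 : Im (trace y) = tth by apply: tt_mid_Im; rewrite y1 andbT; apply: le_trans y0; rewrite oppr_le0.
    rewrite I1 lexx; split=> //; first exact: ltW.
    have : - ttD <= Re (trace y).
      rewrite opprK; have := y1; rewrite le_eqVlt => /predU1P[->//|y1'].
      by apply/ltW/tt_mid_Re_lt => //; lra.
    have := tt_slope => E h.
    have -> : sb * Re (trace y) - cb * tth + sb * ttC = sb * (Re (trace y) + ttD) by lra.
    by rewrite mulr_ge0 ?(ltW s0)//; lra.
  have [ry|yr] := leP r y.
    rewrite tt_out_Im// mulr0 subr0; split=> //; first exact: ltW.
    rewrite -mulrDr mulr_ge0 ?(ltW s0)// /ttC subr_ge0.
    by have := ry; rewrite le_eqVlt => /predU1P[<-//|/(tt_out_Re_lt (lexx r))/ltW].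
  have h : 1 <= y <= r by rewrite !ltW.
  have E := tt_side_line h; rewrite E addNr; split=> //.
    by apply: ltW; rewrite -(tt_out_Im (lexx r)); apply: tt_side_Im_lt => //; exact: ltW.
  by apply/ltW/tt_side_Im_lt => //; exact: ltW.
have [x0|x0] := leP 0 x.
  have [h1 h2 h3 h4] := pos x x0; split => //.
  have : sb * Re (trace x) <= 0 by rewrite (pmulr_rle0 _ s0).
  by lra.
have x0' : 0 <= - x by rewrite oppr_ge0 ltW.
have [] := pos _ x0'; rewrite tz_trace_opp Re_refl Im_refl => h1 h2 h3 h4; split => //.
  have : 0 <= sb * Re (trace x) by rewrite (pmulr_rge0 _ s0); lra.
  by lra.
by move: h3; rewrite mulrN.
Qed.

Lemma tt_boundary_notin (x : R) : ~ tt_dom (trace x).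
Proof.
have pos (y : R) : 0 <= y -> ~ tt_dom (trace y).
  move=> y0 [h1 h2 h3 h4]; have [y1|y1] := leP y 1.
    by move: h2; rewrite tt_mid_Im ?ltxx//; apply/andP; split => //; lra.
  have [ry|yr] := leP r y; first by move: h1; rewrite tt_out_Im// ltxx.
  have h : 1 <= y <= r by rewrite !ltW.
  by move: h3; rewrite (tt_side_line h) addNr ltxx.
have [x0|x0] := leP 0 x; first exact: pos.
have x0' : 0 <= - x by rewrite oppr_ge0 ltW.
move=> [h1 h2 h3 h4]; apply: (pos _ x0'); rewrite tz_trace_opp.
by rewrite /tt_dom/= Re_refl Im_refl mulrN opprK; split.
Qed.

Lemma tt_neq0 (x : R) : trace x != 0.
Proof.
have h0 := tth_gt0; have [x0|x0|x0] := ltgtP x 0.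
- have := @tt_trace_Re_lt0 (- x); rewrite oppr_gt0 => /(_ x0).
  rewrite tz_trace_opp Re_refl; apply: contraTN => /eqP->.
  by rewrite /= oppr0 ltxx.
- by have := tt_trace_Re_lt0 x0; apply: contraTN => /eqP->; rewrite /= ltxx.
- apply: contraTN h0 => /eqP E; rewrite -(@tt_mid_Im x) ?E ?ltxx//.
  by rewrite x0 lerN10 ler01.
Qed.

Lemma tt_inj (x y : R) : trace x = trace y -> x = y.
Proof.
have r1' := r1.
have pos (u v : R) : 0 < u -> u < v -> trace u <> trace v.
  move=> u0 uv E.
  have [v1|v1] := leP v 1.
    have u1 : -1 <= u by lra.
    by have := tt_mid_Re_lt u1 uv v1; rewrite E ltxx.
  have [ru|ur] := leP r u.
    by have := tt_out_Re_lt ru uv; rewrite E ltxx.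
  have [vr|rv] := leP v r.
    have [u1|u1] := leP 1 u.
      by have := tt_side_Im_lt u1 uv vr; rewrite E ltxx.
    have := tt_side_Im_lt (lexx 1) v1 vr; rewrite -E -/tth tt_mid_Im ?ltxx//.
    by apply/andP; split; lra.
  have Iv : Im (trace u) = 0 by rewrite E tt_out_Im// ltW.
  have [u1|u1] := leP 1 u.
    by have := tt_side_Im_lt u1 ur (lexx r); rewrite Iv tt_out_Im ?ltxx.
  have := tth_gt0; rewrite -(@tt_mid_Im u) ?Iv ?ltxx//.
  by apply/andP; split; lra.
have pos2 (u v : R) : 0 < u -> 0 < v -> trace u = trace v -> u = v.
  move=> u0 v0 E; have [uv|vu|//] := ltgtP u v.
    by case: (pos _ _ u0 uv).
  by case: (pos _ _ v0 vu).
move=> E; have Re_pos (u : R) : u < 0 -> 0 < Re (trace u).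
  move=> u0; have := @tt_trace_Re_lt0 (- u); rewrite oppr_gt0 => /(_ u0).
  by rewrite tz_trace_opp Re_refl oppr_lt0.
have R0 := tt_Re0.
have ER := congr1 (@complex.Re R) E.
have [x0|x0|x0] := ltgtP x 0; have [y0|y0|y0] := ltgtP y 0.
- apply: oppr_inj; apply: pos2; rewrite ?oppr_gt0// !tz_trace_opp.
  by rewrite E.
- by have := Re_pos _ x0; have := tt_trace_Re_lt0 y0; lra.
- by have := Re_pos _ x0; rewrite y0 in ER; lra.
- by have := Re_pos _ y0; have := tt_trace_Re_lt0 x0; lra.
- exact: pos2.
- by have := tt_trace_Re_lt0 x0; rewrite y0 in ER; lra.
- by have := Re_pos _ y0; rewrite x0 in ER; lra.
- by have := tt_trace_Re_lt0 y0; rewrite x0 in ER; lra.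
- by rewrite x0 y0.
Qed.

(** The trapezoid is an intersection of four half-planes. The condition [e <= 0] says that a
    half-plane also contains 0, the value of the map at infinity, as the minimum principle
    demands. *)
Lemma tt_half_planes (v : C) :
  (forall p q e : R, Complex p q != 0 -> e <= 0 ->
     (forall x : R, e <= p * Re (trace x) - q * Im (trace x)) ->
     e < p * Re v - q * Im v) -> tt_dom v.
Proof.
move=> P; have h0 := tth_gt0; have C0 := ttC_gt0; have s0 := sb_gt0.
have sN0 : sb != 0 by rewrite gt_eqF.
have B := tt_boundary_ge0.
have n1 : Complex 0 (-1) != 0 :> C by rewrite eq_complex/= oppr_eq0 oner_eq0 andbF.
have n2 : Complex 0 1 != 0 :> C by rewrite eq_complex/= oner_eq0 andbF.
have n3 : Complex sb cb != 0 :> C by rewrite eq_complex/= (negbTE sN0).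
have n4 : Complex (- sb) cb != 0 :> C by rewrite eq_complex/= oppr_eq0 (negbTE sN0).
have T0 : - tth <= 0 by rewrite oppr_le0 ltW.
have C0' : - (sb * ttC) <= 0 by rewrite oppr_le0 mulr_ge0 ?ltW.
have P1 := P _ _ 0 n1 (lexx 0); have P2 := P _ _ _ n2 T0.
have P3 := P _ _ _ n3 C0'; have P4 := P _ _ _ n4 C0'.
have {}P1 : 0 < 0 * Re v - -1 * Im v by apply: P1 => x; have [h _ _ _] := B x; lra.
have {}P2 : - tth < 0 * Re v - 1 * Im v by apply: P2 => x; have [_ h _ _] := B x; lra.
have {}P3 : - (sb * ttC) < sb * Re v - cb * Im v by apply: P3 => x; have [_ _ h _] := B x; lra.
have {}P4 : - (sb * ttC) < - sb * Re v - cb * Im v by apply: P4 => x; have [_ _ _ h] := B x; lra.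
by split; lra.
Qed.

End trapezoid_trace_theory.

(** * Image and injectivity of the trapezoid map *)

Section trapezoid_image.
Variable R : realType.
Local Notation C := (complex R).
Variables (b r : R).
Hypothesis b01 : 0 < b < 1.
Hypothesis r1 : 1 < r.

Local Notation phi := (@tzphi R b r).
Local Notation S := (@tzmap R b r).
Local Notation trace := (tztrace b r).

Lemma tz_trapezoid_trace :
  trapezoid_trace r (sin (pi * b)) (cos (pi * b)) (tzspeed b r) (tztrace b r).
Proof.
split.
- exact: r1.
- exact: sb_gt0.
- by move=> x; rewrite cmod_gt0 scphi_neq0.
- exact: tz_trace_clim.
- exact: tz_trace_lim.
- exact: tz_trace_opp.
- exact: tz_trace_mid.
- exact: tz_trace_side.
- exact: tz_trace_out.
Qed.

Definition tz_dom := tt_dom r (sin (pi * b)) (cos (pi * b)) trace.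

Definition tzS (p : sphere R) : C := if p is Some z then S z else 0.

Lemma tzS_scts : scts tzS.
Proof. by split => /=; [exact: tzmap_cts|exact: tzmap_inf]. Qed.

Lemma tz_interior (z : C) : uhp z -> tz_dom (S z).
Proof.
move=> uz; apply: (tt_half_planes tz_trapezoid_trace) => p q e w00 q0 qb.
have nz w : uhp w -> phi w != 0 by move=> _; exact: scphi_neq0.
have M w : Re (Complex p q * w) = p * Re w - q * Im w by rewrite !ReImE.
rewrite -M; apply: (@min_principle R tzS phi (Complex p q) e tzS_scts (tzmap_diff b01 r1) nz w00) => //.
  by rewrite M/= !mulr0 subr0.
Qed.

(** The segment from the image of i to y stays in the convex domain, which the boundary values
    avoid. *)
Lemma tz_onto (y : C) : tz_dom y -> exists2 z, uhp z & S z = y.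
Proof.
move=> Dy; have ui : uhp (Complex 0 1 : C) by rewrite /uhp/=.
have Di := tz_interior ui.
apply: (@segment_onto R tzS phi (Complex 0 1) y tzS_scts (tzmap_diff b01 r1)) => //.
  by move=> z _; exact: scphi_neq0.
move=> t t01; have seg : tz_dom (S (Complex 0 1) + Complex t 0 * (y - S (Complex 0 1))).
  move: (S _) Di Dy => v [a1 a2 a3 a4] [c1 c2 c3 c4]; rewrite /tz_dom /tt_dom/=.
  have -> : Re (v + Complex t 0 * (y - v)) = Re v + t * (Re y - Re v).
    by rewrite !ReImE/=; ring.
  have -> : Im (v + Complex t 0 * (y - v)) = Im v + t * (Im y - Im v).
    by rewrite !ReImE/=; ring.
  split.
  - exact: convex_gt.
  - have h1 : - (tth trace) < - Im v by rewrite ltrN2.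
    have h2 : - (tth trace) < - Im y by rewrite ltrN2.
    by have := convex_gt h1 h2 t01; lra.
  - by have := convex_gt a3 c3 t01; lra.
  - by have := convex_gt a4 c4 t01; lra.
split.
  apply/eqP => H; move: seg => [+ _ _ _].
  by rewrite /= in H; rewrite -H ltxx.
move=> x; apply/eqP => H; apply: (tt_boundary_notin tz_trapezoid_trace (x := x)).
by rewrite /tzS/= in H; rewrite /tztrace H.
Qed.

(** Grouping opposite prevertices, the argument of the integrand is minus a convex combination of
    two sums of arguments, each in (0, pi) in this quadrant. *)
Lemma tzphi_quadrant (z : C) : uhp z -> 0 < Re z -> Im (phi z) < 0.
Proof.
move=> uz rz; rewrite Im_scphi.
have h1 : 0 < carg (z - Complex (- r) 0) + carg (z - Complex r 0) < pi.
  by apply: carg_sum_lt => //; exact: lt_trans r1.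
have h2 : 0 < carg (z - Complex (- 1) 0) + carg (z - Complex 1 0) < pi by exact: carg_sum_lt.
have A : scarg (tzl b r) z =
   - ((1 - b) * (carg (z - Complex (- r) 0) + carg (z - Complex r 0)) +
      b * (carg (z - Complex (- 1) 0) + carg (z - Complex 1 0))).
  rewrite /scarg !big_cons big_nil/= addr0; ring.
rewrite A sinN mulrN oppr_lt0 mulr_gt0//.
  by rewrite cmod_gt0 scphi_neq0.
move: h1 h2; set s1 := carg _ + _; set s2 := carg _ + _ => /andP[h1 h1'] /andP[h2 h2'].
case/andP: b01 => b0 b1; have b1' : 0 < 1 - b by rewrite subr_gt0.
rewrite sin_gt0_pi// addr_gt0 ?mulr_gt0//=.
have k1 : (1 - b) * s1 < (1 - b) * pi by rewrite ltr_pM2l.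
have k2 : b * s2 < b * pi by rewrite ltr_pM2l.
by lra.
Qed.

Lemma tzphi_axis (z : C) : uhp z -> Re z = 0 -> Re (phi z) < 0.
Proof.
move=> uz rz; rewrite Re_scphi.
have E (x : R) : carg (z - Complex (- x) 0) = pi - carg (z - Complex x 0).
  rewrite -carg_conjN; last by apply: Im_gt0_neq0; exact: uhp_sub_real.
  congr carg; apply: complex_ext.
    by rewrite -/(refl _) Re_refl !ReImE/= rz; ring.
  by rewrite -/(refl _) Im_refl !ReImE/=; ring.
have A : scarg (tzl b r) z = - pi.
  rewrite /scarg !big_cons big_nil/= addr0 !E; ring.
by rewrite A cosN cospi mulrN1 oppr_lt0 cmod_gt0 scphi_neq0.
Qed.

(** If z and w had the same image, the mean value theorem along the segment, with the direction w -
    z divided out, would give a point where Im phi vanishes, which the quadrant excludes; when both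
    points are on the imaginary axis, Re phi would vanish instead. *)
Let tz_inj_half (z w : C) : uhp z -> uhp w -> 0 <= Re z -> 0 <= Re w ->
  S z = S w -> z = w.
Proof.
move=> uz uw rz rw E; apply/eqP; apply: contraT => zw.
have wz : w - z != 0 by rewrite subr_eq0 eq_sym.
have cc (z0 : C) : cuhp z0 -> clim (inear (@uhp R) z0) S (S z0).
  move=> cz; apply: (clim_inear_sub (D' := @cuhp R)); last exact: tzmap_cts.
  by apply/inearP; exists 1 => // v _; exact: ltW.
have us (t : R) : 0 < t < 1 -> uhp (z + Complex t 0 * (w - z)).
  by move=> /andP[t0 t1]; apply: uhp_convex => //; rewrite !ltW.
have H (w0 : C) := @cuhp_MVT R S phi z w (w0 / (w - z)) (tzmap_cts b01 r1) (tzmap_diff b01 r1)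
  (ltW uz) (ltW uw) us.
have EE (w0 c : C) : w0 / (w - z) * (c * (w - z)) = w0 * c by field.
have [pos|npos] := pselect (0 < Re z \/ 0 < Re w).
  have [t t01 Ht] := H (Complex 0 1).
  move: Ht; rewrite E subrr mulr0 EE => Ht.
  have := @tzphi_quadrant _ (us t t01); move: Ht.
  move: (phi _) => p; rewrite !ReImE/= => Ht H'.
  suff : Im p < 0 by lra.
  apply: H'.
  rewrite mul0r subr0; case/andP: t01 => t0 t1.
  case: pos => pos; first by nra.
  have : 0 < t * Re w by rewrite mulr_gt0.
  by nra.
have rz0 : Re z = 0.
  by apply/eqP; rewrite eq_le rz andbT leNgt; apply/negP => h; apply: npos; left.
have rw0 : Re w = 0.
  by apply/eqP; rewrite eq_le rw andbT leNgt; apply/negP => h; apply: npos; right.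
have [t t01 Ht] := H 1.
move: Ht; rewrite E subrr mulr0 EE mul1r => Ht.
have := @tzphi_axis _ (us t t01); rewrite -Ht /= ltxx => X.
have : false by apply: X; rewrite !ReImE/= rz0 rw0; ring.
by [].
Qed.

(** Since Im phi < 0 in the quadrant, the real part of S increases strictly along upward half-lines,
    and its limit there is 0. *)
Let tz_Re_neg (z : C) : uhp z -> 0 < Re z -> Re (S z) < 0.
Proof.
move=> uz rz.
have up (w : C) (t : R) : uhp w -> 0 < Re w -> 0 < t -> Re (S w) < Re (S (w + Complex 0 t)).
  move=> uw rw t0; have uw' : cuhp (w + Complex 0 t).
    by rewrite /cuhp/= !ReImE/= addr_ge0 ?(ltW t0)// ltW.
  have us (e : R) : 0 < e < 1 -> uhp (w + Complex e 0 * ((w + Complex 0 t) - w)).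
    move=> /andP[e0 e1]; rewrite addrAC subrr add0r /uhp/= !ReImE/= mul0r addr0.
    by rewrite addr_gt0// mulr_gt0.
  have [e e01] := cuhp_MVT 1 (tzmap_cts b01 r1) (tzmap_diff b01 r1) (ltW uw) uw' us.
  rewrite !mul1r.
  have -> : w + Complex 0 t - w = Complex 0 t by rewrite addrAC subrr add0r.
  move=> E.
  have := @tzphi_quadrant _ (us e e01).
  have -> : w + Complex 0 t - w = Complex 0 t by rewrite addrAC subrr add0r.
  move: E; move: (S _) (S w) => s1 s2; set p := phi _ => E H.
  have {}H : Im p < 0 by apply: H; rewrite !ReImE/=; lra.
  have {E} : Re s1 - Re s2 = - (Im p * t).
    by move: E H; move: p => p; rewrite !ReImE/= => -> _; ring.
  have : Im p * t < 0 by rewrite pmulr_llt0.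
  by lra.
rewrite ltNge; apply/negP => h0.
have h1 : 0 < Re (S (z + Complex 0 1)) by apply: le_lt_trans (up _ _ uz rz ltr01).
have /climP/(_ _ h1)[N H] := tzmap_inf b01 r1.
have [t [t1 t2]] : exists t : R, 1 < t /\ N < t.
  exists (Num.max 1 N + 1); split; apply: (@le_lt_trans _ _ (Num.max 1 N)).
  - by rewrite le_max lexx.
  - by rewrite ltrDl.
  - by rewrite le_max lexx orbT.
  - by rewrite ltrDl.
have t3 : 0 < t by rewrite (lt_trans _ t1).
pose w := z + Complex 0 t.
have cw : cuhp w by rewrite /cuhp/= !ReImE/= addr_ge0 ?(ltW t3)// ltW.
have uz1 : uhp (z + Complex 0 1) by rewrite /uhp/= !ReImE/= addr_gt0.
have rz1 : 0 < Re (z + Complex 0 1) by rewrite !ReImE/= addr0.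
have h2 := @up (z + Complex 0 1) (t - 1) uz1 rz1; rewrite subr_gt0 in h2.
have {}h2 := h2 t1.
have Ew : z + Complex 0 1 + Complex 0 (t - 1) = w.
  by apply: complex_ext; rewrite !ReImE/=; ring.
rewrite Ew in h2.
have := H w cw; rewrite subr0 => /(_ _)/wrap[].
  rewrite (lt_le_trans _ (Im_le_cmod _))// !ReImE/= ger0_norm ?addr_ge0 ?(ltW t3)//; last exact: ltW.
  by rewrite (lt_trans t2)// ltrDr.
move=> h3; have h4 := le_lt_trans (le_trans (ler_norm _) (Re_le_cmod _)) h3.
by have := lt_trans h2 h4; rewrite ltxx.
Qed.

Local Opaque tzmap.

Let tz_Re_refl (z : C) : cuhp z -> Re (S (refl z)) = - Re (S z).
Proof. by move=> cz; rewrite tzmap_refl// Re_refl. Qed.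

Let tz_sign (z : C) : uhp z -> Num.sg (Re (S z)) = - Num.sg (Re z).
Proof.
move=> uz; have ur : uhp (refl z) by rewrite /uhp/= Im_refl.
have [z0|z0|z0] := ltgtP (Re z) 0.
- rewrite (ltr0_sg z0) opprK gtr0_sg//.
  have rz0 : 0 < Re (refl z) by rewrite Re_refl oppr_gt0.
  by rewrite -oppr_lt0 -(tz_Re_refl (ltW uz)); exact: tz_Re_neg.
- by rewrite (gtr0_sg z0) ltr0_sg// tz_Re_neg.
- rewrite z0 sgr0 oppr0; apply/eqP; rewrite sgr_eq0; apply/eqP.
  have := tz_Re_refl (ltW uz : cuhp _).
  have -> : refl z = z by apply: complex_ext; rewrite ?Re_refl ?Im_refl// z0 oppr0.
  lra.
Qed.

(** Inner points go into the open trapezoid and boundary points outside it, so only points of the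
    same kind compete; among inner points the sign of the real part separates the two quadrants, and
    reflection exchanges them. *)
Lemma tz_inj (p q : sphere R) : scuhp p -> scuhp q -> tzS p = tzS q -> p = q.
Proof.
have n0 (z : C) : cuhp z -> S z <> 0.
  rewrite /cuhp/= le_eqVlt => /predU1P[I0|uz E].
    have -> : z = Complex (Re z) 0 by apply: complex_ext.
    by apply/eqP/(tt_neq0 tz_trapezoid_trace).
  by have [+ _ _ _] := tz_interior uz; rewrite E/= ltxx.
have inj (z w : C) : cuhp z -> cuhp w -> S z = S w -> z = w.
  rewrite /cuhp/= le_eqVlt => /predU1P[z0|uz].
    have zE : z = Complex (Re z) 0 by apply: complex_ext.
    rewrite le_eqVlt => /predU1P[w0|uw] E.
      have wE : w = Complex (Re w) 0 by apply: complex_ext.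
      rewrite zE wE in E *; congr Complex.
      exact: (tt_inj tz_trapezoid_trace E).
    have := tz_interior uw; rewrite -E zE => H.
    by case: (tt_boundary_notin tz_trapezoid_trace H).
  rewrite le_eqVlt => /predU1P[w0|uw] E.
    have wE : w = Complex (Re w) 0 by apply: complex_ext.
    have := tz_interior uz; rewrite E wE => H.
    by case: (tt_boundary_notin tz_trapezoid_trace H).
  have sg : Num.sg (Re z) = Num.sg (Re w).
    by apply: oppr_inj; rewrite -(tz_sign uz) -(tz_sign uw) E.
  have [z0|z0] := leP 0 (Re z).
    have w0 : 0 <= Re w by rewrite -sgr_ge0 -sg sgr_ge0.
    exact: tz_inj_half.
  have w0 : Re w < 0 by rewrite -sgr_lt0 -sg sgr_lt0.
  have uz' : uhp (refl z) by rewrite /uhp/= Im_refl.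
  have uw' : uhp (refl w) by rewrite /uhp/= Im_refl.
  rewrite -(reflK z) -(reflK w); congr refl; apply: tz_inj_half => //.
  - by rewrite Re_refl oppr_ge0 ltW.
  - by rewrite Re_refl oppr_ge0 ltW.
  - by rewrite (tzmap_refl b01 r1 (ltW uz)) (tzmap_refl b01 r1 (ltW uw)) E.
case: p q => [z|] [w|]//= cz cw E.
- by congr Some; exact: inj.
- by case: (n0 z).
- by case: (n0 w).
Qed.

End trapezoid_image.

(** * The map onto half the exterior *)

(** With M and m the larger and the smaller of p and q, the weighted product of a and b is at most
    M, so the left side is at most (m / M)^(-1/2); finally M <= m + 1 and t <= m. *)
Lemma powR_quotient_le (R : realType) (al t p q a b : R) : 0 < al < 1 -> 0 < t ->
  t <= p -> t <= q -> p <= q + 1 -> q <= p + 1 ->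
  0 <= a <= Num.max p q -> 0 <= b <= Num.max p q ->
  p `^ (- 2^-1) * (a `^ al * (b `^ (1 - al) * q `^ (- 2^-1))) <= (t / (1 + t)) `^ (- 2^-1).
Proof.
move=> /andP[a0 a1] t0 tp tq pq qp /andP[aa m2] /andP[bb m3].
set M := Num.max p q in m2 m3; set m := Num.min p q.
have m0 : t <= m by rewrite /m le_min tp.
have Mm1 : M <= m + 1.
  by rewrite /M /m maxEle minEle; case: ifP => _.
have mM : m <= M by rewrite /M /m maxEle minEle; case: ifP => //; move/negbT; rewrite -ltNge => /ltW.
have mgt0 : 0 < m by exact: lt_le_trans m0.
have M0 : 0 < M by exact: lt_le_trans mM.
have pw (x g : R) : 0 <= x -> x <= M -> 0 < g -> x `^ g <= M `^ g.
  by move=> xx xM g0; apply: ge0_ler_powR => //; rewrite ?nnegrE ?ltW.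
have pqE : p `^ (- 2^-1) * q `^ (- 2^-1) = M `^ (- 2^-1) * m `^ (- 2^-1).
  rewrite /M /m maxEle minEle; case: ifP => _ //; exact: mulrC.
have -> : p `^ (- 2^-1) * (a `^ al * (b `^ (1 - al) * q `^ (- 2^-1))) =
  (p `^ (- 2^-1) * q `^ (- 2^-1)) * (a `^ al * b `^ (1 - al)).
  by rewrite -[RHS]mulrA; congr (_ * _); rewrite mulrA; exact: mulrC.
rewrite pqE.
have h1 : a `^ al * b `^ (1 - al) <= M.
  have -> : M = M `^ al * M `^ (1 - al).
    rewrite -powRD; last by apply/implyP => _; rewrite gt_eqF.
    by rewrite addrC subrK powRr1// ltW.
  by apply: ler_pM; rewrite ?powR_ge0// pw// subr_gt0.
apply: (@le_trans _ _ (M `^ (- 2^-1) * m `^ (- 2^-1) * M)).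
  by rewrite ler_wpM2l// mulr_ge0 ?powR_ge0.
have -> : M `^ (- 2^-1) * m `^ (- 2^-1) * M = (m / M) `^ (- 2^-1).
  rewrite powRM ?invr_ge0 ?(ltW M0) ?(ltW mgt0)//.
  have -> : M^-1 = M `^ (-1) by rewrite powR_inv1 ?powRr1 // ltW.
  rewrite -powRrM mulrAC mulrC; congr (_ * _).
  rewrite -[X in _ * X](powRr1 (ltW M0)) -powRD; last by apply/implyP => _; rewrite gt_eqF.
  by congr (M `^ _); lra.
apply: powRN_le; rewrite ?invr_ge0 ?divr_gt0//; first by rewrite addr_gt0.
have t1 : 0 < 1 + t by rewrite addr_gt0.
rewrite ler_pdivrMr// mulrAC ler_pdivlMr//; nra.
Qed.

(** * Estimates for an integrand tending to 1 at infinity *)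

Section exterior_map.
Variable R : realType.
Local Notation C := (complex R).
Variables (al x2 x3 : R).
Hypothesis al01 : 0 < al < 1.
Hypothesis x2_gt : -1 < x2.
Hypothesis x23 : x2 < x3.
Hypothesis x3_lt0 : x3 < 0.
Hypothesis residue0 : 2^-1 + al * x2 + (1 - al) * x3 = 0.

(** The exponents sum to 0, so the integrand tends to 1. [residue0] states that the sum of exponent
    times prevertex vanishes too, which leaves a remainder of order u^-2, integrable up to
    infinity. *)
Definition exl : seq (R * R) := [:: (-1, - 2^-1); (x2, al); (x3, 1 - al); (0, - 2^-1)].
Definition exphi : C -> C := scphi exl.
Definition exmap : C -> C := vprim exphi 1.

Let beta01 : 0 <= (2^-1 : R) < 1.
Proof. by apply/andP; split; lra. Qed.

Lemma exphi_le (z : C) : uhp z -> cmod (exphi z) <= (Im z / (1 + Im z)) `^ (- 2^-1).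
Proof.
move=> uz; have z0 : 0 < Im z := uz; case/andP: al01 => a0 a1.
rewrite cmod_scphi; last exact: uhp_scfree.
rewrite prod_seq4/=.
set p := cmod (z - Complex (-1) 0); set q := cmod (z - Complex 0 0).
have p0 : Im z <= p := Im_le_dist z (-1); have q0 : Im z <= q := Im_le_dist z 0.
have pq : p <= q + 1.
  have -> : p = cmod ((z - Complex 0 0) + Complex 1 0).
    by rewrite /p; congr cmod; apply: complex_ext; rewrite !ReImE/=; ring.
  by rewrite (le_trans (cmodD _ _))// cmod_real normr1.
have qp : q <= p + 1.
  have -> : q = cmod ((z - Complex (-1) 0) - Complex 1 0).
    by rewrite /q; congr cmod; apply: complex_ext; rewrite !ReImE/=; ring.
  by rewrite (le_trans (cmodD _ _))// cmodN cmod_real normr1.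
have mid (x : R) : -1 < x -> x < 0 -> cmod (z - Complex x 0) <= Num.max p q.
  move=> x1 x0.
  have -> : z - Complex x 0 = Complex (- x) 0 * (z - Complex (-1) 0)
      + Complex (1 + x) 0 * (z - Complex 0 0).
    by apply: complex_ext; rewrite !ReImE/=; ring.
  rewrite (le_trans (cmodD _ _))// !cmodM !cmod_real -/p -/q.
  rewrite (gtr0_norm (_ : 0 < - x)) ?oppr_gt0// (gtr0_norm (_ : 0 < 1 + x)); last by lra.
  have hp : p <= Num.max p q by rewrite le_max lexx.
  have hq : q <= Num.max p q by rewrite le_max lexx orbT.
  have h1 : - x * p <= - x * Num.max p q by rewrite ler_pM2l// oppr_gt0.
  have h2 : (1 + x) * q <= (1 + x) * Num.max p q by rewrite ler_pM2l//; lra.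
  apply: (le_trans (lerD h1 h2)); rewrite -mulrDl.
  have -> : - x + (1 + x) = 1 by ring.
  by rewrite mul1r.
have m2 := mid x2 x2_gt (lt_trans x23 x3_lt0).
have m3 := mid x3 (lt_trans x2_gt x23) x3_lt0.
by apply: powR_quotient_le; rewrite ?cmod_ge0 ?a0.
Qed.

(** From u^2 / (u - x) = u + x + x^2 / (u - x): weighted by the exponents, the first two terms
    cancel in the sum. The logarithmic derivative is therefore O(u^-3). *)
Lemma exl_sum (u : C) : scfree exl u -> u != 0 ->
  u ^+ 2 * scpre exl u = scpre [seq (p.1, p.2 * p.1 ^+ 2) | p <- exl] u.
Proof.
move=> fu u0; rewrite /scpre big_map !big_cons !big_nil/=.
have f1 : u - Complex (-1) 0 != 0 by rewrite subr_eq0; apply: (fu (-1, - 2^-1)); left.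
have f2 : u - Complex x2 0 != 0 by rewrite subr_eq0; apply: (fu (x2, al)); right; left.
have f3 : u - Complex x3 0 != 0 by rewrite subr_eq0; apply: (fu (x3, 1 - al)); do 2 right; left.
have f4 : u - Complex 0 0 != 0 by rewrite subr_eq0; apply: (fu (0, - 2^-1)); do 3 right; left.
pose g1 : C := Complex (- 2^-1) 0; pose y1 : C := Complex (-1) 0.
have E (x g : R) : Complex (g * x ^+ 2) 0 = Complex g 0 * Complex x 0 ^+ 2 :> C.
  by apply: complex_ext; rewrite !expr2 !ReImE/=; ring.
rewrite !E.
have K (x g : C) : u - x != 0 -> u ^+ 2 * (g / (u - x)) = g * u + g * x + g * x ^+ 2 / (u - x).
  by move=> ux; field.
rewrite !mulrDr !K//.
have S1 : Complex (- 2^-1) 0 + Complex al 0 + Complex (1 - al) 0 + Complex (- 2^-1) 0 = 0 :> C.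
  by apply: complex_ext; rewrite !ReImE/=; [field|ring].
have S2 : Complex (- 2^-1) 0 * Complex (-1) 0 + Complex al 0 * Complex x2 0 +
    Complex (1 - al) 0 * Complex x3 0 + Complex (- 2^-1) 0 * Complex 0 0 = 0 :> C.
  by apply: complex_ext; rewrite !ReImE/=; [rewrite -[RHS]residue0; ring|ring].
move: S1 S2 f1 f2 f3 f4.
move: (Complex (- 2^-1) 0) (Complex (-1) 0) (Complex al 0) (Complex x2 0) (Complex (1 - al) 0)
  (Complex x3 0) (Complex 0 0) => a1 c1 a2 c2 a3 c3 c4 S1 S2 f1 f2 f3 f4.
have -> : a1 * u + a1 * c1 + a1 * c1 ^+ 2 / (u - c1) +
   (a2 * u + a2 * c2 + a2 * c2 ^+ 2 / (u - c2) +
   (a3 * u + a3 * c3 + a3 * c3 ^+ 2 / (u - c3) +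
    (a1 * u + a1 * c4 + a1 * c4 ^+ 2 / (u - c4) + u ^+ 2 * 0))) =
  (a1 + a2 + a3 + a1) * u + (a1 * c1 + a2 * c2 + a3 * c3 + a1 * c4) +
  (a1 * c1 ^+ 2 / (u - c1) + (a2 * c2 ^+ 2 / (u - c2) + (a3 * c3 ^+ 2 / (u - c3) +
   (a1 * c4 ^+ 2 / (u - c4) + 0)))).
  move: (_ / (u - c1)) (_ / (u - c2)) (_ / (u - c3)) (_ / (u - c4)) => *; ring.
by rewrite S1 S2 mul0r !add0r.
Qed.

Lemma expre_le (z : C) : uhp z -> cmod (scpre exl z) <= 2 / Im z ^+ 3.
Proof.
move=> uz; have z0 : 0 < Im z := uz; case/andP: al01 => a0 a1.
have zn0 : z != 0 by exact: Im_gt0_neq0.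
have qz : 0 < cmod z by rewrite cmod_gt0.
have -> : scpre exl z = scpre [seq (p.1, p.2 * p.1 ^+ 2) | p <- exl] z / z ^+ 2.
  rewrite -exl_sum//; last exact: uhp_scfree.
  by rewrite [X in X / _]mulrC mulfK// expf_neq0.
rewrite cmodM cmodV cmodX.
have h := cmod_scpre [seq (p.1, p.2 * p.1 ^+ 2) | p <- exl] uz.
have h2 : \sum_(p <- [seq (p.1, p.2 * p.1 ^+ 2) | p <- exl]) `|p.2| <= 2 :> R.
  rewrite big_map !big_cons big_nil/= ![`|_ * _ ^+ 2|]normrM !normrX.
  have n1 : `|-1| = 1 :> R by rewrite normrN normr1.
  have n2 : `|- 2^-1| = 2^-1 :> R by rewrite normrN ger0_norm.
  have n3 : `|x2| <= 1 by rewrite ltr0_norm; [rewrite lerNl; exact: ltW|exact: lt_trans x3_lt0].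
  have n4 : `|x3| <= 1 by rewrite ltr0_norm// lerNl ltW// (lt_trans x2_gt).
  rewrite n1 n2 normr0 (gtr0_norm a0) (gtr0_norm (_ : 0 < 1 - al)) ?subr_gt0//.
  have k2 : `|x2| ^+ 2 <= 1 by rewrite exprn_ile1.
  have k3 : `|x3| ^+ 2 <= 1 by rewrite exprn_ile1.
  have l2 : al * `|x2| ^+ 2 <= al by rewrite ler_piMr// ltW.
  have l3 : (1 - al) * `|x3| ^+ 2 <= 1 - al by rewrite ler_piMr// subr_ge0 ltW.
  move: l2 l3; move: (al * _) ((1 - al) * _) => u v; rewrite expr1n expr0n/=; lra.
have -> : 2 / Im z ^+ 3 = 2 / Im z * (Im z ^+ 2)^-1 by rewrite exprS invfM mulrA.
apply: ler_pM; rewrite ?invr_ge0 ?cmod_ge0 ?exprn_ge0 ?cmod_ge0//.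
  by apply: (le_trans h); rewrite ler_wpM2r// invr_ge0 ltW.
rewrite lef_pV2 ?posrE ?exprn_gt0// lerXn2r ?nnegrE ?cmod_ge0 ?(ltW z0)//.
by rewrite (le_trans (ler_norm _))// Im_le_cmod.
Qed.

(** Each logarithm of z - x differs from that of z by at most 1 / (|z| - 1), and the exponents sum
    to 0. *)
Lemma exphi_inf (t : R) : 0 < t -> clim (cinf (@cuhp R)) (fun z => exphi (z + Complex 0 t)) 1.
Proof.
move=> t0; case/andP: al01 => a0 a1.
pose L (z : C) : C := \sum_(p <- exl) Complex p.2 0 * clog (z - Complex p.1 0).
have D (x : R) (z : C) : -1 <= x -> x <= 0 -> uhp z -> 1 < cmod z ->
    cmod (clog (z - Complex x 0) - clog z) <= (cmod z - 1)^-1.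
  move=> x1 x0 uz z1.
  have uzx := uhp_sub_real x uz.
  have n1 : cmod (Complex x 0) <= 1 by rewrite cmod_real ler_norml; lra.
  have dl (w : C) : uhp w -> cdiff (@uhp R) (@clog R) w w^-1.
    move=> uw; apply: cdiff_clog => // v uv; split; [exact: ltW|exact: Im_gt0_neq0].
  have := uhp_mvt dl uz uzx (c := 0) (e := (cmod z - 1)^-1); rewrite mulr0 subr0.
  have -> : z - Complex x 0 - z = - Complex x 0 by rewrite addrAC subrr add0r.
  move=> H; apply: (le_trans (H _)).
    move=> s /andP[s0 s1]; rewrite subr0 cmodV lef_pV2 ?posrE; last by rewrite subr_gt0.
      rewrite (le_trans _ (cmodBD _ _))// cmodM cmodN cmod_real (ger0_norm s0) lerD2l lerN2.
      by rewrite mulr_ile1// cmod_ge0.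
    rewrite (lt_le_trans _ (cmodBD _ _))// cmodM cmodN cmod_real (ger0_norm s0) subr_gt0.
    by rewrite (le_lt_trans _ z1)// mulr_ile1// cmod_ge0.
  by rewrite cmodN -[leRHS]mulr1 ler_wpM2l// invr_ge0 subr_ge0 ltW.
have L0 : clim (cinf (@cuhp R)) (fun z => L (z + Complex 0 t)) 0.
  (* Beyond this radius each difference of logarithms is below e / 2, and the absolute exponents sum
     to 2. *)
  apply/climP => e e0; exists (1 + t + 2 / e) => z cz zN.
  have uz := shift_uhp cz t0.
  set w := z + Complex 0 t in uz *.
  have wz : cmod z - t <= cmod w.
    by have := cmodBD z (Complex 0 t); rewrite cmod_imag (gtr0_norm t0).
  have ei : 0 < 2 / e by rewrite divr_gt0.
  have w1 : 2 / e < cmod w - 1 by lra.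
  have w2 : 1 < cmod w by lra.
  have -> : L w - 0 = \sum_(p <- exl) Complex p.2 0 * (clog (w - Complex p.1 0) - clog w).
    rewrite subr0 /L !big_cons !big_nil/=.
    have S1 : Complex (- 2^-1) 0 + Complex al 0 + Complex (1 - al) 0 + Complex (- 2^-1) 0 = 0 :> C.
      by apply: complex_ext; rewrite !ReImE/=; [field|ring].
    move: (clog (w - Complex (-1) 0)) (clog (w - Complex x2 0)) (clog (w - Complex x3 0))
      (clog (w - Complex 0 0)) (clog w) S1 => b1 b2 b3 b4 b.
    move: (Complex (- 2^-1) 0) (Complex al 0) (Complex (1 - al) 0) => c1 c2 c3 S1.
    rewrite -[LHS]subr0 -(mul0r b) -S1; ring.
  rewrite !big_cons big_nil/= addr0.
  have B1 := D (-1) w (lexx _) (ltW (ltrN10 _)) uz w2.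
  have B2 := D x2 w (ltW x2_gt) (ltW (lt_trans x23 x3_lt0)) uz w2.
  have B3 := D x3 w (ltW (lt_trans x2_gt x23)) (ltW x3_lt0) uz w2.
  have B4 := D 0 w (lerN10 _) (lexx _) uz w2.
  have B : (cmod w - 1)^-1 < e / 2.
    by rewrite -[ltRHS]invrK invf_div ltf_pV2// posrE//; lra.
  have tri (v1 v2 v3 v4 : C) : cmod (v1 + (v2 + (v3 + v4))) <= cmod v1 + (cmod v2 + (cmod v3 + cmod v4)).
    do 2 (rewrite (le_trans (cmodD _ _))// lerD2l).
    exact: cmodD.
  apply: (le_lt_trans (tri _ _ _ _)); rewrite !cmodM !cmod_real.
  have n2 : `|- 2^-1| = 2^-1 :> R by rewrite normrN ger0_norm.
  rewrite n2 (gtr0_norm a0) (gtr0_norm (_ : 0 < 1 - al)) ?subr_gt0//.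
  move: B1 B2 B3 B4 B; move: (cmod (_ - _)) (cmod (_ - _)) (cmod (_ - _)) (cmod (_ - _)) (_^-1).
  move=> b1 b2 b3 b4 b h1 h2 h3 h4 h5.
  nra.
apply: (@clim_comp R C C _ (inear setT 0) (fun z => L (z + Complex 0 t)) (@cexp R)).
  move=> A /inearP[e e0 HA]; have /climP/(_ e e0) := L0.
  by apply: filterS => w we; apply: HA.
have -> : 1 = cexp 0 :> C by rewrite /cexp/= expR0 cos0 sin0 mulr1 mulr0.
exact: cdiff_cts (cdiff_cexp setT 0).
Qed.

Let exphi' (z : C) := exphi z * scpre exl z.

Let exphi_diff (z : C) : uhp z -> cdiff (@uhp R) exphi z (exphi' z).
Proof. exact: cdiff_scphi. Qed.

Let quot_ge1 (t : R) : 0 < t -> 1 <= (t / (1 + t)) `^ (- 2^-1).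
Proof.
move=> t0; have t1 : 0 < 1 + t by rewrite addr_gt0.
rewrite -[leLHS](oner_powR (- 2^-1)); apply: powRN_le => //; first by rewrite divr_gt0.
by rewrite ler_pdivrMr// mul1r lerDr.
Qed.

Let exphi_le2 (z : C) : 1 <= Im z -> cmod (exphi z) <= 2.
Proof.
move=> z1; have z0 : 0 < Im z by rewrite (lt_le_trans _ z1).
apply: (le_trans (exphi_le z0)).
have zz : 0 < 1 + Im z by rewrite addr_gt0.
apply: (@le_trans _ _ ((2^-1 : R) `^ (- 2^-1))).
  apply: powRN_le => //; rewrite ler_pdivlMr//; lra.
have e2 : (2 : R) = 2 `^ 1 by rewrite powRr1.
have e3 : (2^-1 : R) = 2 `^ (-1) by rewrite powR_inv1.
rewrite [X in X `^ _]e3 -powRrM mulN1r opprK [leRHS]e2.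
by apply: ler_powR; rewrite ?ler1n//; lra.
Qed.

Let exphi'_bound (z : C) : uhp z -> cmod (exphi' z) <= 8 * majo 2^-1 (Im z) / Im z.
Proof.
move=> uz; have z0 : 0 < Im z := uz; case/andP: al01 => a0 a1.
rewrite cmodM /majo.
have -> : 8 * ((Im z / (1 + Im z)) `^ (- 2^-1) * (1 + Im z) ^- 2) / Im z =
  (Im z / (1 + Im z)) `^ (- 2^-1) * (8 * (1 + Im z) ^- 2 / Im z).
  move: (_ `^ _) ((1 + _) ^- 2) => u v; ring.
apply: ler_pM; rewrite ?cmod_ge0 ?exphi_le//.
have z1 : 0 < 1 + Im z by rewrite addr_gt0.
have [h|h] := leP (Im z) 1.
  apply: (le_trans (cmod_scpre exl uz)); rewrite ler_wpM2r ?invr_ge0 ?(ltW z0)//.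
  have -> : \sum_(p <- exl) `|p.2| = 2 :> R.
    rewrite !big_cons big_nil/= normrN ger0_norm// (gtr0_norm a0) (gtr0_norm (_ : 0 < 1 - al)) ?subr_gt0//.
    by field.
  rewrite ler_pdivlMr ?exprn_gt0//; move: (Im z) z0 h => t t0 t1; rewrite expr2; nra.
apply: (le_trans (expre_le uz)).
rewrite exprS invfM [X in 2 * X]mulrC mulrA ler_wpM2r ?invr_ge0 ?(ltW z0)//.
rewrite ler_pdivrMr ?exprn_gt0// mulrAC ler_pdivlMr ?exprn_gt0//.
by move: (Im z) z0 h => t t0 t1; rewrite !expr2; nra.
Qed.

(** The derivative at height y + t is at most 2 times 2 / (y + t)^3; its integral upwards, to a
    height where the integrand is within e of 1, is at most 2 / y^2, and e is arbitrary. *)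
Let exphi_near1 (z : C) : 1 <= Im z -> cmod (exphi z - 1) <= 2 / Im z ^+ 2.
Proof.
move=> z1; have z0 : 0 < Im z by rewrite (lt_le_trans _ z1).
apply/ler_addgt0Pr => e e0.
have /climP/(_ _ e0)[N H] := exphi_inf ltr01.
have [T [T0 TN]] : exists T : R, 1 < T /\ N < T.
  exists (Num.max 1 N + 1); split; apply: (@le_lt_trans _ _ (Num.max 1 N)).
  - by rewrite le_max lexx.
  - by rewrite ltrDl.
  - by rewrite le_max lexx orbT.
  - by rewrite ltrDl.
have T00 : 0 <= T by rewrite (le_trans _ (ltW T0)).
pose J : C := Complex 0 1.
pose p (t : R) := exphi (z + Complex t 0 * J).
have pz (t : R) : z + Complex t 0 * J = z + Complex 0 t.
  by apply: complex_ext; rewrite !ReImE/=; ring.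
have up (t : R) : 0 <= t -> uhp (z + Complex t 0 * J).
  by move=> t0; rewrite pz /uhp/= !ReImE/= (lt_le_trans z0)// lerDl.
have pd (t : R) : 0 <= t -> pderiv p t (exphi' (z + Complex t 0 * J) * J).
  by move=> t0; apply: cdiff_pderiv (exphi_diff (up t t0)); apply: uhp_line_near; exact: up.
pose B (t : R) := - 2 * ((Im z + t)^-1) ^+ 2.
pose B' (t : R) := 4 * ((Im z + t)^-1) ^+ 3.
have Bd (t : R) : 0 <= t -> is_derive t 1 B (B' t).
  move=> t0; have y0 : Im z + t != 0 by rewrite gt_eqF// ltr_wpDr.
  have d2 : is_derive t 1 (fun s : R => Im z + s) 1.
    have := is_deriveD (is_derive_cst (Im z : R) t 1) (is_derive_id t (1 : R)).
    by rewrite add0r.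
  have d3 := @is_deriveV R (fun s : R => Im z + s) t 1 1 y0 d2.
  have H2 := is_deriveZ (- 2 : R) (is_deriveX 2 d3).
  apply: (is_derive_eq H2); rewrite /GRing.scale/= expr1 /B' mulr1.
  by field.
have oc t : t \in `](0:R), T[ -> 0 <= t by rewrite in_itv/= => /andP[/ltW].
have M := @path_mvt R p (fun t => exphi' (z + Complex t 0 * J) * J) B B' 0 T 0 T00.
have {M} : cmod (p T - p 0) <= B T - B 0.
  rewrite -[p T - p 0]subr0 -(mulr0 (Complex (T - 0) 0 : C)); apply: M.
  - by move=> t /oc; exact: pd.
  - by move=> t /oc; exact: Bd.
  - move=> t /oc t0; rewrite subr0 cmodM cmod_imag normr1 mulr1 cmodM.
    have u := up t t0; have E : Im (z + Complex t 0 * J) = Im z + t by rewrite pz !ReImE/=.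
    have h1 : 1 <= Im (z + Complex t 0 * J) by rewrite E (le_trans z1)// lerDl.
    have := expre_le u; rewrite E => h2.
    have -> : B' t = 2 * (2 / (Im z + t) ^+ 3) by rewrite /B' exprVn; ring.
    by apply: ler_pM; rewrite ?cmod_ge0 ?exphi_le2.
  - split; apply: derivable_within_continuous => t; rewrite in_itv/= => /andP[t0 _];
      by have [[] ? _ [] ? _] := pd t t0.
  - apply: derivable_within_continuous => t; rewrite in_itv/= => /andP[t0 _].
    by have [] := Bd t t0.
have p0 : p 0 = exphi z by rewrite /p; congr exphi; apply: complex_ext; rewrite !ReImE/=; ring.
have pT : cmod (p T - 1) < e.
  have := H (z + Complex 0 (T - 1)); rewrite -addrA.
  have -> : Complex 0 (T - 1) + Complex 0 1 = Complex 0 T :> C.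
    by apply: complex_ext; rewrite !ReImE/=; ring.
  rewrite /p pz; apply.
    by rewrite /cuhp/= !ReImE/= addr_ge0 ?(ltW z0)// subr_ge0 ltW.
  apply: (lt_le_trans TN); apply: le_trans (le_trans (ler_norm _) (Im_le_cmod _)).
  by rewrite !ReImE/=; lra.
rewrite p0 /B addr0 => h.
have : cmod (exphi z - 1) <= cmod (p T - exphi z) + cmod (p T - 1).
  rewrite -(cmodN (p T - exphi z)) (le_trans _ (cmodD _ _))// le_eqVlt; apply/orP; left.
  by apply/eqP; congr cmod; ring.
have q0 : 0 <= (Im z + T)^-1 ^+ 2 by rewrite exprn_ge0// invr_ge0 addr_ge0// ltW.
move: h; rewrite -exprVn; move: q0 pT.
move: (cmod _) (cmod _) (cmod _) (_ ^+ 2) (_ ^+ 2) => *; lra.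
Qed.

Let exphi_bound (z : C) : uhp z -> cmod (exphi z - 1) <= 8 * majo 2^-1 (Im z).
Proof.
move=> uz; have z0 : 0 < Im z := uz.
have q1 := quot_ge1 z0; have m0 := majo_ge0 2^-1 z0.
have [h|h] := leP (Im z) 1.
  have c1 : cmod (exphi z - 1) <= cmod (exphi z) + 1.
    by have := cmodD (exphi z) (- 1); rewrite cmodN cmod1.
  have := exphi_le uz; rewrite /majo.
  set q := _ `^ _ in q1 * => h2.
  apply: (le_trans c1); apply: (@le_trans _ _ (2 * q)); first by lra.
  have -> : 8 * (q * (1 + Im z) ^- 2) = 2 * q * (4 * (1 + Im z) ^- 2) by ring.
  rewrite ler_peMr//; first by lra.
  have z1 : 0 < 1 + Im z by rewrite addr_gt0.
  rewrite ler_pdivlMr ?exprn_gt0//; move: (Im z) z0 h => t t0 t1; rewrite expr2; nra.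
apply: (le_trans (exphi_near1 (ltW h))).
have := majo_lb_large beta01 (ltW h); lra.
Qed.

Lemma exmap_cts (z : C) : cuhp z -> clim (inear (@cuhp R) z) exmap (exmap z).
Proof. exact: (vprim_cts beta01 exphi_diff exphi_bound). Qed.

Lemma exmap_inf : clim (cinf (@cuhp R)) (fun z => exmap z - z) 0.
Proof.
apply: clim_near (vprim_inf beta01 exphi_diff exphi_bound exphi_inf).
by apply: nearW => z; rewrite mul1r.
Qed.

Let exphi'_cts (z : C) : uhp z -> clim (inear (@uhp R) z) exphi' (exphi' z).
Proof.
move=> uz; apply: climM; last exact: scpre_clim.
by apply: scphi_clim; exact: uhp_scfree.
Qed.

Lemma exmap_diff (z : C) : uhp z -> cdiff (@uhp R) exmap z (exphi z).
Proof. exact: (vprim_diff beta01 exphi_diff exphi'_cts exphi_bound exphi'_bound exphi_inf). Qed.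

Lemma exmap_bcdiff (x : R) : x \notin [:: -1; x2; x3; 0] ->
  cdiff (@cuhp R) exmap (Complex x 0) (exphi (Complex x 0)).
Proof.
move=> xl.
apply: (vprim_diff_boundary beta01 exphi_diff exphi'_cts exphi_bound exphi'_bound exphi_inf).
  by rewrite /cuhp/=.
apply: scphi_clim => p pl; apply: contraNneq xl => /(congr1 (@complex.Re R))/= ->.
by move: pl => /= [<-|[<-|[<-|[<-|[]]]]] /=; rewrite !inE eqxx ?orbT.
Qed.

(** The four arguments increase with the prevertex, inside (0, pi). That of the integrand is a
    weighted mean of the two middle ones minus the midpoint of the outer ones, hence less than pi /
    2 in absolute value. *)
Lemma exphi_Re_gt0 (z : C) : uhp z -> 0 < Re (exphi z).
Proof.
move=> uz; rewrite Re_scphi mulr_gt0 ?cmod_gt0 ?scphi_neq0//.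
have u x := uhp_sub_real x uz; case/andP: al01 => a0 a1.
have E (x : R) : z - Complex x 0 = Complex (Re z - x) (Im z).
  by apply: complex_ext; rewrite !ReImE/= ?subr0.
have lt_arg (x y : R) : x < y -> carg (z - Complex x 0) < carg (z - Complex y 0).
  by move=> xy; rewrite !E; apply: carg_lt => //; lra.
have A1 := carg_gt0 (u (-1)); have A4 := carg_ltpi (u 0).
have h1 := lt_arg _ _ x2_gt; have h2 := lt_arg _ _ x23; have h3 := lt_arg _ _ x3_lt0.
rewrite /scarg !big_cons big_nil/= addr0.
move: A1 A4 h1 h2 h3.
move: (carg _) (carg _) (carg _) (carg _) => t3 t2 t4 t1 A1 A4 h1 h2 h3.
have p0 := pi_gt0 R.
have a1' : 0 < 1 - al by rewrite subr_gt0.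
have k1 : 0 < al * (t2 - t1) + (1 - al) * (t3 - t1) by rewrite addr_gt0// mulr_gt0//; lra.
have k2 : 0 < al * (t4 - t2) + (1 - al) * (t4 - t3) by rewrite addr_gt0// mulr_gt0//; lra.
by rewrite cos_gt0_pihalf//; lra.
Qed.

End exterior_map.

(** The half exterior in turned position: the axis of symmetry becomes the real line, the halves of
    the two parallel sides become the vertical pieces [et_up] and [et_down], and the leg joins them.
    The geometry below depends on these data alone. *)
Record exterior_trace (R : realType) (x2 x3 sa ca : R) (m : R -> R) (T : R -> complex R) : Prop :=
  ExteriorTrace {
    et_x2 : -1 < x2;
    et_x23 : x2 < x3;
    et_x3 : x3 < 0;
    et_sa : 0 < sa;
    et_speed : forall x, 0 < m x;
    et_clim : forall x : R, clim (nbhs x) T (T x);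
    et_inf : forall e : R, 0 < e -> exists N : R, forall x, N < `|x| -> cmod (T x - Complex x 0) < e;
    et_out : forall x, x < -1 \/ 0 < x -> pderiv T x (Complex (m x) 0);
    et_up : forall x, -1 < x < x2 -> pderiv T x (Complex 0 (m x));
    et_side : forall x, x2 < x < x3 -> pderiv T x (Complex (m x * sa) (m x * ca));
    et_down : forall x, x3 < x < 0 -> pderiv T x (Complex 0 (- m x)) }.

(** * Geometry of the boundary trace of the half exterior *)

Section exterior_trace_theory.
Variable R : realType.
Local Notation C := (complex R).
Variables (x2 x3 sa ca : R) (m : R -> R) (T : R -> C).
Hypothesis et : exterior_trace x2 x3 sa ca m T.

Let x2_gt := et_x2 et.
Let x23 := et_x23 et.
Let x3_lt := et_x3 et.
Let sa0 := et_sa et.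
Let m0 := et_speed et.

Let cRe : continuous (fun x => Re (T x)).
Proof. by move=> x; exact: (clim_Re (et_clim et x)). Qed.
Let cIm : continuous (fun x => Im (T x)).
Proof. by move=> x; exact: (clim_Im (et_clim et x)). Qed.

Lemma et_Im0 (x : R) : x <= -1 \/ 0 <= x -> Im (T x) = 0.
Proof.
move=> xo; apply/eqP; rewrite -normr_eq0 eq_le normr_ge0 andbT.
apply/ler_addgt0Pr => e e0; rewrite add0r.
have [N H] := et_inf et e0.
suff [y yN ->] : exists2 y : R, N < `|y| & Im (T x) = Im (T y).
  apply/ltW/(le_lt_trans _ (H y yN)); apply: le_trans (Im_le_cmod _).
  by rewrite !ReImE/= subr0.
case: xo => xo.
  exists (x - (`|N| + 1)).
    have n0 := ler_norm N; have n1 := normr_ge0 N; rewrite (@ltr0_norm _ (x - _)); lra.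
  apply/esym/(derive_zero_eq (u := fun t => Im (T t)) (u' := fun=> 0) _ cIm) => [|t /andP[_ tx]|t _].
  - by have := normr_ge0 N; lra.
  - by have [] := et_out et (or_introl (lt_le_trans tx xo)).
  - by [].
exists (x + (`|N| + 1)).
  have n0 := ler_norm N; have n1 := normr_ge0 N; rewrite (@gtr0_norm _ (x + _)); lra.
apply/(derive_zero_eq (u := fun t => Im (T t)) (u' := fun=> 0) _ cIm) => [|t /andP[tx _]|t _].
- by have := normr_ge0 N; lra.
- by have [] := et_out et (or_intror (le_lt_trans xo tx)).
- by [].
Qed.

Lemma et_Re_out (x y : R) : y <= -1 \/ 0 <= x -> x < y -> Re (T x) < Re (T y).
Proof.
move=> xo xy; apply: (derive_pos_lt (u := fun t => Re (T t)) (u' := m) xy cRe) => [t /andP[xt ty]|t _].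
  have to : t < -1 \/ 0 < t by case: xo => xo; [left|right]; lra.
  by have [] := et_out et to.
exact: m0.
Qed.

Lemma et_Re_up (x : R) : -1 <= x <= x2 -> Re (T x) = Re (T (-1)).
Proof.
move=> /andP[x1 xx2]; apply/esym.
apply: (derive_zero_eq (u := fun t => Re (T t)) (u' := fun=> 0) x1 cRe) => [t /andP[xt tx]|t _]; last by [].
have t1 : -1 < t < x2 by apply/andP; split; lra.
by have [] := et_up et t1.
Qed.

Lemma et_Re_down (x : R) : x3 <= x <= 0 -> Re (T x) = Re (T 0).
Proof.
move=> /andP[x1 xx2].
apply: (derive_zero_eq (u := fun t => Re (T t)) (u' := fun=> 0) xx2 cRe) => [t /andP[xt tx]|t _]; last by [].
have t1 : x3 < t < 0 by apply/andP; split; lra.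
by have [] := et_down et t1.
Qed.

Lemma et_Im_up (x y : R) : -1 <= x -> x < y -> y <= x2 -> Im (T x) < Im (T y).
Proof.
move=> x1 xy yx2.
apply: (derive_pos_lt (u := fun t => Im (T t)) (u' := m) xy cIm) => [t /andP[xt ty]|t _]; last exact: m0.
have t1 : -1 < t < x2 by apply/andP; split; lra.
by have [] := et_up et t1.
Qed.

Lemma et_Im_down (x y : R) : x3 <= x -> x < y -> y <= 0 -> Im (T y) < Im (T x).
Proof.
move=> x1 xy yx2; rewrite -ltrN2.
apply: (derive_pos_lt (u := fun t => - Im (T t)) (u' := m) xy (opp_continuous_fun cIm)) => [t /andP[xt ty]|t _]; last exact: m0.
have t1 : x3 < t < 0 by apply/andP; split; lra.
by have [_ h] := et_down et t1; have := is_deriveN h; rewrite /= opprK.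
Qed.

Lemma et_Re_side (x y : R) : x2 <= x -> x < y -> y <= x3 -> Re (T x) < Re (T y).
Proof.
move=> x1 xy yx2.
apply: (derive_pos_lt (u := fun t => Re (T t)) (u' := fun t => m t * sa) xy cRe) => [t /andP[xt ty]|t _].
  have t1 : x2 < t < x3 by apply/andP; split; lra.
  by have [] := et_side et t1.
by rewrite mulr_gt0 ?m0.
Qed.

Definition etX0 : R := Re (T (-1)).
Definition etX1 : R := Re (T 0).
Definition etC : R := Im (T x2).
Definition etD : R := Im (T x3).

Let T_x2 : Re (T x2) = etX0.
Proof. by apply: et_Re_up; rewrite lexx andbT ltW. Qed.
Let T_x3 : Re (T x3) = etX1.
Proof. by apply: et_Re_down; rewrite lexx/= ltW. Qed.

Lemma et_line (x : R) : x2 <= x <= x3 -> sa * (Im (T x) - etC) = ca * (Re (T x) - etX0).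
Proof.
move=> /andP[xa xb]; pose u (t : R) := sa * Im (T t) - ca * Re (T t).
have cu : continuous u by exact: lincomb_continuous.
have E : u x2 = u x.
  apply: (derive_zero_eq (u := u) (u' := fun t => sa * (m t * ca) - ca * (m t * sa)) xa cu) => [t /andP[xt tx]|t _].
    have t1 : x2 < t < x3 by apply/andP; split; lra.
    have [h1 h2] := et_side et t1.
    exact: (is_deriveB (is_deriveZ sa h2) (is_deriveZ ca h1)).
  by ring.
by move: E; rewrite /u T_x2 -/etC; lra.
Qed.

Lemma etC_gt0 : 0 < etC.
Proof. by rewrite -(et_Im0 (or_introl (lexx (-1)))); exact: et_Im_up. Qed.
Lemma etD_gt0 : 0 < etD.
Proof. by rewrite -(et_Im0 (or_intror (lexx 0))); exact: et_Im_down. Qed.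
Lemma etX01 : etX0 < etX1.
Proof. by rewrite -T_x2 -T_x3; exact: et_Re_side. Qed.
Lemma et_slope : sa * (etD - etC) = ca * (etX1 - etX0).
Proof. by rewrite -T_x3; apply: et_line; rewrite lexx (ltW x23). Qed.

Let et_Im_side (t : R) : x2 < t < x3 -> 0 < Im (T t).
Proof.
move=> /andP[h2 h3].
have r1 : etX0 < Re (T t) by rewrite -T_x2; apply: et_Re_side => //; exact: ltW.
have r2 : Re (T t) < etX1 by rewrite -T_x3; apply: et_Re_side => //; exact: ltW.
have L : sa * (Im (T t) - etC) = ca * (Re (T t) - etX0) by apply: et_line; rewrite !ltW.
have S := et_slope; have C0 := etC_gt0; have D0 := etD_gt0.
have H : sa * (etX1 - etX0) * Im (T t) = sa * (etC * (etX1 - Re (T t)) + etD * (Re (T t) - etX0)).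
  have -> : sa * (etX1 - etX0) * Im (T t) =
    (etX1 - etX0) * (sa * (Im (T t) - etC)) + sa * (etX1 - etX0) * etC by ring.
  rewrite L; have -> : (etX1 - etX0) * (ca * (Re (T t) - etX0)) =
    (ca * (etX1 - etX0)) * (Re (T t) - etX0) by ring.
  by rewrite -S; ring.
have P : 0 < sa * (etX1 - etX0) * Im (T t).
  by rewrite H mulr_gt0// addr_gt0// mulr_gt0// subr_gt0.
by move: P; rewrite pmulr_rgt0// mulr_gt0// subr_gt0 etX01.
Qed.

Lemma et_Re_le (x : R) : x <= -1 -> Re (T x) <= etX0.
Proof.
by rewrite le_eqVlt => /predU1P[->//|h]; apply/ltW/et_Re_out => //; left.
Qed.

Lemma et_Re_ge (x : R) : 0 <= x -> etX1 <= Re (T x).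
Proof.
by rewrite le_eqVlt => /predU1P[<-//|h]; apply/ltW/et_Re_out => //; right.
Qed.

(* the region above the graph of the boundary curve *)
Definition et_dom : set C := [set w | 0 < Im w /\
  [\/ Re w < etX0, etX1 < Re w | ca * (Re w - etX0) < sa * (Im w - etC)]].

Lemma et_trace_range (x : R) : -1 <= x <= 0 ->
  [/\ 0 <= Im (T x), etX0 <= Re (T x) <= etX1 & sa * (Im (T x) - etC) <= ca * (Re (T x) - etX0)].
Proof.
move=> /andP[x1 x0].
have X01 := ltW etX01.
have [h2|h2] := leP x x2.
  rewrite et_Re_up ?x1// -/etX0 subrr mulr0 lexx X01; split=> //.
    have := x1; rewrite le_eqVlt => /predU1P[<-|h]; first by rewrite et_Im0//; left.
    by rewrite -(et_Im0 (or_introl (lexx (-1)))); apply/ltW/et_Im_up.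
  rewrite pmulr_rle0// subr_le0.
  by have := h2; rewrite le_eqVlt => /predU1P[->//|h]; apply/ltW/et_Im_up.
have [h3|h3] := leP x3 x.
  rewrite et_Re_down ?h3// -/etX1 X01 lexx; split=> //.
    have := x0; rewrite le_eqVlt => /predU1P[->|h]; first by rewrite et_Im0//; right.
    by rewrite -(et_Im0 (or_intror (lexx 0))); apply/ltW/et_Im_down.
  rewrite -et_slope ler_pM2l// lerD2r.
  by have := h3; rewrite le_eqVlt => /predU1P[<-//|h]; apply/ltW/et_Im_down.
have L : sa * (Im (T x) - etC) = ca * (Re (T x) - etX0).
  by apply: et_line; rewrite !ltW.
rewrite L lexx (ltW (et_Im_side _)) ?h2//; split=> //; rewrite -T_x2 -T_x3.
by rewrite !ltW// et_Re_side// ltW.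
Qed.

Let ivt (a b y : R) : a <= b -> Re (T a) <= y <= Re (T b) -> exists2 x, a <= x <= b & Re (T x) = y.
Proof.
move=> ab /andP[ya yb].
have yy : Num.min (Re (T a)) (Re (T b)) <= y <= Num.max (Re (T a)) (Re (T b)).
  by rewrite ge_min le_max ya yb orbT.
have [x] := @IVT R (fun t => Re (T t)) a b y ab (continuous_subspaceT cRe) yy.
by rewrite in_itv/= => xab E; exists x.
Qed.

Lemma et_Re_onto (y : R) : exists x, Re (T x) = y.
Proof.
have [N H] := et_inf et ltr01.
pose a := y - `|N| - 2 - `|y|; pose b := y + `|N| + 2 + `|y|.
have n1 := normr_ge0 N; have n2 := normr_ge0 y; have n3 := ler_norm N.
have n4 := ler_norm y; have n5 := ler_norm (- y); rewrite normrN in n5.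
have aN : N < `|a| by rewrite ltr0_norm /a; lra.
have bN : N < `|b| by rewrite gtr0_norm /b; lra.
have Ha := le_lt_trans (Re_le_cmod _) (H a aN); have Hb := le_lt_trans (Re_le_cmod _) (H b bN).
move: Ha Hb; rewrite !ReImE/= !ltr_norml => /andP[_ ha] /andP[hb _].
have ab : a <= b by rewrite /a /b; lra.
have yy : Re (T a) <= y <= Re (T b) by move: ha hb; rewrite /a /b => ha hb; apply/andP; split; lra.
by have [x _ <-] := ivt ab yy; exists x.
Qed.

(** Every abscissa occurs on the boundary curve, so lying above all boundary points of the same
    abscissa fixes the position relative to the real line and to the leg. *)
Lemma et_above (w : C) : (forall x : R, Re (T x) = Re w -> Im (T x) < Im w) -> et_dom w.
Proof.
move=> H; have X01 := etX01; split.
  have [x E] := et_Re_onto (Re w); have := H x E; apply: le_lt_trans.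
  have [x1|x1] := leP x (-1); first by rewrite et_Im0//; left.
  have [x0|x0] := leP 0 x; first by rewrite et_Im0//; right.
  by have [|] := @et_trace_range x; first by rewrite !ltW.
have [h0|h0] := ltP (Re w) etX0; first by apply: Or31.
have [h1|h1] := ltP etX1 (Re w); first by apply: Or32.
apply: Or33.
have yy : Re (T x2) <= Re w <= Re (T x3) by rewrite T_x2 T_x3 h0.
have [x xi E] := ivt (ltW x23) yy.
by rewrite -E -(et_line xi) ltr_pM2l// ltrD2r; exact: H.
Qed.

Lemma et_Im_gt0 (t : R) : -1 < t < 0 -> 0 < Im (T t).
Proof.
move=> /andP[t1 t0]; have [h2|h2] := leP t x2.
  by rewrite -(et_Im0 (or_introl (lexx (-1)))); exact: et_Im_up.
have [h3|h3] := leP x3 t.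
  by rewrite -(et_Im0 (or_intror (lexx 0))); exact: et_Im_down.
by apply: et_Im_side; rewrite h2.
Qed.

Lemma et_inj (x y : R) : T x = T y -> x = y.
Proof.
have X01 := etX01; have C0 := etC_gt0; have D0 := etD_gt0.
have key (u v : R) : u < v -> T u <> T v.
  move=> uv E; have ER := congr1 (@complex.Re R) E; have EI := congr1 (@complex.Im R) E.
  rewrite /= in ER EI.
  have [v1|v1] := leP v (-1).
    by have := et_Re_out (or_introl v1) uv; rewrite ER ltxx.
  have [u0|u0] := leP 0 u.
    by have := et_Re_out (or_intror u0) uv; rewrite ER ltxx.
  have [u1|u1] := leP u (-1).
    have Iu : Im (T v) = 0 by rewrite -EI et_Im0//; left.
    have [v0|v0] := ltP v 0; first by have := @et_Im_gt0 v; rewrite v1 v0 Iu ltxx => /(_ isT).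
    by have := et_Re_le u1; have := et_Re_ge v0; lra.
  have Iu : 0 < Im (T u) by apply: et_Im_gt0; rewrite u1.
  have [v0|v0] := leP 0 v; first by move: Iu; rewrite EI et_Im0 ?ltxx//; right.
  have [v2|v2] := leP v x2.
    by have := et_Im_up (ltW u1) uv v2; rewrite EI ltxx.
  have [u3|u3] := leP x3 u.
    by have := et_Im_down u3 uv (ltW v0); rewrite EI ltxx.
  (* The real part is constant on the vertical pieces, so u and v may be moved to the ends of the
     leg, along which it increases strictly. *)
  pose u' := Num.max u x2; pose v' := Num.min v x3.
  have hu : Re (T u) = Re (T u').
    by rewrite /u' maxEle; case: ifP => // h; rewrite T_x2; apply: et_Re_up; rewrite h ltW.
  have hv : Re (T v) = Re (T v').
    rewrite /v' minEle; case: ifP => // /negbT; rewrite -ltNge => h.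
    by rewrite T_x3; apply: et_Re_down; rewrite !ltW.
  have : Re (T u') < Re (T v').
    by apply: et_Re_side; rewrite ?le_max ?ge_min ?lexx ?orbT// lt_min !gt_max uv u3 v2 x23.
  by rewrite -hu -hv ER ltxx.
move=> E; have [h|h|//] := ltgtP x y; first by case: (key _ _ h).
by case: (key _ _ h).
Qed.

End exterior_trace_theory.

(** * Position of the image and injectivity *)

Section exterior_map_image.
Variable R : realType.
Local Notation C := (complex R).
Variables (al x2 x3 : R).
Hypothesis al01 : 0 < al < 1.
Hypothesis x2_gt : -1 < x2.
Hypothesis x23 : x2 < x3.
Hypothesis x3_lt0 : x3 < 0.
Hypothesis residue0 : 2^-1 + al * x2 + (1 - al) * x3 = 0.

Local Notation phi := (@exphi R al x2 x3).
Local Notation H := (@exmap R al x2 x3).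

Definition extrace (x : R) : C := H (Complex x 0).
Definition exspeed (x : R) : R := cmod (phi (Complex x 0)).

Let arg_real (x : R) : x \notin [:: -1; x2; x3; 0] ->
  scarg (exl al x2 x3) (Complex x 0) =
  - 2^-1 * (if x < -1 then pi else 0) + (al * (if x < x2 then pi else 0)
   + ((1 - al) * (if x < x3 then pi else 0) + - 2^-1 * (if x < 0 then pi else 0))).
Proof.
rewrite !inE !negb_or => /and4P[h1 h2 h3 h4].
by rewrite /scarg !big_cons big_nil/= !carg_real_sub// addr0.
Qed.

Let deriv (x th : R) : x \notin [:: -1; x2; x3; 0] -> scarg (exl al x2 x3) (Complex x 0) = th ->
  pderiv extrace x (Complex (exspeed x * cos th) (exspeed x * sin th)).
Proof.
move=> xl <-; have := boundary_pderiv (exmap_bcdiff al01 x2_gt x23 x3_lt0 residue0 xl).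
rewrite (_ : phi (Complex x 0) = Complex (exspeed x * cos (scarg (exl al x2 x3) (Complex x 0)))
  (exspeed x * sin (scarg (exl al x2 x3) (Complex x 0))))//.
by apply: complex_ext; rewrite ?Re_scphi ?Im_scphi.
Qed.

Let free (x : R) : x != -1 -> x != x2 -> x != x3 -> x != 0 -> x \notin [:: -1; x2; x3; 0].
Proof. by move=> h1 h2 h3 h4; rewrite !inE !negb_or h1 h2 h3 h4. Qed.

Lemma ex_exterior_trace :
  exterior_trace x2 x3 (sin (pi * al)) (cos (pi * al)) exspeed extrace.
Proof.
have y1 := x2_gt; have y2 := x23; have y3 := x3_lt0.
have gef (x y : R) : y <= x -> (x < y) = false by move=> h; apply/negbTE; rewrite -leNgt.
split.
- exact: x2_gt.
- exact: x23.
- exact: x3_lt0.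
- exact: sb_gt0.
- by move=> x; rewrite /exspeed cmod_gt0 scphi_neq0.
- by move=> x; apply: boundary_clim; apply: exmap_cts => //; rewrite /cuhp/=.
- move=> e e0; have /climP/(_ e e0)[N HN] := exmap_inf al01 x2_gt x23 x3_lt0 residue0.
  exists N => x Nx; have := HN (Complex x 0); rewrite subr0 cmod_real; apply => //.
  by rewrite /cuhp/=.
- move=> x xo.
  have xl : x \notin [:: -1; x2; x3; 0] by apply: free; apply/eqP; case: xo => xo; lra.
  have A : scarg (exl al x2 x3) (Complex x 0) = 0.
    rewrite arg_real//; case: xo => xo.
      have -> : x < x2 by lra.
      have -> : x < x3 by lra.
      have -> : x < 0 by lra.
      by rewrite xo; field.
    by rewrite !gef ?mulr0 ?addr0//; lra.
  by have := deriv xl A; rewrite cos0 sin0 mulr1 mulr0.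
- move=> x /andP[h1 h2].
  have xl : x \notin [:: -1; x2; x3; 0] by apply: free; apply/eqP; lra.
  have A : scarg (exl al x2 x3) (Complex x 0) = pi / 2.
    rewrite arg_real// h2 gef ?(ltW h1)//.
    have -> : x < x3 by lra.
    have -> : x < 0 by lra.
    by field.
  by have := deriv xl A; rewrite cos_pihalf sin_pihalf mulr1 mulr0.
- move=> x /andP[h1 h2].
  have xl : x \notin [:: -1; x2; x3; 0] by apply: free; apply/eqP; lra.
  have A : scarg (exl al x2 x3) (Complex x 0) = pi / 2 - pi * al.
    rewrite arg_real// h2 (gef _ _ (ltW h1)) gef; last by lra.
    have -> : x < 0 by lra.
    by field.
  have := deriv xl A.
  by rewrite cosB sinB cos_pihalf sin_pihalf !mul0r !mul1r add0r subr0.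
- move=> x /andP[h1 h2].
  have xl : x \notin [:: -1; x2; x3; 0] by apply: free; apply/eqP; lra.
  have A : scarg (exl al x2 x3) (Complex x 0) = - (pi / 2).
    by rewrite arg_real// h2 !gef; lra.
  by have := deriv xl A; rewrite cosN sinN cos_pihalf sin_pihalf mulrN1 mulr0.
Qed.

(** The mean value theorem, with u - v divided out, makes the real part of the quotient a value of
    Re phi. At least one point is off the real axis, so the open segment lies in the open
    half-plane. *)
Lemma exmap_quotient (u v : C) : cuhp u -> cuhp v -> 0 < Im u + Im v -> u != v ->
  exists2 q : C, 0 < Re q & H u - H v = q * (u - v).
Proof.
move=> cu cv uv0 uv; have d0 : u - v != 0 by rewrite subr_eq0.
have us (t : R) : 0 < t < 1 -> uhp (v + Complex t 0 * (u - v)).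
  move=> /andP[t0 t1]; move: cu cv uv0; rewrite /cuhp/uhp/= !ReImE/= => cu cv uv0.
  have -> : Im v + (t * (Im u - Im v) + 0 * (Re u - Re v)) = t * Im u + (1 - t) * Im v by ring.
  have [u0|u0] := ltP 0 (Im u).
    by rewrite ltr_pwDl ?mulr_gt0// mulr_ge0// subr_ge0 ltW.
  by rewrite ltr_wpDl ?mulr_ge0 ?(ltW t0)// mulr_gt0 ?subr_gt0//; lra.
have [t t01 E] := cuhp_MVT (u - v)^-1 (exmap_cts al01 x2_gt x23 x3_lt0 residue0)
  (exmap_diff al01 x2_gt x23 x3_lt0 residue0) cv cu us.
exists ((u - v)^-1 * (H u - H v)); last by rewrite mulrAC mulVf// mul1r.
rewrite E mulrC mulfK//; apply: exphi_Re_gt0 => //; exact: us.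
Qed.

(** When H u and the boundary value at x have the same real part, their difference divided by u - x
    has positive real part; together with Im u > 0 this forces H u to lie above. So the image is
    above the graph without any winding number. *)
Lemma exmap_interior (u : C) : uhp u ->
  et_dom x2 (sin (pi * al)) (cos (pi * al)) extrace (H u).
Proof.
move=> uu; apply: (et_above ex_exterior_trace) => x E.
have cx : cuhp (Complex x 0 : C) by rewrite /cuhp/=.
have ux : u != Complex x 0 by apply: contraTneq uu => ->; rewrite /uhp/= ltxx.
have [|q q0 Eq] := exmap_quotient (ltW uu) cx _ ux; first by rewrite addr0.
have iu : 0 < Im u := uu.
move: Eq; rewrite -/(extrace x); move: (extrace x) (H u) E => w1 w2 E Eq.
have ER := congr1 (@complex.Re R) Eq; have EI := congr1 (@complex.Im R) Eq.
move: ER EI; rewrite !ReImE/= E subrr subr0 => ER EI.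
have K : (Im w2 - Im w1) * Im u = Re q * ((Re u - x) ^+ 2 + Im u ^+ 2).
  rewrite EI; have -> : (Re q * Im u + Im q * (Re u - x)) * Im u =
    Re q * Im u ^+ 2 + (Im q * Im u) * (Re u - x) by ring.
  have -> : Im q * Im u = Re q * (Re u - x) by lra.
  ring.
have P : 0 < (Im w2 - Im w1) * Im u.
  by rewrite K mulr_gt0// ltr_wpDl ?sqr_ge0// exprn_gt0.
by move: P; rewrite pmulr_lgt0// subr_gt0.
Qed.

Lemma exmap_inj (u v : C) : cuhp u -> cuhp v -> H u = H v -> u = v.
Proof.
move=> cu cv E; apply/eqP; apply: contraT => uv.
have [uv0|] := ltP 0 (Im u + Im v).
  have [q q0 Eq] := exmap_quotient cu cv uv0 uv.
  move: Eq; rewrite E subrr => /esym/eqP; rewrite mulf_eq0 subr_eq0 (negbTE uv) orbF.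
  by move=> /eqP q00; rewrite q00/= ltxx in q0.
move: cu cv; rewrite /cuhp/= => cu cv le0.
have u0 : u = Complex (Re u) 0 by apply: complex_ext => //=; lra.
have v0 : v = Complex (Re v) 0 by apply: complex_ext => //=; lra.
move: E; rewrite u0 v0 => E.
by have := et_inj ex_exterior_trace E => Ex; rewrite u0 v0 Ex eqxx in uv.
Qed.

End exterior_map_image.

(** * The exterior chart *)

Section reciprocal_map.
Variable R : realType.
Local Notation C := (complex R).
Variables (al x2 x3 p : R).
Hypothesis al01 : 0 < al < 1.
Hypothesis x2_gt : -1 < x2.
Hypothesis x23 : x2 < x3.
Hypothesis x3_lt0 : x3 < 0.
Hypothesis residue0 : 2^-1 + al * x2 + (1 - al) * x3 = 0.

Local Notation phi := (@exphi R al x2 x3).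
Local Notation H := (@exmap R al x2 x3).
Local Notation T := (extrace al x2 x3).
Hypothesis p_in : etX0 T < p < etX1 T.

Let et := ex_exterior_trace al01 x2_gt x23 x3_lt0 residue0.
Let P : C := Complex p 0.

(* [- w^-1] maps the closed half-plane to itself and 0 to infinity *)
Definition exK (w : C) : C := if w == 0 then 0 else (H (- w^-1) - P)^-1.

Lemma cuhp_invN (w : C) : cuhp w -> cuhp (- w^-1).
Proof.
move=> cw; have [->|w0] := eqVneq w 0; first by rewrite invr0 oppr0 /cuhp/=.
have E : Im (- w^-1) = Im w / cmod w ^+ 2.
  by case: w {cw w0} => x y; rewrite sqr_cmod/= opprK.
rewrite /cuhp/= E divr_ge0// exprn_ge0// cmod_ge0//.
Qed.

Lemma uhp_invN (w : C) : uhp w -> uhp (- w^-1).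
Proof.
move=> uw; have w0 : w != 0 by exact: Im_gt0_neq0.
have E : Im (- w^-1) = Im w / cmod w ^+ 2.
  by case: w {uw w0} => x y; rewrite sqr_cmod/= opprK.
by rewrite /uhp/= E divr_gt0// exprn_gt0// cmod_gt0.
Qed.

(** Interior values have positive imaginary part, and the boundary values on the real axis have
    abscissas outside the open interval that contains [p]. *)
Lemma exmap_neq (u : C) : cuhp u -> H u - P != 0.
Proof.
move=> cu; rewrite subr_eq0; apply/eqP => E.
have [iu|] := ltP 0 (Im u).
  have [] := exmap_interior al01 x2_gt x23 x3_lt0 residue0 iu.
  by rewrite E/= ltxx.
move: cu; rewrite /cuhp/= => cu iu.
have u0 : u = Complex (Re u) 0 by apply: complex_ext => //=; lra.
have TE : T (Re u) = P by rewrite /extrace -u0.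
have IT : Im (T (Re u)) = 0 by rewrite TE.
have RT : Re (T (Re u)) = p by rewrite TE.
case/andP: p_in => p0 p1.
have [h|h] := leP (Re u) (-1); first by have := et_Re_le et h; rewrite RT leNgt p0.
have [h'|h'] := leP 0 (Re u); first by have := et_Re_ge et h'; rewrite RT leNgt p1.
have : -1 < Re u < 0 by rewrite h.
by move=> /(et_Im_gt0 et); rewrite IT ltxx.
Qed.

Let clim_invN (w : C) : w != 0 -> cuhp w ->
  (fun v : C => - v^-1) @ inear (@cuhp R) w --> inear (@cuhp R) (- w^-1).
Proof.
move=> w0 cw.
have /clim_inearP Hc : clim (inear (@cuhp R) w) (fun v : C => - v^-1) (- w^-1).
  by apply: climN; apply: climV => //; exact: clim_id.
move=> A /inearP[e e0 HA]; have [d d0 Hd] := Hc e e0.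
apply/inearP; exists d => // v vw cv; apply: HA; first exact: Hd.
exact: cuhp_invN.
Qed.

Lemma exK_clim_neq0 (w : C) : w != 0 -> cuhp w -> clim (inear (@cuhp R) w) exK (exK w).
Proof.
move=> w0 cw; have cu := cuhp_invN cw.
rewrite {2}/exK (negbTE w0).
apply: (clim_near (f := (fun u => (H u - P)^-1) \o (fun v : C => - v^-1))).
  apply/inearP; exists (cmod w); first by rewrite cmod_gt0.
  move=> v vw _; rewrite /exK/= ifF//; apply/negbTE; apply: contraTneq vw => ->.
  by rewrite sub0r cmodN ltxx.
apply: clim_comp (clim_invN w0 cw) _.
apply: climV; first exact: exmap_neq.
by apply: climB; [exact: exmap_cts|exact: clim_cst].
Qed.

Lemma exK_inf : clim (cinf (@cuhp R)) exK (H 0 - P)^-1.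
Proof.
have c0 : cuhp (0 : C) by rewrite /cuhp/=.
have /clim_inearP Hc : clim (inear (@cuhp R) 0) (fun u => (H u - P)^-1) (H 0 - P)^-1.
  apply: climV; first exact: exmap_neq.
  by apply: climB; [exact: exmap_cts|exact: clim_cst].
apply/climP => e /Hc[d d0 Hd]; exists d^-1 => w cw wd.
have w0 : w != 0 by rewrite -cmod_gt0 (lt_trans _ wd)// invr_gt0.
rewrite /exK (negbTE w0); apply: Hd; last exact: cuhp_invN.
by rewrite subr0 cmodN cmodV -[ltRHS]invrK ltf_pV2 ?posrE ?invr_gt0// cmod_gt0.
Qed.

(** With u = - 1 / w one has H u = u + o(1), so 1 / (H u - p) is asymptotic to 1 / u = - w: the pole
    has become a simple zero. *)
Lemma exK_cdiff0 : cdiff (@cuhp R) exK 0 (-1).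
Proof.
exists (fun w => if w == 0 then -1 else exK w / w); split=> [w _|].
  rewrite {2}/exK eqxx !subr0; case: ifP => [/eqP ->|/negbT w0].
    by rewrite /exK eqxx mul0r.
  by rewrite mulrC divfK.
apply/climP => e e0.
have /climP/(_ 1 ltr01)[N HN] := exmap_inf al01 x2_gt x23 x3_lt0 residue0.
(* For |u| > M, H u is within 1 of u and H u - p exceeds (1 + |p|) / e in modulus, which makes the
   relative error smaller than e. *)
pose M := `|N| + (1 + `|p|) + (1 + `|p|) / e + 1.
have p0 : 0 < 1 + `|p| by rewrite ltr_wpDr.
have pe : 0 < (1 + `|p|) / e by rewrite divr_gt0.
have M0 : 0 < M by rewrite /M; have := normr_ge0 N; lra.
apply/inearP; exists M^-1; first by rewrite invr_gt0.
move=> w; rewrite subr0 => wM cw; case: eqP => [_|/eqP w0]; first by rewrite subrr cmod0.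
have cu := cuhp_invN cw; set u := - w^-1 in cu.
have uM : M < cmod u.
  by rewrite /u cmodN cmodV -[ltLHS]invrK ltf_pV2 ?posrE ?invr_gt0// cmod_gt0.
have h1 : cmod (H u - u - 0) < 1.
  by apply: HN => //; rewrite (le_lt_trans _ uM)// /M; have := ler_norm N; lra.
have hn := exmap_neq cu.
have u0 : u != 0 by rewrite -cmod_gt0 (lt_trans M0).
have -> : exK w / w - -1 = (H u - u - P) / (H u - P).
  rewrite /exK (negbTE w0) -/u.
  have -> : w^-1 = - u by rewrite /u opprK.
  by move: (H u) hn => h hn; field.
have h2 : cmod (H u - u - P) <= 1 + `|p|.
  rewrite (le_trans (cmodD _ _))// cmodN cmod_real lerD2r.
  by move: h1; rewrite subr0 => /ltW.
have h3 : (1 + `|p|) / e < cmod (H u - P).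
  have := cmodBD u (H u - u - P).
  have -> : u + (H u - u - P) = H u - P by ring.
  by move: uM h2; rewrite /M; have := normr_ge0 N; lra.
rewrite cmodM cmodV ltr_pdivrMr; last by rewrite (lt_trans _ h3).
apply: (le_lt_trans h2); by move: h3; rewrite ltr_pdivrMr// mulrC.
Qed.

Let exK_cdiff_gen (D : set C) (w c : C) : w != 0 -> D `<=` (@cuhp R) -> D w ->
  (forall v, D v -> D (- v^-1)) ->
  cdiff D H (- w^-1) c -> cdiff D exK w (- (c * w ^- 2) / (H (- w^-1) - P) ^+ 2).
Proof.
move=> w0 Dc Dw Di HD.
apply: (cdiff_eq (f := (fun u => (H u - P)^-1) \o (fun v : C => - v^-1))).
- apply/inearP; exists (cmod w); first by rewrite cmod_gt0.
  move=> v vw _; rewrite /exK/= ifF//; apply/negbTE; apply: contraTneq vw => ->.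
  by rewrite sub0r cmodN ltxx.
- by rewrite /exK/= (negbTE w0).
have d1 : cdiff D (fun v : C => - v^-1) w (w ^- 2).
  have := cdiffN (cdiffV w0 (cdiff_id D w)); congr cdiff.
  by rewrite mulNr mul1r opprK.
have d2 : cdiff D (fun u => (H u - P)^-1) (- w^-1) (- c / (H (- w^-1) - P) ^+ 2).
  apply: cdiffV; first by apply: exmap_neq; apply: Dc; exact: Di.
  by have := cdiffB HD (cdiff_cst D (- w^-1) P); rewrite subr0.
have nD : \forall v \near inear D w, D (- v^-1).
  by apply/inearP; exists 1 => // v _; exact: Di.
have := cdiff_comp nD d1 d2; congr cdiff.
by move: (_ ^+ 2) => x; rewrite !mulNr mulrAC.
Qed.

Lemma exK_diff (w : C) : uhp w -> exists2 c : C, c != 0 & cdiff (@uhp R) exK w c.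
Proof.
move=> uw; have w0 : w != 0 by exact: Im_gt0_neq0.
have uu := uhp_invN uw.
exists (- (phi (- w^-1) * w ^- 2) / (H (- w^-1) - P) ^+ 2).
  rewrite mulf_neq0 ?oppr_eq0 ?mulf_neq0 ?invr_eq0 ?expf_neq0 ?scphi_neq0//.
  by apply: exmap_neq; exact: ltW.
apply: exK_cdiff_gen => //; [by move=> v; exact: ltW|exact: uhp_invN|].
exact: exmap_diff.
Qed.

Lemma invN_real (x : R) : - (Complex x 0)^-1 = Complex (- x^-1) 0 :> C.
Proof.
by have [->|x0] := eqVneq x 0; apply: complex_ext; rewrite ?ReImE/= ?expr0n ?addr0 ?mul0r ?mulr0 ?invr0 ?oppr0//;
 field.
Qed.

(** For nonzero x <= 1 the point - 1 / x lies at or below -1, or in the positive half-line: the part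
    of the boundary that goes to the axis of symmetry. *)
Lemma exK_real (x : R) : x <= 1 -> Im (exK (Complex x 0)) = 0.
Proof.
move=> x1; rewrite /exK; case: ifP => // /negbT w0.
have x0 : x != 0 by apply: contra w0 => /eqP ->.
rewrite invN_real.
have : Im (T (- x^-1)) = 0.
  apply: (et_Im0 et); have [xp|xn] := ltP 0 x.
    by left; rewrite lerN2 invf_ge1.
  by right; rewrite oppr_ge0 invr_le0.
rewrite /extrace; move: (H _) => h IT; have : Im (h - P) = 0 by rewrite !ReImE/= IT subr0.
by case: (h - P) => u v /= ->; rewrite mul0r oppr0.
Qed.

Lemma exK_bdiff (x : R) : x < 1 -> exists2 c : C, c != 0 & cdiff (@cuhp R) exK (Complex x 0) c.
Proof.
move=> x1; have [->|x0] := eqVneq x 0.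
  by exists (-1); [rewrite oppr_eq0 oner_eq0|exact: exK_cdiff0].
have w0 : Complex x 0 != 0 :> C by rewrite eq_complex/= (negbTE x0).
exists (- (phi (- (Complex x 0)^-1) * (Complex x 0) ^- 2) / (H (- (Complex x 0)^-1) - P) ^+ 2).
  rewrite mulf_neq0 ?oppr_eq0 ?mulf_neq0 ?invr_eq0 ?expf_neq0 ?scphi_neq0//.
  by apply: exmap_neq; apply: cuhp_invN; rewrite /cuhp/=.
apply: exK_cdiff_gen => //; [by rewrite /cuhp/=|exact: cuhp_invN|].
rewrite invN_real; apply: exmap_bcdiff => //.
have y1 := x2_gt; have y2 := x23; have y3 := x3_lt0.
have hx : - x^-1 < -1 \/ 0 < - x^-1.
  have [xp|xn] := ltP 0 x.
    by left; rewrite ltrN2 invf_gt1.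
  by right; rewrite oppr_gt0 invr_lt0 lt_neqAle x0.
by rewrite !inE !negb_or; apply/and4P; split; apply/eqP; case: hx => hx; lra.
Qed.

Lemma exK_cts (w : C) : cuhp w -> clim (inear (@cuhp R) w) exK (exK w).
Proof.
move=> cw; have [->|w0] := eqVneq w 0; last exact: exK_clim_neq0.
exact: (cdiff_cts exK_cdiff0).
Qed.

Lemma exK_inj (w v : C) : cuhp w -> cuhp v -> exK w = exK v -> w = v.
Proof.
move=> cw cv; rewrite /exK; have hw := exmap_neq (cuhp_invN cw); have hv := exmap_neq (cuhp_invN cv).
case: eqP => [->|w0]; case: eqP => [-> //|v0].
- by move=> /esym/eqP; rewrite invr_eq0 (negbTE hv).
- by move=> /eqP; rewrite invr_eq0 (negbTE hw).
move=> /invr_inj/addIr/(exmap_inj al01 x2_gt x23 x3_lt0 residue0 (cuhp_invN cw) (cuhp_invN cv)).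
by move=> /oppr_inj/invr_inj.
Qed.

Lemma exK_neq_inf (w : C) : cuhp w -> exK w != (H 0 - P)^-1.
Proof.
move=> cw; have c0 : cuhp (0 : C) by rewrite /cuhp/=.
have h0 := exmap_neq c0; rewrite /exK; have [w0|w0] := eqVneq w 0.
  by rewrite eq_sym invr_eq0.
apply/eqP => /invr_inj/addIr/(exmap_inj al01 x2_gt x23 x3_lt0 residue0 (cuhp_invN cw) c0)/eqP.
by rewrite oppr_eq0 invr_eq0 (negbTE w0).
Qed.

Lemma exK_Im_lt0 (w : C) : cuhp w -> 0 < Im w \/ 1 < Re w -> Im (exK w) < 0.
Proof.
move=> cw wo.
have w0 : w != 0.
  by apply/eqP => w0; case: wo; rewrite w0/= ?ltxx// ltNge ler01.
have inv_Im (z : C) : 0 < Im z -> Im z^-1 < 0.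
  move=> z0; have zn : z != 0 by exact: Im_gt0_neq0.
  have -> : Im z^-1 = - (Im z / cmod z ^+ 2) by case: z {z0 zn} => x y; rewrite sqr_cmod.
  by rewrite oppr_lt0 divr_gt0// exprn_gt0// cmod_gt0.
rewrite /exK (negbTE w0); apply: inv_Im.
suff : 0 < Im (H (- w^-1)) by move: (H _) => h; rewrite !ReImE/= subr0.
have [iw|iw] := ltP 0 (Im w).
  by have [] := exmap_interior al01 x2_gt x23 x3_lt0 residue0 (uhp_invN iw).
case: wo; first by rewrite ltNge iw.
move=> w1; have E : w = Complex (Re w) 0.
  by apply: complex_ext => //=; apply/eqP; rewrite eq_le iw.
rewrite E invN_real; apply: (et_Im_gt0 et); rewrite ltrN2 oppr_lt0 invr_gt0.
by rewrite invf_lt1 ?w1//= (lt_trans _ w1).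
Qed.

End reciprocal_map.

(** * Doubling a map of the quadrant by reflection *)

Section quadrant_reflection.
Variable R : realType.
Local Notation C := (complex R).
Variables (K : C -> C) (kinf q lam : R).
Hypothesis q0 : 0 < q.
Hypothesis lam0 : 0 < lam.
Hypothesis K_cts : forall w, cuhp w -> clim (inear (@cuhp R) w) K (K w).
Hypothesis K_inf : clim (cinf (@cuhp R)) K (Complex kinf 0).
Hypothesis K_diff : forall w, uhp w -> exists2 c : C, c != 0 & cdiff (@uhp R) K w c.
Hypothesis K_bdiff : forall x : R, x < 1 ->
  exists2 c : C, c != 0 & cdiff (@cuhp R) K (Complex x 0) c.
Hypothesis K_real : forall x : R, x <= 1 -> Im (K (Complex x 0)) = 0.
Hypothesis K_Im : forall w, cuhp w -> 0 < Im w \/ 1 < Re w -> Im (K w) < 0.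
Hypothesis K_inj : forall w v, cuhp w -> cuhp v -> K w = K v -> w = v.
Hypothesis K_neq : forall w, cuhp w -> K w != Complex kinf 0.

Let L : C := Complex 0 lam.
Let W (s : C) : C := 1 + Complex q 0 * s ^+ 2.
Let G (s : C) : C := L * K (W s).

(** [W] sends the closed quadrant into the closed half-plane and the imaginary axis into the reals
    up to 1. There K is real, so G is purely imaginary, hence fixed by [refl], and the two halves
    agree. *)
Definition qmap (s : C) : C := if 0 <= Re s then G s else refl (G (refl s)).
Definition sqmap (p : sphere R) : C := if p is Some s then qmap s else L * Complex kinf 0.

Let quad (s : C) := cuhp s /\ 0 <= Re s.

Let ImW (s : C) : Im (W s) = 2 * q * Re s * Im s.
Proof. by rewrite /W expr2 !ReImE/=; ring. Qed.
Let ReW (s : C) : Re (W s) = 1 + q * (Re s ^+ 2 - Im s ^+ 2).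
Proof. by rewrite /W !expr2 !ReImE/=; ring. Qed.

Let W_cuhp (s : C) : quad s -> cuhp (W s).
Proof.
move=> [h1 h2]; rewrite /cuhp/= ImW mulr_ge0// mulr_ge0// mulr_ge0// ltW//.
Qed.

Let W_axis (s : C) : Re s = 0 -> W s = Complex (1 - q * Im s ^+ 2) 0.
Proof. by move=> s0; apply: complex_ext; rewrite ?ReW ?ImW s0/=; ring. Qed.

Let G_axis (s : C) : Re s = 0 -> refl (G s) = G s.
Proof.
move=> s0; have K0 : Im (K (W s)) = 0.
  by rewrite W_axis//; apply: K_real; rewrite gerBl mulr_ge0 ?sqr_ge0 ?ltW.
apply: complex_ext; rewrite ?Re_refl ?Im_refl// /G /L !ReImE/= K0; ring.
Qed.

Let refl_quad (s : C) : cuhp s -> Re s <= 0 -> quad (refl s).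
Proof. by move=> h1 h2; split; rewrite ?/cuhp/= ?Im_refl// Re_refl oppr_ge0. Qed.

Let refl_axis (s : C) : Re s = 0 -> refl s = s.
Proof. by move=> s0; apply: complex_ext; rewrite ?Re_refl ?Im_refl// s0 oppr0. Qed.

Lemma qmap_refl (s : C) : qmap (refl s) = refl (qmap s).
Proof.
rewrite /qmap Re_refl oppr_ge0; have [s0|s0|s0] := ltgtP (Re s) 0.
- by rewrite reflK.
- by rewrite reflK.
- by rewrite G_axis// refl_axis.
Qed.

Let reflB (s t : C) : refl s - refl t = refl (s - t).
Proof. by apply: complex_ext; rewrite !(ReImE, Re_refl, Im_refl)/=; ring. Qed.
Let cmod_refl (s : C) : cmod (refl s) = cmod s.
Proof. by rewrite cmodN cmod_conjc. Qed.

Let W_clim (z : C) : quad z -> W @ inear quad z --> inear (@cuhp R) (W z).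
Proof.
move=> qz A /inearP[e e0 HA].
have /clim_inearP Hc : clim (inear quad z) W (W z).
  apply: climD; first exact: clim_cst.
  apply: climM; first exact: clim_cst.
  by apply: climM; exact: clim_id.
have [d d0 Hd] := Hc e e0.
by apply/inearP; exists d => // v vz qv; apply: HA; [exact: Hd|exact: W_cuhp].
Qed.

Let G_clim (z : C) : quad z -> clim (inear quad z) G (G z).
Proof.
move=> qz; apply: climM; first exact: clim_cst.
exact: clim_comp (W_clim qz) (K_cts (W_cuhp qz)).
Qed.

Lemma sqmap_scts : scts sqmap.
Proof.
split.
  have pos (z : C) : quad z -> clim (inear (@cuhp R) z) qmap (qmap z).
    move=> qz; have [cz rz] := qz; have /clim_inearP Hc := G_clim qz.
    have Ez : qmap z = G z by rewrite /qmap rz.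
    apply/clim_inearP => e e0; have [d d0 Hd] := Hc e e0; rewrite Ez.
    have [r0|r0] := ltP 0 (Re z).
      exists (Num.min d (Re z)); first by rewrite lt_min d0.
      move=> w; rewrite lt_min => /andP[wd wr] cw.
      have w0 : 0 <= Re w.
        have := le_lt_trans (Re_le_cmod _) wr; rewrite !ReImE/= ltr_norml => /andP[h _].
        by apply: ltW; lra.
      by rewrite /qmap w0; apply: Hd.
    have z0 : Re z = 0 by apply/eqP; rewrite eq_le r0.
    exists d => // w wd cw; rewrite /qmap; have [w0|w0] := leP 0 (Re w); first exact: Hd.
    rewrite -(G_axis z0) reflB cmod_refl; apply: Hd; last by apply: refl_quad => //; exact: ltW.
    by rewrite -(refl_axis z0) reflB cmod_refl.
  move=> z cz; have [r0|r0] := leP 0 (Re z); first exact: pos.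
  have qr := refl_quad cz (ltW r0).
  have /clim_inearP Hc := pos _ qr; apply/clim_inearP => e /Hc[d d0 Hd].
  exists d => // w wd cw; have -> : qmap w - qmap z = refl (qmap (refl w) - qmap (refl z)).
    by rewrite -reflB !qmap_refl !reflK.
  rewrite cmod_refl; apply: Hd; first by rewrite reflB cmod_refl.
  by rewrite /cuhp/= Im_refl.
have /climP Hc : clim (cinf quad) G (L * Complex kinf 0).
  apply: climM; first exact: clim_cst.
  apply: clim_comp K_inf => A [N HN]; exists (1 + (1 + `|N|) / q) => w qw wN.
  apply: HN; first exact: W_cuhp.
  have n0 := normr_ge0 N; have w1 : 1 < cmod w.
    by rewrite (le_lt_trans _ wN)// lerDl divr_ge0 ?addr_ge0 ?(ltW q0).
  have w2 : (1 + `|N|) / q < cmod w ^+ 2.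
    rewrite expr2; have w0 : cmod w <= cmod w * cmod w by rewrite ler_peMl ?cmod_ge0// ltW.
    by rewrite (lt_le_trans _ w0)//; lra.
  rewrite ltr_pdivrMr// in w2.
  have h := cmodBD (Complex q 0 * w ^+ 2) 1.
  have E : Complex q 0 * w ^+ 2 + 1 = W w by rewrite /W addrC.
  rewrite E cmodM cmodX cmod_real (gtr0_norm q0) cmod1 in h.
  have := ler_norm N; move: w2 h; rewrite mulrC; move: (q * _) (cmod (W w)) => *; lra.
apply/climP => e /Hc[N HN]; exists N => w cw wN /=; rewrite /qmap.
have [w0|w0] := leP 0 (Re w); first by apply: HN.
have -> : L * Complex kinf 0 = refl (L * Complex kinf 0).
  by apply: complex_ext; rewrite !(Re_refl, Im_refl, ReImE)/=; ring.
rewrite reflB cmod_refl; apply: HN; last by rewrite cmod_refl.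
by apply: refl_quad => //; exact: ltW.
Qed.

(** Extension of K by conjugation. In both quadrants [qmap] is L Kt (W s), so differentiability
    across the imaginary axis reduces to that of [Kt] at real points below 1. *)
Let Kt (w : C) : C := if 0 <= Im w then K w else conjc (K (conjc w)).

Let conjcB (s t : C) : conjc s - conjc t = conjc (s - t).
Proof. by case: s => a b; case: t => c d; apply: complex_ext; rewrite !ReImE/= ?opprB// opprK addrC. Qed.
Let conjcK (s : C) : conjc (conjc s) = s.
Proof. by case: s => a b /=; rewrite opprK. Qed.
Let Im_conjc (s : C) : Im (conjc s) = - Im s. Proof. by case: s. Qed.

Let cdiff_conjc (D : set C) (f : C -> C) (z c : C) : cdiff D f z c ->
  cdiff [set w | D (conjc w)] (fun w => conjc (f (conjc w))) (conjc z) (conjc c).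
Proof.
move=> /cdiffP H; apply/cdiffP => e /H/inearP[d d0 Hd]; apply/inearP; exists d => // w wd Dw.
have E : conjc (f (conjc w)) - conjc (f (conjc (conjc z))) - (w - conjc z) * conjc c =
    conjc (f (conjc w) - f z - (conjc w - z) * c).
  rewrite conjcK; move: (f _) (f _) => [a1 a2] [b1 b2].
  case: w {wd Dw} => w1 w2; case: z {H Hd} => z1 z2; case: c => c1 c2.
  by apply: complex_ext; rewrite !ReImE/=; ring.
have F : cmod (conjc w - z) = cmod (w - conjc z) by rewrite -{1}(conjcK z) conjcB cmod_conjc.
by rewrite E cmod_conjc -F; apply: Hd => //; rewrite F.
Qed.

Let Kt_diff (w : C) : 0 < Im w -> exists2 c : C, c != 0 & cdiff setT Kt w c.
Proof.
move=> iw; have [c c0 /cdiffP cd] := K_diff iw; exists c => //.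
apply/cdiffP => e e0; have /inearP[d d0 Hd] := cd e e0.
apply/inearP; exists (Num.min d (Im w)); first by rewrite lt_min d0.
move=> v; rewrite lt_min => /andP[vd vi] _.
have v0 : 0 < Im v.
  have := le_lt_trans (Im_le_cmod _) vi; rewrite !ReImE/= ltr_norml => /andP[h _].
  by lra.
have -> : Kt v = K v by rewrite /Kt (ltW v0).
have -> : Kt w = K w by rewrite /Kt (ltW iw).
exact: Hd.
Qed.

Let Kt_diffN (w : C) : Im w < 0 -> exists2 c : C, c != 0 & cdiff setT Kt w c.
Proof.
move=> iw; have iw' : 0 < Im (conjc w) by rewrite Im_conjc oppr_gt0.
have [c c0 cd] := K_diff iw'; exists (conjc c); first by rewrite -cmod_gt0 cmod_conjc cmod_gt0.
have /cdiffP {}cd := cdiff_conjc cd; rewrite conjcK in cd.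
apply/cdiffP => e e0; have /inearP[d d0 Hd] := cd e e0.
apply/inearP; exists (Num.min d (- Im w)); first by rewrite lt_min d0 oppr_gt0.
move=> v; rewrite lt_min => /andP[vd vi] _.
have v0 : Im v < 0.
  have := le_lt_trans (Im_le_cmod _) vi; rewrite !ReImE/= ltr_norml => /andP[_ h].
  by lra.
have -> : Kt v = conjc (K (conjc v)) by rewrite /Kt leNgt v0.
have -> : Kt w = conjc (K (conjc w)) by rewrite /Kt leNgt iw.
apply: Hd => //.
by rewrite /uhp/= Im_conjc oppr_gt0.
Qed.

Let Kt_bdiff (x : R) : x < 1 -> exists2 c : C, c != 0 & cdiff setT Kt (Complex x 0) c.
Proof.
move=> x1; have [c c0 cd] := K_bdiff x1; exists c => //.
(* K is real along the axis, so its derivative there is real and the conjugate half has the same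
   one. *)
have cR : Im c = 0.
  have [_ d2] := boundary_pderiv cd.
  have d3 : is_derive x 1 (fun t : R => Im (K (Complex t 0))) 0.
    have nx : \forall t \near x, (cst 0 : R -> R) t = Im (K (Complex t 0)).
      by apply: filterS (lt_nbhsl x1) => t t1; exact/esym/K_real/ltW.
    exact: (near_eq_is_derive nx (is_derive_cst (0 : R) x 1)).
  by case: d2 => _ <-; case: d3.
have cE : conjc c = c by case: c cR {c0 cd} => a b /= ->; rewrite oppr0.
have xE : conjc (Complex x 0) = Complex x 0 :> C by rewrite /= oppr0.
have Kx : conjc (K (Complex x 0)) = K (Complex x 0).
  by have := K_real (ltW x1); case: (K _) => a b /= ->; rewrite oppr0.
have cd' := cdiff_conjc cd; rewrite xE cE in cd'.
move/cdiffP: cd' => cd'; move/cdiffP: cd => cd; apply/cdiffP => e e0.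
have /inearP[d d0 Hd] := cd e e0; have /inearP[d' d'0 Hd'] := cd' e e0.
apply/inearP; exists (Num.min d d'); first by rewrite lt_min d0.
move=> v; rewrite lt_min => /andP[vd vd'] _; rewrite {2}/Kt/= lexx /Kt.
have [v0|v0] := leP 0 (Im v); first exact: Hd.
have := Hd' v vd'; rewrite xE Kx; apply.
by rewrite /cuhp/= Im_conjc oppr_ge0 ltW.
Qed.

Lemma sqmap_diff (s : C) : uhp s ->
  exists2 c : C, c != 0 & cdiff (@uhp R) (fun w => sqmap (Some w)) s c.
Proof.
move=> us; have is0 : 0 < Im s := us.
have s0 : s != 0 by exact: Im_gt0_neq0.
have [c c0 cd] : exists2 c : C, c != 0 & cdiff setT Kt (W s) c.
  have [h|h|h] := ltgtP 0 (Im (W s)); [exact: Kt_diff|exact: Kt_diffN|].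
  have r0 : Re s = 0.
    move/esym/eqP: h; rewrite ImW !mulf_eq0 (gt_eqF is0) orbF (gt_eqF q0) orbF pnatr_eq0/=.
    by move/eqP.
  rewrite W_axis//; apply: Kt_bdiff.
  by rewrite gtrBl mulr_gt0// exprn_gt0.
exists (L * (c * (Complex q 0 * (2 * s)))).
  rewrite !mulf_neq0// ?pnatr_eq0//; first by rewrite eq_complex/= (gt_eqF lam0) andbF.
  by rewrite eq_complex/= (gt_eqF q0).
have E (w : C) : uhp w -> L * Kt (W w) = qmap w.
  move=> uw; have iw : 0 < Im w := uw; rewrite /Kt /qmap ImW.
  have [w0|w0] := leP 0 (Re w).
    by rewrite mulr_ge0 ?(ltW iw)// mulr_ge0// mulr_ge0// ltW.
  rewrite leNgt pmulr_llt0// pmulr_rlt0 ?w0 ?mulr_gt0//=.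
  have -> : conjc (W w) = W (refl w).
    apply: complex_ext; last by rewrite Im_conjc !ImW Re_refl Im_refl; ring.
    have -> : Re (conjc (W w)) = Re (W w) by case: (W w).
    by rewrite !ReW Re_refl Im_refl sqrrN.
  rewrite /G; case: (K _) => a b.
  by apply: complex_ext; rewrite ?Re_refl ?Im_refl /L !ReImE/=; ring.
have dW : cdiff (@uhp R) W s (Complex q 0 * (2 * s)).
  have := cdiffD (cdiff_cst (@uhp R) s 1) (cdiffZ (Complex q 0) (cdiffX 1 (cdiff_id (@uhp R) s))).
  by rewrite add0r expr1 mulr1.
have nT : \forall w \near inear (@uhp R) s, [set: C] (W w) by apply/inearP; exists 1.
have dL := cdiffZ L (cdiff_comp nT dW cd).
apply: (cdiff_eq _ _ dL); last exact: E.
by apply/inearP; exists 1 => // w _ uw; exact: E.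
Qed.

Let qmap_sg (s : C) : quad s -> 0 < Re s -> 0 < Re (qmap s).
Proof.
move=> qs rs; rewrite /qmap (ltW rs) /G /L !ReImE/= mul0r sub0r -mulrN mulr_gt0// oppr_gt0.
apply: K_Im; first exact: W_cuhp.
have [i0|i0] := ltP 0 (Im s); first by left; rewrite ImW !mulr_gt0.
have is0 : Im s = 0 by apply/eqP; rewrite eq_le i0; case: qs.
by right; rewrite ReW is0 expr0n subr0 ltrDl mulr_gt0// exprn_gt0.
Qed.

Let qmap_sgE (s : C) : cuhp s -> Num.sg (Re (qmap s)) = Num.sg (Re s).
Proof.
move=> cs; have [r0|r0|r0] := ltgtP (Re s) 0.
- rewrite (ltr0_sg r0) -(reflK s) qmap_refl Re_refl sgrN gtr0_sg//.
  apply: qmap_sg; first by apply: refl_quad => //; exact: ltW.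
  by rewrite Re_refl oppr_gt0.
- by rewrite (gtr0_sg r0) gtr0_sg// qmap_sg//; split=> //; exact: ltW.
- rewrite r0 sgr0; apply/eqP; rewrite sgr_eq0.
  by have := congr1 (@complex.Re R) (qmap_refl s); rewrite refl_axis// Re_refl => h; apply/eqP; lra.
Qed.

Let qmap_inj_quad (s t : C) : quad s -> quad t -> qmap s = qmap t -> s = t.
Proof.
move=> qs qt; have [cs rs] := qs; have [ct rt] := qt; rewrite /qmap rs rt /G.
have L0 : L != 0 by rewrite eq_complex/= (gt_eqF lam0) andbF.
move=> /(mulfI L0)/(K_inj (W_cuhp qs) (W_cuhp qt))/addrI.
have Q0 : Complex q 0 != 0 :> C by rewrite eq_complex/= (gt_eqF q0).
move=> /(mulfI Q0)/eqP; rewrite eqf_sqr => /orP[/eqP//|/eqP E].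
have ER := congr1 (@complex.Re R) E; have EI := congr1 (@complex.Im R) E.
move: ER EI; rewrite !ReImE/= => ER EI; move: cs ct; rewrite /cuhp/= => cs ct.
by apply: complex_ext; lra.
Qed.

Lemma sqmap_inj (p p' : sphere R) : scuhp p -> scuhp p' -> sqmap p = sqmap p' -> p = p'.
Proof.
have L0 : L != 0 by rewrite eq_complex/= (gt_eqF lam0) andbF.
have inf (s : C) : cuhp s -> qmap s <> L * Complex kinf 0.
  have pos (t : C) : quad t -> qmap t <> L * Complex kinf 0.
    move=> qt; have [ct rt] := qt; rewrite /qmap rt /G => /(mulfI L0) E.
    by have := K_neq (W_cuhp qt); rewrite E eqxx.
  move=> cs; have [r0|r0] := leP 0 (Re s); first exact: pos.
  move=> E; apply: (pos (refl s)); first by apply: refl_quad => //; exact: ltW.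
  rewrite qmap_refl E; apply: complex_ext; rewrite !(Re_refl, Im_refl, ReImE)/=; ring.
have inj (s t : C) : cuhp s -> cuhp t -> qmap s = qmap t -> s = t.
  move=> cs ct E; have sg : Num.sg (Re s) = Num.sg (Re t) by rewrite -(qmap_sgE cs) -(qmap_sgE ct) E.
  have [s0|s0] := leP 0 (Re s).
    apply: qmap_inj_quad => //; split=> //.
    by rewrite -sgr_ge0 -sg sgr_ge0.
  have t0 : Re t < 0 by rewrite -sgr_lt0 -sg sgr_lt0.
  rewrite -(reflK s) -(reflK t); congr refl; apply: qmap_inj_quad.
  - by apply: refl_quad => //; exact: ltW.
  - by apply: refl_quad => //; exact: ltW.
  - by rewrite !qmap_refl E.
case: p p' => [s|] [t|]//= cs ct E.
- by congr Some; exact: inj.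
- by case: (inf s).
- by case: (inf t).
Qed.

End quadrant_reflection.

Section trapezoid_regions.
Variable R : realType.
Local Notation C := (complex R).
Implicit Types (c d t : R) (z w : C).

Definition trcl c d : set C := [set z | [/\ -1 <= Im z, Im z <= 0,
  Re z + (d - c) * Im z <= c & - Re z + (d - c) * Im z <= c]].
Definition trin c d : set C := [set z | [/\ -1 < Im z, Im z < 0,
  Re z + (d - c) * Im z < c & - Re z + (d - c) * Im z < c]].

Lemma trcl_refl c d z : trcl c d z -> trcl c d (refl z).
Proof. by move=> [h1 h2 h3 h4]; split; rewrite ?Re_refl ?Im_refl ?opprK. Qed.

Lemma trcl_convex c d z w t : trcl c d z -> trcl c d w -> 0 <= t <= 1 ->
  trcl c d (z + Complex t 0 * (w - z)).
Proof.
move=> [a1 a2 a3 a4] [b1 b2 b3 b4] /andP[t0 t1].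
have -> : z + Complex t 0 * (w - z) = Complex ((1 - t) * Re z + t * Re w) ((1 - t) * Im z + t * Im w).
  by apply: complex_ext; rewrite !ReImE/=; ring.
have t1' : 0 <= 1 - t by rewrite subr_ge0.
have cv (x y b : R) : x <= b -> y <= b -> (1 - t) * x + t * y <= b.
  move=> xb yb; have h1 := ler_wpM2l t1' xb; have h2 := ler_wpM2l t0 yb; lra.
split=> /=.
- by have := cv (- Im z) (- Im w) 1; lra.
- exact: cv.
- by have := cv _ _ _ a3 b3; lra.
- by have := cv _ _ _ a4 b4; lra.
Qed.

End trapezoid_regions.

(** * The chart of the exterior of the trapezoid *)

Section exterior_chart.
Variable R : realType.
Local Notation C := (complex R).
Variables (al k q : R).
Hypothesis al01 : 0 < al < 1.
Hypothesis k01 : 0 < k < 1.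
Hypothesis q0 : 0 < q.
Hypothesis qE : q ^+ 2 + (1 - 2 * al) * (1 - k ^+ 2) * q = k ^+ 2.

(** [exx2] and [exx3] are the values of - 1 / (1 + q s^2) at s = 1 and s = 1 / k, where q = a^2. *)
Definition exx2 : R := - (1 + q)^-1.
Definition exx3 : R := - (k ^+ 2 / (q + k ^+ 2)).

Let x2_gt : -1 < exx2.
Proof. by rewrite /exx2 ltrN2 invf_lt1 ?ltrDl// addr_gt0. Qed.
Let k2 : 0 < k ^+ 2 < 1.
Proof. by case/andP: k01 => k0 k1; rewrite exprn_gt0//= expr_lt1// ltW. Qed.
Let qk : 0 < q + k ^+ 2.
Proof. by case/andP: k2 => h _; rewrite addr_gt0. Qed.
Let x23 : exx2 < exx3.
Proof.
rewrite /exx2 /exx3 ltrN2 ltr_pdivrMr// mulrC ltr_pdivlMr ?addr_gt0//.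
by case/andP: k2 => h0 h1; have := q0; nra.
Qed.
Let x3_lt0 : exx3 < 0.
Proof. by rewrite /exx3 oppr_lt0 divr_gt0//; case/andP: k2. Qed.
Let residue0 : 2^-1 + al * exx2 + (1 - al) * exx3 = 0.
Proof.
have q1 : 1 + q != 0 by rewrite gt_eqF// addr_gt0.
have qk0 : q + k ^+ 2 != 0 by rewrite gt_eqF.
rewrite /exx2 /exx3.
have -> : 2^-1 + al * - (1 + q)^-1 + (1 - al) * - (k ^+ 2 / (q + k ^+ 2)) =
  (q ^+ 2 + (1 - 2 * al) * (1 - k ^+ 2) * q - k ^+ 2) / (2 * (1 + q) * (q + k ^+ 2)).
  by field; rewrite q1 qk0.
by rewrite qE subrr mul0r.
Qed.

Local Notation H := (@exmap R al exx2 exx3).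
Local Notation T := (extrace al exx2 exx3).

Lemma exterior_trace_residue :
  exterior_trace exx2 exx3 (sin (pi * al)) (cos (pi * al)) (exspeed al exx2 exx3) T.
Proof. exact: ex_exterior_trace al01 x2_gt x23 x3_lt0 residue0. Qed.

Let et := exterior_trace_residue.

(** The horizontal width of the leg, that is the height of the trapezoid before scaling. [exp_] is
    the abscissa that corresponds to the centre of the trapezoid. *)
Definition exlam : R := etX1 T - etX0 T.
Definition exp_ : R := (etX0 T + etX1 T) / 2.
(** In terms of the point z of the exterior this is 1 / (z - excenter), so the point sent to
    infinity becomes a zero, [exJ_pole]. *)
Definition exJ := sqmap (exK al exx2 exx3 exp_) (etX1 T - exp_)^-1 q exlam.
Definition exc : R := etC exx2 T / exlam.
Definition exd : R := etD exx3 T / exlam.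
Definition excenter : C := Complex 0 (- 2^-1).

Lemma exlam_gt0 : 0 < exlam.
Proof. by rewrite subr_gt0; exact: (etX01 et). Qed.

Let p_in : etX0 T < exp_ < etX1 T.
Proof.
have h : etX0 T < etX1 T by exact: (etX01 et).
by rewrite /exp_; apply/andP; split; [exact: (midf_lt h).1|exact: (midf_lt h).2].
Qed.

Let kinfE : (H 0 - Complex exp_ 0)^-1 = Complex (etX1 T - exp_)^-1 0.
Proof.
have -> : H 0 = Complex (etX1 T) 0.
  apply: complex_ext => //; exact: (et_Im0 et (or_intror (lexx 0))).
have n0 : etX1 T - exp_ != 0 by rewrite gt_eqF// subr_gt0; case/andP: p_in.
apply: complex_ext; rewrite /= ?subrr ?expr0n ?addr0 ?mul0r ?oppr0//.
by field.
Qed.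

Let K := exK al exx2 exx3 exp_.
Let K_cts := exK_cts al01 x2_gt x23 x3_lt0 residue0 p_in.
Let K_inf : clim (cinf (@cuhp R)) K (Complex (etX1 T - exp_)^-1 0).
Proof. by rewrite -kinfE; exact: exK_inf. Qed.
Let K_diff := exK_diff al01 x2_gt x23 x3_lt0 residue0 p_in.
Let K_bdiff := exK_bdiff al01 x2_gt x23 x3_lt0 residue0 p_in.
Let K_real (x : R) : x <= 1 -> Im (K (Complex x 0)) = 0.
Proof. exact: exK_real. Qed.
Let K_Im (w : C) : cuhp w -> 0 < Im w \/ 1 < Re w -> Im (K w) < 0.
Proof. exact: exK_Im_lt0. Qed.
Let K_inj := exK_inj al01 x2_gt x23 x3_lt0 residue0 p_in.
Let K_neq (w : C) : cuhp w -> K w != Complex (etX1 T - exp_)^-1 0.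
Proof. by rewrite -kinfE; exact: exK_neq_inf. Qed.

Lemma exJ_scts : scts exJ.
Proof. by apply: sqmap_scts; [exact: q0|exact: K_cts|exact: K_inf|exact: K_real]. Qed.

Lemma exJ_diff (s : C) : uhp s -> exists2 c : C, c != 0 & cdiff (@uhp R) (fun w => exJ (Some w)) s c.
Proof.
by apply: sqmap_diff; [exact: q0|exact: exlam_gt0|exact: K_diff|exact: K_bdiff|exact: K_real].
Qed.

Lemma exJ_inj (p p' : sphere R) : scuhp p -> scuhp p' -> exJ p = exJ p' -> p = p'.
Proof. exact: (sqmap_inj q0 exlam_gt0 K_real K_Im K_inj K_neq). Qed.

Lemma exJ_refl (s : C) : exJ (Some (refl s)) = refl (exJ (Some s)).
Proof. exact: (qmap_refl _ q0 K_real). Qed.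

Lemma exJ_pole : exJ (Some (Complex 0 (Num.sqrt q)^-1)) = 0.
Proof.
rewrite /exJ /sqmap /qmap/= lexx.
have -> : 1 + Complex q 0 * Complex 0 (Num.sqrt q)^-1 ^+ 2 = 0 :> C.
  have sq : (Num.sqrt q)^-1 * (Num.sqrt q)^-1 = q^-1 by rewrite -invfM -expr2 sqr_sqrtr// ltW.
  move: sq; move: (Num.sqrt q)^-1 => i sq.
  apply: complex_ext; rewrite expr2 !ReImE/=; last by ring.
  have -> : 1 + (q * (0 * 0 - i * i) - 0 * (0 * i + i * 0)) = 1 - q * (i * i) by ring.
  by rewrite sq mulfV ?subrr// gt_eqF.
by rewrite /exK eqxx mulr0.
Qed.

(* The plane point with chart value [Complex 0 exlam * (h - exp_)^-1] *)
Local Opaque etX0 etX1 etC etD.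

Let Z (h : C) : C := Complex (Im h / exlam) (- ((Re h - etX0 T) / exlam)).

Let ZE (h : C) : h != Complex exp_ 0 ->
  excenter + (Complex 0 exlam * (h - Complex exp_ 0)^-1)^-1 = Z h.
Proof.
move=> hp; have l0 : exlam != 0 by rewrite gt_eqF// exlam_gt0.
have L0 : Complex 0 exlam != 0 :> C by rewrite eq_complex/= (negbTE l0) andbF.
have E : (Complex 0 exlam)^-1 = Complex 0 (- exlam^-1) :> C.
  by apply: (mulfI L0); rewrite mulfV//; apply: complex_ext; rewrite !ReImE/=; field.
rewrite invfM invrK E; apply: complex_ext; rewrite !ReImE/=; first by field.
rewrite /exp_ /exlam in l0 *; move: (etX0 T) (etX1 T) l0 => u v l0.
by field.
Qed.

Let slope : sin (pi * al) * (exd - exc) = cos (pi * al).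
Proof.
have l0 : exlam != 0 by rewrite gt_eqF// exlam_gt0.
rewrite /exd /exc -mulrBl mulrA (et_slope et) -/exlam mulfK//.
Qed.

Lemma exc_gt0 : 0 < exc. Proof. by rewrite divr_gt0 ?exlam_gt0// (etC_gt0 et). Qed.
Lemma exd_gt0 : 0 < exd. Proof. by rewrite divr_gt0 ?exlam_gt0// (etD_gt0 et). Qed.
Lemma exd_exc : exd - exc = cos (pi * al) / sin (pi * al).
Proof. by rewrite -slope mulrAC mulfV ?mul1r// gt_eqF// (et_sa et). Qed.

Let side (h : C) : (Re (Z h) + (exd - exc) * Im (Z h) <= exc) =
  (sin (pi * al) * (Im h - etC exx2 T) <= cos (pi * al) * (Re h - etX0 T)).
Proof.
have l0 := exlam_gt0; have s0 := et_sa et.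
rewrite -subr_ge0 -(subr_ge0 (_ * _)) -slope.
have -> : sin (pi * al) * (exd - exc) * (Re h - etX0 T) - sin (pi * al) * (Im h - etC exx2 T) =
  (sin (pi * al) * exlam) * (exc - (Re (Z h) + (exd - exc) * Im (Z h))).
  have ce : exc * exlam = etC exx2 T by rewrite /exc mulfVK// gt_eqF.
  rewrite -ce /Z/=; move: (exd - exc) exc (etX0 T) (Re h) (Im h) (sin _) exlam l0 => y a b c e f g g0.
  by field; rewrite gt_eqF.
by rewrite pmulr_rge0// mulr_gt0.
Qed.

Lemma excenter_in : trcl exc exd excenter.
Proof.
by have := exc_gt0; have := exd_gt0; split=> /=; lra.
Qed.

Let other (x y : R) : 0 <= x -> -1 <= y -> y <= 0 -> - x + (exd - exc) * y <= exc.
Proof. by move=> x0 y1 y0; have := exc_gt0; have := exd_gt0; nra. Qed.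

Let hP (u : C) : cuhp u -> H u != Complex exp_ 0.
Proof. by move=> cu; rewrite -subr_eq0; exact: (exmap_neq al01 x2_gt x23 x3_lt0 residue0 p_in). Qed.

Let frac (a u v : R) : u < v -> u <= a <= v -> -1 <= - ((a - u) / (v - u)) <= 0.
Proof.
move=> uv /andP[h1 h2]; have l : 0 < v - u by rewrite subr_gt0.
by rewrite lerN2 oppr_le0 divr_ge0 ?(ltW l) ?subr_ge0// ler_pdivrMr// mul1r lerD2r h2.
Qed.

Let Z_in (x : R) : -1 <= x <= 0 -> trcl exc exd (Z (T x)).
Proof.
move=> x01; have [h1 h23 h4] := et_trace_range et x01.
have l0 := exlam_gt0.
have /andP[y1 y0] : -1 <= Im (Z (T x)) <= 0 := frac (etX01 et) h23.
split=> //; first by rewrite side.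
by apply: other => //=; rewrite divr_ge0// ltW.
Qed.

Let Z_out (h : C) : et_dom exx2 (sin (pi * al)) (cos (pi * al)) T h -> ~ trcl exc exd (Z h).
Proof.
move=> [_ hh] [h1 h2 h3 h4]; have l0 := exlam_gt0; case: hh => hh.
- by move: h2; rewrite oppr_le0 pmulr_lge0 ?invr_gt0// subr_ge0 leNgt hh.
- by move: h1; rewrite lerN2 ler_pdivrMr// mul1r lerD2r leNgt hh.
- by move: h3; rewrite side leNgt hh.
Qed.

Let Zaxis_out (x : R) : x < -1 \/ 0 < x -> ~ trcl exc exd (Z (T x)).
Proof.
move=> hx [h1 h2 h3 h4]; have l0 := exlam_gt0; case: hx => hx.
  move: h2; rewrite oppr_le0 pmulr_lge0 ?invr_gt0// subr_ge0 leNgt.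
  by rewrite (et_Re_out et (or_introl (lexx (-1))) hx).
move: h1; rewrite lerN2 ler_pdivrMr// mul1r lerD2r leNgt.
by rewrite (et_Re_out et (or_intror (lexx 0)) hx).
Qed.

Let J_quad (s : C) : 0 <= Re s ->
  exJ (Some s) = Complex 0 exlam * K (1 + Complex q 0 * s ^+ 2).
Proof. by move=> rs; rewrite /exJ/= /qmap rs. Qed.

Let refl_inv (j : C) : excenter + (refl j)^-1 = refl (excenter + j^-1).
Proof.
have E : (refl j)^-1 = refl (j^-1) by rewrite /refl invrN; congr (- _); rewrite fmorphV.
by rewrite E; apply: complex_ext; rewrite !(Re_refl, Im_refl, ReImE)/=; ring.
Qed.

Let refl_eq0 (j : C) : (refl j == 0) = (j == 0).
Proof. by rewrite -!cmod_eq0 cmodN cmod_conjc. Qed.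

Lemma exJ_boundary (x : R) : exJ (Some (Complex x 0)) != 0 /\
  trcl exc exd (excenter + (exJ (Some (Complex x 0)))^-1).
Proof.
have pos (y : R) : 0 <= y -> exJ (Some (Complex y 0)) != 0 /\
    trcl exc exd (excenter + (exJ (Some (Complex y 0)))^-1).
  move=> y0; rewrite J_quad//; pose w : R := 1 + q * y ^+ 2.
  have w1 : 1 <= w by rewrite lerDl mulr_ge0 ?sqr_ge0// ltW.
  have w0 : 0 < w by rewrite (lt_le_trans _ w1).
  have -> : 1 + Complex q 0 * Complex y 0 ^+ 2 = Complex w 0 :> C.
    by rewrite /w !expr2; apply: complex_ext; rewrite !ReImE/=; ring.
  have wn : Complex w 0 != 0 :> C by rewrite eq_complex/= (gt_eqF w0).
  have wi : - (Complex w 0)^-1 = Complex (- w^-1) 0 :> C.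
    exact: invN_real.
  rewrite /K /exK (negbTE wn) wi; have cu : cuhp (Complex (- w^-1) 0 : C) by rewrite /cuhp/=.
  rewrite ZE ?hP//; split.
    rewrite mulf_neq0 ?invr_eq0 ?subr_eq0 ?hP// eq_complex/= (gt_eqF exlam_gt0) andbF//.
  by apply: Z_in; rewrite lerN2 oppr_le0 invr_ge0 (ltW w0) invf_le1// w1.
have [x0|x0] := leP 0 x; first exact: pos.
have x0' : 0 <= - x by rewrite oppr_ge0 ltW.
have -> : Complex x 0 = refl (Complex (- x) 0) :> C.
  by apply: complex_ext; rewrite ?Re_refl ?Im_refl/= ?opprK.
have [h1 h2] := pos _ x0'; rewrite exJ_refl refl_eq0 refl_inv; split=> //.
exact: trcl_refl.
Qed.

Lemma exJ_boundaryy : exJ None != 0 /\ trcl exc exd (excenter + (exJ None)^-1).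
Proof.
rewrite /exJ/= -kinfE; have c0 : cuhp (0 : C) by rewrite /cuhp/=.
split.
  by rewrite mulf_neq0 ?invr_eq0 ?subr_eq0 ?hP// eq_complex/= (gt_eqF exlam_gt0) andbF.
rewrite ZE ?hP//; apply: (@Z_in 0); by rewrite lexx lerN10.
Qed.

Lemma exJ_interior (s : C) : uhp s -> exJ (Some s) != 0 ->
  ~ trcl exc exd (excenter + (exJ (Some s))^-1).
Proof.
have pos (t : C) : uhp t -> 0 <= Re t -> exJ (Some t) != 0 ->
    ~ trcl exc exd (excenter + (exJ (Some t))^-1).
  move=> ut rt; rewrite J_quad//; set w := 1 + _.
  have it : 0 < Im t := ut.
  have Iw : Im w = 2 * q * Re t * Im t by rewrite /w expr2 !ReImE/=; ring.
  have Rw : Re w = 1 + q * (Re t ^+ 2 - Im t ^+ 2) by rewrite /w !expr2 !ReImE/=; ring.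
  rewrite /K /exK; have [_|wn] := eqVneq w 0; first by rewrite mulr0 eqxx.
  have cw : cuhp w by rewrite /cuhp/= Iw mulr_ge0 ?(ltW it)// mulr_ge0// mulr_ge0// ltW.
  move=> _; rewrite ZE ?hP//; last exact: cuhp_invN.
  have [rp|r0] := ltP 0 (Re t).
    apply: Z_out; apply: exmap_interior => //; apply: uhp_invN.
    by rewrite /uhp/= Iw !mulr_gt0.
  have r00 : Re t = 0 by apply/eqP; rewrite eq_le r0.
  have wE : w = Complex (Re w) 0 by apply: complex_ext => //=; rewrite Iw r00 mulr0 mul0r.
  have w1 : Re w < 1.
    by rewrite Rw r00 expr0n/= sub0r gtrDl pmulr_rlt0// oppr_lt0 exprn_gt0.
  have w0 : Re w != 0 by apply: contra_neq wn => h; rewrite wE h.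
  have wi : - (Complex (Re w) 0)^-1 = Complex (- (Re w)^-1) 0 :> C.
    exact: invN_real.
  rewrite wE wi; apply: Zaxis_out; have [wp|wn0] := ltP 0 (Re w).
    by left; rewrite ltrN2 invf_gt1.
  by right; rewrite oppr_gt0 invr_lt0 lt_neqAle w0.
move=> us; have [r0|r0] := leP 0 (Re s); first exact: pos.
rewrite -(reflK s) exJ_refl refl_eq0 refl_inv => j0 h.
apply: (pos (refl s)) => //; first by rewrite /uhp/= Im_refl.
  by rewrite Re_refl oppr_ge0 ltW.
by rewrite -[X in trcl _ _ X]reflK; exact: trcl_refl.
Qed.

(** In this chart the segment from 0 to 1 / (z - excenter) consists of the points from z on, along
    the ray from the centre to infinity. Were one of them a boundary value, z would lie between the
    centre and a point of the closed trapezoid, hence in it by convexity. *)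
Lemma exJ_onto (z : C) : ~ trcl exc exd z -> exists2 s, uhp s & exJ (Some s) = (z - excenter)^-1.
Proof.
move=> zo; have sq : 0 < Num.sqrt q by rewrite sqrtr_gt0.
pose s0 : C := Complex 0 (Num.sqrt q)^-1.
have us0 : uhp s0 by rewrite /uhp/= invr_gt0.
have zc : z - excenter != 0.
  by rewrite subr_eq0; apply/eqP => E; apply: zo; rewrite E; exact: excenter_in.
(* [segment_onto] takes the derivative as a total function: it is chosen where it exists, and 1
   elsewhere. *)
pose dd (s : C) : C := if pselect (uhp s) is left us then xget 0 [set c : C | c != 0 /\ cdiff (@uhp R) (fun w => exJ (Some w)) s c] else 1.
have ddP (s : C) : uhp s -> dd s != 0 /\ cdiff (@uhp R) (fun w => exJ (Some w)) s (dd s).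
  move=> us; rewrite /dd; case: pselect => // us'.
  have [c c0 cd] := exJ_diff us; have X : [set c : C | c != 0 /\ cdiff (@uhp R) (fun w => exJ (Some w)) s c] c by [].
  exact: (xgetPex 0 (ex_intro _ c X)).
have av (j : C) (t : R) : j != 0 -> trcl exc exd (excenter + j^-1) -> 0 <= t <= 1 ->
    j != Complex t 0 * (z - excenter)^-1.
  move=> j0 hj t01; apply/eqP => E; apply: zo.
  have t0 : Complex t 0 != 0 :> C by apply: contraNneq j0 => h; rewrite E h mul0r.
  have := trcl_convex excenter_in hj t01.
  have -> : excenter + Complex t 0 * (excenter + j^-1 - excenter) = z; last by [].
  by rewrite E invfM invrK addrAC subrr add0r mulrA mulfV// mul1r addrC subrK.
have [] := @segment_onto R exJ dd s0 (z - excenter)^-1 exJ_scts.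
- by move=> s us; have [] := ddP s us.
- by move=> s us; have [] := ddP s us.
- exact: us0.
- move=> t t01; rewrite /s0 exJ_pole subr0 add0r; split.
    by have [h1 h2] := exJ_boundaryy; exact: av.
  by move=> x; have [h1 h2] := exJ_boundary x; exact: av.
by move=> s us Es; exists s.
Qed.

Local Transparent etX0 etX1 etC etD.

Lemma exJ_vertices :
  [/\ excenter + (exJ (Some (Complex 1 0)))^-1 = Complex exc 0 :> C &
      excenter + (exJ (Some (Complex k^-1 0)))^-1 = Complex exd (- 1) :> C].
Proof.
case/andP: (k01) => kg0 _; have kn := lt0r_neq0 kg0; have l0 := exlam_gt0.
have E (y w x : R) : 0 <= y -> w = 1 + q * y ^+ 2 -> 0 < w -> x = - w^-1 ->
    excenter + (exJ (Some (Complex y 0)))^-1 = Z (T x).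
  move=> y0 wE w0 ->; rewrite J_quad//.
  have -> : 1 + Complex q 0 * Complex y 0 ^+ 2 = Complex w 0 :> C.
    by rewrite wE !expr2; apply: complex_ext; rewrite !ReImE/=; ring.
  have wn : Complex w 0 != 0 :> C by rewrite eq_complex/= (gt_eqF w0).
  have wi : - (Complex w 0)^-1 = Complex (- w^-1) 0 :> C.
    exact: invN_real.
  rewrite /K /exK (negbTE wn) wi; have cu : cuhp (Complex (- w^-1) 0 : C) by rewrite /cuhp/=.
  by rewrite ZE ?hP.
split.
  rewrite (E _ (1 + q) exx2)//; first last.
  - by rewrite addr_gt0.
  - by rewrite expr1n mulr1.
  have R2 : Re (T exx2) = etX0 T by apply: (et_Re_up et); rewrite lexx andbT ltW.
  by rewrite /Z R2 subrr mul0r oppr0.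
rewrite (E _ (1 + q * k^-1 ^+ 2) exx3)//; first last.
- have -> : 1 + q * k^-1 ^+ 2 = (q + k ^+ 2) / k ^+ 2 by field.
  by rewrite invf_div.
- by rewrite addr_gt0// mulr_gt0// exprn_gt0// invr_gt0.
- by rewrite invr_ge0 ltW.
have R3 : Re (T exx3) = etX1 T by apply: (et_Re_down et); rewrite lexx/= ltW.
rewrite /Z R3; congr Complex; congr (- _).
exact: (divff (lt0r_neq0 l0)).
Qed.

End exterior_chart.

(** * Conformal maps onto rectangles *)

Section compact_inverse.

(** A continuous map from a compact set to a Hausdorff space is closed, and the preimage of a closed
    set under f is the image by F of its preimage under E. *)
Lemma compact_inverse_continuous (T T' U : topologicalType) (K : set T)
    (F : T -> T') (E : T -> U) (f : T' -> U) : hausdorff_space T' -> compact K ->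
  {within K, continuous F} -> {within K, continuous E} ->
  (forall p, K p -> f (F p) = E p) -> {within F @` K, continuous f}.
Proof.
move=> hT cK cF cE fE; apply/continuous_closedP => B cB.
have /closed_subspaceP[V cV VK] := (continuous_closedP _).1 cE B cB.
apply/closed_subspaceP; exists (F @` (V `&` K)).
  apply: compact_closed => //; apply: continuous_compact.
    by apply: continuous_subspaceW cF => p [].
  by rewrite setIC; apply: compact_closedI.
apply/seteqP; split=> y [].
  move=> [p [Vp Kp] <-] Ky; split=> //.
  change (B (f (F p))); rewrite fE//.
  by have : (V `&` K) p by []; rewrite VK => -[].
move=> By [p Kp Ep]; rewrite -Ep in By *; split; last by exists p.
by exists p => //; rewrite VK; split=> //; change (B (E p)); rewrite -fE.
Qed.

End compact_inverse.

Section conformal_inverse.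
Variable R : realType.
Local Notation C := (complex R).

Definition suhp : set (sphere R) := [set p | if p is Some z then 0 < Im (z : C) else False].

Lemma suhp_scuhp : suhp `<=` @scuhp R.
Proof. by case=> //= z; exact: ltW. Qed.

Lemma nbhs_infty (B : set (sphere R)) : nbhs (None : sphere R) B ->
  exists N : R, forall w : C, N < cmod w -> B (Some w).
Proof.
move=> [U /= [cU clU] UB].
have cc : continuous (fun w : plane R => cmod w).
  move=> z; have H : clim (nbhs (z : plane R)) (fun w : C => w) (z : C).
    by apply/climP => e e0; exact: near_plane.
  exact: clim_cmod H.
have : compact ((fun w : plane R => cmod w) @` U).
  by apply: continuous_compact => //; exact: continuous_subspaceT.
move=> /compact_bounded[M [_ HM]]; exists (M + 1) => w wM; apply: UB; left.
exists w => // Uw; have := HM (M + 1); rewrite ltrDl ltr01 => /(_ isT (cmod w)).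
move=> h; have : cmod w <= M + 1 by rewrite -(ger0_norm (cmod_ge0 w)); apply: h; exists w.
by rewrite leNgt wM.
Qed.

Lemma suhp_dense : @scuhp R `<=` closure suhp.
Proof.
move=> [z|] cz B nB.
  have nB' : nbhs (z : plane R) [set w : plane R | B (Some w)] by exact: nB.
  have /nbhs_planeP[e e0 He] := nB'.
  exists (Some (z + Complex 0 (e / 2))); split.
    by rewrite /suhp/= !ReImE/= ltr_wpDl// divr_gt0.
  apply: He; rewrite addrAC subrr add0r cmod_imag gtr0_norm ?divr_gt0//.
  by rewrite ltr_pdivrMr// ltr_pMr// ltr1n.
have [N HN] := nbhs_infty nB; exists (Some (Complex 0 (`|N| + 1))); split.
  by rewrite /suhp/= ltr_wpDl.
apply: HN; rewrite cmod_imag; have h := ler_norm N; have h' := normr_ge0 N.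
by rewrite (@ger0_norm _ (`|N| + 1)); lra.
Qed.

Lemma closure_image_suhp (F : sphere R -> sphere R) : {within @scuhp R, continuous F} ->
  closure (F @` suhp) = F @` @scuhp R.
Proof.
move=> cF; apply/seteqP; split.
  have cl : closed (F @` @scuhp R).
    apply: compact_closed; first exact: sphere_hausdorff.
    by apply: continuous_compact => //; exact: scuhp_compact.
  rewrite [X in _ `<=` X](closure_id _).1//.
  by apply: closureS; move=> _ [p Hp <-]; exists p => //; exact: suhp_scuhp.
move=> _ [p Kp <-] B nB.
have /subspace_continuousP/(_ p Kp) cFp := cF.
have := cFp B nB; rewrite /within/= => nB'.
have [q [uq HB]] := suhp_dense Kp nB'.
by exists (F q); split; [exists q|apply: HB; exact: suhp_scuhp].
Qed.

(** Points near the image of z are images because Phi is open there, and of points near z because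
    the inverse is continuous by compactness. The difference quotient of g is then the ratio of
    those of E and Phi. *)
Lemma inverse_cdiff (Phi E : sphere R -> plane R) (g : C -> C) (z : C) :
  scts Phi -> {in @scuhp R &, injective Phi} ->
  (forall z, uhp z -> exists2 c : C, c != 0 & cdiff (@uhp R) (fun w => Phi (Some w)) z c) ->
  (forall z, uhp z -> exists c : C, cdiff (@uhp R) (fun w => E (Some w)) z c) ->
  (forall p, scuhp p -> g (Phi p) = E p) -> uhp z ->
  exists c : C, cdiff setT g (Phi (Some z)) c.
Proof.
move=> cP iP dP dE gE uz.
have [c c0 [qP [PE qPc]]] := dP z uz; have [e [qE [EE qEc]]] := dE z uz.
exists (e / c); exists (fun w => if w == Phi (Some z) then e / c else
  (g w - g (Phi (Some z))) / (w - Phi (Some z))); split.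
  move=> w _; case: eqP => [->|/eqP h]; first by rewrite !subrr mul0r.
  by rewrite mulrC divfK// subr_eq0.
have qlim : clim (inear (@uhp R) z) (fun w => qE w / qP w) (e / c).
  by apply: climM => //; exact: climV.
pose psi (w : plane R) : sphere R := xget None [set p | scuhp p /\ Phi p = w].
have psiE p : scuhp p -> psi (Phi p) = p.
  move=> Xp; rewrite /psi; case: xgetP => [q _ [Xq Eq]|/(_ p)/= H].
    by apply: iP => //; rewrite inE.
  by exfalso; apply: H; split.
have psic : {within Phi @` @scuhp R, continuous psi}.
  apply: (@compact_inverse_continuous _ _ _ _ Phi id _ (@plane_hausdorff R)) => //.
  - exact: scuhp_compact.
  - exact: scts_within.
  - by apply: continuous_subspaceT => x; exact: cvg_id.
have zX : scuhp (Some z) by exact: ltW.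
pose d (s : C) : C := xget 0 [set c : C | c != 0 /\ cdiff (@uhp R) (fun w => Phi (Some w)) s c].
have dP' (s : C) : uhp s -> d s != 0 /\ cdiff (@uhp R) (fun w => Phi (Some w)) s (d s).
  move=> us; have [c' c'0 ds] := dP s us.
  have X : [set c : C | c != 0 /\ cdiff (@uhp R) (fun w => Phi (Some w)) s c] c' by [].
  exact: (xgetPex 0 (ex_intro _ c' X)).
have [r r0 Hr] := @local_open R (fun w => Phi (Some w)) d z (fun s us => (dP' s us).2)
  (fun s us => (dP' s us).1) uz.
apply/climP => eps eps0; have /climP/(_ _ eps0)/inearP[del del0 Hdel] := qlim.
pose N : set (sphere R) := [set p | if p is Some w then cmod (w - z) < del else False].
have nz : nbhs (psi (Phi (Some z))) N by rewrite psiE//; exact: (near_plane z del0).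
have Px : (Phi @` @scuhp R) (Phi (Some z)) by exists (Some z).
have /subspace_continuousP/(_ _ Px)/(_ N nz) H := psic.
have /nbhs_planeP[r' r'0 Hr'] := H.
apply/inearP; exists (Num.min r r'); first by rewrite lt_min r0.
move=> w; rewrite lt_min => /andP[wr wr'] _.
case: eqP => [_|/eqP wn]; first by rewrite subrr cmod0.
have [v uv Ev] := Hr w wr.
have vX : scuhp (Some v) by exact: ltW.
have Pw : (Phi @` @scuhp R) w by exists (Some v).
have vd : N (psi w) := Hr' w wr' Pw.
rewrite -Ev psiE// in vd.
have vz : v - z != 0 by rewrite subr_eq0; apply: contraNneq wn => vz; rewrite -Ev vz.
have qv : qP v != 0.
  by apply: contraNneq wn => qv0; rewrite -Ev -subr_eq0 PE// qv0 mulr0.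
have gw : g w = E (Some v) by rewrite -Ev gE.
have -> : (g w - g (Phi (Some z))) / (w - Phi (Some z)) = qE v / qP v.
  by rewrite gw gE// -Ev PE// EE//; field; rewrite vz qv.
exact: Hdel.
Qed.

End conformal_inverse.

Section rectangle_maps.
Variable R : realType.
Local Notation C := (complex R).

Record rect_map (E : sphere R -> plane R) (h : R) : Prop := RectMap {
  rm_h : 0 < h;
  rm_scts : scts E;
  rm_inj : {in @scuhp R &, injective E};
  rm_diff : forall z, uhp z -> exists c : C, cdiff (@uhp R) (fun w => E (Some w)) z c;
  rm_open : E @` @suhp R = open_rect h;
  rm_closed : E @` @scuhp R = closed_rect h }.

(** A quarter turn: it exchanges the roles of the sides, inverts the modulus and shifts the vertices
    by one place. *)
Lemma rect_map_rotate (E : sphere R -> plane R) (h : R) : rect_map E h ->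
  rect_map (fun p => (E p - 1) * Complex 0 (- h^-1)) h^-1.
Proof.
move=> [h0 cE iE dE oE cE'].
have hn : h != 0 by rewrite gt_eqF.
have K0 : Complex 0 (- h^-1) != 0 :> C by rewrite eq_complex/= oppr_eq0 invr_eq0 (negbTE hn) andbF.
have RE (w : C) : Re ((w - 1) * Complex 0 (- h^-1)) = Im w / h.
  by rewrite !ReImE/=; ring.
have IE (w : C) : Im ((w - 1) * Complex 0 (- h^-1)) = (1 - Re w) / h.
  by rewrite !ReImE/=; ring.
pose back (w : C) : C := Complex (1 - h * Im w) (h * Re w).
have backK (w : C) : (back w - 1) * Complex 0 (- h^-1) = w.
  apply: complex_ext; rewrite ?RE ?IE /back/=; by field.
split.
- by rewrite invr_gt0.
- have [c1 c2] := cE; split=> [z cz|].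
    by apply: climM; [apply: climB; [exact: c1|exact: clim_cst]|exact: clim_cst].
  by apply: climM; [apply: climB; [exact: c2|exact: clim_cst]|exact: clim_cst].
- by move=> p q Xp Xq /(mulIf K0)/addIr/(iE _ _ Xp Xq).
- move=> z uz; have [c dc] := dE z uz.
  have := cdiffM (cdiffB dc (cdiff_cst _ _ 1)) (cdiff_cst _ _ (Complex 0 (- h^-1))).
  by set c' := (X in cdiff _ _ _ X) => H; exists c'.
- apply/seteqP; split=> [_ [p up <-]|w [/andP[w1 w2] /andP[w3 w4]]].
    have : (E @` @suhp R) (E p) by exists p.
    rewrite oE => -[/andP[e1 e2] /andP[e3 e4]]; split; rewrite ?RE ?IE.
      by rewrite divr_gt0//= ltr_pdivrMr// mul1r.
    by rewrite divr_gt0 ?subr_gt0//= ltr_pdivrMr// mulVf// gtrBl.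
  have : open_rect h (back w).
    split; rewrite /back/=.
      rewrite subr_gt0 gtrBl mulr_gt0// andbT -ltr_pdivlMl// mulr1 w4//.
    by rewrite mulr_gt0//= gtr_pMr.
  by rewrite -oE => -[p up Ep]; exists p => //; rewrite Ep backK.
- apply/seteqP; split=> [_ [p up <-]|w [/andP[w1 w2] /andP[w3 w4]]].
    have : (E @` @scuhp R) (E p) by exists p.
    rewrite cE' => -[/andP[e1 e2] /andP[e3 e4]]; split; rewrite ?RE ?IE.
      by rewrite divr_ge0 ?(ltW h0)//= ler_pdivrMr// mul1r.
    by rewrite divr_ge0 ?subr_ge0 ?(ltW h0)//= ler_pdivrMr// mulVf// gerBl.
  have : closed_rect h (back w).
    split; rewrite /back/=.
      rewrite subr_ge0 gerBl mulr_ge0 ?(ltW h0)// andbT -ler_pdivlMl// mulr1 w4//.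
    by rewrite mulr_ge0 ?(ltW h0)//= ger_pMr.
  by rewrite -cE' => -[p up Ep]; exists p => //; rewrite Ep backK.
Qed.

Section interior.
Variables (Phi E : sphere R -> plane R) (h : R).
Hypothesis cP : scts Phi.
Hypothesis iP : {in @scuhp R &, injective Phi}.
Hypothesis dP : forall z, uhp z ->
  exists2 c : C, c != 0 & cdiff (@uhp R) (fun w => Phi (Some w)) z c.
Hypothesis rE : rect_map E h.

(** The composite of [E] with the inverse of [Phi]; outside the image it takes the default value
    [E None]. *)
Let g (w : C) : C := E (xget None [set p | scuhp p /\ Phi p = w]).

Let gE p : scuhp p -> g (Phi p) = E p.
Proof.
move=> Xp; rewrite /g; congr E; case: xgetP => [q _ [Xq Eq]|/(_ p)/= H].
  by apply: iP => //; rewrite inE.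
by exfalso; apply: H; split.
Qed.

Let g_diff z : uhp z -> exists c : C, cdiff setT g (Phi (Some z)) c.
Proof. by move=> uz; apply: (inverse_cdiff cP iP dP (rm_diff rE) gE uz). Qed.

(* conformal maps in a chart of the sphere with inverse [chi] *)
Lemma chart_conformal (chi : plane R -> sphere R) (f : sphere R -> plane R) :
  continuous chi ->
  (forall p, scuhp p -> f (chi (Phi p)) = E p) ->
  holomorphic_on [set chi (Phi p) | p in @suhp R] f ->
  conformal_onto_rect [set chi (Phi p) | p in @suhp R] h f.
Proof.
move=> cchi fE hol.
have cF : {within @scuhp R, continuous (fun p => chi (Phi p))}.
  by move=> p; apply: continuous_comp; [exact: (scts_within cP)|exact: cchi].
have cl : closure [set chi (Phi p) | p in @suhp R] = [set chi (Phi p) | p in @scuhp R].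
  exact: closure_image_suhp cF.
have inj : {in [set chi (Phi p) | p in @scuhp R] &, injective f}.
  move=> x y /set_mem[p Xp <-] /set_mem[q Xq <-]; rewrite !fE// => EE.
  by congr (chi (Phi _)); apply: (rm_inj rE) => //; rewrite inE.
split=> //.
- split.
  + move=> _ [p up <-]; have Xp := suhp_scuhp up; rewrite /= fE//.
    by rewrite -(rm_open rE); exists p.
  + move=> x y /set_mem[p up <-] /set_mem[q uq <-] EE; apply: inj => //; rewrite inE.
      by exists p => //; exact: suhp_scuhp.
    by exists q => //; exact: suhp_scuhp.
  + move=> w; rewrite -(rm_open rE) => -[p up <-]; exists (chi (Phi p)); first by exists p.
    by rewrite fE//; exact: suhp_scuhp.
- rewrite cl; apply: (compact_inverse_continuous (@sphere_hausdorff R) (@scuhp_compact R) cF).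
    exact: (scts_within (rm_scts rE)).
  by move=> p Xp; exact: fE.
- rewrite cl; split=> //.
  + move=> _ [p Xp <-]; rewrite /= fE//.
    by rewrite -(rm_closed rE); exists p.
  + move=> w; rewrite -(rm_closed rE) => -[p up <-]; exists (chi (Phi p)); first by exists p.
    by rewrite fE.
Qed.

Lemma interior_conformal : exists2 f : sphere R -> plane R,
  conformal_onto_rect [set Some (Phi p) | p in @suhp R] h f &
  forall p, scuhp p -> f (Some (Phi p)) = E p.
Proof.
exists (fun x => if x is Some w then g w else 0); last by move=> p Xp; exact: gE.
apply: (@chart_conformal Some) => //.
- exact: one_point_compactification_some_continuous.
- split; last by case.
  move=> z [[q|//] uq [<-]]; have [c dc] := g_diff uq.
  exact: cdiff_derivable dc.
Qed.

(** The inverse of the chart 1 / (z - y), in which infinity is the origin. *)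
Definition inv_chart (y w : plane R) : sphere R := if w == 0 then None else Some (y + w^-1).

Lemma inv_chart_continuous y : continuous (inv_chart y).
Proof.
move=> w B; have [->|w0] := eqVneq w 0.
  rewrite /inv_chart eqxx => nB; have [N HN] := nbhs_infty nB.
  have M0 : 0 < `|N| + cmod y + 1 by rewrite ltr_wpDl// addr_ge0// cmod_ge0.
  apply/nbhs_planeP; exists ((`|N| + cmod y + 1)^-1); first by rewrite invr_gt0.
  move=> v; rewrite subr0 /= => vN; have [v0|v0] := eqVneq v 0; first exact: nbhs_singleton nB.
  apply: HN; have h1 : `|N| + cmod y + 1 < cmod v^-1.
    by rewrite cmodV -[ltLHS]invrK ltf_pV2 ?posrE ?invr_gt0// cmod_gt0.
  have := cmodBD v^-1 y; rewrite [v^-1 + y]addrC; have := ler_norm N.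
  by move: h1; move: (cmod v^-1) (cmod y) (cmod _) => *; lra.
rewrite {1}/inv_chart (negbTE w0) => nB.
have /nbhs_planeP[e e0 He] : nbhs (y + w^-1 : plane R) [set u : plane R | B (Some u)] := nB.
have H : clim (inear setT w) (fun v : C => y + v^-1) (y + w^-1).
  by apply: climD; [exact: clim_cst|apply: climV => //; exact: clim_id].
have /climP/(_ e e0)/inearP[d d0 Hd] := H.
apply/nbhs_planeP; exists (Num.min d (cmod w)); first by rewrite lt_min d0 cmod_gt0.
move=> v; rewrite lt_min => /andP[vd vw]; rewrite /= /inv_chart.
have [v0|v0] := eqVneq v 0; first by move: vw; rewrite v0 sub0r cmodN ltxx.
by apply: He; exact: Hd.
Qed.

Lemma exterior_conformal (y : C) (z0 : C) : uhp z0 -> Phi (Some z0) = 0 ->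
  exists2 f : sphere R -> plane R,
  conformal_onto_rect [set inv_chart y (Phi p) | p in @suhp R] h f &
  forall p, scuhp p -> f (inv_chart y (Phi p)) = E p.
Proof.
move=> uz0 z00.
pose chart (x : sphere R) : C := if x is Some w then (w - y)^-1 else 0.
have chartK w : chart (inv_chart y w) = w.
  rewrite /chart /inv_chart; have [//|w0] := eqVneq w 0.
  by rewrite addrAC subrr add0r invrK.
exists (fun x => g (chart x)); last by move=> p Xp; rewrite chartK gE.
apply: (@chart_conformal (inv_chart y)); first exact: inv_chart_continuous.
  by move=> p Xp; rewrite chartK gE.
split.
  move=> z [[q|//] uq]; rewrite /inv_chart.
  have [//|P0] := eqVneq (Phi (Some q)) 0; move=> [zE].
  have [c dc] := g_diff uq.
  have zy : z - y != 0 by rewrite -zE addrAC subrr add0r invr_eq0.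
  have dV : cdiff setT (fun w : C => (w - y)^-1) z (- 1 / (z - y) ^+ 2).
    have d1 := cdiffB (cdiff_id setT z) (cdiff_cst setT z y); rewrite subr0 in d1.
    exact: (@cdiffV R setT (fun w : C => w - y) z 1 zy d1).
  have PE : Phi (Some q) = (z - y)^-1 by rewrite -zE addrAC subrr add0r invrK.
  rewrite PE in dc.
  have nT : \forall w \near inear setT z, [set: C] ((w - y)^-1) by apply/inearP; exists 1.
  exact: (cdiff_derivable (cdiff_comp nT dV dc)).
(* At infinity the coordinate is w = 1 / z, and the chart reads 1 / (1 / w - y) = w / (1 - w y),
   which is differentiable at 0. *)
move=> _; have [c dc] := g_diff uz0; rewrite z00 in dc.
have dV : cdiff setT (fun w : C => w / (1 - w * y)) 0 1.
  have n1 : 1 - 0 * y != 0 :> C by rewrite mul0r subr0 oner_eq0.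
  have d1 : cdiff setT (fun w : C => 1 - w * y) 0 (0 - (1 * y + 0 * 0)).
    by apply: cdiffB; [exact: cdiff_cst|apply: cdiffM; [exact: cdiff_id|exact: cdiff_cst]].
  have := cdiffM (cdiff_id setT (0 : C)) (@cdiffV R setT (fun w : C => 1 - w * y) 0 _ n1 d1).
  by congr cdiff; rewrite !mul0r subr0 invr1 addr0 mulr1.
have E0 : (0 : C) / (1 - 0 * y) = 0 by rewrite mul0r.
rewrite -E0 in dc.
have nT : \forall w \near inear setT (0 : C), [set: C] (w / (1 - w * y)) by apply/inearP; exists 1.
apply: (@cdiff_derivable R _ 0 (c * 1)).
apply: (cdiff_eq _ _ (cdiff_comp nT dV dc)); last first.
  by rewrite /= mul0r /sphere_inv eqxx.
have y1 : 0 < cmod y + 1 by rewrite ltr_wpDl// cmod_ge0.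
apply/inearP; exists (cmod y + 1)^-1; first by rewrite invr_gt0.
move=> w wy _; rewrite /= /sphere_inv; have [->|w0] := eqVneq w 0; first by rewrite mul0r.
rewrite /chart /=; congr g.
have wy1 : 1 - w * y != 0.
  rewrite subr_eq0; apply/eqP => /(congr1 (@cmod R)); rewrite cmod1 cmodM => H.
  move: wy; rewrite subr0 -[(_ + _)^-1]mul1r ltr_pdivlMr// mulrDr -H mulr1.
  by rewrite ltNge lerDl cmod_ge0.
have -> : w^-1 - y = (1 - w * y) / w by field.
by rewrite invf_div.
Qed.

End interior.
End rectangle_maps.

Lemma scale_unit_lt (R : realType) (x c : R) : 0 < c -> - c < x < c -> 0 < (x + c) / (2 * c) < 1.
Proof.
move=> c0 /andP[h1 h2]; have c2 : 0 < 2 * c by rewrite mulr_gt0.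
by rewrite divr_gt0//= ?ltr_pdivrMr// ?mul1r; lra.
Qed.

Lemma scale_unit_le (R : realType) (x c : R) : 0 < c -> - c <= x <= c -> 0 <= (x + c) / (2 * c) <= 1.
Proof.
move=> c0 /andP[h1 h2]; have c2 : 0 < 2 * c by rewrite mulr_gt0.
by rewrite divr_ge0 ?(ltW c2)//= ?ler_pdivrMr// ?mul1r; lra.
Qed.

(** * The map of the half-plane onto a rectangle *)

Section rectangle_from_half_plane.
Local Opaque tzmap.
Variable R : realType.
Local Notation C := (complex R).
Variable r : R.
Hypothesis r1 : 1 < r.

Let b01 : 0 < (2^-1 : R) < 1.
Proof. by apply/andP; split; lra. Qed.

Local Notation T := (tztrace 2^-1 r).
Let tt := tz_trapezoid_trace b01 r1.
Let rc : R := ttC r T.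
Let rh : R := tth T.
Let c0 : 0 < rc := ttC_gt0 tt.
Let h0 : 0 < rh := tth_gt0 tt.

(** For b = 1/2 the trapezoid is the rectangle of width 2 rc and height rh, symmetric about the
    imaginary axis; it is translated and scaled to width 1. *)
Definition rectE (p : sphere R) : plane R :=
  (tzS 2^-1 r p + Complex rc 0) * Complex (2 * rc)^-1 0.
Definition recth : R := rh / (2 * rc).

Let sin12 : sin (pi * 2^-1) = 1 :> R. Proof. exact: sin_pihalf. Qed.
Let cos12 : cos (pi * 2^-1) = 0 :> R. Proof. exact: cos_pihalf. Qed.

Let c20 : 0 < 2 * rc. Proof. by rewrite mulr_gt0. Qed.
Let c2n : 2 * rc != 0. Proof. by rewrite gt_eqF. Qed.
Let ReE p : Re (rectE p) = (Re (tzS 2^-1 r p) + rc) / (2 * rc).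
Proof. by rewrite /rectE; move: (tzS _ _ _) => z; rewrite !ReImE/=; ring. Qed.
Let ImE p : Im (rectE p) = Im (tzS 2^-1 r p) / (2 * rc).
Proof. by rewrite /rectE; move: (tzS _ _ _) => z; rewrite !ReImE/=; ring. Qed.

Let domE (z : C) : tz_dom 2^-1 r z <-> (- rc < Re z < rc /\ 0 < Im z < rh).
Proof.
rewrite /tz_dom /tt_dom/= sin12 cos12 -/rc -/rh !mul1r !mul0r !subr0; split.
  by move=> [h1 h2 h3 h4]; split; apply/andP; split => //; lra.
by move=> [/andP[h1 h2] /andP[h3 h4]]; split => //; lra.
Qed.

Let back (w : C) : C := Complex (2 * rc * Re w - rc) (2 * rc * Im w).

Let clbox p : scuhp p -> - rc <= Re (tzS 2^-1 r p) <= rc /\ 0 <= Im (tzS 2^-1 r p) <= rh.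
Proof.
have box0 : - rc <= 0 <= rc /\ 0 <= (0 : R) <= rh.
  by rewrite oppr_le0 lexx (ltW c0) (ltW h0).
case: p => [z|] Xp; last exact: box0.
have [iz|iz] := ltP 0 (Im z).
  by have /domE[/andP[h1 h2] /andP[h3 h4]] := tz_interior b01 r1 iz; rewrite !ltW.
have -> : z = Complex (Re z) 0 by apply: complex_ext => //=; move: Xp; rewrite /scuhp/= => Xp; lra.
have := tt_boundary_ge0 tt (Re z); rewrite sin12 cos12 -/rc -/rh !mul1r !mul0r !subr0.
rewrite -[T (Re z)]/(tzS 2^-1 r (Some (Complex (Re z) 0))).
by move: (tzS _ _ _) => w [h1 h2 h3 h4]; rewrite h1 h2; split=> //; apply/andP; split; lra.
Qed.

Let open_sub : rectE @` @suhp R = open_rect recth.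
Proof.
apply/seteqP; split.
  move=> _ [[z|//] uz <-]; have /domE[/andP[h1 h2] /andP[h3 h4]] := tz_interior b01 r1 uz.
  split; rewrite ?ReE ?ImE /=.
    by apply: scale_unit_lt; rewrite ?h1.
  by rewrite divr_gt0//= ltr_pM2r ?invr_gt0.
move=> w [/andP[w1 w2] /andP[w3 w4]].
have : tz_dom 2^-1 r (back w).
  apply/domE; split; apply/andP; split; rewrite /back/=.
  - by rewrite ltrBrDl subrr mulr_gt0.
  - have : 2 * rc * Re w < 2 * rc by rewrite gtr_pMr.
    by lra.
  - by rewrite mulr_gt0.
  - by move: w4; rewrite /recth ltr_pdivlMr// mulrC.
move=> /(tz_onto b01 r1)[z uz Sz]; exists (Some z) => //.
by apply: complex_ext; rewrite ?ReE ?ImE /= Sz /back/=; field; rewrite gt_eqF.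
Qed.

Let closed_sub : rectE @` @scuhp R `<=` closed_rect recth.
Proof.
move=> _ [p /clbox[/andP[h1 h2] /andP[h3 h4]] <-]; split; rewrite ?ReE ?ImE.
  by apply: scale_unit_le; rewrite ?h1.
by rewrite divr_ge0 ?(ltW c20)//= ler_pM2r ?invr_gt0.
Qed.

Let rectE_scts : scts rectE.
Proof.
have [c1 c2] := tzS_scts b01 r1; split=> [z cz|].
  by apply: climM; [apply: climD; [exact: c1|exact: clim_cst]|exact: clim_cst].
by apply: climM; [apply: climD; [exact: c2|exact: clim_cst]|exact: clim_cst].
Qed.

(** The image is compact, hence closed, and contains the open rectangle; every point of the closed
    one is approached by moving it slightly towards the centre. *)
Let closed_sup : closed_rect recth `<=` rectE @` @scuhp R.
Proof.
have cl : closed (rectE @` @scuhp R).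
  apply: compact_closed; first exact: plane_hausdorff.
  apply: continuous_compact; last exact: scuhp_compact.
  exact: scts_within.
have rh0 : 0 < recth by rewrite divr_gt0.
move=> w [/andP[w1 w2] /andP[w3 w4]]; apply: cl => B /nbhs_planeP[e e0 He].
pose ctr : C := Complex 2^-1 (recth / 2).
pose del := Num.min 2^-1 (e / (2 * (cmod (ctr - w) + 1))).
have cm : 0 < cmod (ctr - w) + 1 by rewrite ltr_wpDl// cmod_ge0.
have d0 : 0 < del by rewrite /del lt_min invr_gt0 ltr0n/= divr_gt0// mulr_gt0.
have d1 : del < 1 by rewrite gt_min; apply/orP; left; lra.
pose v := w + Complex del 0 * (ctr - w); exists v; split; last first.
  apply: He; rewrite /v addrAC subrr add0r cmodM cmod_real gtr0_norm//.
  have h1 : del <= e / (2 * (cmod (ctr - w) + 1)) by rewrite ge_min lexx orbT.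
  have h2 : del * (cmod (ctr - w) + 1) <= e / 2.
    apply: (le_trans (ler_wpM2r (ltW cm) h1)).
    by rewrite invfM mulrA mulfVK// gt_eqF.
  have h3 : del * cmod (ctr - w) <= del * (cmod (ctr - w) + 1) by rewrite ler_pM2l// lerDl.
  by apply: (le_lt_trans h3); apply: (le_lt_trans h2); lra.
have : open_rect recth v.
  have -> : v = Complex ((1 - del) * Re w + del * 2^-1) ((1 - del) * Im w + del * (recth / 2)).
    by rewrite /v /ctr; apply: complex_ext; rewrite !ReImE/=; ring.
  have d1' : 0 < 1 - del by rewrite subr_gt0.
  split=> /=; apply/andP; split.
  - by rewrite ltr_wpDl ?mulr_ge0 ?(ltW d1')// mulr_gt0.
  - have k1 : (1 - del) * Re w <= (1 - del) by rewrite ger_pMr.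
    by lra.
  - by rewrite ltr_wpDl ?mulr_ge0 ?(ltW d1')// mulr_gt0// divr_gt0.
  - have k1 : (1 - del) * Im w <= (1 - del) * recth by rewrite ler_pM2l.
    have k2 : 0 < del * recth by rewrite mulr_gt0.
    by move: k1 k2; move: recth (Im w) => x y; lra.
by rewrite -open_sub => -[p up Ep]; exists p => //; exact: suhp_scuhp.
Qed.

Lemma rectE_rect_map : rect_map rectE recth.
Proof.
have K0 : Complex (2 * rc)^-1 0 != 0 :> C by rewrite eq_complex/= invr_eq0 (negbTE c2n).
split.
- by rewrite divr_gt0.
- exact: rectE_scts.
- by move=> p q /set_mem Xp /set_mem Xq /(mulIf K0)/addIr; exact: tz_inj.
- move=> z uz; have dc := tzmap_diff b01 r1 uz.
  have := cdiffM (cdiffD dc (cdiff_cst _ _ (Complex rc 0))) (cdiff_cst _ _ (Complex (2 * rc)^-1 0)).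
  by set c' := (X in cdiff _ _ _ X) => H; exists c'.
- exact: open_sub.
- by apply/seteqP; split; [exact: closed_sub|exact: closed_sup].
Qed.

Let T_r : T r = Complex (- rc) 0.
Proof. by apply: complex_ext => /=; [rewrite opprK|apply: (tt_out_Im tt)]. Qed.
Let T_1 : T 1 = Complex (- rc) rh.
Proof.
have := tt_slope tt; rewrite sin12 cos12 mul0r mul1r oppr0 => /eqP; rewrite subr_eq0 => /eqP E.
apply: complex_ext; last by [].
by rewrite -[RHS]/(- ttC r T) -E /ttD opprK.
Qed.

Lemma rectE_vertices : [/\ rectE (Some (Complex r 0)) = Complex 0 0,
  rectE (Some (Complex (- r) 0)) = Complex 1 0,
  rectE (Some (Complex (-1) 0)) = Complex 1 recth &
  rectE (Some (Complex 1 0)) = Complex 0 recth].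
Proof.
have E x : tzS 2^-1 r (Some (Complex x 0)) = T x := erefl.
have cn : rc != 0 by rewrite gt_eqF.
split; apply: complex_ext; rewrite ?ReE ?ImE E ?(tt_opp tt) ?Re_refl ?Im_refl ?T_r ?T_1 /recth /=;
  by field.
Qed.

End rectangle_from_half_plane.

(** * The map onto the interior of the trapezoid *)

Section interior_chart.
Variable R : realType.
Local Notation C := (complex R).
Variables (al r : R).
Hypothesis al01 : 0 < al < 1.
Hypothesis r1 : 1 < r.

Let b01 : 0 < 1 - al < 1.
Proof. by case/andP: al01 => a0 a1; apply/andP; split; lra. Qed.

Local Notation T := (tztrace (1 - al) r).
Let tt := tz_trapezoid_trace b01 r1.
Let h : R := tth T.
Let h0 : 0 < h := tth_gt0 tt.

(** The factor - 1 / h gives height 1 and turns the figure upside down, so the side that carried the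
    image of infinity becomes the upper one. The exponent 1 - alpha makes the lower angles equal to
    pi alpha. *)
Definition inPhi (p : sphere R) : plane R := tzS (1 - al) r p * Complex (- h^-1) 0.
Definition inc : R := ttC r T / h.
Definition ind : R := ttD T / h.

Lemma inc_gt0 : 0 < inc. Proof. by rewrite divr_gt0// (ttC_gt0 tt). Qed.
Let s1 : sin (pi * (1 - al)) = sin (pi * al).
Proof. by rewrite mulrBr mulr1 sinB sinpi cospi mul0r sub0r mulN1r opprK. Qed.
Let c1 : cos (pi * (1 - al)) = - cos (pi * al).
Proof. by rewrite mulrBr mulr1 cosB sinpi cospi mul0r addr0 mulN1r. Qed.
Let sa0 : 0 < sin (pi * al). Proof. by rewrite -s1; exact: (tt_sb tt). Qed.

Let hn : h != 0. Proof. by rewrite gt_eqF. Qed.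

Lemma ind_inc : ind - inc = cos (pi * al) / sin (pi * al).
Proof.
have := tt_slope tt; rewrite s1 c1 mulNr [RHS]opprK -/h => E.
have sn : sin (pi * al) != 0 by rewrite gt_eqF.
apply: (mulfI sn); rewrite mulrCA mulfV// mulr1 /ind /inc -mulrBl mulrA E mulfK//.
Qed.

Lemma inPhi_scts : scts inPhi.
Proof.
have [k1 k2] := tzS_scts b01 r1; split=> [z cz|].
  by apply: climM; [exact: k1|exact: clim_cst].
by apply: climM; [exact: k2|exact: clim_cst].
Qed.

Let K0 : Complex (- h^-1) 0 != 0 :> C.
Proof. by rewrite eq_complex/= oppr_eq0 invr_eq0 (negbTE hn). Qed.

Lemma inPhi_inj : {in @scuhp R &, injective inPhi}.
Proof. by move=> p q /set_mem Xp /set_mem Xq /(mulIf K0); exact: tz_inj. Qed.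

Lemma inPhi_diff (z : C) : uhp z ->
  exists2 c : C, c != 0 & cdiff (@uhp R) (fun w => inPhi (Some w)) z c.
Proof.
move=> uz; have := cdiffM (tzmap_diff b01 r1 uz) (cdiff_cst _ _ (Complex (- h^-1) 0)).
set c := (X in cdiff _ _ _ X) => H; exists c; last exact: H.
have -> : c = tzphi (1 - al) r z * Complex (- h^-1) 0.
  by rewrite /c; move: (tzmap _ _ _) => t; rewrite mulr0 addr0.
by apply: mulf_neq0; [exact: scphi_neq0|exact: K0].
Qed.

Let domE (w : C) : tz_dom (1 - al) r w <-> trin inc ind (w * Complex (- h^-1) 0).
Proof.
rewrite /tz_dom /tt_dom /trin/= s1 c1 -/h ind_inc.
have -> : Re (w * Complex (- h^-1) 0) = - (Re w / h) by rewrite !ReImE/=; ring.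
have -> : Im (w * Complex (- h^-1) 0) = - (Im w / h) by rewrite !ReImE/=; ring.
have sn : sin (pi * al) != 0 by rewrite gt_eqF.
have E1 : sin (pi * al) * Re w - - cos (pi * al) * Im w + sin (pi * al) * ttC r T =
    (inc - (- (Re w / h) + cos (pi * al) / sin (pi * al) * - (Im w / h))) * (sin (pi * al) * h).
  by rewrite /inc; move: (sin _) sn (cos _) h hn (ttC _ _) => s sn c h' hn' t; field; rewrite sn hn'.
have E2 : - (sin (pi * al) * Re w) - - cos (pi * al) * Im w + sin (pi * al) * ttC r T =
    (inc - (- - (Re w / h) + cos (pi * al) / sin (pi * al) * - (Im w / h))) * (sin (pi * al) * h).
  by rewrite /inc; move: (sin _) sn (cos _) h hn (ttC _ _) => s sn c h' hn' t; field; rewrite sn hn'.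
have P : 0 < sin (pi * al) * h by rewrite mulr_gt0.
rewrite E1 E2 !pmulr_lgt0// !subr_gt0 ltrN2 oppr_lt0 ltr_pdivrMr// mul1r.
by rewrite pmulr_lgt0 ?invr_gt0//; split=> -[].
Qed.

Lemma inPhi_image : inPhi @` @suhp R = trin inc ind.
Proof.
apply/seteqP; split.
  by move=> _ [[z|//] uz <-]; apply/domE; exact: tz_interior.
move=> w Dw; pose v := w / Complex (- h^-1) 0.
have vw : v * Complex (- h^-1) 0 = w by rewrite mulfVK.
have : tz_dom (1 - al) r v by apply/domE; rewrite vw.
by move=> /(tz_onto b01 r1)[z uz Sz]; exists (Some z) => //; rewrite /inPhi/= Sz.
Qed.

Lemma inPhi_vertices : [/\ inPhi (Some (Complex r 0)) = Complex inc 0,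
  inPhi (Some (Complex (- r) 0)) = Complex (- inc) 0,
  inPhi (Some (Complex (-1) 0)) = Complex (- ind) (-1) &
  inPhi (Some (Complex 1 0)) = Complex ind (-1)].
Proof.
have E x : tzS (1 - al) r (Some (Complex x 0)) = T x := erefl.
have T_r : T r = Complex (- ttC r T) 0.
  by apply: complex_ext => /=; [rewrite opprK|apply: (tt_out_Im tt)].
have T_1 : T 1 = Complex (- ttD T) h.
  by apply: complex_ext => //=; rewrite opprK.
rewrite /inPhi /inc /ind !E !(tt_opp tt) T_r T_1; move: (ttC r T) (ttD T) h hn => c d h' hn'.
split; apply: complex_ext; rewrite /refl !ReImE/=; by field.
Qed.

End interior_chart.

(** * The trapezoidal curve *)

Section trapezoid_curve.
Variable R : realType.
Local Notation C := (complex R).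

Definition halfplane (p q b : R) : set C := [set z | p * Re z + q * Im z < b].

Lemma halfplane_open (p q b : R) : open (halfplane p q b : set (plane R)).
Proof.
rewrite openE => z /= hz; rewrite /halfplane/= in hz.
pose N := `|p| + `|q| + 1; have N0 : 0 < N by rewrite ltr_wpDl// addr_ge0.
apply/nbhs_planeP; exists ((b - (p * Re z + q * Im z)) / N); first by rewrite divr_gt0 ?subr_gt0.
move=> w; rewrite ltr_pdivlMr// => wz; rewrite /halfplane/=.
have h1 : p * (Re w - Re z) <= `|p| * cmod (w - z).
  rewrite (le_trans (ler_norm _))// normrM ler_wpM2l//.
  by rewrite (le_trans _ (Re_le_cmod _))// !ReImE.
have h2 : q * (Im w - Im z) <= `|q| * cmod (w - z).
  rewrite (le_trans (ler_norm _))// normrM ler_wpM2l//.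
  by rewrite (le_trans _ (Im_le_cmod _))// !ReImE.
have h3 := cmod_ge0 (w - z).
by move: wz h1 h2 h3; rewrite /N; move: (cmod _) => m; lra.
Qed.

Variables (c d : R).
Hypothesis c0 : 0 < c.
Hypothesis d0 : 0 < d.

Local Notation L := (trapezoid c d).
Local Notation cl := (trcl c d).
Local Notation int := (trin c d).

Lemma trin_halfplanes : int = halfplane 0 (-1) 1 `&` halfplane 0 1 0
  `&` halfplane 1 (d - c) c `&` halfplane (-1) (d - c) c.
Proof.
rewrite /trin /halfplane; apply/seteqP; split=> z /=.
  by move=> [h1 h2 h3 h4]; split; [split; [split|]|]; lra.
by move=> [[[h1 h2] h3] h4]; split; lra.
Qed.

Lemma trcl_halfplanes : cl = ~` (halfplane 0 1 (-1) `|` halfplane 0 (-1) 0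
  `|` halfplane (-1) (c - d) (- c) `|` halfplane 1 (c - d) (- c)).
Proof.
rewrite /trcl /halfplane; apply/seteqP; split=> z /=.
  by move=> [h1 h2 h3 h4] [[[]|]|]; lra.
move=> H; split; rewrite leNgt; apply/negP => h; apply: H.
- by do 3 left; lra.
- by do 2 left; right; lra.
- by left; right; lra.
- by right; lra.
Qed.

Lemma trin_open : open (int : set (plane R)).
Proof. by rewrite trin_halfplanes; do 3 (apply: openI; last exact: halfplane_open); exact: halfplane_open. Qed.

Lemma trcl_closed : closed (cl : set (plane R)).
Proof.
rewrite trcl_halfplanes; apply: open_closedC.
by do 3 (apply: openU; last exact: halfplane_open); exact: halfplane_open.
Qed.

Lemma trcl_compact : compact (cl : set (plane R)).
Proof.
have H := @cball_compact R 0 (c + d + 1).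
apply: (subclosed_compact trcl_closed H) => z [h1 h2 h3 h4] /=; rewrite subr0.
apply: (le_trans (cmod_le_ReIm _)).
have hI : `|Im z| <= 1 by rewrite ler_norml; lra.
have hR : `|Re z| <= c + d.
  have k : 0 <= d * (1 + Im z) + c * - Im z.
    by rewrite addr_ge0// mulr_ge0 ?(ltW c0) ?(ltW d0)//; lra.
  by rewrite ler_norml; lra.
by lra.
Qed.

Lemma trin_trcl : int `<=` cl.
Proof. by move=> z [h1 h2 h3 h4]; split; exact: ltW. Qed.

Lemma segmentC (z w : C) : segment z w = segment w z.
Proof.
suff H (u v : C) : segment u v `<=` segment v u by apply/seteqP; split; exact: H.
move=> _ [t + <-]; rewrite /= in_itv/= => /andP[t0 t1]; exists (1 - t : R).
  by rewrite /= in_itv/= subr_ge0 t1 gerBl.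
by apply: complex_ext; rewrite !ReImE/=; ring.
Qed.

Let seg_ext (z w u : C) (t : R) : 0 <= t <= 1 ->
  Re u = Re z + t * (Re w - Re z) -> Im u = Im z + t * (Im w - Im z) -> segment z w u.
Proof.
move=> t01 ER EI; exists t; first by rewrite /= in_itv/=.
by apply: complex_ext; rewrite ?ER ?EI !ReImE/=; ring.
Qed.

Lemma trapezoid_boundary : L = cl `\` int.
Proof.
rewrite /trapezoid /polygon4; apply/seteqP; split=> z.
  have E (u v : C) (t : R) : u + Complex t 0 * (v - u) =
      Complex (Re u + t * (Re v - Re u)) (Im u + t * (Im v - Im u)).
    by apply: complex_ext; rewrite !ReImE/=; ring.
  have c1 := c0; have d1 := d0.
  move=> [[[|]|]|] [t + <-]; rewrite /= in_itv/= => /andP[t0 t1]; rewrite E /=;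
    have td : 0 <= t * d by [rewrite mulr_ge0 ?(ltW d1)];
    have tc : 0 <= t * c by [rewrite mulr_ge0 ?(ltW c1)];
    have td' : 0 <= (1 - t) * d by [rewrite mulr_ge0 ?(ltW d1)// subr_ge0];
    have tc' : 0 <= (1 - t) * c by [rewrite mulr_ge0 ?(ltW c1)// subr_ge0];
    (split; [split=> /=; lra|move=> [/= h1 h2 h3 h4]; lra]).
move=> [[h1 h2 h3 h4] nI].
have [e1|n1] := eqVneq (Im z) (-1).
  right; apply: (seg_ext (t := (d - Re z) / (2 * d))); rewrite /= ?e1.
  - have d2 : 0 < 2 * d by rewrite mulr_gt0.
    by rewrite e1 in h3 h4; rewrite divr_ge0 ?ler_pdivrMr ?(ltW d2)//; lra.
  - by field; rewrite gt_eqF.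
  - by ring.
have [e2|n2] := eqVneq (Im z) 0.
  left; left; right; apply: (seg_ext (t := (Re z + c) / (2 * c))); rewrite /= ?e2.
  - have c2 : 0 < 2 * c by rewrite mulr_gt0.
    by rewrite e2 in h3 h4; rewrite divr_ge0 ?ler_pdivrMr ?(ltW c2)//; lra.
  - by field; rewrite gt_eqF.
  - by ring.
have [e3|n3] := eqVneq (Re z + (d - c) * Im z) c.
  left; right; apply: (seg_ext (t := - Im z)); rewrite /=; first by lra.
  - by rewrite -[LHS](addrK ((d - c) * Im z)) e3; ring.
  - by ring.
have [e4|n4] := eqVneq (- Re z + (d - c) * Im z) c.
  left; left; left; apply: (seg_ext (t := 1 + Im z)); rewrite /=; first by lra.
  - have E : Re z = (d - c) * Im z - c by move: e4; lra.
    by rewrite /= E; ring.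
  - by ring.
by exfalso; apply: nI; split; rewrite lt_neqAle ?h1 ?h2 ?h3 ?h4 ?andbT// eq_sym.
Qed.

Definition trext : set (sphere R) := [set None] `|` [set Some z | z in ~` cl].

Hypothesis ext_connected : connected trext.

(** The open trapezoid is open, and within the complement of L it is also the trace of the closed
    one. Its intersection with the component of infinity is thus open and closed there, and misses
    infinity, so it is empty. *)
Lemma trapezoid_exterior : curve_exterior L = trext.
Proof.
rewrite /curve_exterior; set A := ~` to_sphere L.
have subA : trext `<=` A.
  move=> _ [->|[z nz <-]] [w Lw] //= [wz]; apply: nz; rewrite -wz.
  by move: Lw; rewrite trapezoid_boundary => -[].
apply/seteqP; split; last first.
  by apply: connected_component_max => //; left.
set B := connected_component A None.
have BA : B `<=` A by exact: connected_component_sub.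
have BN : B None by apply: connected_component_refl; apply: subA; left.
have Bc : connected B by exact: component_connected.
have dich p : A p -> trext p \/ [set Some z | z in int] p.
  case: p => [z|] Ap; last by left; left.
  have [cz|ncz] := pselect (cl z); last by left; right; exists z.
  right; exists z => //; apply: contrapT => nz; apply: Ap; exists z => //.
  by rewrite trapezoid_boundary.
move=> p Bp; case: (dich p (BA p Bp)) => // Ip; exfalso.
have E1 : B `&` [set Some z | z in int] = B `&` [set Some z | z in cl].
  apply/seteqP; split=> q [Bq [z iz zq]]; split=> //; first by exists z => //; exact: trin_trcl.
  exists z => //; apply: contrapT => nz; apply: (BA q Bq); exists z => //.
  by rewrite trapezoid_boundary.
have : B `&` [set Some z | z in int] = B.
  apply: Bc.
  - by exists p.
  - exists [set Some z | z in int] => //.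
    exact: one_point_compactification_open_some trin_open.
  - exists [set Some z | z in cl]; last exact: E1.
    apply: compact_closed; first exact: sphere_hausdorff.
    exact: (continuous_compact (continuous_subspaceT
      (@one_point_compactification_some_continuous (plane R))) trcl_compact).
move=> E; have : (B `&` [set Some z | z in int]) None by rewrite E.
by move=> [_ [z _]].
Qed.

Lemma trapezoid_interior : curve_interior L = [set Some z | z in int].
Proof.
rewrite /curve_interior trapezoid_exterior; apply/seteqP; split.
  move=> [z|] [Lz Xz]; last by exfalso; apply: Xz; left.
  have [cz|ncz] := pselect (cl z); last by exfalso; apply: Xz; right; exists z.
  exists z => //; apply: contrapT => nz; apply: Lz; exists z => //.
  by rewrite trapezoid_boundary.
move=> _ [z iz <-]; split.
  by move=> [w + [wz]]; rewrite trapezoid_boundary wz => -[].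
move=> [//|[w ncw [wz]]]; apply: ncw; rewrite wz; exact: trin_trcl.
Qed.

End trapezoid_curve.

(** * Parametrization of a quadrilateral and its winding *)

Section quadrilateral_parametrization.
Variable R : realType.
Local Notation C := (complex R).

Let cis (t : R) : C := Complex (cos t) (sin t).

Let cisD (s t : R) : cis (s + t) = cis s * cis t.
Proof. by apply: complex_ext; rewrite !ReImE/= ?cosD ?sinD; ring. Qed.

Let polar (z : C) : z != 0 -> 0 <= Im z -> z = Complex (cmod z) 0 * cis (carg z).
Proof.
move=> z0 iz; have cz : cmod z != 0 by rewrite cmod_eq0.
by apply: complex_ext; rewrite !ReImE/= ?cos_carg ?sin_carg//; field.
Qed.

Let polar_ex (z : C) : z != 0 -> exists t : R, z = Complex (cmod z) 0 * cis t.
Proof.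
move=> z0; have [iz|iz] := leP 0 (Im z); first by exists (carg z); exact: polar.
have z0' : conjc z != 0 by rewrite -cmod_eq0 cmod_conjc cmod_eq0.
have iz' : 0 <= Im (conjc z) by case: z iz {z0 z0'} => a b /= h; rewrite oppr_ge0 ltW.
have := polar z0' iz'; rewrite cmod_conjc => E; exists (- carg (conjc z)).
move: E; move: (cmod z) (carg _) => m t E.
have [E1 E2] := (congr1 (@complex.Re R) E, congr1 (@complex.Im R) E).
case: z {E z0 z0' iz iz'} E1 E2 => a b /= E1 E2.
by apply: complex_ext; rewrite !ReImE/= ?cosN ?sinN; lra.
Qed.

(** For rho = (Q - w) / (P - w), the product of P - w by [lerp rho s] is the point at parameter s of
    the segment from P to Q, seen from w. *)
Let lerp (rho : C) (s : R) : C := 1 + Complex s 0 * (rho - 1).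

Let lerp_Im (rho : C) (s : R) : Im (lerp rho s) = s * Im rho.
Proof. by rewrite /lerp !ReImE/=; ring. Qed.
Let lerp_Re (rho : C) (s : R) : Re (lerp rho s) = 1 + s * (Re rho - 1).
Proof. by rewrite /lerp !ReImE/=; ring. Qed.
Let lerp0 rho : lerp rho 0 = 1.
Proof. by apply: complex_ext; rewrite ?lerp_Re ?lerp_Im/= !mul0r ?addr0. Qed.
Let lerp1 rho : lerp rho 1 = rho.
Proof. by apply: complex_ext; rewrite ?lerp_Re ?lerp_Im/= !mul1r// addrC subrK. Qed.

Let lerp_neq0 (rho : C) (s : R) : 0 < Im rho -> 0 <= s -> lerp rho s != 0.
Proof.
move=> ir; rewrite le_eqVlt => /predU1P[<-|s0]; first by rewrite lerp0 oner_eq0.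
by apply: Im_gt0_neq0; rewrite lerp_Im mulr_gt0.
Qed.

Let carg_scale (x : R) (z : C) : 0 < x -> carg (Complex x 0 * z) = carg z.
Proof.
move=> x0; rewrite /carg cmodM cmod_real (gtr0_norm x0); congr acos.
have -> : Re (Complex x 0 * z) = x * Re z by rewrite !ReImE/=; ring.
by rewrite -mulf_div divff ?mul1r// gt_eqF.
Qed.

Let carg_lerp_lt (rho : C) (s t : R) : 0 < Im rho -> 0 <= s -> s < t ->
  carg (lerp rho s) < carg (lerp rho t).
Proof.
move=> ir s0 st; have t0 : 0 < t by exact: le_lt_trans st.
have E (u : R) : 0 < u -> lerp rho u = Complex u 0 * Complex (u^-1 + (Re rho - 1)) (Im rho).
  by move=> u0; apply: complex_ext; rewrite ?lerp_Re ?lerp_Im !ReImE/=; field; rewrite gt_eqF.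
move: s0; rewrite le_eqVlt => /predU1P[<-|s0].
  rewrite lerp0 -[1]/(Complex 1 0) carg_pos// carg_gt0// lerp_Im mulr_gt0//.
rewrite !E// !carg_scale//; apply: carg_lt => //.
by rewrite ltrD2r ltf_pV2 ?posrE.
Qed.

Let carg_lerp_le (rho : C) (s t : R) : 0 < Im rho -> 0 <= s -> s <= t ->
  carg (lerp rho s) <= carg (lerp rho t).
Proof.
move=> ir s0; rewrite le_eqVlt => /predU1P[->//|st].
by apply/ltW/carg_lerp_lt.
Qed.

(** Clamped parameters write the closed polygonal path as a single continuous formula, without
    gluing four pieces. *)
Let clamp (x : R) : R := Num.max 0 (Num.min x 1).

Let clamp01 x : 0 <= clamp x <= 1.
Proof. by rewrite /clamp le_max lexx/= ge_max ler01 ge_min lexx orbT. Qed.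
Let clamp_le x y : x <= y -> clamp x <= clamp y.
Proof.
move=> xy; rewrite /clamp ge_max !le_max lexx/=; apply/orP; right.
by rewrite le_min !ge_min xy lexx orbT.
Qed.
Let clamp_id x : 0 <= x <= 1 -> clamp x = x.
Proof. by move=> /andP[x0 x1]; rewrite /clamp (min_idPl x1) (max_idPr x0). Qed.
Let clamp_ge1 x : 1 <= x -> clamp x = 1.
Proof. by move=> x1; rewrite /clamp (min_idPr x1) (max_idPr ler01). Qed.
Let clamp_le0 x : x <= 0 -> clamp x = 0.
Proof.
move=> x0; rewrite /clamp (min_idPl (le_trans x0 ler01)); exact/max_idPl.
Qed.

Let clamp_cts (a b : R) : continuous (fun x => clamp (a * x - b)).
Proof.
have E x : clamp x = (`|x| - `|x - 1| + 1) / 2.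
  rewrite /clamp; have [h1|h1] := leP x 0; have [h2|h2] := leP x 1; rewrite ?(min_idPl h2) ?(min_idPr (ltW h2)).
  - by rewrite (max_idPl h1) (ler0_norm h1) ler0_norm; lra.
  - by lra.
  - by rewrite (max_idPr (ltW h1)) (gtr0_norm h1) ler0_norm; lra.
  - by rewrite (max_idPr ler01) (gtr0_norm h1) gtr0_norm; lra.
rewrite (_ : (fun x => _) = fun x => (`|a * x - b| - `|a * x - b - 1| + 1) / 2); last first.
  by apply/funext => x; rewrite E.
have lin (e : R) : continuous (fun x : R => a * x - e).
  by move=> x; apply: cvgB; [apply: cvgM; [exact: cvg_cst|exact: cvg_id]|exact: cvg_cst].
move=> x; apply: cvgM; last exact: cvg_cst.
apply: cvgD; last exact: cvg_cst.
by apply: cvgB; apply: cvg_norm; [exact: lin|rewrite -addrA -opprD; under eq_fun do rewrite -addrA -opprD; exact: lin].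
Qed.

(** A product of equations serves as a family of rewriting rules: on each quarter the parameters of
    earlier sides are 1 and those of later sides are 0. Both [s] and [s - 0] occur, because
    [quad_path] and [arg] write the first parameter differently. *)
Let clq (s : R) : 0 <= s <= 1 ->
  (((clamp s = s) * (clamp (s - 0) = s) * (clamp (s - 1) = 0) * (clamp (s - 2) = 0) * (clamp (s - 3) = 0)) *
  ((clamp (1 + s) = 1) * (clamp (1 + s - 0) = 1) * (clamp (1 + s - 1) = s) * (clamp (1 + s - 2) = 0) * (clamp (1 + s - 3) = 0)) *
  ((clamp (2 + s) = 1) * (clamp (2 + s - 0) = 1) * (clamp (2 + s - 1) = 1) * (clamp (2 + s - 2) = s) * (clamp (2 + s - 3) = 0)) *
  ((clamp (3 + s) = 1) * (clamp (3 + s - 0) = 1) * (clamp (3 + s - 1) = 1) * (clamp (3 + s - 2) = 1) * (clamp (3 + s - 3) = s)))%type.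
Proof.
move=> s01; have /andP[s0 s1] := s01; have c0 := clamp_id s01.
have e (x : R) : x = s -> clamp x = s by move=> ->.
by do ![split]; (first [apply: e; ring | apply: clamp_le0; lra | apply: clamp_ge1; lra]).
Qed.

Variables (A0 A1 A2 A3 : C).

Definition quad_path (t : R) : C :=
  A0 + Complex (clamp (4 * t)) 0 * (A1 - A0) + Complex (clamp (4 * t - 1)) 0 * (A2 - A1)
  + Complex (clamp (4 * t - 2)) 0 * (A3 - A2) + Complex (clamp (4 * t - 3)) 0 * (A0 - A3).

Let piece (P Q : C) (s : R) : C := P + Complex s 0 * (Q - P).

Let quad_piece (s : R) : 0 <= s <= 1 ->
  [/\ quad_path (s / 4) = piece A0 A1 s, quad_path ((1 + s) / 4) = piece A1 A2 s,
      quad_path ((2 + s) / 4) = piece A2 A3 s & quad_path ((3 + s) / 4) = piece A3 A0 s].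
Proof.
move=> s01; have /andP[s0 s1] := s01.
have c0 := clamp_id s01.
have h x : 4 * (x / 4) = x :> R by field.
rewrite /quad_path !h; split.
- rewrite !(clq s01).
  by apply: complex_ext; rewrite !ReImE/=; ring.
- rewrite !(clq s01).
  by apply: complex_ext; rewrite !ReImE/=; ring.
- rewrite !(clq s01).
  by apply: complex_ext; rewrite !ReImE/=; ring.
- rewrite !(clq s01).
  by apply: complex_ext; rewrite !ReImE/=; ring.
Qed.

Let quarter (t : R) : 0 <= t <= 1 -> exists2 s, 0 <= s <= 1 &
  [\/ t = s / 4, t = (1 + s) / 4, t = (2 + s) / 4 | t = (3 + s) / 4].
Proof.
move=> /andP[t0 t1]; have [h1|h1] := lerP t (1 / 4).
  by exists (4 * t); [apply/andP; split; lra|apply: Or41; field].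
have [h2|h2] := lerP t (2 / 4).
  by exists (4 * t - 1); [apply/andP; split; lra|apply: Or42; field].
have [h3|h3] := lerP t (3 / 4).
  by exists (4 * t - 2); [apply/andP; split; lra|apply: Or43; field].
by exists (4 * t - 3); [apply/andP; split; lra|apply: Or44; field].
Qed.

Lemma quad_path_vertices : [/\ quad_path 0 = A0, quad_path (1 / 4) = A1,
  quad_path (2 / 4) = A2, quad_path (3 / 4) = A3 & quad_path 1 = A0].
Proof.
have h0 : 0 <= (0 : R) <= 1 by rewrite lexx ler01.
have h1 : 0 <= (1 : R) <= 1 by rewrite lexx ler01.
have [e0 e1 e2 e3] := quad_piece h0; have [_ _ _ e4] := quad_piece h1.
have p0 P Q : piece P Q 0 = P by rewrite /piece; apply: complex_ext; rewrite !ReImE/=; ring.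
have p1 P Q : piece P Q 1 = Q by rewrite /piece; apply: complex_ext; rewrite !ReImE/=; ring.
split.
- by rewrite -[RHS](p0 A0 A1) -e0 mul0r.
- by rewrite -[RHS](p0 A1 A2) -e1 addr0.
- by rewrite -[RHS](p0 A2 A3) -e2 addr0.
- by rewrite -[RHS](p0 A3 A0) -e3 addr0.
- by rewrite -[RHS](p1 A3) -e4; congr quad_path; field.
Qed.

Lemma quad_path_image : quad_path @` `[0, 1]%classic = polygon4 A0 A1 A2 A3.
Proof.
apply/seteqP; split.
  move=> _ [t + <-]; rewrite /= in_itv/= => t01; have [s s01] := quarter t01.
  have [e0 e1 e2 e3] := quad_piece s01.
  have s01' : `[0, 1]%classic s by rewrite /= in_itv/=.
  case=> ->; rewrite ?e0 ?e1 ?e2 ?e3.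
  - by left; left; left; exists s.
  - by left; left; right; exists s.
  - by left; right; exists s.
  - by right; exists s.
move=> _ [[[|]|]|] [s + <-]; rewrite /= in_itv/= => s01; have [e0 e1 e2 e3] := quad_piece s01;
  have /andP[s0 s1] := s01.
- by exists (s / 4); [rewrite /= in_itv/=; apply/andP; split; lra|rewrite e0].
- by exists ((1 + s) / 4); [rewrite /= in_itv/=; apply/andP; split; lra|rewrite e1].
- by exists ((2 + s) / 4); [rewrite /= in_itv/=; apply/andP; split; lra|rewrite e2].
- by exists ((3 + s) / 4); [rewrite /= in_itv/=; apply/andP; split; lra|rewrite e3].
Qed.

Let clamp_clim (b t : R) : clim (nbhs t) (fun t => Complex (clamp (4 * t - b)) 0) (Complex (clamp (4 * t - b)) 0).
Proof. by apply: clim_Complex; [exact: clamp_cts|exact: cvg_cst]. Qed.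

Lemma quad_path_continuous : continuous (quad_path : R -> plane R).
Proof.
move=> t; apply/(cvg_clim (F := nbhs t)).
have k b P Q : clim (nbhs t) (fun t => Complex (clamp (4 * t - b)) 0 * (Q - P : C))
    (Complex (clamp (4 * t - b)) 0 * (Q - P)).
  by apply: climM; [exact: clamp_clim|exact: clim_cst].
have E u : quad_path u = A0 + Complex (clamp (4 * u - 0)) 0 * (A1 - A0)
  + Complex (clamp (4 * u - 1)) 0 * (A2 - A1)
  + Complex (clamp (4 * u - 2)) 0 * (A3 - A2) + Complex (clamp (4 * u - 3)) 0 * (A0 - A3).
  by rewrite subr0.
rewrite (funext E); cbv beta.
by do 3 (apply: climD; last exact: k); apply: climD; [exact: clim_cst|exact: k].
Qed.

Section argument.
Variable w : C.
Hypothesis I0 : 0 < Im ((A1 - w) / (A0 - w)).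
Hypothesis I1 : 0 < Im ((A2 - w) / (A1 - w)).
Hypothesis I2 : 0 < Im ((A3 - w) / (A2 - w)).
Hypothesis I3 : 0 < Im ((A0 - w) / (A3 - w)).

Let q0 := (A1 - w) / (A0 - w).
Let q1 := (A2 - w) / (A1 - w).
Let q2 := (A3 - w) / (A2 - w).
Let q3 := (A0 - w) / (A3 - w).

Let den0 (x y : C) : 0 < Im (x / y) -> y != 0.
Proof. by apply: contraTneq => ->; rewrite invr0 mulr0 /= ltxx. Qed.

Let n0 : A0 - w != 0. Proof. exact: den0 I0. Qed.
Let n1 : A1 - w != 0. Proof. exact: den0 I1. Qed.
Let n2 : A2 - w != 0. Proof. exact: den0 I2. Qed.
Let n3 : A3 - w != 0. Proof. exact: den0 I3. Qed.

(** The quotient of [quad_path t - w] by [A0 - w] is a product of four factors, one for each side.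
    The sum of their arguments is a continuous determination of its argument. *)
Let arg (t : R) : R := carg (lerp q0 (clamp (4 * t - 0))) + carg (lerp q1 (clamp (4 * t - 1)))
  + carg (lerp q2 (clamp (4 * t - 2))) + carg (lerp q3 (clamp (4 * t - 3))).

Let mod (t : R) : R := cmod (lerp q0 (clamp (4 * t - 0))) * cmod (lerp q1 (clamp (4 * t - 1)))
  * cmod (lerp q2 (clamp (4 * t - 2))) * cmod (lerp q3 (clamp (4 * t - 3))).

Let cl0 x : 0 <= clamp x. Proof. by have /andP[] := clamp01 x. Qed.

Let lpolar (q : C) (s : R) : 0 < Im q -> 0 <= s ->
  lerp q s = Complex (cmod (lerp q s)) 0 * cis (carg (lerp q s)).
Proof.
move=> iq s0; apply: polar; first exact: lerp_neq0.
by rewrite lerp_Im mulr_ge0// ltW.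
Qed.

Let prod_polar (t : R) : lerp q0 (clamp (4 * t - 0)) * lerp q1 (clamp (4 * t - 1)) *
  lerp q2 (clamp (4 * t - 2)) * lerp q3 (clamp (4 * t - 3)) = Complex (mod t) 0 * cis (arg t).
Proof.
rewrite (lpolar I0 (cl0 _)) (lpolar I1 (cl0 _)) (lpolar I2 (cl0 _)) (lpolar I3 (cl0 _)).
have CM (x y : R) : Complex (x * y) 0 = Complex x 0 * Complex y 0 :> C.
  by apply: complex_ext; rewrite !ReImE/=; ring.
rewrite /arg /mod !cisD !CM; do 4 move: (cis _).
by do 4 move: (Complex _ _); move=> *; ring.
Qed.

Let quad_prod (t : R) : 0 <= t <= 1 -> quad_path t - w = (A0 - w) *
  (lerp q0 (clamp (4 * t - 0)) * lerp q1 (clamp (4 * t - 1)) *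
  lerp q2 (clamp (4 * t - 2)) * lerp q3 (clamp (4 * t - 3))).
Proof.
move=> t01; have [s s01] := quarter t01; have c0 := clamp_id s01.
have /andP[s0 s1] := s01.
have [e0 e1 e2 e3] := quad_piece s01.
have h x : 4 * (x / 4) = x :> R by field.
have st (P Q : C) : P - w != 0 -> piece P Q s - w = (P - w) * lerp ((Q - w) / (P - w)) s.
  by move=> P0; rewrite /piece /lerp; move: (Complex s 0) => u; field.
case=> tE; rewrite tE ?h ?e0 ?e1 ?e2 ?e3 st//.
- rewrite !(clq s01).
  by rewrite !lerp0 !mulr1.
- rewrite !(clq s01).
  rewrite !lerp0 !mulr1 lerp1 mulrA /q0 /q1; congr (_ * _).
  by rewrite mulrC mulfVK.
- rewrite !(clq s01).
  rewrite !lerp0 !mulr1 !lerp1 !mulrA; congr (_ * _).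
  by rewrite /q0 /q1; field; rewrite n0 n1.
- rewrite !(clq s01).
  rewrite !lerp1 !mulrA; congr (_ * _).
  by rewrite /q0 /q1 /q2; field; rewrite n0 n1 n2.
Qed.

(** All four terms are nondecreasing, and the one of the side that contains the parameter s
    increases strictly. *)
Let arg_lt (s t : R) : 0 <= s -> s < t -> t <= 1 -> arg s < arg t.
Proof.
move=> s0 st t1.
have le (q : C) (b : R) : 0 < Im q ->
    carg (lerp q (clamp (4 * s - b))) <= carg (lerp q (clamp (4 * t - b))).
  by move=> iq; apply: carg_lerp_le => //; apply: clamp_le; lra.
have lt (q : C) (b : R) : 0 < Im q -> 0 <= 4 * s - b < 1 ->
    carg (lerp q (clamp (4 * s - b))) < carg (lerp q (clamp (4 * t - b))).
  move=> iq /andP[b0 b1]; apply: carg_lerp_lt => //.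
  rewrite [ltLHS]clamp_id ?b0 ?ltW//.
  have [h|h] := leP 1 (4 * t - b); first by rewrite clamp_ge1.
  by rewrite clamp_id; [lra|apply/andP; split; lra].
have l0 := le q0 0 I0; have l1 := le q1 1 I1; have l2 := le q2 2 I2; have l3 := le q3 3 I3.
rewrite /arg; have [h1|h1] := ltP s (1 / 4).
  by have := lt q0 0 I0 ltac:(apply/andP; split; lra); lra.
have [h2|h2] := ltP s (2 / 4).
  by have := lt q1 1 I1 ltac:(apply/andP; split; lra); lra.
have [h3|h3] := ltP s (3 / 4).
  by have := lt q2 2 I2 ltac:(apply/andP; split; lra); lra.
by have := lt q3 3 I3 ltac:(apply/andP; split; lra); lra.
Qed.

Let arg0 : arg 0 = 0.
Proof.
rewrite /arg mulr0 !clamp_le0 ?subr_le0// !lerp0 -[1]/(Complex 1 0) carg_pos//.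
by rewrite !addr0.
Qed.

Let mod_gt0 (t : R) : 0 < mod t.
Proof. by rewrite /mod !mulr_gt0// cmod_gt0 lerp_neq0. Qed.

Let cis_eq1 (x p : R) : 0 < p -> 0 < x < 4 * pi -> Complex p 0 * cis x = Complex 1 0 -> x = 2 * pi.
Proof.
move=> p0 /andP[x0 x4] E; have pn : p != 0 by rewrite gt_eqF.
have [E1 E2] := (congr1 (@complex.Re R) E, congr1 (@complex.Im R) E).
rewrite !ReImE/= in E1 E2.
have sx : sin x = 0 by apply: (mulfI pn); lra.
have cx : 0 < cos x by rewrite -(pmulr_rgt0 _ p0); lra.
pose y := x / 2.
have xy : x = y + y by rewrite /y; field.
have y0 : 0 < y by rewrite /y; lra.
have y2 : y < 2 * pi by rewrite /y; lra.
have sc : sin y * cos y = 0 by move: sx; rewrite xy sinD; lra.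
have [/eqP sy|sy] := eqVneq (sin y) 0; last first.
  move/eqP: sc; rewrite mulf_eq0 (negbTE sy)/= => /eqP cy.
  move: cx; rewrite xy cosD cy; have := sqr_ge0 (sin y); rewrite expr2; lra.
have [h|h] := ltP y pi.
  have := @sin_gt0_pi R y; rewrite y0 h (eqP sy) ltxx => /(_ isT).
  by [].
have [yp|yp] := eqVneq y pi; first by rewrite xy yp; ring.
have {}h : pi < y by rewrite lt_neqAle eq_sym yp h.
have : 0 < sin (y - pi) by apply: sin_gt0_pi; apply/andP; split; lra.
by rewrite sinB sinpi cospi (eqP sy); lra.
Qed.

(** The path closes up, so the total is a multiple of 2 pi; it is positive, and below 4 pi as a sum
    of four arguments below pi. *)
Let arg1 : arg 1 = 2 * pi.
Proof.
have E := quad_prod (t := 1) ltac:(by rewrite lexx ler01).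
have [_ _ _ _ v1] := quad_path_vertices; rewrite v1 prod_polar in E.
apply: (cis_eq1 (mod_gt0 1)); last first.
  by apply: (mulfI n0); rewrite -E; exact: esym (mulr1 _).
rewrite -[X in X < _]arg0 arg_lt//=.
rewrite /arg mulr1; have c1 b : b <= 3 -> clamp (4 - b) = 1 by move=> hb; apply: clamp_ge1; lra.
rewrite !c1//; try lra; rewrite !lerp1.
have := carg_ltpi I0; have := carg_ltpi I1; have := carg_ltpi I2; have := carg_ltpi I3.
by rewrite -/q0 -/q1 -/q2 -/q3; lra.
Qed.

Lemma quad_path_winds : winds_once quad_path w.
Proof.
have [th0 E0] := polar_ex n0.
exists (fun t => th0 + arg t); split.
- apply: continuous_subspaceT => t; apply: cvgD; first exact: cvg_cst.
  have k (q : C) (b : R) : 0 < Im q ->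
      carg (lerp q (clamp (4 * u - b))) @[u --> t] --> carg (lerp q (clamp (4 * t - b))).
    move=> iq; have := @carg_continuous R _ (lerp_neq0 iq (cl0 (4 * t - b))).
    apply: cvg_comp; apply/cvg_clim; rewrite /lerp.
    apply: climD; first exact: clim_cst.
    by apply: climM; [exact: clamp_clim|exact: clim_cst].
  by do 3 (apply: cvgD; last exact: k); exact: k.
- move=> t; rewrite in_itv/= => t01; have := quad_prod t01; rewrite prod_polar => E.
  have m0 := mod_gt0 t.
  have cE : cmod (quad_path t - w) = cmod (A0 - w) * mod t.
    by rewrite E !cmodM cmod_real (gtr0_norm m0) /cmod/= cos2Dsin2 sqrtr1 mulr1.
  rewrite normc_cmod cE E [in LHS]E0 -/(cis _) cisD; do 2 move: (cis _) => ?.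
  have -> : Complex (cmod (A0 - w) * mod t) 0 = Complex (cmod (A0 - w)) 0 * Complex (mod t) 0 :> C.
    by apply: complex_ext; rewrite !ReImE/=; ring.
  by ring.
- by rewrite arg0 arg1; ring.
Qed.

(** Seen from w, the argument increases strictly and has not yet gained 2 pi before t = 1, so no
    direction occurs twice. *)
Lemma quad_path_inj : {in `[0, 1[ &, injective quad_path}.
Proof.
suff H (s t : R) : 0 <= s -> s < t -> t < 1 -> quad_path s != quad_path t.
  move=> s t; rewrite !in_itv/= => /andP[s0 s1] /andP[t0 t1] E.
  have [st|st|//] := ltgtP s t.
    by move: (H s t s0 st t1); rewrite E eqxx.
  by move: (H t s t0 st s1); rewrite E eqxx.
move=> s0 st t1; apply/eqP => E.
have t0 : 0 <= t by rewrite ltW// (le_lt_trans s0).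
have Es := quad_prod (t := s) ltac:(rewrite s0; lra).
have Et := quad_prod (t := t) ltac:(rewrite t0; lra).
rewrite E in Es; have := etrans (esym Es) Et; rewrite !prod_polar => /(mulfI n0) F.
have h1 := arg_lt s0 st (ltW t1); have h2 := arg_lt t0 t1 (lexx 1).
have h3 : 0 <= arg s by move: s0; rewrite le_eqVlt => /predU1P[<-|s0]; rewrite ?arg0// -arg0 ltW// arg_lt// ltW// (lt_trans st).
rewrite arg1 in h2.
have p0 := @pi_gt0 R.
suff : arg t - arg s = 2 * pi by lra.
apply: (cis_eq1 (p := mod t / mod s)); first by rewrite divr_gt0.
  by apply/andP; split; lra.
have ms := mod_gt0 s; have msn : mod s != 0 by rewrite gt_eqF.
have F' : Complex (mod s) 0 * cis (arg s) = Complex (mod t) 0 * cis (arg s) * cis (arg t - arg s).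
  by rewrite F -mulrA -cisD; congr (_ * cis _); ring.
have cs0 : Complex (mod s) 0 * cis (arg s) != 0.
  rewrite -cmod_eq0 cmodM cmod_real (gtr0_norm ms) /cmod/= cos2Dsin2 sqrtr1 mulr1//.
apply: (mulfI cs0); rewrite -[Complex 1 0]/(1 : C) mulr1 {2}F'.
have CM (x y : R) : Complex (x / y) 0 = Complex x 0 * Complex y^-1 0 :> C.
  by apply: complex_ext; rewrite !ReImE/=; ring.
have CV : Complex (mod s) 0 * Complex (mod s)^-1 0 = 1 :> C.
  by apply: complex_ext; rewrite !ReImE/=; field.
rewrite CM; move: CV; move: (cis (arg s)) (cis _) (Complex (mod s) 0) (Complex (mod t) 0) (Complex (mod s)^-1 0) => x y u v i CV.
by rewrite -[RHS]mul1r -CV; ring.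
Qed.

End argument.

(** Injectivity needs one interior viewpoint, [w0]; the winding condition is checked from every
    interior point. *)
Lemma quad_admissible (L : set (plane R)) (w0 : C) : polygon4 A0 A1 A2 A3 = L ->
  curve_interior L (Some w0) ->
  (forall w, curve_interior L (Some w) ->
    [/\ 0 < Im ((A1 - w) / (A0 - w)), 0 < Im ((A2 - w) / (A1 - w)),
       0 < Im ((A3 - w) / (A2 - w)) & 0 < Im ((A0 - w) / (A3 - w))]) ->
  admissible L A0 A1 A2 A3.
Proof.
move=> LE Lw0 H; have [v0 v1 v2 v3 v4] := quad_path_vertices.
exists quad_path; split; first split.
- split; [|by rewrite v0 v4| |by rewrite -LE quad_path_image].
    by apply: continuous_subspaceT; exact: quad_path_continuous.
  by have [h0 h1 h2 h3] := H w0 Lw0; exact: quad_path_inj h0 h1 h2 h3.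
- by move=> w /H[h0 h1 h2 h3]; exact: quad_path_winds.
exists 0, (1 / 4), (2 / 4), (3 / 4); split => //; try lra.
Qed.

End quadrilateral_parametrization.

(** * Connectedness of the exterior and admissible quadruples *)

Section upper_half_plane_connected.
Variable R : realType.
Local Notation C := (complex R).

Lemma suhp_connected : connected (@suhp R).
Proof.
pose o : C := Complex 0 1.
pose seg (z : C) : set (sphere R) := [set Some (o + Complex t 0 * (z - o)) | t in `[0, 1]%classic].
have -> : @suhp R = \bigcup_(z in @uhp R) seg z.
  apply/seteqP; split.
    move=> [z|//] uz; exists z => //; exists 1; first by rewrite /= in_itv/= lexx ler01.
    by congr Some; apply: complex_ext; rewrite !ReImE/=; ring.
  move=> _ [z uz [t + <-]]; rewrite /= in_itv/= => /andP[t0 t1]; rewrite /suhp.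
  have uz' : 0 < Im z := uz.
  rewrite !ReImE/=.
  have -> : 1 + (t * (Im z - 1) + 0 * (Re z - 0)) = (1 - t) + t * Im z by ring.
  move: t0; rewrite le_eqVlt => /predU1P[<-|t0]; first by rewrite mul0r addr0 subr0 ltr01.
  by rewrite ltr_wpDl ?subr_ge0// mulr_gt0.
apply: bigcup_connected.
  exists (Some o) => z uz; exists 0; first by rewrite /= in_itv/= lexx ler01.
  by congr Some; apply: complex_ext; rewrite !ReImE/=; ring.
move=> z uz; apply: connected_continuous_connected; first exact: segment_connected.
apply: continuous_subspaceT => t.
have k : (fun t : R => o + Complex t 0 * (z - o) : plane R) @ nbhs t --> (o + Complex t 0 * (z - o) : plane R).
  apply/cvg_clim; apply: climD; first exact: clim_cst.
  by apply: climM; [apply: clim_Complex; [exact: cvg_id|exact: cvg_cst]|exact: clim_cst].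
exact: (continuous_comp k (@one_point_compactification_some_continuous (plane R) _)).
Qed.

End upper_half_plane_connected.

Section trapezoid_exterior_chart.
Variable R : realType.
Local Notation C := (complex R).
Variables (al k q : R).
Hypothesis al01 : 0 < al < 1.
Hypothesis k01 : 0 < k < 1.
Hypothesis q0 : 0 < q.
Hypothesis qE : q ^+ 2 + (1 - 2 * al) * (1 - k ^+ 2) * q = k ^+ 2.

Local Notation J := (exJ al k q).
Local Notation y := (excenter R).

Lemma exJ_image : [set inv_chart y (J p) | p in @suhp R] = trext (exc al k q) (exd al k q).
Proof.
apply/seteqP; split.
  move=> _ [[s|//] us <-]; rewrite /inv_chart; case: eqVneq => [_|J0]; first by left.
  by right; exists (y + (J (Some s))^-1) => //; exact: exJ_interior.
move=> _ [->|[z zo <-]].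
  exists (Some (Complex 0 (Num.sqrt q)^-1)); first by rewrite /suhp/= invr_gt0 sqrtr_gt0.
  by rewrite exJ_pole// /inv_chart eqxx.
have [s us Js] := exJ_onto al01 k01 q0 qE zo; exists (Some s) => //.
rewrite Js /inv_chart invr_eq0 subr_eq0; case: eqVneq => [zE|_]; last by rewrite invrK addrC subrK.
by exfalso; apply: zo; rewrite zE; exact: excenter_in.
Qed.

Lemma trext_connected : connected (trext (exc al k q) (exd al k q)).
Proof.
rewrite -exJ_image; apply: connected_continuous_connected; first exact: suhp_connected.
apply: (continuous_subspaceW (@suhp_scuhp R)) => p.
by apply: continuous_comp; [exact: (scts_within (exJ_scts al01 k01 q0 qE))|exact: inv_chart_continuous].
Qed.

End trapezoid_exterior_chart.

Section trapezoid_quadruples.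
Variable R : realType.
Local Notation C := (complex R).
Variables (c d : R).
Hypothesis c0 : 0 < c.
Hypothesis d0 : 0 < d.
Hypothesis ext_connected : connected (trext c d).

Let p1 : C := Complex c 0.
Let p2 : C := Complex (- c) 0.
Let p3 : C := Complex (- d) (- 1).
Let p4 : C := Complex d (- 1).

Let Im_div_gt0 (u v : C) : 0 < Re v * Im u - Im v * Re u -> 0 < Im (u / v).
Proof.
move=> H; have v0 : v != 0.
  by apply: contraTneq H => ->; rewrite /= !mul0r subrr ltxx.
have cv : 0 < cmod v ^+ 2 by rewrite exprn_gt0// cmod_gt0.
rewrite -(pmulr_lgt0 _ cv); set w := u / v.
have uE : u = w * v by rewrite /w mulfVK.
by move: H; rewrite uE !ReImE sqr_cmod; move: (w) => z; lra.
Qed.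

(** A positive imaginary part of the quotient means that the next vertex is reached by a
    counterclockwise turn of less than pi about w: each side has w on its left. *)
Let interior_left (w : C) : curve_interior (trapezoid c d) (Some w) ->
  [/\ 0 < Im ((p2 - w) / (p1 - w)), 0 < Im ((p3 - w) / (p2 - w)),
      0 < Im ((p4 - w) / (p3 - w)) & 0 < Im ((p1 - w) / (p4 - w))].
Proof.
rewrite trapezoid_interior// => -[z [h1 h2 h3 h4] [<-]].
have k1 : 0 < c * - Im z by rewrite mulr_gt0// oppr_gt0.
have k2 : 0 < d * (1 + Im z) by rewrite mulr_gt0//; lra.
by split; apply: Im_div_gt0; rewrite /p1 /p2 /p3 /p4 !ReImE/=; lra.
Qed.

Let center_in : curve_interior (trapezoid c d) (Some (excenter R)).
Proof.
rewrite trapezoid_interior//; exists (excenter R) => //.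
by have := c0; have := d0; split=> /=; lra.
Qed.

Lemma trapezoid_admissible : admissible (trapezoid c d) p1 p2 p3 p4.
Proof.
apply: quad_admissible center_in interior_left.
rewrite /polygon4 /trapezoid /polygon4 -/p1 -/p2 -/p3 -/p4.
rewrite (segmentC p1 p2) (segmentC p2 p3) (segmentC p3 p4) (segmentC p4 p1).
by apply/seteqP; split=> z /=; tauto.
Qed.

Lemma trapezoid_admissible_rot : admissible (trapezoid c d) p2 p3 p4 p1.
Proof.
apply: quad_admissible center_in _; last by move=> w /interior_left[].
rewrite /polygon4 /trapezoid /polygon4 -/p1 -/p2 -/p3 -/p4.
rewrite (segmentC p1 p2) (segmentC p2 p3) (segmentC p3 p4) (segmentC p4 p1).
by apply/seteqP; split=> z /=; tauto.
Qed.

End trapezoid_quadruples.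

(** * Moduli of the two quadrilaterals on both sides of the curve *)

Section trapezoid_moduli.
Variable R : realType.
Local Notation C := (complex R).
Variables (al k q l c d : R).
Hypothesis al01 : 0 < al < 1.
Hypothesis k01 : 0 < k < 1.
Hypothesis l01 : 0 < l < 1.
Hypothesis q0 : 0 < q.
Hypothesis qE : q ^+ 2 + (1 - 2 * al) * (1 - k ^+ 2) * q = k ^+ 2.
Hypothesis cE : exc al k q = c.
Hypothesis dE : exd al k q = d.
Hypothesis cI : inc al l^-1 = c.
Hypothesis dI : ind al l^-1 = d.

Let p1 : C := Complex c 0.
Let p2 : C := Complex (- c) 0.
Let p3 : C := Complex (- d) (- 1).
Let p4 : C := Complex d (- 1).
Let L := trapezoid c d.

Let c0 : 0 < c. Proof. by rewrite -cE exc_gt0. Qed.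
Let d0 : 0 < d. Proof. by rewrite -dE exd_gt0. Qed.
Let conn : connected (trext c d). Proof. by rewrite -cE -dE; exact: trext_connected. Qed.
Let l1 : 1 < l^-1. Proof. by case/andP: l01 => l0 ll; rewrite invf_gt1. Qed.
Let k1 : 1 < k^-1. Proof. by case/andP: k01 => k0 kk; rewrite invf_gt1. Qed.

Let realX (x : R) : scuhp (Some (Complex x 0) : sphere R).
Proof. by rewrite /scuhp/=. Qed.

Let int_modulus (E : sphere R -> plane R) (h : R) (v1 v2 v3 v4 : C) (x1 x2 x3 x4 : R) :
  rect_map E h ->
  inPhi al l^-1 (Some (Complex x1 0)) = v1 -> inPhi al l^-1 (Some (Complex x2 0)) = v2 ->
  inPhi al l^-1 (Some (Complex x3 0)) = v3 -> inPhi al l^-1 (Some (Complex x4 0)) = v4 ->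
  [/\ E (Some (Complex x1 0)) = Complex 0 0, E (Some (Complex x2 0)) = Complex 1 0,
      E (Some (Complex x3 0)) = Complex 1 h & E (Some (Complex x4 0)) = Complex 0 h] ->
  is_modulus (curve_interior L) v1 v2 v3 v4 h.
Proof.
move=> rE e1 e2 e3 e4 [f1 f2 f3 f4]; split; first exact: rm_h rE.
have [f cf fE] := interior_conformal (inPhi_scts al01 l1) (inPhi_inj al01 l1) (inPhi_diff al01 l1) rE.
exists f; split.
  rewrite trapezoid_interior// -cI -dI -(inPhi_image al01 l1).
  by rewrite (_ : [set Some z | z in _] = [set Some (inPhi al l^-1 p) | p in @suhp R])// image_comp.
by rewrite -e1 -e2 -e3 -e4; split; rewrite fE.
Qed.

Let ext_modulus (E : sphere R -> plane R) (h : R) (v1 v2 v3 v4 : C) (x1 x2 x3 x4 : R) :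
  rect_map E h ->
  inv_chart (excenter R) (exJ al k q (Some (Complex x1 0))) = Some v1 ->
  inv_chart (excenter R) (exJ al k q (Some (Complex x2 0))) = Some v2 ->
  inv_chart (excenter R) (exJ al k q (Some (Complex x3 0))) = Some v3 ->
  inv_chart (excenter R) (exJ al k q (Some (Complex x4 0))) = Some v4 ->
  [/\ E (Some (Complex x1 0)) = Complex 0 0, E (Some (Complex x2 0)) = Complex 1 0,
      E (Some (Complex x3 0)) = Complex 1 h & E (Some (Complex x4 0)) = Complex 0 h] ->
  is_modulus (curve_exterior L) v1 v2 v3 v4 h.
Proof.
move=> rE e1 e2 e3 e4 [f1 f2 f3 f4]; split; first exact: rm_h rE.
have iJ : {in @scuhp R &, injective (exJ al k q)}.
  by move=> p p' /set_mem Xp /set_mem Xp'; exact: exJ_inj.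
have uz : uhp (Complex 0 (Num.sqrt q)^-1) by rewrite /uhp/= invr_gt0 sqrtr_gt0.
have [f cf fE] := exterior_conformal (exJ_scts al01 k01 q0 qE) iJ
  (exJ_diff al01 k01 q0 qE) rE (excenter R) uz (exJ_pole al k q0).
exists f; split.
  by rewrite trapezoid_exterior// -cE -dE -exJ_image.
by rewrite -e1 -e2 -e3 -e4; split; rewrite fE.
Qed.

Let in_vertices := inPhi_vertices al01 l1.

Let ex_vertices :
  [/\ inv_chart (excenter R) (exJ al k q (Some (Complex 1 0))) = Some p1,
      inv_chart (excenter R) (exJ al k q (Some (Complex (-1) 0))) = Some p2,
      inv_chart (excenter R) (exJ al k q (Some (Complex (- k^-1) 0))) = Some p3 &
      inv_chart (excenter R) (exJ al k q (Some (Complex k^-1 0))) = Some p4].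
Proof.
have [e1 e2] := exJ_vertices al01 k01 q0 qE; rewrite cE in e1; rewrite dE in e2.
have nz x := (exJ_boundary al01 k01 q0 qE x).1.
have rr x : refl (Complex x 0) = Complex (- x) 0 :> C.
  by apply: complex_ext; rewrite ?Re_refl ?Im_refl.
have J1 := exJ_refl al01 k01 q0 qE (Complex 1 0); have J2 := exJ_refl al01 k01 q0 qE (Complex k^-1 0).
rewrite !rr in J1 J2.
have flip (u v : C) : u != 0 -> excenter R + u^-1 = v -> excenter R + (refl u)^-1 = refl v.
  have E w : refl w = - conjc w by apply: complex_ext; rewrite ?Re_refl ?Im_refl; case: w => a b /=; rewrite ?opprK.
  move=> u0 <-; rewrite !E rmorphD/= fmorphV opprD invrN.
  by congr (_ + _); apply: complex_ext; rewrite /excenter/= ?oppr0 ?opprK.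
have some (u v : C) : u != 0 -> excenter R + u^-1 = v -> inv_chart (excenter R) u = Some v.
  by move=> u0 <-; rewrite /inv_chart (negbTE u0).
have n1 := nz 1; have n2 := nz k^-1; have n3 := nz (-1); have n4 := nz (- k^-1).
move: n1 n2 n3 n4 e1 e2 J1 J2; move: (exJ _ _ _ _) (exJ _ _ _ _) (exJ _ _ _ _) (exJ _ _ _ _).
move=> j1 j2 j3 j4 n1 n2 n3 n4 e1 e2 J1 J2.
split; apply: some => //.
- by rewrite J1 (flip _ _ n1 e1) rr.
- by rewrite J2 (flip _ _ n2 e2); apply: complex_ext; rewrite ?Re_refl ?Im_refl.
Qed.

Let rotate_vertices (E : sphere R -> plane R) (h : R) (x1 x2 x3 x4 : sphere R) : 0 < h ->
  [/\ E x1 = Complex 0 0, E x2 = Complex 1 0, E x3 = Complex 1 h & E x4 = Complex 0 h] ->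
  let E' p := (E p - 1) * Complex 0 (- h^-1) in
  [/\ E' x2 = Complex 0 0, E' x3 = Complex 1 0, E' x4 = Complex 1 h^-1 & E' x1 = Complex 0 h^-1].
Proof.
move=> h0 [e1 e2 e3 e4] /=; have hn : h != 0 by rewrite gt_eqF.
by rewrite e1 e2 e3 e4; split; apply: complex_ext; rewrite !ReImE/=; field.
Qed.

Lemma modulus_ratio_ge : ((recth l^-1 / recth k^-1)%:E <= modulus_ratio_sup L)%E.
Proof.
apply: ereal_sup_ubound; exists p1, p2, p3, p4, (recth l^-1), (recth k^-1).
have [i1 i2 i3 i4] := in_vertices; have [e1 e2 e3 e4] := ex_vertices.
rewrite cI dI in i1 i2 i3 i4.
split => //; first exact: trapezoid_admissible.
  exact: (int_modulus (rectE_rect_map l1) i1 i2 i3 i4 (rectE_vertices l1)).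
exact: (ext_modulus (rectE_rect_map k1) e4 e3 e2 e1 (rectE_vertices k1)).
Qed.

Lemma modulus_ratio_ge' : ((recth k^-1 / recth l^-1)%:E <= modulus_ratio_sup L)%E.
Proof.
have rl := rectE_rect_map l1; have rk := rectE_rect_map k1.
have hk := rm_h rk; have hk' : 0 < (recth k^-1)^-1 by rewrite invr_gt0.
have hk'' : 0 < (recth k^-1)^-1^-1 by rewrite invrK.
(* The exterior quadruple is read in the reverse order, so one shift inside is three shifts outside:
   three quarter turns, hence a modulus inverted three times. *)
apply: ereal_sup_ubound; exists p2, p3, p4, p1, (recth l^-1)^-1, (recth k^-1)^-1^-1^-1.
have [i1 i2 i3 i4] := in_vertices; have [e1 e2 e3 e4] := ex_vertices.
rewrite cI dI in i1 i2 i3 i4.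
split; first exact: trapezoid_admissible_rot.
- exact: (int_modulus (rect_map_rotate rl) i2 i3 i4 i1 (rotate_vertices (rm_h rl) (rectE_vertices l1))).
- apply: (ext_modulus (rect_map_rotate (rect_map_rotate (rect_map_rotate rk))) e1 e4 e3 e2).
  exact: (rotate_vertices hk'' (rotate_vertices hk' (rotate_vertices hk (rectE_vertices k1)))).
- by rewrite !invrK mulrC.
Qed.

End trapezoid_moduli.

(** * Euler integrals *)

Lemma powR_expln (R : realType) (a x : R) : 0 < a -> a `^ x = expR (x * ln a).
Proof. by move=> a0; rewrite /powR gt_eqF. Qed.

Section binomial_series_half.
Variable R : realType.
Implicit Types (n N : nat) (x : R).

(** The coefficients of the binomial series of (1 - x)^(-1/2). *)
Definition bhalf n : R := pochhammer 2^-1 n / n`!%:R.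

Lemma bhalfS n : bhalf n.+1 * n.+1%:R = bhalf n * (2^-1 + n%:R).
Proof.
rewrite /bhalf /pochhammer big_ord_recr/= factS natrM.
have f0 : n`!%:R != 0 :> R by rewrite pnatr_eq0 -lt0n fact_gt0.
have n0 : n.+1%:R != 0 :> R by rewrite pnatr_eq0.
by field; rewrite f0 addrC natr1 n0.
Qed.

Lemma bhalf_ge0 n : 0 <= bhalf n.
Proof. by rewrite divr_ge0// prodr_ge0// => i _; rewrite addr_ge0. Qed.

Lemma bhalf_le1 n : bhalf n <= 1.
Proof.
elim: n => [|n ih]; first by rewrite /bhalf /pochhammer big_ord0 fact0 divr1.
have n0 : 0 < n.+1%:R :> R by rewrite ltr0n.
rewrite -(ler_pM2r n0) bhalfS mul1r.
apply: (@le_trans _ _ (1 * (2^-1 + n%:R))); first by rewrite ler_wpM2r// addr_ge0.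
by have := @natr1 R n; move: n.+1%:R n%:R => u v; lra.
Qed.

Definition bpart N x : R := \sum_(0 <= i < N) bhalf i * x ^+ i.
Definition dbpart N x : R := \sum_(0 <= i < N) bhalf i * (i%:R * x ^+ i.-1).

Lemma is_derive_exprn n x : is_derive x 1 (fun y : R => y ^+ n) (n%:R * x ^+ n.-1).
Proof.
elim: n => [|n ih]; first by rewrite mul0r; exact: is_derive_cst.
have -> : (fun y : R => y ^+ n.+1) = (fun y => y * y ^+ n) by apply/funext => y; rewrite exprS.
apply: (is_derive_eq (is_deriveM (is_derive_id x (1 : R)) ih)); rewrite /GRing.scale/=.
case: n {ih} => [|n] /=; first by rewrite expr0; ring.
by rewrite exprS; have := @natr1 R n.+1; move: n.+2%:R => u <-; ring.
Qed.

Lemma bpart_derive N x : is_derive x 1 (bpart N) (dbpart N x).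
Proof.
elim: N => [|N ih].
  have -> : bpart 0 = cst 0 by apply/funext => y; rewrite /bpart big_nil.
  by rewrite /dbpart big_nil; exact: is_derive_cst.
have -> : bpart N.+1 = fun y => bpart N y + bhalf N * y ^+ N.
  by apply/funext => y; rewrite /bpart big_nat_recr.
rewrite /dbpart big_nat_recr//= -/(dbpart N x).
exact: (is_deriveD ih (is_deriveZ (bhalf N) (is_derive_exprn N x))).
Qed.

(** The function (1 - x)^(-1/2) solves 2 (1 - x) y' = y; truncating its series leaves a single term
    as defect. *)
Lemma bpart_ode N x : 2 * (1 - x) * dbpart N x - bpart N x = - (2 * N%:R * bhalf N * x ^+ N.-1).
Proof.
elim: N => [|N ih]; first by rewrite /dbpart /bpart !big_nil; ring.
rewrite /dbpart /bpart !big_nat_recr//= -/(dbpart N x) -/(bpart N x).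
have E : N%:R * (x * x ^+ N.-1) = N%:R * x ^+ N :> R.
  by case: N {ih} => [|N]; rewrite ?mul0r// -exprS.
have b := bhalfS N.
have -> : 2 * N.+1%:R * bhalf N.+1 * x ^+ N = 2 * (bhalf N * (2^-1 + N%:R)) * x ^+ N.
  by rewrite -b; ring.
transitivity (2 * (1 - x) * dbpart N x - bpart N x + 2 * bhalf N * (N%:R * x ^+ N.-1)
  - 2 * bhalf N * (N%:R * (x * x ^+ N.-1)) - bhalf N * x ^+ N); first by ring.
by rewrite ih E; field.
Qed.

(** Multiplied by the root it should invert, the partial sum would be 1 in the limit; by [bpart_ode]
    the derivative of this product is explicit and of constant sign for x in (0, 1). *)
Let bs N x := bpart N x * Num.sqrt (1 - x).

Let bs_derive N x : x < 1 ->
  is_derive x 1 (bs N) (- (N%:R * bhalf N * x ^+ N.-1) / Num.sqrt (1 - x)).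
Proof.
move=> x1; have x1' : 0 < 1 - x by rewrite subr_gt0.
have s0 : 0 < Num.sqrt (1 - x) by rewrite sqrtr_gt0.
have d1 : is_derive x 1 (fun y : R => 1 - y) (0 - 1).
  exact: (is_deriveB (is_derive_cst (1 : R) x 1) (is_derive_id x (1 : R))).
have d2 := @is_derive1_comp R _ (fun y : R => 1 - y) x _ _ (is_derive1_sqrt x1') d1.
have d3 := is_deriveM (bpart_derive N x) d2.
apply: (is_derive_eq d3); rewrite /GRing.scale/=.
have ss : Num.sqrt (1 - x) * Num.sqrt (1 - x) = 1 - x by rewrite -expr2 sqr_sqrtr// ltW.
have o := bpart_ode N x.
have o' : N%:R * bhalf N * x ^+ N.-1 = (bpart N x - 2 * (1 - x) * dbpart N x) / 2.
  by rewrite -[bpart N x - _]opprB o; field.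
by rewrite o' /=; move: ss s0; move: (Num.sqrt (1 - x)) => v ss v0; rewrite -ss; field; rewrite gt_eqF.
Qed.

Let bs_continuous N : continuous (bs N).
Proof.
move=> y; apply: cvgM.
  by have [d _] := bpart_derive N y; exact/differentiable_continuous/derivable1_diffP.
apply: (@continuous_comp _ _ _ (fun y : R => 1 - y)); last exact: sqrt_continuous.
by apply: cvgB; [exact: cvg_cst|exact: cvg_id].
Qed.

Let bpart0 N : bpart N.+1 0 = 1.
Proof.
rewrite /bpart big_nat_recl// big1_seq ?addr0; last by move=> i _; rewrite expr0n/= mulr0.
by rewrite expr0 mulr1 /bhalf /pochhammer big_ord0 fact0 divr1.
Qed.

Let bs0 N : bs N.+1 0 = 1.
Proof. by rewrite /bs bpart0 subr0 sqrtr1 mulr1. Qed.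

Lemma bpart_ge0 N x : 0 <= x -> 0 <= bpart N x.
Proof. by move=> x0; apply: sumr_ge0 => i _; rewrite mulr_ge0 ?exprn_ge0// bhalf_ge0. Qed.

(** The product [bs] starts at 1 and decreases. Its slope on (0, x) is at least that of - K c^(N +
    1), where K is the inverse root at x, since the coefficients are at most 1. *)
Lemma bpart_bounds N x : 0 < x < 1 ->
  (1 - x ^+ N.+1 / Num.sqrt (1 - x)) / Num.sqrt (1 - x) <= bpart N.+1 x <= (Num.sqrt (1 - x))^-1.
Proof.
move=> /andP[x0 x1]; have s0 : 0 < Num.sqrt (1 - x) by rewrite sqrtr_gt0 subr_gt0.
pose K := (Num.sqrt (1 - x))^-1; have K0 : 0 < K by rewrite invr_gt0.
have lt1 c : c \in `]0, x[ -> c < 1 by rewrite in_itv/= => /andP[_ cx]; exact: lt_trans x1.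
have cpos c : c \in `]0, x[ -> 0 <= N.+1%:R * bhalf N.+1 * c ^+ N.
  by rewrite in_itv/= => /andP[/ltW c0 _]; rewrite mulr_ge0 ?exprn_ge0// mulr_ge0 ?bhalf_ge0.
apply/andP; split.
  rewrite ler_pdivrMr// -[leRHS]/(bs N.+1 x).
  pose f y := bs N.+1 y + K * y ^+ N.+1.
  have df c : c \in `]0, x[ -> is_derive c 1 f
      (- (N.+1%:R * bhalf N.+1 * c ^+ N) / Num.sqrt (1 - c) + K * (N.+1%:R * c ^+ N)).
    move=> cx; exact: (is_deriveD (bs_derive N.+1 (lt1 _ cx)) (is_deriveZ K (is_derive_exprn N.+1 c))).
  have cf : {within `[0, x], continuous f}.
    apply: continuous_subspaceT => y; apply: cvgD; first exact: bs_continuous.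
    by apply: cvgM; [exact: cvg_cst|exact: exprn_continuous].
  have [c cx fE] := MVT x0 df cf.
  have c0 : 0 <= c by move: cx; rewrite in_itv/= => /andP[/ltW].
  have sc : Num.sqrt (1 - x) <= Num.sqrt (1 - c).
    by rewrite ler_sqrt ?subr_ge0 ?(ltW (lt1 _ cx))// lerD2l lerN2; move: cx; rewrite in_itv/= => /andP[_ /ltW].
  have h : 0 <= f x - f 0.
    rewrite fE mulr_ge0 ?subr0 ?(ltW x0)// addrC mulNr subr_ge0.
    rewrite [leRHS]mulrC ler_pM ?cpos// ?invr_ge0 ?sqrtr_ge0//.
      by rewrite ler_wpM2r ?exprn_ge0// ler_piMr// bhalf_le1.
    by rewrite lef_pV2 ?posrE// (lt_le_trans s0).
  move: h; rewrite /f bs0 expr0n/= mulr0 addr0 subr_ge0 mulrC => h.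
  by rewrite lerBlDr.
rewrite -[leRHS]div1r ler_pdivlMr// -[leLHS]/(bs N.+1 x).
have [c cx fE] := MVT x0 (fun c cx => bs_derive N.+1 (lt1 c cx)) (continuous_subspaceT (@bs_continuous N.+1)).
have : bs N.+1 x - bs N.+1 0 <= 0.
  rewrite fE subr0 mulr_le0_ge0 ?(ltW x0)// mulNr oppr_le0 mulr_ge0 ?cpos// invr_ge0 sqrtr_ge0//.
by rewrite bs0 subr_le0.
Qed.

Lemma bpart_cvg x : 0 < x < 1 -> bpart ^~ x @ \oo --> (Num.sqrt (1 - x))^-1.
Proof.
move=> x01; have /andP[x0 x1] := x01.
rewrite -(cvg_shiftS (bpart ^~ x)).
apply: (@squeeze_cvgr _ _ _ _ (fun N => (1 - x ^+ N.+1 / Num.sqrt (1 - x)) / Num.sqrt (1 - x))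
  (fun=> (Num.sqrt (1 - x))^-1)).
- by apply: nearW => N; exact: bpart_bounds.
- have xN : (x ^+ N.+1 : R) @[N --> \oo] --> (0 : R).
    have := @cvg_geometric R 1 x; rewrite (gtr0_norm x0) => /(_ x1).
    have -> : geometric 1 x = (fun n => x ^+ n) by apply/funext => n; rewrite /geometric/= mul1r.
    by rewrite -cvg_shiftS.
  have := cvgM (cvgB (cvg_cst (1 : R)) (cvgM xN (cvg_cst (Num.sqrt (1 - x))^-1))) (cvg_cst (Num.sqrt (1 - x))^-1).
  by rewrite mul0r subr0 mul1r; apply.
- exact: cvg_cst.
Qed.

Lemma bpart_le N x : 0 < x < 1 -> bpart N x <= (Num.sqrt (1 - x))^-1.
Proof.
case: N => [|N] x01; first by rewrite /bpart big_nil invr_ge0 sqrtr_ge0.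
by have /andP[] := bpart_bounds N x01.
Qed.

End binomial_series_half.

(** * Beta integrals with second parameter 1/2 *)

Section beta_half.
Variable R : realType.
Local Notation mu := (@lebesgue_measure R).
Local Notation I01 := (`]0%R, 1%R[%classic : set R).

Lemma powR_continuous_at (a x : R) : 0 < x -> {for x, continuous (@powR R ^~ a)}.
Proof.
by move=> x0; have [d _] := is_derive1_powR a x0; exact/differentiable_continuous/derivable1_diffP.
Qed.

Lemma powR_within01 (p : R) : 0 < p -> {within `[0, 1], continuous (@powR R ^~ p)}.
Proof.
move=> p0; apply/continuous_within_itvP => //; split.
- by move=> x; rewrite in_itv/= => /andP[x0 _]; exact: powR_continuous_at.
- by rewrite powR0 ?gt_eqF//; exact: powR_cvg0.
- by apply: cvg_at_left_filter; apply: powR_continuous_at.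
Qed.

Lemma powR_half_inv (x : R) : 0 <= x -> x `^ (2^-1 - 1) = (Num.sqrt x)^-1.
Proof.
move=> x0; have -> : 2^-1 - 1 = - 2^-1 :> R by field.
by rewrite powRN powR12_sqrt.
Qed.

Lemma powR_le1 (t q : R) : 0 < t <= 1 -> 0 <= q -> t `^ q <= 1.
Proof.
move=> /andP[t0 t1] q0; have := @ge0_ler_powR R q q0 t 1.
by rewrite powR1; apply; rewrite ?nnegrE ?ler01 ?(ltW t0).
Qed.

Lemma integrable01Z (k : R) (f : R -> R) :
  mu.-integrable I01 (EFin \o f) -> mu.-integrable I01 (EFin \o (fun t => k * f t)).
Proof.
move=> fi; have -> : EFin \o (fun t => k * f t) = (fun t => k%:E * (EFin \o f) t)%E by [].
by apply: integrableZl.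
Qed.

Lemma Rintegral01Z (k : R) (f : R -> R) : mu.-integrable I01 (EFin \o f) ->
  \int[mu]_(t in I01) (k * f t) = k * \int[mu]_(t in I01) f t.
Proof. by move=> fi; apply: RintegralZl. Qed.

Lemma Rintegral01D (f g : R -> R) :
  mu.-integrable I01 (EFin \o f) -> mu.-integrable I01 (EFin \o g) ->
  \int[mu]_(t in I01) (f t + g t) = \int[mu]_(t in I01) f t + \int[mu]_(t in I01) g t.
Proof. by move=> fi gi; apply: RintegralD. Qed.

Lemma integrable01_le (f g : R -> R) :
  (forall t : R, 0 < t < 1 -> {for t, continuous f}) ->
  (forall t : R, 0 < t < 1 -> `|f t| <= g t) ->
  mu.-integrable I01 (EFin \o g) -> mu.-integrable I01 (EFin \o f).
Proof.
move=> cf fg; apply: le_integrable => //.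
- apply/measurable_EFinP; apply: open_continuous_measurable_fun; first exact: interval_open.
  by move=> t; rewrite inE/= in_itv/=; exact: cf.
- move=> t /=; rewrite in_itv/= => t01; rewrite lee_fin.
  by rewrite (le_trans (fg t t01))// ler_norm.
Qed.

Lemma sqrt1B_derive (t : R) : t < 1 ->
  is_derive t 1 (fun y : R => Num.sqrt (1 - y)) (- (2 * Num.sqrt (1 - t))^-1).
Proof.
move=> t1; have t1' : 0 < 1 - t by rewrite subr_gt0.
have d1 : is_derive t 1 (fun y : R => 1 - y) (0 - 1).
  exact: (is_deriveB (is_derive_cst (1 : R) t 1) (is_derive_id t (1 : R))).
apply: (is_derive_eq (@is_derive1_comp R _ (fun y : R => 1 - y) t _ _ (is_derive1_sqrt t1') d1)).
by rewrite sub0r mulrN1.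
Qed.

Lemma sqrt1B_continuous : continuous (fun y : R => Num.sqrt (1 - y)).
Proof.
move=> t; apply: (@continuous_comp _ _ _ (fun y : R => 1 - y)); last exact: sqrt_continuous.
by apply: cvgB; [exact: cvg_cst|exact: cvg_id].
Qed.

Section weight.
Implicit Type t : R.
Variable p : R.
Hypothesis p0 : 0 < p.

Definition bweight (t : R) : R := t `^ (p - 1) / Num.sqrt (1 - t).

Let K : R := 1 + 2^-1 `^ (p - 1).
(** A majorant of the weight with the elementary primitive [Mp]: up to 1/2 the root is at least 1/2,
    and beyond 1/2 the power is at most [K], whatever the sign of p - 1. *)
Let M (t : R) : R := 2 * t `^ (p - 1) + K / Num.sqrt (1 - t).
Let Mp (t : R) : R := 2 / p * t `^ p + - (2 * K) * Num.sqrt (1 - t).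
(** It vanishes at both ends, so the integral of its derivative [dG] is the recurrence between the
    beta values at p and p + 1. *)
Let G (t : R) : R := t `^ p * Num.sqrt (1 - t).
Let dG (t : R) : R := p * bweight t - (p + 2^-1) * (t * bweight t).

Let K1 : 1 <= K. Proof. by rewrite lerDl powR_ge0. Qed.
Let s0 t : 0 < t < 1 -> 0 < Num.sqrt (1 - t).
Proof. by move=> /andP[_ t1]; rewrite sqrtr_gt0 subr_gt0. Qed.

Let powRS (t : R) : 0 < t -> t * t `^ (p - 1) = t `^ p.
Proof.
move=> t0; rewrite -[X in X * _](powRr1 (ltW t0)) -powRD ?(gt_eqF t0) ?implybT//.
by congr (_ `^ _); ring.
Qed.

Let dMp t : 0 < t < 1 -> is_derive t 1 Mp (M t).
Proof.
move=> t01; have /andP[t0 t1] := t01; have pn : p != 0 by rewrite gt_eqF.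
have sn : Num.sqrt (1 - t) != 0 by rewrite gt_eqF// s0.
apply: (is_derive_eq (is_deriveD (is_deriveZ (2 / p) (is_derive1_powR p t0))
  (is_deriveZ (- (2 * K)) (sqrt1B_derive t1)))).
by rewrite /GRing.scale/= /M; field; rewrite sn pn.
Qed.

Let dGE t : 0 < t < 1 -> is_derive t 1 G (dG t).
Proof.
move=> t01; have /andP[t0 t1] := t01; have sn : Num.sqrt (1 - t) != 0 by rewrite gt_eqF// s0.
apply: (is_derive_eq (is_deriveM (is_derive1_powR p t0) (sqrt1B_derive t1))).
rewrite /GRing.scale/= /dG /bweight -(powRS t0).
have ss : Num.sqrt (1 - t) * Num.sqrt (1 - t) = 1 - t by rewrite -expr2 sqr_sqrtr// ltW// subr_gt0.
have tE : t = 1 - Num.sqrt (1 - t) * Num.sqrt (1 - t) by rewrite ss; ring.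
move: tE sn; move: (Num.sqrt (1 - t)) (t `^ _) => v u -> vn.
by field.
Qed.

Let cw t : 0 < t < 1 -> {for t, continuous bweight}.
Proof.
move=> t01; have /andP[t0 t1] := t01; apply: cvgM; first exact: powR_continuous_at.
by apply: cvgV; [rewrite gt_eqF// s0|exact: sqrt1B_continuous].
Qed.

Let cM t : 0 < t < 1 -> {for t, continuous M}.
Proof.
move=> t01; have /andP[t0 t1] := t01; apply: cvgD.
  by apply: cvgM; [exact: cvg_cst|exact: powR_continuous_at].
apply: cvgM; first exact: cvg_cst.
by apply: cvgV; [rewrite gt_eqF// s0|exact: sqrt1B_continuous].
Qed.

Let M0 t : 0 < t < 1 -> 0 <= M t.
Proof.
move=> t01; rewrite addr_ge0 ?mulr_ge0 ?powR_ge0//; exact: le_trans K1.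
Qed.

Let cMp : {within `[0, 1], continuous Mp}.
Proof.
move=> t; apply: cvgD; apply: cvgM; try exact: cvg_cst.
  exact: powR_within01.
by apply: continuous_subspaceT; exact: sqrt1B_continuous.
Qed.

Let cG : {within `[0, 1], continuous G}.
Proof.
move=> t; apply: cvgM; first exact: powR_within01.
by apply: continuous_subspaceT; exact: sqrt1B_continuous.
Qed.

Let iM : mu.-integrable I01 (EFin \o M) /\ \int[mu]_(x in I01) M x = Mp 1 - Mp 0.
Proof.
exact: ge0_FTC_oo.
Qed.

Lemma bweight_ge0 t : 0 <= bweight t.
Proof. by rewrite mulr_ge0 ?powR_ge0// invr_ge0 sqrtr_ge0. Qed.

Let w_le t : 0 < t < 1 -> bweight t <= M t.
Proof.
move=> t01; have /andP[t0 t1] := t01; have sp := s0 t01.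
have [h|h] := leP t 2^-1.
  apply: (@le_trans _ _ (2 * t `^ (p - 1))); last first.
    by rewrite lerDl divr_ge0 ?sqrtr_ge0// (le_trans _ K1).
  rewrite /bweight mulrC ler_wpM2r ?powR_ge0// -[2]invrK lef_pV2 ?posrE ?invr_gt0//.
  have -> : 2^-1 = Num.sqrt (2^-1 ^+ 2) :> R by rewrite sqrtr_sqr ger0_norm.
  by rewrite ler_sqrt ?subr_ge0 ?(ltW t1)//; rewrite expr2; lra.
apply: (@le_trans _ _ (K / Num.sqrt (1 - t))); last by rewrite lerDr mulr_ge0 ?powR_ge0.
rewrite /bweight ler_wpM2r ?invr_ge0 ?sqrtr_ge0// /K.
have [q0|q0] := leP 0 (p - 1).
  apply: (@le_trans _ _ 1); last by rewrite lerDl powR_ge0.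
  by apply: powR_le1; rewrite ?t0 ?(ltW t1) ?(ltW p0).
apply: (@le_trans _ _ (2^-1 `^ (p - 1))); last by rewrite lerDr.
rewrite -(opprK (p - 1)) [leLHS]powRN [leRHS]powRN lef_pV2 ?posrE ?powR_gt0//.
by rewrite ge0_ler_powR ?nnegrE ?oppr_ge0 ?(ltW q0) ?(ltW h) ?(ltW t0).
Qed.

Lemma bweight_integrable : mu.-integrable I01 (EFin \o bweight).
Proof.
apply: (integrable01_le cw _ iM.1) => t t01.
by rewrite ger0_norm ?bweight_ge0// w_le.
Qed.

Let ctw t : 0 < t < 1 -> {for t, continuous (fun t => t * bweight t)}.
Proof. by move=> t01; apply: cvgM; [exact: cvg_id|exact: cw]. Qed.

Let itw : mu.-integrable I01 (EFin \o (fun t => t * bweight t)).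
Proof.
apply: (integrable01_le ctw _ bweight_integrable) => t /andP[t0 t1].
have w0 := bweight_ge0 t; rewrite ger0_norm; last by rewrite mulr_ge0 // ltW.
by rewrite ler_piMl // ltW.
Qed.

Lemma BetaE : Beta p 2^-1 = \int[mu]_(t in I01) bweight t.
Proof.
apply: eq_Rintegral => t; rewrite inE/= in_itv/= => /andP[_ t1].
by rewrite powR_half_inv// subr_ge0 ltW.
Qed.

Lemma Beta_shift : Beta (p + 1) 2^-1 = \int[mu]_(t in I01) (t * bweight t).
Proof.
apply: eq_Rintegral => t; rewrite inE/= in_itv/= => /andP[t0 t1].
by rewrite powR_half_inv ?subr_ge0 ?ltW// addrK /bweight mulrA powRS.
Qed.

Lemma Beta_half_rec : (p + 2^-1) * Beta (p + 1) 2^-1 = p * Beta p 2^-1.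
Proof.
have pn : p != 0 by rewrite gt_eqF.
(* [dG] changes sign; adding the majorant makes the integrand nonnegative, as the fundamental
   theorem used here requires. *)
have [iH eH] : mu.-integrable I01 (EFin \o (fun t => dG t + M t)) /\
    \int[mu]_(t in I01) (dG t + M t) = (G 1 + Mp 1) - (G 0 + Mp 0).
  apply: (@ge0_FTC_oo R (fun t => dG t + M t) (fun t => G t + Mp t)) => //.
  - by move=> t; apply: cvgD; [exact: cG|exact: cMp].
  - by move=> t; rewrite in_itv/= => t01; exact: (is_deriveD (dGE t01) (dMp t01)).
  - move=> t; rewrite in_itv/= => t01; apply: cvgD; last exact: cM.
    apply: cvgB; first by apply: cvgM; [exact: cvg_cst|exact: cw].
    by apply: cvgM; [exact: cvg_cst|exact: ctw].
  - move=> t; rewrite in_itv/= => t01; have /andP[t0 t1] := t01.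
    have w0 := bweight_ge0 t; have h := w_le t01.
    have tp : t * bweight t <= K / Num.sqrt (1 - t).
      rewrite /bweight mulrA powRS// ler_wpM2r ?invr_ge0 ?sqrtr_ge0// (le_trans _ K1)//.
      by apply: powR_le1; rewrite ?t0 ?(ltW t1) ?(ltW p0).
    have e1 : 0 <= p * (bweight t * (1 - t)) by rewrite mulr_ge0 ?(ltW p0)// mulr_ge0// subr_ge0 ltW.
    have e2 : 0 <= t `^ (p - 1) by exact: powR_ge0.
    have e3 : 0 <= t * bweight t by rewrite mulr_ge0// ltW.
    by rewrite /dG; move: e1 e2 e3 tp; rewrite /M; move: (K / _) (bweight t) (t `^ _) => *; lra.
have iw := bweight_integrable.
have mI : measurable I01 by exact: measurable_itv.
have E : \int[mu]_(t in I01) (p * bweight t + M t) =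
    \int[mu]_(t in I01) ((p + 2^-1) * (t * bweight t) + (dG t + M t)).
  by apply: eq_Rintegral => t _; rewrite /dG; ring.
have ip : mu.-integrable I01 (EFin \o (fun t => p * bweight t)) by exact: (integrable01Z p iw).
have iq : mu.-integrable I01 (EFin \o (fun t => (p + 2^-1) * (t * bweight t))).
  exact: (integrable01Z (p + 2^-1) itw).
have E1 := Rintegral01D ip iM.1; rewrite (Rintegral01Z p iw) iM.2 -BetaE in E1.
have E2 := Rintegral01D iq iH; rewrite (Rintegral01Z (p + 2^-1) itw) eH -Beta_shift in E2.
have G1 : G 1 = 0 by rewrite /G subrr sqrtr0 mulr0.
have G0 : G 0 = 0 by rewrite /G powR0// mul0r.
have := etrans (esym E1) (etrans E E2); rewrite G1 G0.
by move: (_ * _) (_ * _) (Mp 1) (Mp 0) => u v x y; lra.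
Qed.

End weight.

Lemma Beta_half_pochhammer (p : R) n : 0 < p ->
  pochhammer (p + 2^-1) n * Beta (p + n%:R) 2^-1 = pochhammer p n * Beta p 2^-1.
Proof.
move=> p0; elim: n => [|n ih]; first by rewrite /pochhammer !big_ord0 addr0.
have pn : 0 < p + n%:R by rewrite ltr_wpDr.
have := Beta_half_rec pn; rewrite -[p + n%:R + 1]addrA natr1 => E.
rewrite /pochhammer !big_ord_recr/= -/(pochhammer _ _) -/(pochhammer _ _).
have -> : p + 2^-1 + n%:R = p + n%:R + 2^-1 by ring.
by rewrite -mulrA E mulrCA ih; ring.
Qed.

(** Euler's integral for the hypergeometric series: the binomial series of (1 - z t)^(-1/2) is
    integrated term by term against the weight, its partial sums being dominated by (1 -
    z)^(-1/2). *)
Lemma hyp2F1_half_integral (p z : R) : 0 < p -> 0 < z < 1 -> Beta p 2^-1 != 0 ->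
  mu.-integrable I01 (EFin \o (fun t => bweight p t / Num.sqrt (1 - z * t))) /\
  Beta p 2^-1 * hyp2F1 2^-1 p (p + 2^-1) z =
    \int[mu]_(t in I01) (bweight p t / Num.sqrt (1 - z * t)).
Proof.
move=> p0 /andP[z0 z1] B0; have iw := bweight_integrable p0.
have mI : measurable I01 by exact: measurable_itv.
have zt (t : R) : 0 < t < 1 -> 0 < z * t < z.
  by move=> /andP[t0 t1]; rewrite mulr_gt0//= gtr_pMr.
have zt1 (t : R) : 0 < t < 1 -> 0 < z * t < 1.
  by move=> /zt/andP[-> h]; exact: lt_trans z1.
have cw t : 0 < t < 1 -> {for t, continuous (bweight p)}.
  move=> /andP[t0 t1]; apply: cvgM; first exact: powR_continuous_at.
  by apply: cvgV; [rewrite gt_eqF// sqrtr_gt0 subr_gt0|exact: sqrt1B_continuous].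
have cb N t : {for t, continuous (fun t => bpart N (z * t))}.
  apply: (@continuous_comp _ _ _ (fun t : R => z * t)); first exact: mulrl_continuous.
  by have [d _] := bpart_derive N (z * t); exact/differentiable_continuous/derivable1_diffP.
pose M t : R := (Num.sqrt (1 - z))^-1 * bweight p t.
have iM : mu.-integrable I01 (EFin \o M) by exact: (integrable01Z _ iw).
have bM N t : 0 < t < 1 -> `|bweight p t * bpart N (z * t)| <= M t.
  move=> t01; have /andP[zt0 zt2] := zt1 t t01; have /andP[_ zt3] := zt t t01.
  have b0 := bpart_ge0 N (ltW zt0).
  rewrite ger0_norm; last by rewrite mulr_ge0 ?bweight_ge0.
  rewrite /M mulrC ler_wpM2r ?bweight_ge0//.
  apply: (le_trans (bpart_le N (zt1 t t01))).
  rewrite lef_pV2 ?posrE ?sqrtr_gt0 ?subr_gt0// ler_sqrt ?subr_ge0 ?(ltW zt2)//.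
  by rewrite lerD2l lerN2 ltW.
have [i1 c1] := @Rintegral_dct R I01 (fun N t => bweight p t * bpart N (z * t))
  (fun t => bweight p t / Num.sqrt (1 - z * t)) M mI
  ltac:(move=> N; apply: open_continuous_measurable_fun; [exact: interval_open|];
    move=> t; rewrite inE/= in_itv/= => t01; apply: cvgM; [exact: cw|exact: cb]) iM
  ltac:(move=> t; rewrite /= in_itv/= => t01; apply: cvgM; [exact: cvg_cst|exact: bpart_cvg (zt1 t t01)])
  ltac:(move=> N t; rewrite /= in_itv/=; exact: bM).
split => //.
have iwt n : mu.-integrable I01 (EFin \o (fun t => t ^+ n * bweight p t)).
  apply: (integrable01_le _ _ iw) => t t01; first by apply: cvgM; [exact: exprn_continuous|exact: cw].
  have /andP[t0 t1] := t01; have w0 := bweight_ge0 p t.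
  have tn : 0 <= t ^+ n <= 1 by rewrite exprn_ge0 ?exprn_ile1 ?(ltW t0) ?(ltW t1).
  have /andP[tn0 tn1] := tn; rewrite ger0_norm; last by rewrite mulr_ge0.
  by rewrite ler_piMl.
have Bn n : Beta (p + n%:R) 2^-1 = \int[mu]_(t in I01) (t ^+ n * bweight p t).
  rewrite BetaE; apply: eq_Rintegral => t; rewrite inE/= in_itv/= => /andP[t0 t1].
  rewrite /bweight mulrA -powR_mulrn ?(ltW t0)// -powRD ?(gt_eqF t0) ?implybT//.
  by congr (_ `^ _ * _); ring.
have S N : \int[mu]_(t in I01) (bweight p t * bpart N (z * t)) = Beta p 2^-1 *
    series (fun n => pochhammer 2^-1 n * pochhammer p n / pochhammer (p + 2^-1) n * z ^+ n / n`!%:R) N.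
  elim: N => [|N ih].
    rewrite /series/= big_geq// mulr0; under eq_Rintegral do rewrite /bpart big_geq// mulr0.
    by rewrite Rintegral_cst// mul0r.
  have E t : bweight p t * bpart N.+1 (z * t) =
      bweight p t * bpart N (z * t) + bhalf R N * z ^+ N * (t ^+ N * bweight p t).
    by rewrite /bpart big_nat_recr//= exprMn; ring.
  under eq_Rintegral do rewrite E.
  have j1 : mu.-integrable I01 (EFin \o (fun t => bweight p t * bpart N (z * t))).
    apply: (integrable01_le _ _ iM) => t t01; last exact: bM.
    by apply: cvgM; [exact: cw|exact: cb].
  rewrite (Rintegral01D j1) ?Rintegral01Z//; last exact: (integrable01Z _ (iwt N)).
  rewrite ih -Bn /series/= big_nat_recr//= mulrDr; congr (_ + _).
  have q0 : pochhammer (p + 2^-1) N != 0.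
    by rewrite gt_eqF// prodr_gt0// => i _; rewrite ltr_wpDr// addr_gt0.
  have := Beta_half_pochhammer N p0 => BP.
  have -> : Beta (p + N%:R) 2^-1 = pochhammer p N * Beta p 2^-1 / pochhammer (p + 2^-1) N.
    by apply: (canRL (mulfK q0)); rewrite mulrC.
  by rewrite /bhalf; ring.
have c2 : series (fun n => pochhammer 2^-1 n * pochhammer p n / pochhammer (p + 2^-1) n * z ^+ n / n`!%:R)
    @ \oo --> (Beta p 2^-1)^-1 * \int[mu]_(t in I01) (bweight p t / Num.sqrt (1 - z * t)).
  rewrite (_ : series _ = fun N => (Beta p 2^-1)^-1 * \int[mu]_(t in I01) (bweight p t * bpart N (z * t))).
    by apply: cvgM; [exact: cvg_cst|exact: c1].
  by apply/funext => N; rewrite S mulKf.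
by rewrite /hyp2F1 (cvg_lim _ c2)// mulVKf.
Qed.

End beta_half.

(** * Side lengths *)

Section exponential_coordinates.
Variable R : realType.
Implicit Types x y : R.

Lemma expR_powR x y : expR x `^ y = expR (y * x).
Proof. by rewrite powR_expln ?expR_gt0// expRK. Qed.

Lemma expR_sqrt x : Num.sqrt (expR x) = expR (2^-1 * x).
Proof. by rewrite -powR12_sqrt ?expR_ge0// expR_powR. Qed.

Lemma expR_exprn x n : expR x ^+ n = expR (n%:R * x).
Proof. by rewrite expRM_natl. Qed.

Lemma pos_expR y : 0 < y -> exists x, y = expR x.
Proof. by move=> y0; exists (ln y); rewrite lnK. Qed.

(* normalizes a monomial in positive quantities to a single exponential *)
Definition expRE := (expR_powR, expR_sqrt, expR_exprn, =^~ @expRN R, =^~ @expRD R).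

End exponential_coordinates.

(** * Substitution in integrals over the unit interval *)

Section substitution.
Variable R : realType.
Local Notation mu := (@lebesgue_measure R).
Local Notation I01 := (`]0%R, 1%R[%classic : set R).

Lemma FTC01_scaled (H g : R -> R) (K : R) : K != 0 ->
  {within `[0, 1], continuous H} ->
  (forall t : R, 0 < t < 1 -> is_derive t 1 H (K * g t)) ->
  (forall t : R, 0 < t < 1 -> {for t, continuous g}) ->
  (forall t : R, 0 < t < 1 -> 0 <= g t) ->
  K * \int[mu]_(t in I01) g t = H 1 - H 0.
Proof.
move=> K0 cH dH cg g0.
have [_ ->] : mu.-integrable I01 (EFin \o g) /\
    \int[mu]_(t in I01) g t = K^-1 * H 1 - K^-1 * H 0.
  apply: (@ge0_FTC_oo R g (fun t => K^-1 * H t)) => //.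
  - by move=> t; apply: cvgM; [exact: cvg_cst|exact: cH].
  - move=> t; rewrite in_itv/= => t01.
    by apply: (is_derive_eq (is_deriveZ K^-1 (dH t t01))); rewrite /GRing.scale/= mulKf.
by rewrite -mulrBr mulVKf.
Qed.

Lemma mobius_derive (a b c e t : R) : c + e * t != 0 ->
  is_derive t 1 (fun t => (a + b * t) / (c + e * t)) ((b * c - a * e) / (c + e * t) ^+ 2).
Proof.
move=> n0.
have lin (u v : R) : is_derive t 1 (fun t => u + v * t) (0 + v * 1).
  exact: (is_deriveD (is_derive_cst u t 1) (is_deriveZ v (is_derive_id t (1 : R)))).
apply: (is_derive_eq (is_deriveM (lin a b) (@is_deriveV R (fun t => c + e * t) t _ 1 n0 (lin c e)))).
by rewrite /GRing.scale/=; field.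
Qed.

Lemma mobius_continuous (a b c e t : R) : c + e * t != 0 ->
  {for t, continuous (fun t => (a + b * t) / (c + e * t))}.
Proof.
by move=> /(mobius_derive a b)[d _]; exact/differentiable_continuous/derivable1_diffP.
Qed.

Lemma within01 (f : R -> R) : (forall t : R, 0 <= t <= 1 -> {for t, continuous f}) ->
  {within `[0, 1], continuous f}.
Proof.
move=> cf; apply: continuous_in_subspaceT => t.
by rewrite inE/= in_itv/=; exact: cf.
Qed.

Lemma continuous_at_comp (f g : R -> R) (t : R) :
  {for t, continuous f} -> continuous g -> {for t, continuous (fun u => g (f u))}.
Proof. by move=> cf cg; exact: (continuous_comp cf (cg (f t))). Qed.

Lemma powR_continuous_comp (f : R -> R) (c t : R) : {for t, continuous f} -> 0 < f t ->
  {for t, continuous (fun u => f u `^ c)}.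
Proof. by move=> cf f0; exact: (continuous_comp cf (powR_continuous_at (a := c) f0)). Qed.

Lemma bweight_sqrt_continuous (p z t : R) : 0 < t < 1 -> 0 < z < 1 ->
  {for t, continuous (fun t => bweight p t / Num.sqrt (1 - z * t))}.
Proof.
move=> /andP[t0 t1] /andP[z0 z1]; apply: cvgM.
  apply: cvgM; first exact: powR_continuous_at.
  by apply: cvgV; [rewrite gt_eqF// sqrtr_gt0 subr_gt0|exact: sqrt1B_continuous].
apply: cvgV; first by rewrite gt_eqF// sqrtr_gt0 subr_gt0 (lt_trans _ z1)// gtr_pMr.
exact: (continuous_at_comp (@mulrl_continuous R z t) (@sqrt1B_continuous R)).
Qed.

End substitution.

Section speed.
Variable R : realType.
Local Notation C := (complex R).

Let cmod_sub (x p : R) : cmod (Complex x 0 - Complex p 0) = `|x - p|.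
Proof.
have -> : Complex x 0 - Complex p 0 = Complex (x - p) 0 :> C.
  by apply: complex_ext; rewrite !ReImE/=; ring.
exact: cmod_real.
Qed.

Let free (s : seq (R * R)) (x : R) : all (fun p => x != p.1) s -> scfree s (Complex x 0).
Proof.
move=> H p ps; have : x != p.1.
  elim: s H ps => //= q s ih /andP[h1 h2] [<-//|]; exact: ih.
by rewrite eq_complex/= eqxx andbT.
Qed.

Lemma tzspeedE (b r x : R) : x ^+ 2 != 1 -> x ^+ 2 != r ^+ 2 ->
  tzspeed b r x = `|x ^+ 2 - r ^+ 2| `^ (b - 1) * `|x ^+ 2 - 1| `^ (- b).
Proof.
move=> x1 xr.
have [h1 h2] : x != 1 /\ x != - 1.
  by split; apply: contra x1 => /eqP->; rewrite ?expr1n ?sqrrN ?expr1n.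
have [h3 h4] : x != r /\ x != - r.
  by split; apply: contra xr => /eqP->; rewrite ?sqrrN.
rewrite /tzspeed /tzphi cmod_scphi; last first.
  by apply: free; rewrite /tzl/= h1 h2 h3 h4.
rewrite /tzl prod_seq4/= !cmod_sub !opprK.
have -> : x ^+ 2 - r ^+ 2 = (x + r) * (x - r) by ring.
have -> : x ^+ 2 - 1 = (x + 1) * (x - 1) by ring.
by rewrite !normrM !powRM//; ring.
Qed.

Lemma exspeedE (al x2 x3 x : R) : x != -1 -> x != x2 -> x != x3 -> x != 0 ->
  exspeed al x2 x3 x = `|x + 1| `^ (- 2^-1) *
    (`|x - x2| `^ al * (`|x - x3| `^ (1 - al) * `|x| `^ (- 2^-1))).
Proof.
move=> h1 h2 h3 h4; rewrite /exspeed /exphi cmod_scphi; last first.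
  by apply: free; rewrite /exl/= h1 h2 h3 h4.
by rewrite /exl prod_seq4/= !cmod_sub opprK subr0.
Qed.

End speed.

(** * Side lengths of the trapezoid maps *)

Section trapezoid_lengths.
Variable R : realType.
Local Notation C := (complex R).
Local Notation mu := (@lebesgue_measure R).
Local Notation I01 := (`]0%R, 1%R[%classic : set R).
Variables (l b sb cb : R) (m : R -> R) (T : R -> C).
Hypothesis l01 : 0 < l < 1.
Hypothesis tt : trapezoid_trace l^-1 sb cb m T.
Hypothesis mE : forall x, x ^+ 2 != 1 -> x ^+ 2 != l^-1 ^+ 2 ->
  m x = `|x ^+ 2 - l^-1 ^+ 2| `^ (b - 1) * `|x ^+ 2 - 1| `^ (- b).

Let l0 : 0 < l. Proof. by case/andP: l01. Qed.
Let P0 : 0 < 1 - l ^+ 2.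
Proof. by case/andP: l01 => h0 h1; rewrite subr_gt0 expr_lt1// ltW. Qed.

Let ReT : continuous (fun x => Re (T x)).
Proof. by move=> x; exact: (clim_Re (tt_clim tt x)). Qed.
Let ImT : continuous (fun x => Im (T x)).
Proof. by move=> x; exact: (clim_Im (tt_clim tt x)). Qed.

Let half_gt0 : 0 < 2^-1 :> R. Proof. by rewrite invr_gt0. Qed.

Let T0 : Re (T 0) = 0.
Proof.
have := congr1 (@complex.Re R) (tt_opp tt 0); rewrite oppr0 Re_refl => h.
by move: h; move: (Re _) => x; lra.
Qed.

Let speed_lt1 x X : x ^+ 2 = X -> X < 1 -> m x = (l^-1 ^+ 2 - X) `^ (b - 1) * (1 - X) `^ (- b).
Proof.
move=> xX X1; have r1 : 1 < l^-1 ^+ 2 by rewrite exprn_egt1// invf_gt1//; case/andP: l01.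
rewrite mE ?xX ?lt_eqF// ?(lt_trans X1)//.
by rewrite distrC gtr0_norm ?subr_gt0 ?(lt_trans X1)// distrC gtr0_norm ?subr_gt0.
Qed.

(** The substitution x^2 = (1 - t) / (1 - l^2 t) is an involution in x^2 and t that exchanges 0 with
    1 and l^-2 with infinity, the four branch points of the integrand. *)
Lemma ttD_bweight (al : R) : b = 1 - al ->
  (l `^ (2 * al) / 2) * \int[mu]_(t in I01) (bweight al t / Num.sqrt (1 - l ^+ 2 * t)) = ttD T.
Proof.
move=> bE; have P1 := P0; have l1 := l0.
pose X (t : R) : R := (1 + (-1) * t) / (1 + (- l ^+ 2) * t).
pose x (t : R) : R := Num.sqrt (X t).
have M0 (t : R) : 0 <= t <= 1 -> 0 < 1 + (- l ^+ 2) * t.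
  move=> /andP[t0 t1]; have h : 0 <= l ^+ 2 * (1 - t) by rewrite mulr_ge0 ?sqr_ge0// subr_ge0.
  by lra.
have cX (t : R) : 0 <= t <= 1 -> {for t, continuous X}.
  by move=> t01; apply: mobius_continuous; rewrite gt_eqF// M0.
have cx (t : R) : 0 <= t <= 1 -> {for t, continuous x}.
  by move=> t01; exact: (continuous_at_comp (cX t t01) (@sqrt_continuous R)).
transitivity (Re (T (x 1)) - Re (T (x 0))); last first.
  have -> : x 1 = 0 by rewrite /x /X mulr1 subrr mul0r sqrtr0.
  have -> : x 0 = 1 by rewrite /x /X !mulr0 !addr0 divr1 sqrtr1.
  by rewrite T0 sub0r.
apply: (@FTC01_scaled R (fun t => Re (T (x t)))).
- by rewrite gt_eqF// divr_gt0// powR_gt0.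
- by apply: within01 => t t01; exact: (continuous_at_comp (cx t t01) ReT).
- move=> t t01; have /andP[t0 t1] := t01; have t01' : 0 <= t <= 1 by rewrite !ltW.
  have Mt := M0 t t01'; have Nt : 0 < 1 + (-1) * t by lra.
  have Xt : 0 < X t by rewrite divr_gt0.
  have Xt1 : X t < 1.
    rewrite ltr_pdivrMr// mul1r; have : 0 < (1 - l ^+ 2) * t by rewrite mulr_gt0.
    by lra.
  have x0 : 0 < x t by rewrite sqrtr_gt0.
  have xx : x t ^+ 2 = X t by rewrite sqr_sqrtr// ltW.
  have x1 : x t < 1 by rewrite -(ltr_pXn2r (n := 2)) ?nnegrE ?ltW// expr1n xx.
  have dX := mobius_derive (t := t) 1 (-1) (lt0r_neq0 Mt).
  have dx : is_derive t 1 x _ := @is_derive1_comp R _ X t _ _ (is_derive1_sqrt Xt) dX.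
  have [dT _] := tt_mid tt (x := x t) ltac:(apply/andP; split; lra).
  apply: (is_derive_eq (@is_derive1_comp R (fun y => Re (T y)) x t _ _ dT dx)).
  rewrite /= (speed_lt1 xx Xt1) bE.
  have -> : -1 * 1 - 1 * (- l ^+ 2) = - (1 - l ^+ 2) :> R by ring.
  have -> : l^-1 ^+ 2 - X t = (1 - l ^+ 2) / (l ^+ 2 * (1 + (- l ^+ 2) * t)).
    by rewrite /X; field; rewrite !gt_eqF.
  have -> : 1 - X t = t * (1 - l ^+ 2) / (1 + (- l ^+ 2) * t).
    by rewrite /X; field; rewrite gt_eqF.
  rewrite /bweight [(2 * Num.sqrt _)^-1]invfM -[- t]mulN1r -[- (l ^+ 2 * t)]mulNr /X.
  have [u ->] := pos_expR P1; have [v ->] := pos_expR Mt; have [w ->] := pos_expR Nt.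
  have [tau ->] := pos_expR t0; have [lam ->] := pos_expR l1.
  have [two ->] := pos_expR (half_gt0).
  rewrite !(mulrN, mulNr, opprK) !expRE.
  by congr expR; field.
- move=> t t01; apply: bweight_sqrt_continuous => //.
  by rewrite exprn_gt0//= expr_lt1// ?ltW//; case/andP: l01.
- by move=> t _; rewrite mulr_ge0 ?bweight_ge0// invr_ge0 sqrtr_ge0.
Qed.

(** Here x^2 = l^-2 (1 - l^2 t) / (1 - t), which carries t from 0 to 1 while x goes from 1 / l to
    infinity. *)
Lemma ttC_bweight (al : R) : b = 1 - al ->
  (forall e : R, 0 < e -> exists N : R, forall x, N < x -> cmod (T x) < e) ->
  (l / 2) * \int[mu]_(t in I01) (bweight (1 - al) t / Num.sqrt (1 - l ^+ 2 * t)) = ttC l^-1 T.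
Proof.
move=> bE Tinf; have P1 := P0; have l1 := l0.
pose X (t : R) : R := (1 + (- l ^+ 2) * t) / (1 + (-1) * t).
pose x (t : R) : R := l^-1 * Num.sqrt (X t).
have M0 (t : R) : 0 <= t <= 1 -> 0 < 1 + (- l ^+ 2) * t.
  move=> /andP[t0 t1]; have h : 0 <= l ^+ 2 * (1 - t) by rewrite mulr_ge0 ?sqr_ge0// subr_ge0.
  by lra.
have N0 (t : R) : t < 1 -> 0 < 1 + (-1) * t by lra.
have cx (t : R) : t < 1 -> {for t, continuous x}.
  move=> t1; apply: cvgM; first exact: cvg_cst.
  have cX : {for t, continuous X} by apply: mobius_continuous; rewrite gt_eqF// N0.
  exact: (continuous_at_comp cX (@sqrt_continuous R)).
(* At t = 1 the point x would be infinite; the value 0 is the limit of the trace there. *)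
pose H (t : R) : R := if t < 1 then Re (T (x t)) else 0.
have HE (t : R) : t < 1 -> \forall s \near t, H s = Re (T (x s)).
  by move=> t1; near=> s; rewrite /H ifT//; near: s; exact: lt_nbhsl.
have cH (t : R) : t < 1 -> {for t, continuous H}.
  move=> t1; apply: (cvg_trans (near_eq_cvg _)); last first.
    by rewrite /H t1; exact: (continuous_at_comp (cx t t1) ReT).
  by apply: filterS (HE t t1) => s ->.
transitivity (H 1 - H 0); last first.
  rewrite /H ltxx ltr01 sub0r; congr (- Re (T _)).
  by rewrite /x /X !mulr0 !addr0 divr1 sqrtr1 mulr1.
apply: (@FTC01_scaled R H).
- by rewrite gt_eqF// divr_gt0.
- apply/continuous_within_itvP => //; split.
  + by move=> t; rewrite in_itv/= => /andP[_ t1]; exact: cH.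
  + by apply: cvg_at_right_filter; apply: cH.
  + apply/cvgrPdist_lt => e e0; have [N HN] := Tinf e e0.
    pose M := `|N| + 1; have M1 : 0 < M by rewrite ltr_wpDl.
    have lM : 0 < (l * M) ^+ 2 + 1 by rewrite ltr_wpDl// sqr_ge0.
    (* Chosen so that t > 1 - del forces x > M: the condition (l M)^2 (1 - t) < 1 - l^2 t then
       holds. *)
    pose del := (1 - l ^+ 2) / ((l * M) ^+ 2 + 1); have d0 : 0 < del by rewrite divr_gt0.
    have n1 : \forall t \near (1 : R)^'-, 0 < t by exact: nbhs_left_gt.
    have n2 : \forall t \near (1 : R)^'-, t < 1 by exact: nbhs_left_lt.
    have n3 : \forall t \near (1 : R)^'-, 1 - del < t by apply: nbhs_left_gt; rewrite gtrBl.
    apply: filterS (filterI n1 (filterI n2 n3)) => t [t0 [t1]].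
    rewrite ltrBlDl -ltrBlDr => td.
    rewrite /H ltxx t1 sub0r normrN; apply: (le_lt_trans (Re_le_cmod _)); apply: HN.
    apply: (le_lt_trans (ler_norm N)); apply: (@lt_trans _ _ M); first by rewrite ltrDl.
    have Nt := N0 t t1.
    rewrite /x ltr_pdivlMl// -(ltr_pXn2r (n := 2)) ?nnegrE ?mulr_ge0 ?sqrtr_ge0 ?ltW//.
    have Mt : 0 < 1 + (- l ^+ 2) * t by apply: M0; rewrite !ltW.
    rewrite sqr_sqrtr ?divr_ge0 ?ltW// /X ltr_pdivlMr//.
    move: td; rewrite /del ltr_pdivlMr// => td.
    have h : 0 < l ^+ 2 * (1 - t) by rewrite mulr_gt0 ?exprn_gt0// subr_gt0.
    by move: ((l * M) ^+ 2) td => LM; lra.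
- move=> t t01; have /andP[t0 t1] := t01; have t01' : 0 <= t <= 1 by rewrite !ltW.
  have Mt := M0 t t01'; have Nt := N0 t t1.
  have Xt : 0 < X t by rewrite divr_gt0.
  have x0 : 0 < x t by rewrite mulr_gt0 ?invr_gt0 ?sqrtr_gt0.
  have xx : x t ^+ 2 = l^-1 ^+ 2 * X t by rewrite exprMn sqr_sqrtr// ltW.
  have Xr : x t ^+ 2 - l^-1 ^+ 2 = t * (1 - l ^+ 2) / (l ^+ 2 * (1 + (-1) * t)).
    by rewrite xx /X; field; rewrite !gt_eqF.
  have X1 : x t ^+ 2 - 1 = (1 - l ^+ 2) / (l ^+ 2 * (1 + (-1) * t)).
    by rewrite xx /X; field; rewrite !gt_eqF.
  have Xr0 : 0 < x t ^+ 2 - l^-1 ^+ 2 by rewrite Xr divr_gt0// ?mulr_gt0 ?exprn_gt0.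
  have X10 : 0 < x t ^+ 2 - 1 by rewrite X1 divr_gt0// mulr_gt0 ?exprn_gt0.
  have xr : l^-1 < x t.
    by rewrite -(ltr_pXn2r (n := 2)) ?nnegrE ?invr_ge0 ?ltW// -subr_gt0.
  have dX := mobius_derive (t := t) 1 (- l ^+ 2) (lt0r_neq0 Nt).
  have dx : is_derive t 1 x _ := is_deriveZ l^-1 (@is_derive1_comp R _ X t _ _ (is_derive1_sqrt Xt) dX).
  have [dT _] := tt_out tt xr.
  have dH := @is_derive1_comp R (fun y => Re (T y)) x t _ _ dT dx.
  have nH : \forall s \near t, ((fun y => Re (T y)) \o x) s = H s.
    by apply: filterS (HE t t1) => s ->.
  apply: (is_derive_eq (near_eq_is_derive nH dH)).
  rewrite /= mE -1?subr_eq0 ?gt_eqF// !gtr0_norm// Xr X1 bE.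
  have -> : - l ^+ 2 * 1 - 1 * (-1) = 1 - l ^+ 2 :> R by ring.
  rewrite /GRing.scale/= /bweight [(2 * Num.sqrt _)^-1]invfM -[- t]mulN1r -[- (l ^+ 2 * t)]mulNr /X.
  have [u ->] := pos_expR P1; have [v ->] := pos_expR Mt; have [w ->] := pos_expR Nt.
  have [tau ->] := pos_expR t0; have [lam ->] := pos_expR l1.
  have [two ->] := pos_expR (half_gt0).
  rewrite !expRE.
  by congr expR; field.
- move=> t t01; apply: bweight_sqrt_continuous => //.
  by rewrite exprn_gt0//= expr_lt1// ?ltW//; case/andP: l01.
- by move=> t _; rewrite mulr_ge0 ?bweight_ge0// invr_ge0 sqrtr_ge0.
Unshelve. all: by end_near. Qed.

Lemma ttD_elliptic : b = 2^-1 -> l * elliptic_K l = ttD T.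
Proof.
move=> bE; have P1 := P0; have l1 := l0.
have pos (t : R) : 0 < t < 1 -> 0 < 1 - t ^+ 2 /\ 0 < 1 - l ^+ 2 * t ^+ 2.
  move=> /andP[t0 t1]; have h : 0 < 1 - t ^+ 2 by rewrite subr_gt0 expr_lt1// ltW.
  have : 0 <= l ^+ 2 * (1 - t ^+ 2) by rewrite mulr_ge0 ?sqr_ge0// ltW.
  by split => //; lra.
transitivity (- Re (T 1) - - Re (T 0)); last by rewrite T0 oppr0 subr0.
apply: (@FTC01_scaled R (fun t => - Re (T t))).
- by rewrite gt_eqF.
- by apply: within01 => t _; apply: cvgN; exact: ReT.
- move=> t t01; have /andP[t0 t1] := t01; have [h1 h2] := pos t t01.
  have [dT _] := tt_mid tt (x := t) ltac:(apply/andP; split; lra).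
  apply: (is_derive_eq (is_deriveN dT)); rewrite /= opprK (speed_lt1 erefl); last by rewrite -subr_gt0.
  have -> : l^-1 ^+ 2 - t ^+ 2 = (1 - l ^+ 2 * t ^+ 2) / l ^+ 2 by field; rewrite gt_eqF.
  rewrite bE; have [u ->] := pos_expR h1; have [v ->] := pos_expR h2; have [lam ->] := pos_expR l1.
  by rewrite !expRE; congr expR; field.
- move=> t t01; have [h1 h2] := pos t t01.
  apply: cvgV; first by rewrite gt_eqF// sqrtr_gt0 mulr_gt0.
  have c1 (k : R) : {for t, continuous (fun t : R => 1 - k * t ^+ 2)}.
    apply: cvgB; first exact: cvg_cst.
    by apply: cvgM; [exact: cvg_cst|exact: exprn_continuous].
  apply: (continuous_at_comp (f := fun t => (1 - t ^+ 2) * (1 - l ^+ 2 * t ^+ 2))); last exact: sqrt_continuous.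
  apply: cvgM; last exact: c1.
  by apply: cvgB; [exact: cvg_cst|exact: exprn_continuous].
- by move=> t _; rewrite invr_ge0 sqrtr_ge0.
Qed.

(** The substitution x = (1 - l'^2 t^2)^(-1/2), from 1 to 1 / l, is the classical one for the
    complementary integral. *)
Lemma tth_elliptic (l' : R) : b = 2^-1 -> sb = 1 -> l' ^+ 2 = 1 - l ^+ 2 ->
  l * elliptic_K l' = tth T.
Proof.
move=> bE sbE l'E; have P1 := P0; have l1 := l0.
pose W (t : R) : R := 1 - (1 - l ^+ 2) * t ^+ 2.
pose x (t : R) : R := (Num.sqrt (W t))^-1.
have t2 (t : R) : 0 <= t <= 1 -> 0 <= t ^+ 2 <= 1.
  by move=> /andP[t0 t1]; rewrite sqr_ge0 expr_le1.
have W0 (t : R) : 0 <= t <= 1 -> l ^+ 2 <= W t.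
  move=> /t2/andP[_ h]; have : 0 <= (1 - l ^+ 2) * (1 - t ^+ 2) by rewrite mulr_ge0 ?(ltW P1)// subr_ge0.
  by rewrite /W; lra.
have l2 : 0 < l ^+ 2 by rewrite exprn_gt0.
have Wp (t : R) : 0 <= t <= 1 -> 0 < W t by move=> /W0; exact: lt_le_trans.
have cW : continuous W.
  move=> t; apply: cvgB; first exact: cvg_cst.
  by apply: cvgM; [exact: cvg_cst|exact: exprn_continuous].
have cx (t : R) : 0 <= t <= 1 -> {for t, continuous x}.
  move=> /Wp h; apply: cvgV; first by rewrite gt_eqF// sqrtr_gt0.
  exact: (continuous_at_comp (cW t) (@sqrt_continuous R)).
have pos (t : R) : 0 < t < 1 -> 0 < 1 - t ^+ 2.
  by move=> /andP[t0 t1]; rewrite subr_gt0 expr_lt1// ltW.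
transitivity (- Im (T (x 1)) - - Im (T (x 0))); last first.
  have -> : x 1 = l^-1.
    by rewrite /x /W expr1n mulr1 opprB addrC subrK sqrtr_sqr gtr0_norm.
  have -> : x 0 = 1 by rewrite /x /W expr0n mulr0 subr0 sqrtr1 invr1.
  by rewrite (tt_out_Im tt)// oppr0 sub0r opprK.
apply: (@FTC01_scaled R (fun t => - Im (T (x t)))).
- by rewrite gt_eqF.
- by apply: within01 => t t01; apply: cvgN; exact: (continuous_at_comp (cx t t01) ImT).
- move=> t t01; have /andP[t0 t1] := t01; have t01' : 0 <= t <= 1 by rewrite !ltW.
  have h1 := pos t t01; have Wt := Wp t t01'.
  have x0 : 0 < x t by rewrite invr_gt0 sqrtr_gt0.
  have xx : x t ^+ 2 = (W t)^-1 by rewrite exprVn sqr_sqrtr// ltW.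
  have X1 : x t ^+ 2 - 1 = (1 - l ^+ 2) * t ^+ 2 / W t.
    by rewrite xx /W; field; rewrite gt_eqF.
  have Xr : l^-1 ^+ 2 - x t ^+ 2 = (1 - l ^+ 2) * (1 - t ^+ 2) / (l ^+ 2 * W t).
    by rewrite xx /W; field; rewrite !gt_eqF.
  have X10 : 0 < x t ^+ 2 - 1 by rewrite X1 divr_gt0// mulr_gt0// exprn_gt0.
  have Xr0 : 0 < l^-1 ^+ 2 - x t ^+ 2 by rewrite Xr divr_gt0// mulr_gt0.
  have x1 : 1 < x t by rewrite -(ltr_pXn2r (n := 2)) ?nnegrE ?ltW// expr1n -subr_gt0.
  have xr : x t < l^-1.
    have li : 0 <= l^-1 by rewrite invr_ge0 ltW.
    by rewrite -(ltr_pXn2r (n := 2)) ?nnegrE ?(ltW x0) ?li// -subr_gt0.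
  have dW : is_derive t 1 W (- ((1 - l ^+ 2) * (2 * t))).
    have d2 := is_derive_exprn 2 t; rewrite expr1 in d2.
    apply: (is_derive_eq (is_deriveB (is_derive_cst (1 : R) t 1) (is_deriveZ (1 - l ^+ 2) d2))).
    by rewrite sub0r.
  have ds := @is_derive1_comp R _ W t _ _ (is_derive1_sqrt Wt) dW.
  have sn : Num.sqrt (W t) != 0 by rewrite gt_eqF// sqrtr_gt0.
  have dx : is_derive t 1 x _ := @is_deriveV R (fun t => Num.sqrt (W t)) t _ 1 sn ds.
  have [_ dT] := tt_side tt (x := x t) ltac:(by rewrite x1).
  apply: (is_derive_eq (is_deriveN (@is_derive1_comp R (fun y => Im (T y)) x t _ _ dT dx))).
  have ne1 : x t ^+ 2 != 1 by rewrite -subr_eq0 gt_eqF.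
  have ne2 : x t ^+ 2 != l^-1 ^+ 2 by rewrite eq_sym -subr_eq0 gt_eqF.
  rewrite /= mE//.
  rewrite distrC !gtr0_norm// Xr X1 bE sbE l'E /GRing.scale/=.
  have -> : (2 * Num.sqrt (W t))^-1 * - ((1 - l ^+ 2) * (2 * t)) = - ((1 - l ^+ 2) * t / Num.sqrt (W t)).
    by field.
  rewrite -/(W t).
  have [v ->] := pos_expR Wt; have [u ->] := pos_expR P1; have [w ->] := pos_expR h1.
  have [tau ->] := pos_expR t0; have [lam ->] := pos_expR l1.
  rewrite !(mulrN, mulNr, opprK) mulr1 !expRE.
  by congr expR; field.
- move=> t t01; have /andP[t0 t1] := t01; have t01' : 0 <= t <= 1 by rewrite !ltW.
  have h1 := pos t t01; have Wt := Wp t t01'.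
  apply: cvgV; first by rewrite gt_eqF// sqrtr_gt0 mulr_gt0// l'E.
  apply: (continuous_at_comp (f := fun t => (1 - t ^+ 2) * (1 - l' ^+ 2 * t ^+ 2))); last exact: sqrt_continuous.
  apply: cvgM; first by apply: cvgB; [exact: cvg_cst|exact: exprn_continuous].
  by rewrite l'E; exact: cW.
- by move=> t _; rewrite invr_ge0 sqrtr_ge0.
Qed.

End trapezoid_lengths.

(** * Side lengths of the exterior map *)

Section exterior_lengths.
Variable R : realType.
Local Notation C := (complex R).
Local Notation mu := (@lebesgue_measure R).
Local Notation I01 := (`]0%R, 1%R[%classic : set R).
Variables (al k q sa ca : R) (m : R -> R) (T : R -> C).
Hypothesis k01 : 0 < k < 1.
Hypothesis q0 : 0 < q.
Hypothesis et : exterior_trace (exx2 q) (exx3 k q) sa ca m T.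
Hypothesis mE : forall x, x != -1 -> x != exx2 q -> x != exx3 k q -> x != 0 ->
  m x = `|x + 1| `^ (- 2^-1) *
    (`|x - exx2 q| `^ al * (`|x - exx3 k q| `^ (1 - al) * `|x| `^ (- 2^-1))).

Let ImT : continuous (fun x => Im (T x)).
Proof. by move=> x; exact: (clim_Im (et_clim et x)). Qed.

Let k0 : 0 < k. Proof. by case/andP: k01. Qed.
Let k20 : 0 < k ^+ 2. Proof. by rewrite exprn_gt0. Qed.
Let k21 : k ^+ 2 < 1. Proof. by case/andP: k01 => h0 h1; rewrite expr_lt1// ltW. Qed.
Let qk : 0 < q + k ^+ 2. Proof. by rewrite addr_gt0. Qed.
Let q1 : 0 < 1 + q. Proof. by rewrite addr_gt0. Qed.

Let affine_continuous (u t : R) : {for t, continuous (fun t : R => 1 - t * u)}.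
Proof. by apply: cvgB; [exact: cvg_cst|apply: cvgM; [exact: cvg_id|exact: cvg_cst]]. Qed.

Let integrand_continuous (p1 p2 p3 p4 z w t : R) : 0 < t -> 0 < 1 - t -> 0 < 1 - t * z -> 0 < 1 - t * w ->
  {for t, continuous (fun t => t `^ p1 * (1 - t) `^ p2 * (1 - t * z) `^ p3 * (1 - t * w) `^ p4)}.
Proof.
move=> t0 t1 t2 t3; apply: cvgM; last first.
  exact: (powR_continuous_comp (f := fun t => 1 - t * w) (@affine_continuous w t) t3).
apply: cvgM; last first.
  exact: (powR_continuous_comp (f := fun t => 1 - t * z) (@affine_continuous z t) t2).
apply: cvgM; first exact: powR_continuous_at.
have h : {for t, continuous (fun t : R => 1 - t)} by apply: cvgB; [exact: cvg_cst|exact: cvg_id].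
exact: (powR_continuous_comp h t1).
Qed.

(** With t = s^2 the point - 1 / (1 + q t) runs from -1 to [exx2]. All powers of 1 + q t cancel
    except the square from the derivative, which gives the parameter 2 of F_1. *)
Lemma etC_appell :
  (q `^ (3 / 2) * (1 + q) `^ (- al) * (q + k ^+ 2) `^ (al - 1)) *
  \int[mu]_(t in I01) (t `^ (2^-1 - 1) * (1 - t) `^ (3 / 2 + al - 2^-1 - 1)
      * (1 - t * k ^+ 2) `^ (- (al - 1)) * (1 - t * - q) `^ (- 2)) = etC (exx2 q) T.
Proof.
have hk := k20; have hk1 := k21; have hqk := qk; have hq1 := q1; have hq := q0.
pose x (t : R) : R := (- 1 + 0 * t) / (1 + q * t).
have M0 (t : R) : 0 <= t <= 1 -> 0 < 1 + q * t.
  by move=> /andP[t0 t1]; rewrite ltr_wpDr// mulr_ge0// ltW.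
have cx (t : R) : 0 <= t <= 1 -> {for t, continuous x}.
  by move=> t01; apply: mobius_continuous; rewrite gt_eqF// M0.
transitivity (Im (T (x 1)) - Im (T (x 0))); last first.
  have -> : x 1 = exx2 q by rewrite /x /exx2 mul0r addr0 mulr1 mulN1r.
  have -> : x 0 = - 1 by rewrite /x !mulr0 !addr0 divr1.
  by rewrite (et_Im0 et (x := -1)) ?subr0//; left.
apply: (@FTC01_scaled R (fun t => Im (T (x t)))).
- by rewrite gt_eqF// !mulr_gt0// powR_gt0.
- by apply: within01 => t t01; exact: (continuous_at_comp (cx t t01) ImT).
- move=> t t01; have /andP[t0 t1] := t01; have t01' : 0 <= t <= 1 by rewrite !ltW.
  have Mt := M0 t t01'; have N1 : 0 < 1 - t by rewrite subr_gt0.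
  have N2 : 0 < 1 - t * k ^+ 2.
    by rewrite subr_gt0 (lt_trans _ hk1)// gtr_pMl.
  have e1 : x t + 1 = q * t / (1 + q * t) by rewrite /x; field; rewrite gt_eqF.
  have e2 : exx2 q - x t = q * (1 - t) / ((1 + q * t) * (1 + q)).
    by rewrite /x /exx2; field; rewrite !gt_eqF.
  have e3 : exx3 k q - x t = q * (1 - t * k ^+ 2) / ((1 + q * t) * (q + k ^+ 2)).
    by rewrite /x /exx3; field; rewrite !gt_eqF.
  have e4 : - x t = (1 + q * t)^-1 by rewrite /x; field; rewrite gt_eqF.
  have p1 : 0 < x t + 1 by rewrite e1 divr_gt0// mulr_gt0.
  have p2 : 0 < exx2 q - x t by rewrite e2 divr_gt0// mulr_gt0.
  have p3 : 0 < exx3 k q - x t by rewrite e3 divr_gt0// mulr_gt0.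
  have p4 : 0 < - x t by rewrite e4 invr_gt0.
  have dx : is_derive t 1 x _ := mobius_derive (t := t) (-1) 0 (lt0r_neq0 Mt).
  have [_ dT] := et_up et (x := x t) ltac:(apply/andP; split; lra).
  apply: (is_derive_eq (@is_derive1_comp R (fun y => Im (T y)) x t _ _ dT dx)).
  rewrite /= mE; last 4 first.
  + by rewrite -subr_eq0 opprK gt_eqF.
  + by rewrite eq_sym -subr_eq0 gt_eqF.
  + by rewrite eq_sym -subr_eq0 gt_eqF.
  + by rewrite -oppr_eq0 gt_eqF.
  rewrite (distrC (x t)) (distrC (x t)) -(normrN (x t)) !gtr0_norm// e1 e2 e3 e4.
  have -> : 0 * 1 - -1 * q = q by ring.
  have -> : 1 - t * - q = 1 + q * t by ring.
  have [u1 ->] := pos_expR hqk; have [u2 ->] := pos_expR hq1; have [u3 ->] := pos_expR Mt.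
  have [u4 ->] := pos_expR N1; have [u5 ->] := pos_expR N2.
  have [u6 ->] := pos_expR t0; have [u7 ->] := pos_expR hq.
  by rewrite !expRE; congr expR; field.
- move=> t /andP[t0 t1]; apply: integrand_continuous; rewrite ?subr_gt0//.
    by rewrite (lt_trans _ hk1)// gtr_pMl.
  by rewrite mulrN (lt_trans _ ltr01)// oppr_lt0 mulr_gt0.
- by move=> t _; rewrite !mulr_ge0// powR_ge0.
Qed.

(** Here t = (k s)^-2 runs from 0, for s at infinity, to 1, for s = 1 / k. *)
Lemma etD_appell :
  (k `^ (3 - 2 * al) * q `^ (- 2^-1) * (1 + q) `^ (- al) * (q + k ^+ 2) `^ (al - 1)) *
  \int[mu]_(t in I01) (t `^ (2^-1 - 1) * (1 - t) `^ (5 / 2 - al - 2^-1 - 1)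
      * (1 - t * k ^+ 2) `^ (- - al) * (1 - t * - (k ^+ 2 / q)) `^ (- 2)) = etD (exx3 k q) T.
Proof.
have hk := k20; have hk1 := k21; have hqk := qk; have hq1 := q1; have hq := q0; have hk0 := k0.
pose x (t : R) : R := (0 + (- k ^+ 2) * t) / (q + k ^+ 2 * t).
have M0 (t : R) : 0 <= t <= 1 -> 0 < q + k ^+ 2 * t.
  by move=> /andP[t0 t1]; rewrite ltr_wpDr// mulr_ge0// ltW.
have cx (t : R) : 0 <= t <= 1 -> {for t, continuous x}.
  by move=> t01; apply: mobius_continuous; rewrite gt_eqF// M0.
transitivity (Im (T (x 1)) - Im (T (x 0))); last first.
  have -> : x 1 = exx3 k q by rewrite /x /exx3 !mulr1 add0r mulNr.
  have -> : x 0 = 0 by rewrite /x !mulr0 addr0 mul0r.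
  by rewrite (et_Im0 et (x := 0)) ?subr0//; right.
apply: (@FTC01_scaled R (fun t => Im (T (x t)))).
- by rewrite gt_eqF// !mulr_gt0// powR_gt0.
- by apply: within01 => t t01; exact: (continuous_at_comp (cx t t01) ImT).
- move=> t t01; have /andP[t0 t1] := t01; have t01' : 0 <= t <= 1 by rewrite !ltW.
  have Mt := M0 t t01'; have N1 : 0 < 1 - t by rewrite subr_gt0.
  have N2 : 0 < 1 - t * k ^+ 2.
    by rewrite subr_gt0 (lt_trans _ hk1)// gtr_pMl.
  have e1 : x t + 1 = q / (q + k ^+ 2 * t) by rewrite /x; field; rewrite gt_eqF.
  have e2 : x t - exx2 q = q * (1 - t * k ^+ 2) / ((q + k ^+ 2 * t) * (1 + q)).
    by rewrite /x /exx2; field; rewrite !gt_eqF.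
  have e3 : x t - exx3 k q = q * k ^+ 2 * (1 - t) / ((q + k ^+ 2 * t) * (q + k ^+ 2)).
    by rewrite /x /exx3; field; rewrite !gt_eqF.
  have e4 : - x t = k ^+ 2 * t / (q + k ^+ 2 * t) by rewrite /x; field; rewrite gt_eqF.
  have p1 : 0 < x t + 1 by rewrite e1 divr_gt0.
  have p2 : 0 < x t - exx2 q by rewrite e2 divr_gt0// mulr_gt0.
  have p3 : 0 < x t - exx3 k q by rewrite e3 divr_gt0// ?mulr_gt0.
  have p4 : 0 < - x t by rewrite e4 divr_gt0// mulr_gt0.
  have dx : is_derive t 1 x _ := mobius_derive (t := t) 0 (- k ^+ 2) (lt0r_neq0 Mt).
  have [_ dT] := et_down et (x := x t) ltac:(apply/andP; split; lra).
  apply: (is_derive_eq (@is_derive1_comp R (fun y => Im (T y)) x t _ _ dT dx)).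
  rewrite /= mE; last 4 first.
  + by rewrite -subr_eq0 opprK gt_eqF.
  + by rewrite -subr_eq0 gt_eqF.
  + by rewrite -subr_eq0 gt_eqF.
  + by rewrite -oppr_eq0 gt_eqF.
  rewrite -(normrN (x t)) !gtr0_norm// e1 e2 e3 e4.
  have -> : - k ^+ 2 * q - 0 * k ^+ 2 = - (k ^+ 2 * q) by ring.
  have -> : 1 - t * - (k ^+ 2 / q) = (q + k ^+ 2 * t) / q by field; rewrite gt_eqF.
  have [u1 ->] := pos_expR hqk; have [u2 ->] := pos_expR hq1; have [u3 ->] := pos_expR Mt.
  have [u4 ->] := pos_expR N1; have [u5 ->] := pos_expR N2.
  have [u6 ->] := pos_expR t0; have [u7 ->] := pos_expR hq; have [u8 ->] := pos_expR hk0.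
  by rewrite !(mulrN, mulNr, opprK) !expRE; congr expR; field.
- move=> t /andP[t0 t1]; apply: integrand_continuous; rewrite ?subr_gt0//.
    by rewrite (lt_trans _ hk1)// gtr_pMl.
  by rewrite mulrN (lt_trans _ ltr01)// oppr_lt0 mulr_gt0// divr_gt0.
- by move=> t _; rewrite !mulr_ge0// powR_ge0.
Qed.

End exterior_lengths.

(** * Ratios of sides in terms of special functions *)

Section side_lengths.
Variable R : realType.
Local Notation mu := (@lebesgue_measure R).
Implicit Types al l k q c d : R.

Lemma cmod_tztrace_lt (b r e : R) : 0 < b < 1 -> 1 < r -> 0 < e ->
  exists N : R, forall x, N < x -> cmod (tztrace b r x) < e.
Proof.
move=> b01 r1 e0; have [_ cinf] := tzS_scts b01 r1.
have /climP/(_ e e0)[N HN] := cinf.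
exists (Num.max N 0) => x; rewrite gt_max => /andP[Nx x0].
have h : cmod (tzS b r (Some (Complex x 0)) - tzS b r None) < e.
  by apply: HN; [rewrite /cuhp/=|rewrite cmod_real gtr0_norm].
by move: h; rewrite [tzS b r None]/(0 : complex R) subr0.
Qed.

(** For right angles the slope relation gives [ttC = ttD], so the half-width and the height are the
    two complete integrals up to a common factor. *)
Lemma recth_elliptic l l' : 0 < l < 1 -> l' ^+ 2 = 1 - l ^+ 2 ->
  0 < elliptic_K l /\ recth l^-1 = elliptic_K l' / (2 * elliptic_K l).
Proof.
move=> l01 l'E; have /andP[l0 l1] := l01.
have r1 : 1 < l^-1 by rewrite invf_gt1.
have b01 : 0 < (2^-1 : R) < 1 by apply/andP; split; lra.
have tt := tz_trapezoid_trace b01 r1.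
have s1 : sin (pi * 2^-1) = 1 :> R by exact: sin_pihalf.
have c1 : cos (pi * 2^-1) = 0 :> R by exact: cos_pihalf.
have mE := @tzspeedE R 2^-1 l^-1.
have eD := ttD_elliptic l01 tt mE erefl; have eh := tth_elliptic l01 tt mE erefl s1 l'E.
have sl := tt_slope tt; rewrite s1 c1 mul1r mul0r oppr0 in sl.
have C0 := ttC_gt0 tt.
rewrite /recth; move: sl C0 eD eh.
move: (ttC _ _) (ttD _) (tth _) => C D h sl C0 eD eh.
have DC : D = C by lra.
have K0 : 0 < elliptic_K l by rewrite -(pmulr_rgt0 _ l0) eD DC.
split => //; rewrite -eh -DC -eD; field; rewrite !gt_eqF//.
Qed.

Lemma inc_ind_ratio al l : 0 < al < 1 -> 0 < l < 1 ->
  Beta al 2^-1 != 0 -> Beta (1 - al) 2^-1 != 0 ->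
  ind al l^-1 / inc al l^-1 = Beta al 2^-1 / Beta (1 - al) 2^-1
    * (l `^ (2 * al - 1) * hyp2F1 2^-1 al (al + 2^-1) (l ^+ 2)
       / hyp2F1 2^-1 (1 - al) (3 / 2 - al) (l ^+ 2)).
Proof.
move=> al01 l01 B1 B2; have /andP[l0 l1] := l01; have /andP[al0 al1] := al01.
have r1 : 1 < l^-1 by rewrite invf_gt1.
have b01 : 0 < 1 - al < 1 by rewrite subr_gt0 al1 gtrBl.
have tt := tz_trapezoid_trace b01 r1.
have mE := @tzspeedE R (1 - al) l^-1.
have eD := ttD_bweight l01 tt mE erefl.
have eC := ttC_bweight l01 tt mE erefl (fun e => cmod_tztrace_lt b01 r1).
have C0 := ttC_gt0 tt; have h0 := tth_gt0 tt.
have l2 : 0 < l ^+ 2 < 1 by rewrite exprn_gt0//= expr_lt1// ltW.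
have al2 : 0 < 1 - al by rewrite subr_gt0.
have [_ f1] := hyp2F1_half_integral al0 l2 B1; have [_ f2] := hyp2F1_half_integral al2 l2 B2.
rewrite -f1 in eD; rewrite -f2 in eC.
have -> : 3 / 2 - al = 1 - al + 2^-1 by field.
have -> : l `^ (2 * al - 1) = l `^ (2 * al) / l.
  rewrite powRD; last by rewrite (gt_eqF l0) implybT.
  by rewrite powR_inv1 ?ltW.
rewrite /ind /inc; move: eD eC C0 h0.
move: (ttC _ _) (ttD _) (tth _) => C D h eD eC C0 h0.
move: eD eC; move: (hyp2F1 _ al _ _) (hyp2F1 _ (1 - al) _ _) (_ `^ _) => F1 F2 L eD eC.
have F20 : F2 != 0.
  by apply: contraTneq C0 => F20; rewrite -eC F20 !mulr0 ltxx.
rewrite -eD -eC; move: (Beta _ _) (Beta _ _) B1 B2 => u v u0 v0; field.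
by rewrite F20 v0 !gt_eqF.
Qed.

(** The powers of 1 + q and q + k^2 are common to both sides and cancel; the remaining q^(-1/2) /
    q^(3/2) = a^-4 is the origin of the factor a^4. *)
Lemma exc_exd_ratio al k a : 0 < al < 1 -> 0 < k < 1 -> 0 < a ->
  (a ^+ 2) ^+ 2 + (1 - 2 * al) * (1 - k ^+ 2) * a ^+ 2 = k ^+ 2 ->
  Beta 2^-1 (2 - al) != 0 -> Beta 2^-1 (1 + al) != 0 ->
  exd al k (a ^+ 2) / exc al k (a ^+ 2) =
    k `^ (3 - 2 * al) * Beta 2^-1 (2 - al) / (a ^+ 4 * Beta 2^-1 (1 + al))
    * (appellF1 2^-1 (- al) 2 (5 / 2 - al) (k ^+ 2) (- (k ^+ 2 / a ^+ 2))
       / appellF1 2^-1 (al - 1) 2 (3 / 2 + al) (k ^+ 2) (- a ^+ 2)).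
Proof.
move=> al01 k01 a0 qE B1 B2; have q0 : 0 < a ^+ 2 by rewrite exprn_gt0.
have et := exterior_trace_residue al01 k01 q0 qE.
have mE := @exspeedE R al (exx2 (a ^+ 2)) (exx3 k (a ^+ 2)).
have eC := etC_appell k01 q0 et mE; have eD := etD_appell k01 q0 et mE.
have C0 := etC_gt0 et; have X01 := etX01 et.
rewrite /exd /exc /exlam /appellF1.
have -> : 5 / 2 - al - 2^-1 = 2 - al by field.
have -> : 3 / 2 + al - 2^-1 = 1 + al by field.
have E1 : 5 / 2 - al - 2^-1 - 1 = 2 - al - 1 by field.
have E2 : 3 / 2 + al - 2^-1 - 1 = 1 + al - 1 by field.
rewrite E1 in eD; rewrite E2 in eC.
move: eC eD C0 X01; move: (etC _ _) (etD _ _) (etX1 _) (etX0 _) => C D X1 X0.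
move: (\int[mu]_(t in _) _) => IC eC; move: (\int[mu]_(t in _) _) => ID eD C0 X01.
have lam0 : X1 - X0 != 0 by rewrite gt_eqF// subr_gt0.
have IC0 : IC != 0 by apply: contraTneq C0 => IC0; rewrite -eC IC0 mulr0 ltxx.
have p1 : 0 < (1 + a ^+ 2) `^ (- al) by rewrite powR_gt0// addr_gt0.
have p2 : 0 < (a ^+ 2 + k ^+ 2) `^ (al - 1).
  by rewrite powR_gt0// addr_gt0// exprn_gt0//; case/andP: k01.
have qa : (a ^+ 2) `^ (- 2^-1) = (a ^+ 2) `^ (3 / 2) / a ^+ 4.
  by have [u ->] := pos_expR a0; rewrite !expRE; congr expR; field.
have p3 : 0 < (a ^+ 2) `^ (3 / 2) by rewrite powR_gt0.
rewrite -eC -eD qa; move: p1 p2 p3; move: (_ `^ (- al)) (_ `^ (al - 1)) (_ `^ (3 / 2)) => x y z x0 y0 z0.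
move: B1 B2; move: (k `^ _) (Beta _ (2 - al)) (Beta _ (1 + al)) => kk b1 b2 B1 B2; field.
by rewrite IC0 B1 B2 lam0 !gt_eqF.
Qed.

End side_lengths.

(** Ratio and nonzero difference determine a pair. This is how both maps are matched with the given
    c and d, the difference being the cotangent of the acute angle. *)
Lemma eq_of_ratio_diff (R : realFieldType) (c d x y : R) : 0 < c -> 0 < x ->
  d - c != 0 -> y / x = d / c -> y - x = d - c -> x = c /\ y = d.
Proof.
move=> c0 x0 dc r s; have cn : c != 0 by rewrite gt_eqF.
have yE : y = d / c * x by rewrite -r mulfVK// gt_eqF.
have xc : x = c.
  apply: (mulfI dc); have : (d - c) * x = c * (y - x) by rewrite yE; field.
  by rewrite s [c * _]mulrC.
by split => //; rewrite yE xc mulfVK.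
Qed.

Lemma quotient_neq0 (F : fieldType) (x y z r : F) : x / y * z = r -> r != 0 -> x != 0 /\ y != 0.
Proof. by move=> <-; rewrite !mulf_eq0 invr_eq0 !negb_or => /andP[/andP[]]. Qed.

Lemma product_quotient_neq0 (F : fieldType) (x x' y y' z r : F) : x * x' / (y * y') * z = r ->
  r != 0 -> (x != 0 /\ x' != 0) /\ (y != 0 /\ y' != 0).
Proof.
by move=> E r0; have [] := quotient_neq0 E r0; rewrite !mulf_eq0 !negb_or => /andP[? ?] /andP[].
Qed.

Lemma div_halves (R : realFieldType) (x y u v : R) :
  x / (2 * y) / (u / (2 * v)) = x * v / (y * u).
Proof. by rewrite !invfM !invrK; move: y^-1 u^-1 => y' u'; field. Qed.

Lemma cot_gt0 (R : realType) (al : R) : 0 < al < 2^-1 -> 0 < cot (pi * al).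
Proof.
move=> /andP[al0 al2]; have pi0 := @pi_gt0 R.
have h0 : 0 < pi * al by rewrite mulr_gt0.
have h1 : pi * al < pi / 2 by rewrite ltr_pM2l.
rewrite /cot divr_gt0//; first by apply: cos_gt0_pihalf; apply/andP; split; lra.
by apply: sin_gt0_pi; apply/andP; split; lra.
Qed.

Theorem theorem4p11 (R : realType) (alpha c d lambda k A a : R)
  (halpha : 0 < alpha < 2^-1)
  (hc : 0 < c)
  (hd : d = c + cot (pi * alpha))
  (hlambda : 0 < lambda < 1)
  (hlambda_eq :
    Beta alpha 2^-1 / Beta (1 - alpha) 2^-1
    * (lambda `^ (2 * alpha - 1)
       * hyp2F1 2^-1 alpha (alpha + 2^-1) (lambda ^+ 2)
       / hyp2F1 2^-1 (1 - alpha) (3 / 2 - alpha) (lambda ^+ 2))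
    = d / c)
  (hk : 0 < k < 1)
  (hA : A = (2^-1 - alpha) * (1 - k ^+ 2))
  (ha : 0 < a)
  (ha_eq : a ^+ 2 = Num.sqrt (A ^+ 2 + k ^+ 2) - A)
  (hk_eq :
    k `^ (3 - 2 * alpha) * Beta 2^-1 (2 - alpha)
      / (a ^+ 4 * Beta 2^-1 (1 + alpha))
    * (appellF1 2^-1 (- alpha) 2 (5 / 2 - alpha)
         (k ^+ 2) (- (k ^+ 2 / a ^+ 2))
       / appellF1 2^-1 (alpha - 1) 2 (3 / 2 + alpha)
         (k ^+ 2) (- a ^+ 2))
    = d / c) :
  let lambda' := Num.sqrt (1 - lambda ^+ 2) in
  let k' := Num.sqrt (1 - k ^+ 2) in
  ((Num.max
      (elliptic_K lambda * elliptic_K k' / (elliptic_K lambda' * elliptic_K k))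
      (elliptic_K lambda' * elliptic_K k / (elliptic_K lambda * elliptic_K k'))
    )%:E <= modulus_ratio_sup (trapezoid c d))%E.
Proof.
cbv zeta; set lambda' := Num.sqrt (1 - lambda ^+ 2); set k' := Num.sqrt (1 - k ^+ 2).
have /andP[al0 al2] := halpha.
have al01 : 0 < alpha < 1 by rewrite al0 (lt_trans al2)// invf_lt1// ltr1n.
have cot0 := cot_gt0 halpha.
have dcE : d - c = cos (pi * alpha) / sin (pi * alpha) by rewrite hd /cot; ring.
have dc0 : d - c != 0 by rewrite dcE gt_eqF.
have d0 : 0 < d by rewrite hd addr_gt0.
have dc_neq0 : d / c != 0 by rewrite gt_eqF// divr_gt0.
(* A vanishing beta value would make the left side of its equation 0, also in a denominator since
   the inverse of 0 is 0, whereas d / c is positive. *)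
have [B1 B2] := quotient_neq0 hlambda_eq dc_neq0.
have [[_ B3] [_ B4]] := product_quotient_neq0 hk_eq dc_neq0.
have q0 : 0 < a ^+ 2 by rewrite exprn_gt0.
(* The formula for a^2 gives the positive root of q^2 + 2 A q = k^2, the condition for a vanishing
   residue. *)
have qE : (a ^+ 2) ^+ 2 + (1 - 2 * alpha) * (1 - k ^+ 2) * a ^+ 2 = k ^+ 2.
  have sq : (a ^+ 2 + A) ^+ 2 = A ^+ 2 + k ^+ 2.
    by rewrite ha_eq subrK sqr_sqrtr// addr_ge0 ?sqr_ge0.
  have -> : (1 - 2 * alpha) * (1 - k ^+ 2) = 2 * A by rewrite hA; field.
  by rewrite -[RHS](addKr (A ^+ 2)) -sq; ring.
have l1 : 1 < lambda^-1 by case/andP: hlambda => h0 h1; rewrite invf_gt1.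
have [cI dI] := eq_of_ratio_diff hc (inc_gt0 al01 l1) dc0
  (etrans (inc_ind_ratio al01 hlambda B1 B2) hlambda_eq) (etrans (ind_inc al01 l1) (esym dcE)).
have [cE dE] := eq_of_ratio_diff hc (exc_gt0 al01 hk q0 qE) dc0
  (etrans (exc_exd_ratio al01 hk ha qE B3 B4) hk_eq) (etrans (exd_exc al01 hk q0 qE) (esym dcE)).
have sqr' x : 0 < x < 1 -> Num.sqrt (1 - x ^+ 2) ^+ 2 = 1 - x ^+ 2 :> R.
  by move=> /andP[x0 x1]; rewrite sqr_sqrtr// subr_ge0 expr_le1// ltW.
have [Kl hl] := recth_elliptic hlambda (sqr' _ hlambda).
have [Kk hk'] := recth_elliptic hk (sqr' _ hk).
have r0 := modulus_ratio_ge al01 hk hlambda q0 qE cE dE cI dI.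
have r1 := modulus_ratio_ge' al01 hk hlambda q0 qE cE dE cI dI.
rewrite hl hk' -/lambda' -/k' in r0 r1.
rewrite div_halves in r0; rewrite div_halves [_ * elliptic_K lambda]mulrC [elliptic_K k * _]mulrC in r1.
by rewrite maxEge; case: ifP.
Qed.
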